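(* Let $\alpha>0$, let $k,h\ge1$ be integers, and let $Q=k+h(1+\alpha)$. Then the critical Grushin equation $$\Delta_y\varphi+(1+\alpha)^2|y|^{2\alpha}\Delta_z\varphi+|\varphi|^{\frac{4}{Q-2}}\varphi=0,\qquad (y,z)\in\mathbb{R}^k\times\mathbb{R}^h,$$ admits a sequence $(v_j)_{j\ge1}$ of sign-changing solutions with $|||v_j|||<\infty$ for every $j$ and $|||v_j|||\to\infty$ as $j\to\infty$.
   Context: The norm is given by $$|||u|||^2=\int_{\mathbb{R}^k\times\mathbb{R}^h}\left(|\nabla_yu|^2+(\alpha+1)^2|y|^{2\alpha}|\nabla_zu|^2\right)dy\,dz .$$ Solutions are understood in the weak sense, with finite $|||\cdot|||$ norm. A function is sign changing if both its positive part and its negative part are nontrivial. *)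

(* Defs.v *)
From HB Require Import structures.
From mathcomp Require Import all_boot all_order all_algebra.
From mathcomp Require Import all_classical all_reals all_analysis.

Set Implicit Arguments.
Unset Strict Implicit.
Unset Printing Implicit Defensive.

Import Order.TTheory GRing.Theory Num.Theory.
Import numFieldNormedType.Exports.

Local Open Scope classical_set_scope.
Local Open Scope ring_scope.

(** Measurable sets of R^n: the sigma-algebra generated by the coordinates,
    i.e. the Borel sets. *)

Section measurable_rV.
Context (R : realType) (n : nat).

Definition rV_coord (i : 'I_n) (x : 'rV[R]_n) : measurableTypeR R := x ord0 i.

Let rV_set0 : g_sigma_preimage rV_coord set0.
Proof. exact: sigma_algebra0. Qed.

Let rV_setC A :
  g_sigma_preimage rV_coord A -> g_sigma_preimage rV_coord (~` A).
Proof. exact: sigma_algebraC. Qed.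

Let rV_bigcup (F : (set 'rV[R]_n)^nat) :
  (forall i, g_sigma_preimage rV_coord (F i)) ->
  g_sigma_preimage rV_coord (\bigcup_i (F i)).
Proof. exact: sigma_algebra_bigcup. Qed.

HB.instance Definition _ := @isMeasurable.Build default_measure_display
  'rV[R]_n (g_sigma_preimage rV_coord) rV_set0 rV_setC rV_bigcup.

End measurable_rV.

Lemma measurable_rV_coord (R : realType) n (i : 'I_n) :
  measurable_fun [set: 'rV[R]_n] (rV_coord i).
Proof.
move=> _ Y mY; rewrite setTI; apply: sub_sigma_algebra => /=.
rewrite -bigcup_seq/=; exists i => /=; first by rewrite mem_index_enum.
by exists Y => //; rewrite setTI.
Qed.

Lemma measurable_fun_rV d (T : measurableType d) (R : realType) n
    (f : T -> 'rV[R]_n) :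
  (forall i, measurable_fun [set: T] (rV_coord i \o f)) ->
  measurable_fun [set: T] f.
Proof.
move=> mf _ A mA; rewrite setTI.
suff: g_sigma_preimage (@rV_coord R n) `<=`
      [set B | measurable (f @^-1` B)] by exact.
apply: smallest_sub.
  split => /=.
  - by rewrite preimage_set0.
  - by move=> B mB; rewrite setTD -preimage_setC; exact: measurableC.
  - by move=> F mF; rewrite preimage_bigcup; exact: bigcup_measurable.
rewrite -bigcup_seq; apply: bigcup_sub => i _ _ [C mC <-] /=.
by rewrite setTI -[_ @^-1` _]setTI -comp_preimage; exact: mf.
Qed.

Lemma sigma_finite_prod d1 d2 (T1 : measurableType d1)
    (T2 : measurableType d2) (R : realType)
    (m1 : {sigma_finite_measure set T1 -> \bar R})
    (m2 : {sigma_finite_measure set T2 -> \bar R}) :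
  sigma_finite setT (m1 \x m2)%E.
Proof.
have /sigma_finiteP[F [TF ndF Foo]] := sigma_finiteT m1.
have /sigma_finiteP[G [TG ndG Goo]] := sigma_finiteT m2.
exists (fun n => F n `*` G n).
  rewrite -setXTT TF TG predeqE => -[x y]; split.
    move=> [/= [n _ Fnx] [l _ Gly]]; exists (maxn n l) => //; split.
    - by move: x Fnx; exact/subsetPset/ndF/leq_maxl.
    - by move: y Gly; exact/subsetPset/ndG/leq_maxr.
  by move=> [n _ []/= ? ?]; split; exists n.
move=> n; have [mF Fn] := Foo n; have [mG Gn] := Goo n.
split; first exact: measurableX.
by rewrite product_measure1E// lte_mul_pinfty// ge0_fin_numE.
Qed.

Section lebesgue_rV.
Context (R : realType).

Definition cons_rV n (p : measurableTypeR R * 'rV[R]_n) : 'rV[R]_n.+1 :=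
  \row_i oapp (p.2 ord0) p.1 (unlift ord0 i).

Definition uncons_rV n (x : 'rV[R]_n.+1) : measurableTypeR R * 'rV[R]_n :=
  (x ord0 ord0, \row_i x ord0 (lift ord0 i)).

Lemma cons_rVK n : cancel (@cons_rV n) (@uncons_rV n).
Proof.
move=> [a x]; rewrite /uncons_rV/cons_rV mxE unlift_none/=; congr pair.
by apply/rowP => i; rewrite !mxE liftK.
Qed.

Lemma uncons_rVK n : cancel (@uncons_rV n) (@cons_rV n).
Proof.
move=> x; apply/rowP => i; rewrite mxE/=.
by case: unliftP => [j|] -> //=; rewrite mxE.
Qed.

Lemma measurable_cons_rV n : measurable_fun setT (@cons_rV n).
Proof.
apply: measurable_fun_rV => i; case: (unliftP ord0 i) => [j|] ->.
  rewrite (_ : _ \o _ = rV_coord j \o snd).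
    by apply: measurableT_comp => //; exact: measurable_rV_coord.
  by apply/funext => p; rewrite /rV_coord/= mxE liftK.
rewrite (_ : _ \o _ = fst) //.
by apply/funext => p; rewrite /rV_coord/= mxE unlift_none.
Qed.

Lemma measurable_uncons_rV n : measurable_fun setT (@uncons_rV n).
Proof.
apply/measurable_fun_pairP; split; first exact: (measurable_rV_coord ord0).
apply: measurable_fun_rV => i.
rewrite (_ : _ \o _ = rV_coord (lift ord0 i)).
  exact: measurable_rV_coord.
by apply/funext => x; rewrite /rV_coord/= mxE.
Qed.

Section step.
Context n (mu : {sigma_finite_measure set 'rV[R]_n -> \bar R}).

Definition lebesgue_rV_step : set 'rV[R]_n.+1 -> \bar R :=
  pushforward (@lebesgue_measure R \x mu)%E (@cons_rV n).

Let step0 : lebesgue_rV_step set0 = 0%E.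
Proof. by rewrite /lebesgue_rV_step/pushforward preimage_set0 measure0. Qed.

Let step_ge0 A : (0 <= lebesgue_rV_step A)%E.
Proof. by rewrite /lebesgue_rV_step/pushforward measure_ge0. Qed.

Let step_sigma_additive : semi_sigma_additive lebesgue_rV_step.
Proof.
move=> F mF tF mUF; rewrite /lebesgue_rV_step/pushforward preimage_bigcup.
apply: measure_semi_sigma_additive.
- by move=> i; rewrite -[X in measurable X]setTI; exact: measurable_cons_rV.
- apply/trivIsetP => /= i j _ _ ij; rewrite -preimage_setI.
  by move/trivIsetP : tF => /(_ _ _ _ _ ij) ->//; rewrite preimage_set0.
- rewrite -preimage_bigcup -[X in measurable X]setTI.
  exact: measurable_cons_rV.
Qed.

HB.instance Definition _ := isMeasure.Build _ _ _ lebesgue_rV_step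
  step0 step_ge0 step_sigma_additive.

Let step_sigma_finite : sigma_finite setT lebesgue_rV_step.
Proof.
have [F TF Foo] := sigma_finite_prod (@lebesgue_measure R) mu.
exists (fun i => @uncons_rV n @^-1` F i).
  by rewrite -preimage_bigcup -TF.
move=> i; have [mF Fi] := Foo i; split.
  by rewrite -[_ @^-1` _]setTI; exact: measurable_uncons_rV.
rewrite /lebesgue_rV_step /pushforward -comp_preimage.
by rewrite (_ : _ \o _ = id)//; apply/funext => x /=; rewrite cons_rVK.
Qed.

HB.instance Definition _ := Measure_isSigmaFinite.Build _ _ _
  lebesgue_rV_step step_sigma_finite.

End step.

Fixpoint lebesgue_rV n : {sigma_finite_measure set 'rV[R]_n -> \bar R} :=
  if n is m.+1 then lebesgue_rV_step (lebesgue_rV m) else \d_(0 : 'rV[R]_0).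

End lebesgue_rV.

(** Throughout, [x : 'rV[R]_k * 'rV[R]_h] is the point (y, z) of R^k x R^h. *)

Section grushin.
Context {R : realType} {k h : nat}.
Local Notation E := ('rV[R]_k * 'rV[R]_h)%type.
Implicit Types (u phi : E -> R) (x : E) (alpha : R).

Definition lebesgue_kh : set E -> \bar R :=
  (lebesgue_rV R k \x lebesgue_rV R h)%E.
HB.instance Definition _ := Measure.on lebesgue_kh.
HB.instance Definition _ := Measure_isSigmaFinite.Build _ _ _ lebesgue_kh
  (sigma_finite_prod (lebesgue_rV R k) (lebesgue_rV R h)).
Local Notation mu := lebesgue_kh.

Definition enorm n (y : 'rV[R]_n) : R := Num.sqrt (\sum_i (y ord0 i) ^+ 2).

Definition dot n (v w : 'rV[R]_n) : R := \sum_i v ord0 i * w ord0 i.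

Definition dy phi (i : 'I_k) x : R := 'D_((delta_mx ord0 i, 0) : E) phi x.
Definition dz phi (j : 'I_h) x : R := 'D_((0, delta_mx ord0 j) : E) phi x.
Definition grad_y phi x : 'rV[R]_k := \row_i dy phi i x.
Definition grad_z phi x : 'rV[R]_h := \row_j dz phi j x.

Definition iter_derive (s : seq E) phi : E -> R :=
  foldr (fun v f => 'D_v f) phi s.

Definition smooth phi : Prop := forall s : seq E,
  continuous (iter_derive s phi) /\
  forall x v, derivable (iter_derive s phi) x v.

Definition test_fun phi : Prop :=
  smooth phi /\ compact (closure [set x | phi x != 0]).

Definition loc_integrable (f : E -> R) : Prop :=
  measurable_fun setT f /\
  forall K : set E, compact K -> (\int[mu]_(x in K) `|f x|%:E < +oo)%E.

(** [gy] and [gz] are the weak gradients of [u] in y and in z.  The identity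
    defining [gz] carries the weight |y|^alpha, which does not depend on z:
    finiteness of the energy controls |y|^alpha gz only, and gz itself need
    not be integrable near {y = 0}. *)
Definition weak_grad alpha u (gy : E -> 'rV[R]_k) (gz : E -> 'rV[R]_h) : Prop :=
  [/\ loc_integrable u,
      forall i, loc_integrable (fun x => gy x ord0 i),
      forall j, loc_integrable (fun x => enorm x.1 `^ alpha * gz x ord0 j) &
      forall phi, test_fun phi ->
        (forall i, \int[mu]_x (u x * dy phi i x) =
                   - \int[mu]_x (gy x ord0 i * phi x)) /\
        (forall j, \int[mu]_x (u x * (enorm x.1 `^ alpha * dz phi j x)) =
                   - \int[mu]_x (enorm x.1 `^ alpha * gz x ord0 j * phi x))].

Definition energy alpha (gy : E -> 'rV[R]_k) (gz : E -> 'rV[R]_h) : \bar R :=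
  (\int[mu]_x (enorm (gy x) ^+ 2 +
     (alpha + 1) ^+ 2 * enorm x.1 `^ (2 * alpha) * enorm (gz x) ^+ 2)%:E)%E.

(** Weak gradients are unique up to null sets, so that the infimum is over at
    most one value; it is +oo when [u] has no weak gradient. *)
Definition grushin_norm alpha u : \bar R :=
  (ereal_inf [set e | exists gy gz, weak_grad alpha u gy gz /\
                                    e = energy alpha gy gz] `^ 2^-1)%E.

(** The homogeneous dimension Q. *)
Definition hdim alpha : R := k%:R + h%:R * (1 + alpha).

(** The space on which [grushin_norm] is finite and is a norm, i.e. the
    completion of the test functions: integrability at the critical exponent
    2Q/(Q-2) excludes the nonzero constants. *)
Definition energy_space alpha u : Prop :=
  u \in Lfun mu (2 * hdim alpha / (hdim alpha - 2))%:E /\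
  (grushin_norm alpha u < +oo)%E.

Definition weak_solution alpha u : Prop :=
  energy_space alpha u /\
  exists gy gz, weak_grad alpha u gy gz /\
  forall phi, test_fun phi ->
    \int[mu]_x (dot (gy x) (grad_y phi x) +
       (1 + alpha) ^+ 2 * enorm x.1 `^ (2 * alpha) * dot (gz x) (grad_z phi x))
    = \int[mu]_x (`|u x| `^ (4 / (hdim alpha - 2)) * u x * phi x).

Definition sign_changing u : Prop :=
  ~ {ae mu, forall x, u^\+ x = 0} /\ ~ {ae mu, forall x, u^\- x = 0}.

End grushin.

(* Main.v *)
(** Solutions are sought in the form [u(y, z) = N D^(-gam) f(S)], where
    [r = |y|^(1+alpha)], [D = (1 + r)^2 + |z|^2] and [S = 1 - 4 r / D]. As the
    equation is conformally invariant, it reduces to an Emden-Fowler equation for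
    [f] on the interval [0, 1], singular but subcritical at both ends.

    On [c, 1 - c], shooting with zero flux at both ends and the intermediate value
    theorem for the Pruefer angle give solutions with any prescribed number of half
    turns: a Pohozaev multiplier shows that a large initial value forces a large
    energy, hence fast rotation, away from the ends. The number of half turns of
    solutions of bounded energy is bounded uniformly in [c], so many half turns
    force a large energy in the middle of the interval, and this survives the limit
    [c -> 0].

    The resulting [u] is of class C^1 along coordinate lines, which is enough for
    integration by parts against test functions, and its energy density decays like
    an integrable power of [D]. Any weak gradient of [u] agrees almost everywhere
    with the classical one, since smooth bumps determine the integrals over boxes.
    On lines in the direction [z_1] close to [r = 1], [u] takes both the value [0]
    and a value of the order of the size of [f], so the energy is unbounded. *)

Require Import Defs.
From HB Require Import structures.
From mathcomp Require Import all_boot all_order all_algebra.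
From mathcomp Require Import all_classical all_reals all_analysis.
From mathcomp Require Import measurable_realfun.
From mathcomp Require Import ring lra.

Set Implicit Arguments.
Unset Strict Implicit.
Unset Printing Implicit Defensive.

Import Order.TTheory GRing.Theory Num.Theory.
Import numFieldNormedType.Exports.

Local Open Scope classical_set_scope.
Local Open Scope ring_scope.

(** The exponent is critical for [Q], yet the reduced equation sees smaller dimensions: [h + 1] at
    [s = 0], which is the sphere [|y| = 1], [z = 0], and [k] at [s = 1], where [y = 0]. The
    inequalities [h + 1 < Q] and [k < Q] are exactly the two subcriticality conditions. Cutting at
    [c] replaces coefficients with singular ends by bounded ones, so that Picard iteration yields a
    family depending continuously on the initial value; the price is that every estimate must be
    uniform in [c]. This dictates the form of the energy: its kinetic part is divided by both
    weights, so that the nonlinearity cancels in its derivative and the singular coefficients left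
    at the starting end are either integrable or of favourable sign. Largeness is read off at
    [1 / 2], where the estimates from the two ends meet. The norms tend to infinity because the
    constant in their lower bound depends on [alpha], [k] and [h] alone. *)

(** * Differentiation rules, mean value inequalities, Gronwall estimates *)

Section calculus_rules.
Context {R : realType}.
Implicit Types (f g df dg z dz k dk : R -> R) (x a b c : R).

Lemma derE f x a b : is_derive x 1 f a -> a = b -> is_derive x 1 f b.
Proof. by move=> ? <-. Qed.

Lemma derC c x : is_derive x 1 (fun=> c) 0.
Proof. exact: is_derive_cst. Qed.

Lemma derI x : is_derive x 1 (fun t => t) (1 : R).
Proof. exact: is_derive_id. Qed.

Lemma derD f g x a b : is_derive x 1 f a -> is_derive x 1 g b ->
  is_derive x 1 (fun t => f t + g t) (a + b).
Proof. by move=> fa gb; exact: is_deriveD. Qed.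

Lemma derN f x a : is_derive x 1 f a -> is_derive x 1 (fun t => - f t) (- a).
Proof. by move=> fa; exact: is_deriveN. Qed.

Lemma derM f g x a b : is_derive x 1 f a -> is_derive x 1 g b ->
  is_derive x 1 (fun t => f t * g t) (a * g x + f x * b).
Proof.
move=> fa gb; apply: (@is_derive_eq _ _ _ (f * g)).
by rewrite addrC ![_ *: _]mulrC [b * _]mulrC; congr (_ + _).
Qed.

Lemma derX f n x a : is_derive x 1 f a ->
  is_derive x 1 (fun t => f t ^+ n) (n%:R * f x ^+ n.-1 * a).
Proof.
move=> fa; rewrite (_ : (fun t => f t ^+ n) = f ^+ n).
  exact: is_deriveX.
by apply/funext => t; elim: n => [|n IH]; rewrite ?expr0// !exprS IH.
Qed.

Lemma derV f x a : f x != 0 -> is_derive x 1 f a ->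
  is_derive x 1 (fun t => (f t)^-1) (- (f x) ^- 2 * a).
Proof.
move=> fx0 fa; split; first by apply: derivableV => //; exact: ex_derive.
by rewrite deriveV// derive_val.
Qed.

Lemma derComp f g x a b : is_derive (g x) 1 f a -> is_derive x 1 g b ->
  is_derive x 1 (fun t => f (g t)) (a * b).
Proof. by move=> fa gb; exact: is_derive1_comp. Qed.

Lemma derExp f x a : is_derive x 1 f a ->
  is_derive x 1 (fun t => expR (f t)) (expR (f x) * a).
Proof. by apply: derComp. Qed.

Lemma derSin f x a : is_derive x 1 f a ->
  is_derive x 1 (fun t => sin (f t)) (cos (f x) * a).
Proof. by apply: derComp. Qed.

Lemma derCos f x a : is_derive x 1 f a ->
  is_derive x 1 (fun t => cos (f t)) (- sin (f x) * a).
Proof. by apply: derComp. Qed.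

Lemma derAtan f x a : is_derive x 1 f a ->
  is_derive x 1 (fun t => atan (f t)) ((1 + f x ^+ 2)^-1 * a).
Proof. by apply: derComp. Qed.

Lemma derPow f x a r : 0 < f x -> is_derive x 1 f a ->
  is_derive x 1 (fun t => f t `^ r) (r * f x `^ (r - 1) * a).
Proof.
move=> fx; apply: (@derComp (fun t => t `^ r)).
exact: is_derive1_powR.
Qed.

End calculus_rules.

(** Syntax-directed differentiation: the rules fill in the derivative, and [derby] then asks only
    that it equal the announced value, besides the side conditions of inverses and powers. *)
Ltac der := repeat match goal with
  | |- is_derive _ _ (fun _ => ?c) _ => notypeclasses refine (derC _ _)
  | |- is_derive _ _ (fun t => t) _ => notypeclasses refine (derI _)
  | H : is_derive _ _ _ _ |- is_derive _ _ _ _ => notypeclasses refine H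
  | |- is_derive _ _ (GRing.add ?c) _ => notypeclasses refine (derD (derC c _) (derI _))
  | |- is_derive _ _ (GRing.mul ?c) _ => notypeclasses refine (derM (derC c _) (derI _))
  | |- is_derive _ _ (@GRing.opp _) _ => notypeclasses refine (derN (derI _))
  | |- is_derive _ _ (@expR _) _ => notypeclasses refine (derExp (derI _))
  | |- is_derive _ _ (@sin _) _ => notypeclasses refine (derSin (derI _))
  | |- is_derive _ _ (@cos _) _ => notypeclasses refine (derCos (derI _))
  | |- is_derive _ _ (fun t => _ + _) _ => notypeclasses refine (derD _ _)
  | |- is_derive _ _ (fun t => - _) _ => notypeclasses refine (derN _)
  | |- is_derive _ _ (fun t => _ * _) _ => notypeclasses refine (derM _ _)
  | |- is_derive _ _ (fun t => _ ^+ _) _ => notypeclasses refine (derX _ _)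
  | |- is_derive _ _ (fun t => (_)^-1) _ => notypeclasses refine (derV _ _)
  | |- is_derive _ _ (fun t => expR _) _ => notypeclasses refine (derExp _)
  | |- is_derive _ _ (fun t => sin _) _ => notypeclasses refine (derSin _)
  | |- is_derive _ _ (fun t => cos _) _ => notypeclasses refine (derCos _)
  | |- is_derive _ _ (fun t => atan _) _ => notypeclasses refine (derAtan _)
  | |- is_derive _ _ (fun t => _ `^ _) _ => notypeclasses refine (derPow _ _ _)
  end.

Ltac derby := notypeclasses refine (derE _ _); [der|rewrite /=].

Section calculus.
Context {R : realType}.
Implicit Types (f g df dg z dz k dk : R -> R) (x a b c : R).

Lemma der_cont f x a : is_derive x 1 f a -> {for x, continuous f}.
Proof.
move=> fa; apply: differentiable_continuous.
by apply/derivable1_diffP; exact: ex_derive.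
Qed.

Lemma der_eps f x d : is_derive x 1 f d <->
  forall e, 0 < e -> exists2 r, 0 < r &
    forall y, `|y - x| < r -> `|f y - f x - d * (y - x)| <= e * `|y - x|.
Proof.
split => [fd e e0|H].
- have : h^-1 *: (f (h *: 1 + x) - f x) @[h --> 0^'] --> d.
    have := @ex_derive _ _ _ _ _ _ _ fd; move=> /cvg_ex[l /= fl].
    by have := @derive_val _ _ _ _ _ _ _ fd; rewrite /derive (cvg_lim _ fl)// => <-.
  move=> /cvgrPdist_le /(_ e e0) [r /= r0 Hr]; exists r => // y yx.
  have [->|yx0] := eqVneq y x; first by rewrite !subrr mulr0 subr0 normr0 mulr0.
  have yx1 : y - x != 0 by rewrite subr_eq0.
  have := Hr (y - x); rewrite /= sub0r normrN => /(_ yx yx1).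
  rewrite [_%:A]mulr1 subrK => Hd.
  rewrite -[leRHS]mulrC -ler_pdivrMl ?normr_gt0// -normfV -normrM.
  apply: le_trans Hd; rewrite distrC le_eqVlt; apply/orP; left; apply/eqP; congr `|_|.
  by rewrite mulrBr [X in _ = X - _]/GRing.scale/= [d * _]mulrC mulKf.
- have Hc : h^-1 *: (f (h *: 1 + x) - f x) @[h --> 0^'] --> d.
    apply/cvgrPdist_le => e e0; have [r r0 Hr] := H _ e0.
    exists r => //= y; rewrite /= sub0r normrN => yr y0.
    rewrite [_%:A]mulr1; have := Hr (y + x); rewrite addrK => /(_ yr) Hd.
    rewrite distrC -(ler_pM2l (x := `|y|)) ?normr_gt0// -normrM [`|y| * e]mulrC.
    apply: le_trans Hd; rewrite le_eqVlt; apply/orP; left; apply/eqP; congr `|_|.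
    by rewrite mulrBr [y *(_ *: _)]mulrA mulfV// mul1r [d * _]mulrC.
  by split; [apply/cvg_ex; exists d|apply: cvg_lim].
Qed.

Lemma le_of_der f df a b : a <= b ->
  (forall t, a <= t <= b -> is_derive t 1 f (df t)) ->
  (forall t, a <= t <= b -> 0 <= df t) -> f a <= f b.
Proof.
move=> ab fd d0.
have [||c + e] := @MVT_segment _ f df a b ab.
- by move=> x /[!in_itv]/= /andP[ax xb]; apply: fd; rewrite !ltW.
- apply: continuous_in_subspaceT => x; rewrite inE/= in_itv/= => xab.
  exact: der_cont (fd _ xab).
rewrite in_itv/= => cab; by rewrite -subr_ge0 e mulr_ge0// ?subr_ge0// d0.
Qed.

Lemma le_of_der_oo f df a b : a <= b ->
  (forall t, a < t < b -> is_derive t 1 f (df t)) ->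
  {within `[a, b], continuous f} ->
  (forall t, a < t < b -> 0 <= df t) -> f a <= f b.
Proof.
move=> ab fd fc d0; have [->//|nab] := eqVneq a b.
have {}ab : a < b by rewrite lt_neqAle nab.
have fd' x : x \in `]a, b[%R -> is_derive x 1 f (df x) by rewrite in_itv/=; exact: fd.
have [c + e] := MVT ab fd' fc.
rewrite in_itv/= => cab; by rewrite -subr_ge0 e mulr_ge0// ?subr_ge0 ?(ltW ab)// d0.
Qed.

Lemma ge_of_der f df a b : a <= b ->
  (forall t, a <= t <= b -> is_derive t 1 f (df t)) ->
  (forall t, a <= t <= b -> df t <= 0) -> f b <= f a.
Proof.
move=> ab fd d0; rewrite -lerN2.
apply: (@le_of_der (fun t => - f t) (fun t => - df t)) => // t tab.
- exact/derN/fd.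
- by rewrite oppr_ge0 d0.
Qed.

(** Both [g + f] and [g - f] are nondecreasing. This stands in for integrating a bound on [df]: a
    primitive [g] of the bound is exhibited instead. *)
Lemma dist_of_der f g df dg a b : a <= b ->
  (forall t, a <= t <= b -> is_derive t 1 f (df t)) ->
  (forall t, a <= t <= b -> is_derive t 1 g (dg t)) ->
  (forall t, a <= t <= b -> `|df t| <= dg t) -> `|f b - f a| <= g b - g a.
Proof.
move=> ab fd gd dd; rewrite ler_norml; apply/andP; split.
- suff : (f a + g a) <= (f b + g b) by lra.
  apply: (@le_of_der (fun t => f t + g t) (fun t => df t + dg t)) => // t tab.
    by apply: derD; [exact: fd|exact: gd].
  by have := dd t tab; rewrite ler_norml; lra.
- suff : (g a - f a) <= (g b - f b) by lra.
  apply: (@le_of_der (fun t => g t - f t) (fun t => dg t - df t)) => // t tab.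
    by apply: derD; [exact: gd|apply: derN; exact: fd].
  by have := dd t tab; rewrite ler_norml; lra.
Qed.

(** The product [z * expR (- k)] is nonincreasing. The primitive [k] is a parameter, so that
    singular but integrable coefficients are allowed. *)
Lemma gronwall z dz k dk a b : a <= b ->
  (forall t, a <= t <= b -> is_derive t 1 z (dz t)) ->
  (forall t, a <= t <= b -> is_derive t 1 k (dk t)) ->
  (forall t, a <= t <= b -> dz t <= dk t * z t) ->
  z b <= z a * expR (k b - k a).
Proof.
move=> ab zd kd H.
suff : z b * expR (- k b) <= z a * expR (- k a).
  move=> h; rewrite addrC expRD mulrA.
  by rewrite -ler_pdivrMr ?expR_gt0// -expRN.
apply: (@ge_of_der (fun t => z t * expR (- k t))
  (fun t => dz t * expR (- k t) + z t * (expR (- k t) * - dk t))) => // t tab.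
- apply: derM; first exact: zd.
  by apply: derExp; apply: derN; exact: kd.
- rewrite (_ : _ + _ = (dz t - dk t * z t) * expR (- k t)); last by ring.
  by rewrite mulr_le0_ge0 ?expR_ge0// subr_le0 H.
Qed.

Lemma gronwall_rev z dz k dk a b : a <= b ->
  (forall t, a <= t <= b -> is_derive t 1 z (dz t)) ->
  (forall t, a <= t <= b -> is_derive t 1 k (dk t)) ->
  (forall t, a <= t <= b -> - (dk t * z t) <= dz t) ->
  z a <= z b * expR (k b - k a).
Proof.
move=> ab zd kd H.
suff : z a * expR (k a) <= z b * expR (k b).
  move=> h; rewrite expRD mulrA expRN.
  by rewrite ler_pdivlMr ?expR_gt0.
apply: (@le_of_der (fun t => z t * expR (k t))
  (fun t => dz t * expR (k t) + z t * (expR (k t) * dk t))) => // t tab.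
- apply: derM; first exact: zd.
  by apply: derExp; exact: kd.
- rewrite (_ : _ + _ = (dz t + dk t * z t) * expR (k t)); last by ring.
  by rewrite mulr_ge0 ?expR_ge0// -[dk t * _]opprK subr_ge0 H.
Qed.

Lemma reflect_der f x a : is_derive (1 - x) 1 f a ->
  is_derive x 1 (fun t => f (1 - t)) (- a).
Proof.
move=> fa; notypeclasses refine (derE (@derComp _ f (fun t => 1 - t) x a (0 + -1) fa _) _); first by der.
by rewrite add0r mulrN1.
Qed.

(* By the last exit from the sublevel set [z <= 0]. *)
Lemma barrier z dz a b : a <= b ->
  (forall t, a <= t <= b -> is_derive t 1 z (dz t)) ->
  (forall t, a <= t <= b -> 0 < z t -> dz t <= 0) ->
  z a <= 0 -> z b <= 0.
Proof.
move=> ab zd H za; rewrite leNgt; apply/negP => zb.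
pose S := [set t | a <= t <= b /\ z t <= 0].
have Sa : S a by split => //; rewrite lexx ab.
have hS : has_sup S by split; [exists a|exists b => t [/andP[]]].
pose c := sup S.
have cb : c <= b by apply: sup_le_ub => //; [exists a|move=> t [/andP[]]].
have ac : a <= c by apply: sup_upper_bound.
have cab : a <= c <= b by rewrite ac cb.
have zc0 : z c <= 0.
  rewrite leNgt; apply/negP => zc.
  have /cvgrPdist_lt/(_ _ zc)[r /= r0 Hr] := der_cont (zd c cab).
  have [t [tab zt] ct] := @sup_adherent _ S r r0 hS.
  have tc : t <= c by apply: sup_upper_bound.
  have := Hr t; rewrite /= ger0_norm ?subr_ge0// ltrBlDr.
  move: ct; rewrite -/c ltrBlDr addrC => ct /(_ ct) /ltr_normlP[_].
  by move: zt zc; clear; lra.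
have cltb : c < b.
  rewrite lt_neqAle cb andbT; apply/negP => /eqP cb'.
  by move: zc0; rewrite cb' leNgt zb.
have zpos t : c < t -> t <= b -> 0 < z t.
  move=> ct tb; rewrite ltNge; apply/negP => zt.
  have : t <= c by apply: sup_upper_bound => //; split => //; rewrite (le_trans ac (ltW ct)).
  by rewrite leNgt ct.
suff : - z c <= - z b by lra.
apply: (@le_of_der_oo (fun t => - z t) (fun t => - dz t)) => //.
- move=> t /andP[ct tb]; apply: derN; apply: zd.
  by rewrite (ltW tb) (le_trans ac (ltW ct)).
- apply: continuous_in_subspaceT => x; rewrite inE/= in_itv/= => /andP[cx xb].
  apply: continuousN; apply: (der_cont (a := dz x)); apply: zd.
  by rewrite xb (le_trans ac cx).
- move=> t /andP[ct tb]; rewrite oppr_ge0 H ?(ltW tb) ?andbT//.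
  + exact: le_trans ac (ltW ct).
  + by apply: zpos => //; rewrite ltW.
Qed.

Lemma ivt f a b v : a <= b -> (forall t, a <= t <= b -> {for t, continuous f}) ->
  Num.min (f a) (f b) <= v <= Num.max (f a) (f b) ->
  exists2 c, a <= c <= b & f c = v.
Proof.
move=> ab fc fv.
have [|c + e] := @IVT _ f a b v ab _ fv; last first.
  by rewrite in_itv/= => cab; exists c.
by apply: continuous_in_subspaceT => x; rewrite inE/= in_itv/=; exact: fc.
Qed.

(** Near [x] the function [fn n - g x * t] has slope at most [c n + e / 2]; its increments keep this
    bound in the limit, where [c n] disappears. *)
Lemma der_lim (fn dn : nat -> R -> R) f g (x r : R) (c : nat -> R) : 0 < r ->
  (forall t, `|t - x| < r -> fn ^~ t @ \oo --> f t) ->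
  (forall n t, `|t - x| < r -> is_derive t 1 (fn n) (dn n t)) ->
  (forall n t, `|t - x| < r -> `|dn n t - g t| <= c n) ->
  c @ \oo --> 0 -> {for x, continuous g} -> is_derive x 1 f (g x).
Proof.
move=> r0 fl fd dg c0 gc; apply/der_eps => e e0.
have e2 : 0 < e / 2 by rewrite divr_gt0.
have /cvgrPdist_le/(_ _ e2)[r1 /= r10 Hr1] := gc.
exists (Num.min r r1) => [|y]; first by rewrite lt_min r0.
rewrite lt_min => /andP[yr yr1].
have Hn n : `|fn n y - fn n x - g x * (y - x)| <= (c n + e / 2) * `|y - x|.
  have key u v : u <= v -> (forall t, u <= t <= v -> `|t - x| <= `|y - x|) ->
      `|fn n v - fn n u - g x * (v - u)| <= (c n + e / 2) * (v - u).
    move=> uv Huv.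
    have := @dist_of_der (fun t => fn n t - g x * t) (fun t => (c n + e / 2) * t)
      (fun t => dn n t - g x) (fun=> c n + e / 2) u v uv.
    have near_ t : u <= t <= v -> `|t - x| < r /\ `|t - x| < r1.
      by move=> /Huv; split; apply: le_lt_trans yr || apply: le_lt_trans yr1.
    rewrite (_ : _ - _ - (fn n u - g x * u) = fn n v - fn n u - g x * (v - u)); last by ring.
    rewrite -[_ * v - _]mulrBr; apply => t tuv; have [tr tr1] := near_ _ tuv.
    + have fdt := fd n t tr; derby; by ring.
    + derby; by ring.
    + have h1 := dg n t tr.
      have h2 : `|g x - g t| <= e / 2.
        by apply: Hr1 => /=; rewrite distrC.
      rewrite (_ : _ - _ = (dn n t - g t) + (g t - g x)); last by ring.
      by apply: le_trans (ler_normD _ _) _; rewrite lerD// distrC.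
  have [xy|yx] := leP x y.
    have := key x y xy; rewrite ger0_norm ?subr_ge0//; apply => t /andP[xt ty].
    by rewrite ger0_norm ?subr_ge0// lerD2r.
  have := key y x (ltW yx); rewrite [`|y - x|]distrC (ger0_norm (_ : 0 <= x - y)) ?subr_ge0 ?(ltW yx)//.
  rewrite -normrN (_ : - (_ - _ - _) = fn n y - fn n x - g x * (y - x)); last by ring.
  apply => t /andP[yt tx].
  by rewrite distrC ger0_norm ?subr_ge0// lerD2l lerN2.
have yx0 : `|x - x| < r by rewrite subrr normr0.
have L : (fun n => (c n + e / 2) * `|y - x| - `|fn n y - fn n x - g x * (y - x)|) @ \oo -->
   (0 + e / 2) * `|y - x| - `|f y - f x - g x * (y - x)|.
  apply: cvgB; first by apply: cvgMl; apply: cvgD => //; exact: cvg_cst.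
  apply: cvg_norm; apply: cvgB; last exact: cvg_cst.
  by apply: cvgB; exact: fl.
have : 0 <= (0 + e / 2) * `|y - x| - `|f y - f x - g x * (y - x)|.
  rewrite -(cvg_lim _ L)//; apply: limr_ge; first by apply/cvg_ex; eexists; exact: L.
  by near=> n; rewrite subr_ge0.
rewrite subr_ge0 add0r => /le_trans; apply.
rewrite ler_wpM2r//; lra.
Unshelve. all: by end_near. Qed.

End calculus.


Ltac pos := match goal with
  | |- is_true (0 < _ * _)%R => apply: mulr_gt0; pos
  | |- is_true (0 <= _ * _)%R => apply: mulr_ge0; pos
  | |- is_true (0 < _^-1)%R => rewrite invr_gt0; pos
  | |- is_true (0 <= _^-1)%R => rewrite invr_ge0; pos
  | |- is_true (0 < _ + _)%R => first [assumption | apply: addr_gt0; pos | apply: ltr_pwDl; pos | apply: ltr_wpDl; pos]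
  | |- is_true (0 <= _ + _)%R => first [assumption | apply: addr_ge0; pos]
  | |- is_true (0 < _ `^ _)%R => apply: powR_gt0; pos
  | |- is_true (0 <= _ `^ _)%R => apply: powR_ge0
  | |- is_true (0 <= _ ^+ 2)%R => apply: sqr_ge0
  | |- is_true (0 <= _ ^+ _)%R => apply: exprn_ge0; pos
  | |- is_true (0 < _ ^+ _)%R => apply: exprn_gt0; pos
  | |- is_true (0 < expR _)%R => apply: expR_gt0
  | |- is_true (0 <= expR _)%R => apply: expR_ge0
  | |- is_true (0 <= `|_|)%R => apply: normr_ge0
  | |- _ => first [assumption | by [] | by apply: ltW]
  end.

(** * Ordinary differential equations *)

Section antiderivative.
Context {R : realType}.
Let mu := @lebesgue_measure R.

Lemma antiderivative_right (g : R -> R) (a : R) : continuous g ->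
  exists G : R -> R, forall x, a < x -> is_derive x 1 G (g x).
Proof.
move=> gc; exists (fun x => (\int[mu]_(t in `[a, x]) g t)) => x ax.
have gi : mu.-integrable `[a, x + 1] (EFin \o g).
  apply: continuous_compact_integrable => //; first exact: segment_compact.
  exact: continuous_subspaceT.
have xx1 : x < x + 1 by rewrite ltrDl.
have [h1 h2] := @continuous_FTC1_closed R g a x (x + 1) xx1 gi ax (gc x).
by split; [exact: h1|rewrite -derive1E].
Qed.

(** An integral from [t0 - n.+1] is a primitive only to the right of its base point. Normalized to
    vanish at [t0], these primitives agree where they overlap and glue to one on the whole line. *)
Lemma antiderivative (g : R -> R) (t0 : R) : continuous g ->
  exists G : R -> R, G t0 = 0 /\ forall x : R, is_derive x 1 G (g x).
Proof.
move=> gc.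
have /choice[F HF] : forall n : nat, exists G : R -> R, G t0 = 0 /\
    forall x : R, t0 - n.+1%:R < x -> is_derive x 1 G (g x).
  move=> n; have [G HG] := antiderivative_right (t0 - n.+1%:R) gc.
  exists (fun x => G x - G t0); split => [|x nx]; first by rewrite subrr.
  have h := HG x nx; derby; ring.
have F0 n : F n t0 = 0 by case: (HF n).
have FD n (x : R) : t0 - n.+1%:R < x -> is_derive x 1 (F n) (g x) by case: (HF n) => _; exact.
have agree n m x : (n <= m)%N -> t0 - n.+1%:R < x -> F n x = F m x.
  move=> nm nx.
  have nm' : t0 - m.+1%:R <= t0 - n.+1%:R by rewrite lerD2l lerN2 ler_nat.
  have d (t : R) : t0 - n.+1%:R < t -> is_derive t 1 (fun s => F n s - F m s) 0.
    move=> nt; have h1 := FD n t nt; have h2 := FD m t (le_lt_trans nm' nt).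
    derby; ring.
  have z (u v : R) : u <= v -> t0 - n.+1%:R < u ->
      F n v - F m v = F n u - F m u.
    move=> uv nu; apply/eqP; rewrite eq_le; apply/andP; split.
    - apply: (@ge_of_der _ (fun s => F n s - F m s) (fun=> 0)) => // t /andP[ut _].
      exact: d (lt_le_trans nu ut).
    - apply: (@le_of_der _ (fun s => F n s - F m s) (fun=> 0)) => // t /andP[ut _].
      exact: d (lt_le_trans nu ut).
  apply/eqP; rewrite -subr_eq0; apply/eqP.
  have t0n : t0 - n.+1%:R < t0 by rewrite ltrBlDr ltrDl ltr0Sn.
  by have [xt|/ltW xt] := leP t0 x; [rewrite (z t0 x)|rewrite -(z x t0)]; rewrite // !F0 subrr.
(* An index whose half-line certainly contains [x]. *)
pose N x := (Num.truncn `|x - t0|).+1.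
have NP x : t0 - (N x).+1%:R < x.
  have : `|x - t0| < (N x)%:R by apply: truncnS_gt.
  move=> h; rewrite ltrBlDr -ltrBlDl (le_lt_trans (ler_norm _))// distrC (lt_le_trans h)//.
  by rewrite ler_nat.
have GE n x : t0 - n.+1%:R < x -> F (N x) x = F n x.
  move=> nx; case: (leqP n (N x)) => [h|/ltnW h]; first by rewrite (agree n (N x)).
  by rewrite (agree (N x) n).
exists (fun x => F (N x) x); split; first by rewrite F0.
move=> x; apply: (@near_eq_is_derive _ _ _ (F (N x))); last exact/FD/NP.
near=> y; apply/esym/GE; near: y; apply: lt_nbhsr; exact: NP.
Unshelve. all: by end_near. Qed.

End antiderivative.

Section picard.
Context {R : realType}.
Variables (F1 F2 : R -> R -> R -> R) (L B : R).
Hypothesis L0 : 0 < L.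
Hypothesis B0 : 0 <= B.
Hypothesis F1c : forall x y : R -> R, continuous x -> continuous y ->
  continuous (fun t => F1 t (x t) (y t)).
Hypothesis F2c : forall x y : R -> R, continuous x -> continuous y ->
  continuous (fun t => F2 t (x t) (y t)).
Hypothesis F1L : forall t x y x' y',
  `|F1 t x y - F1 t x' y'| <= L * (`|x - x'| + `|y - y'|).
Hypothesis F2L : forall t x y x' y',
  `|F2 t x y - F2 t x' y'| <= L * (`|x - x'| + `|y - y'|).
Hypothesis F1B : forall t x y, `|F1 t x y| <= B.
Hypothesis F2B : forall t x y, `|F2 t x y| <= B.

Definition ode_sol (X Y : R -> R) := forall t : R,
  is_derive t 1 X (F1 t (X t) (Y t)) /\ is_derive t 1 Y (F2 t (X t) (Y t)).

(** Gronwall for the squared distance; the rate [4 * L] comes from bounding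
    [2 * L * (|u| + |v|) ^+ 2] by [4 * L * (u ^+ 2 + v ^+ 2)]. *)
Lemma ode_dep X Y X' Y' (a b : R) : a <= b -> ode_sol X Y -> ode_sol X' Y' ->
  (X b - X' b) ^+ 2 + (Y b - Y' b) ^+ 2 <=
  ((X a - X' a) ^+ 2 + (Y a - Y' a) ^+ 2) * expR (4 * L * (b - a)).
Proof.
move=> ab S S'.
have := @gronwall R (fun t => (X t - X' t) ^+ 2 + (Y t - Y' t) ^+ 2)
  (fun t => 2 * (X t - X' t) * (F1 t (X t) (Y t) - F1 t (X' t) (Y' t)) +
    2 * (Y t - Y' t) * (F2 t (X t) (Y t) - F2 t (X' t) (Y' t)))
  (fun t => 4 * L * t) (fun=> 4 * L) a b ab.
rewrite -mulrBr; apply => t tab.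
- have [h1 h2] := S t; have [h3 h4] := S' t; derby; ring.
- derby; ring.
- set u := X t - X' t; set v := Y t - Y' t.
  have h1 : u * (F1 t (X t) (Y t) - F1 t (X' t) (Y' t)) <= `|u| * (L * (`|u| + `|v|)).
    by apply: le_trans (ler_norm _) _; rewrite normrM ler_wpM2l.
  have h2 : v * (F2 t (X t) (Y t) - F2 t (X' t) (Y' t)) <= `|v| * (L * (`|u| + `|v|)).
    by apply: le_trans (ler_norm _) _; rewrite normrM ler_wpM2l.
  rewrite -[u ^+ 2]real_normK ?num_real// -[v ^+ 2]real_normK ?num_real//.
  rewrite -!mulrA -mulrDr.
  apply: (@le_trans _ _ (2 * (L * (`|u| + `|v|) ^+ 2))); first by lra.
  have : 0 <= L * (`|u| - `|v|) ^+ 2 by rewrite mulr_ge0 ?sqr_ge0// ltW.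
  lra.
Qed.

Section existence.
Variables (t0 x0 y0 : R).

(** The iteration needs a total operator; the default value [0] for discontinuous [g] is never met,
    since all iterates are continuous. *)
Let prim (g : R -> R) : R -> R :=
  if pselect (continuous g) is left gc then projT1 (cid (antiderivative t0 gc))
  else fun=> 0.

Let primP g : continuous g -> prim g t0 = 0 /\ forall x : R, is_derive x 1 (prim g) (g x).
Proof.
by move=> gc; rewrite /prim; case: pselect => // gc'; case: cid.
Qed.

Fixpoint picard (n : nat) : (R -> R) * (R -> R) :=
  if n is m.+1 then
    (fun t => x0 + prim (fun s => F1 s ((picard m).1 s) ((picard m).2 s)) t,
     fun t => y0 + prim (fun s => F2 s ((picard m).1 s) ((picard m).2 s)) t)
  else (fun=> x0, fun=> y0).

Let X n := (picard n).1.
Let Y n := (picard n).2.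

Let XYc n : continuous (X n) /\ continuous (Y n).
Proof.
elim: n => [|n [IHx IHy]]; first by split => x; exact: cvg_cst.
have [_ h1] := primP (F1c IHx IHy); have [_ h2] := primP (F2c IHx IHy).
by split => x; (apply: cvgD; [exact: cvg_cst|]); [exact: der_cont (h1 x)|exact: der_cont (h2 x)].
Qed.

Let Xder n (x : R) : is_derive x 1 (X n.+1) (F1 x (X n x) (Y n x)).
Proof.
have [h1 h2] := XYc n; have [_ h] := primP (F1c h1 h2).
have hx := h x; rewrite /X/=; derby; ring.
Qed.

Let Yder n (x : R) : is_derive x 1 (Y n.+1) (F2 x (X n x) (Y n x)).
Proof.
have [h1 h2] := XYc n; have [_ h] := primP (F2c h1 h2).
have hx := h x; rewrite /Y/=; derby; ring.
Qed.

Let X0 n : X n t0 = x0.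
Proof.
case: n => // n; have [h1 h2] := XYc n; have [h _] := primP (F1c h1 h2).
by rewrite /X/= h addr0.
Qed.

Let Y0 n : Y n t0 = y0.
Proof.
case: n => // n; have [h1 h2] := XYc n; have [h _] := primP (F2c h1 h2).
by rewrite /Y/= h addr0.
Qed.

(** A Bielecki weight: [w] is a smooth substitute for [expR (K * |t - t0|)]. Two components, each
    contracted by [L / K], give the ratio [1 / 2], so that the iteration converges on the whole line
    at once. *)
Let K := 4 * L.
Let K0 : 0 < K. Proof. by rewrite /K mulr_gt0. Qed.
Let w t := expR (K * (t - t0)) + expR (- (K * (t - t0))).
Let w0 t : 0 < w t. Proof. by rewrite addr_gt0 ?expR_gt0. Qed.

Let w1 t : 1 <= w t.
Proof.
have [h|h] := leP 0 (K * (t - t0)).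
- have := expR_ge1Dx (K * (t - t0)); have := expR_gt0 (- (K * (t - t0))); rewrite /w; lra.
- have := expR_ge1Dx (- (K * (t - t0))); have := expR_gt0 (K * (t - t0)); rewrite /w; lra.
Qed.

(** The difference of the two exponentials, divided by [K], is a primitive of [w] vanishing at [t0],
    and it is at most [w / K] in absolute value. *)
Let dom (u du : R -> R) (c : R) : 0 <= c -> u t0 = 0 -> (forall x : R, is_derive x 1 u (du x)) ->
  (forall x, `|du x| <= c * w x) -> forall t, `|u t| <= c / K * w t.
Proof.
move=> c0 u0 ud ub t.
pose v t := c / K * (expR (K * (t - t0)) - expR (- (K * (t - t0)))).
have vd (x : R) : is_derive x 1 v (c * w x).
  by rewrite /v /w; derby; field; rewrite gt_eqF.
have v0 : v t0 = 0 by rewrite /v subrr mulr0 oppr0 subrr mulr0.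
have key (a b : R) : a <= b -> `|u b - u a| <= v b - v a.
  by move=> ab; apply: (dist_of_der ab) => s _.
have cK : 0 <= c / K by rewrite divr_ge0// ltW.
have [tt|/ltW tt] := leP t0 t.
- have := key _ _ tt; rewrite u0 v0 !subr0 => /le_trans; apply; rewrite /v.
  by rewrite ler_wpM2l// /w lerD2l (le_trans _ (expR_ge0 _))// oppr_le0 expR_ge0.
- have := key _ _ tt; rewrite u0 v0 !sub0r normrN => /le_trans; apply; rewrite /v.
  by rewrite -mulrN ler_wpM2l// /w opprB addrC lerD2r (le_trans _ (expR_ge0 _))// oppr_le0 expR_ge0.
Qed.

Let D := 2 * B / K + 1.
Let D0 : 0 <= D. Proof. by rewrite addr_ge0// divr_ge0 ?mulr_ge0// ltW. Qed.

Let step n t : `|X n.+1 t - X n t| + `|Y n.+1 t - Y n t| <= D * 2^-1 ^+ n * w t.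
Proof.
elim: n t => [|n IH] t.
- have h1 : `|X 1 t - X 0 t| <= B / K * w t.
    apply: (dom (u := fun t => X 1 t - X 0 t) (du := fun s => F1 s x0 y0)) => //.
    + by rewrite !X0 subrr.
    + by move=> x; have h := Xder 0 x; notypeclasses refine (derE (derD h (derC (- x0) x)) _); rewrite addr0.
    + by move=> x; rewrite (le_trans (F1B _ _ _))// ler_peMr.
  have h2 : `|Y 1 t - Y 0 t| <= B / K * w t.
    apply: (dom (u := fun t => Y 1 t - Y 0 t) (du := fun s => F2 s x0 y0)) => //.
    + by rewrite !Y0 subrr.
    + by move=> x; have h := Yder 0 x; notypeclasses refine (derE (derD h (derC (- y0) x)) _); rewrite addr0.
    + by move=> x; rewrite (le_trans (F2B _ _ _))// ler_peMr.
  rewrite expr0 mulr1 /D; have := w0 t; lra.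
- have cc : 0 <= L * (D * 2^-1 ^+ n) by rewrite !mulr_ge0// ?exprn_ge0// ltW.
  have h1 : `|X n.+2 t - X n.+1 t| <= L * (D * 2^-1 ^+ n) / K * w t.
    apply: (dom (u := fun t => X n.+2 t - X n.+1 t)
      (du := fun s => F1 s (X n.+1 s) (Y n.+1 s) - F1 s (X n s) (Y n s))) => //.
    + by rewrite !X0 subrr.
    + by move=> x; have g := Xder n.+1 x; have h := Xder n x; derby.
    + move=> x; apply: le_trans (F1L _ _ _ _ _) _; rewrite -mulrA ler_wpM2l ?(ltW L0)//.
  have h2 : `|Y n.+2 t - Y n.+1 t| <= L * (D * 2^-1 ^+ n) / K * w t.
    apply: (dom (u := fun t => Y n.+2 t - Y n.+1 t)
      (du := fun s => F2 s (X n.+1 s) (Y n.+1 s) - F2 s (X n s) (Y n s))) => //.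
    + by rewrite !Y0 subrr.
    + by move=> x; have g := Yder n.+1 x; have h := Yder n x; derby.
    + move=> x; apply: le_trans (F2L _ _ _ _ _) _; rewrite -mulrA ler_wpM2l ?(ltW L0)//.
  apply: le_trans (lerD h1 h2) _; rewrite exprS /K le_eqVlt; apply/orP; left; apply/eqP.
  by field; rewrite gt_eqF.
Qed.

(** Geometric summation with the factor [w t] carried along, so that the convergence is uniform on
    bounded intervals. *)
Let cauchy (Z : nat -> R -> R) : (forall n t, `|Z n.+1 t - Z n t| <= D * 2^-1 ^+ n * w t) ->
  exists Z' : R -> R, forall t, Z ^~ t @ \oo --> Z' t /\
   forall n, `|Z n t - Z' t| <= 2 * D * 2^-1 ^+ n * w t.
Proof.
move=> H.
have tri n m t : `|Z (n + m)%N t - Z n t| <= 2 * D * 2^-1 ^+ n * w t * (1 - 2^-1 ^+ m).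
  elim: m => [|m IH]; first by rewrite addn0 subrr normr0 expr0 subrr mulr0.
  rewrite addnS (_ : _ - _ = (Z (n + m).+1 t - Z (n + m)%N t) + (Z (n + m)%N t - Z n t)); last by ring.
  apply: le_trans (ler_normD _ _) _; apply: le_trans (lerD (H _ _) IH) _.
  rewrite exprD exprS le_eqVlt; apply/orP; left; apply/eqP; by field.
have tri' n m t : (n <= m)%N -> `|Z m t - Z n t| <= 2 * D * 2^-1 ^+ n * w t.
  move=> nm; rewrite -(subnKC nm); apply: le_trans (tri _ _ _) _.
  by rewrite ler_piMr ?mulr_ge0 ?exprn_ge0 ?(ltW (w0 _))// lerBlDr lerDl exprn_ge0.
have c0 t : (fun n => 2 * D * 2^-1 ^+ n * w t) @ \oo --> 0.
  rewrite -(mul0r (w t)) -(mulr0 (2 * D)); apply: cvgMl; apply: cvgMr.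
  by apply: cvg_expr; rewrite ger0_norm// invf_lt1// ltr1n.
have cv t : cvgn (Z ^~ t).
  apply: R_complete; apply/cauchy_exP => e e0.
  have /cvgrPdist_lt/(_ _ e0)[N _ HN] := c0 t.
  exists (Z N t); exists N => // m Nm /=; rewrite /ball/= distrC.
  apply: le_lt_trans (tri' _ _ _ Nm) _.
  by have := HN N (leqnn N); rewrite sub0r normrN => /(le_lt_trans (ler_norm _)).
exists (fun t => limn (Z ^~ t)) => t; split; first exact: cv.
move=> n.
have : `|Z n t - Z m t| @[m --> \oo] --> `|Z n t - limn (Z ^~ t)|.
  by apply: cvg_norm; apply: cvgB; [exact: cvg_cst|exact: cv].
move=> /(@cvg_lim _ _ _)h; rewrite -h//; apply: limr_le.
  by apply: is_cvg_norm; apply: is_cvgB; [exact: is_cvg_cst|exact: cv].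
by exists n => // m nm /=; rewrite distrC tri'.
Qed.

(** The derivative of iterate [n.+1] is the field at iterate [n], and the latter converges locally
    uniformly by the Lipschitz condition, so [der_lim] applies to the shifted sequence. *)
Lemma ode_exists : exists X Y, [/\ ode_sol X Y, X t0 = x0 & Y t0 = y0].
Proof.
have [X' HX] : exists Z' : R -> R, forall t, X ^~ t @ \oo --> Z' t /\
   forall n, `|X n t - Z' t| <= 2 * D * 2^-1 ^+ n * w t.
  by apply: cauchy => n t; apply: le_trans (step n t); rewrite lerDl.
have [Y' HY] : exists Z' : R -> R, forall t, Y ^~ t @ \oo --> Z' t /\
   forall n, `|Y n t - Z' t| <= 2 * D * 2^-1 ^+ n * w t.
  by apply: cauchy => n t; apply: le_trans (step n t); rewrite lerDr.
have wle x t : `|t - x| < 1 -> w t <= expR (K * (`|x - t0| + 1)) * 2.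
  move=> tx; have h : `|t - t0| <= `|x - t0| + 1.
    rewrite (_ : t - t0 = (x - t0) + (t - x)); last by ring.
    by rewrite (le_trans (ler_normD _ _))// lerD2l ltW.
  have h1 : expR (K * (t - t0)) <= expR (K * (`|x - t0| + 1)).
    by rewrite ler_expR ler_pM2l// (le_trans (ler_norm _) h).
  have h2 : expR (- (K * (t - t0))) <= expR (K * (`|x - t0| + 1)).
    by rewrite ler_expR -mulrN ler_pM2l// (le_trans (ler_norm _))// normrN.
  by rewrite /w; lra.
pose W x := expR (K * (`|x - t0| + 1)) * 2.
have unif (Z : nat -> R -> R) (Z' : R -> R) : (forall n, continuous (Z n)) ->
    (forall t, Z ^~ t @ \oo --> Z' t /\ forall n, `|Z n t - Z' t| <= 2 * D * 2^-1 ^+ n * w t) ->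
    continuous Z'.
  move=> Zc HZ x; apply/cvgrPdist_le => e e0.
  have c0 : (fun n => 2 * D * 2^-1 ^+ n * W x) @ \oo --> 0.
    rewrite -(mul0r (W x)) -(mulr0 (2 * D)); apply: cvgMl; apply: cvgMr.
    by apply: cvg_expr; rewrite ger0_norm// invf_lt1// ltr1n.
  have e3 : 0 < e / 3 by rewrite divr_gt0.
  have /cvgrPdist_lt/(_ _ e3)[N _ /(_ N (leqnn N))] := c0.
  rewrite /= sub0r normrN => /(le_lt_trans (ler_norm _)) HN.
  near=> y.
  have y1 : `|y - x| < 1 by rewrite distrC; near: y; exists 1 => //=.
  have a1 : `|Z N x - Z' x| <= e / 3.
    apply: le_trans (proj2 (HZ x) N) _; apply: le_trans (ltW HN); apply: ler_wpM2l.
      by rewrite !mulr_ge0// exprn_ge0.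
    by apply: wle; rewrite subrr normr0.
  have a2 : `|Z N y - Z' y| <= e / 3.
    apply: le_trans (proj2 (HZ y) N) _; apply: le_trans (ltW HN); apply: ler_wpM2l.
      by rewrite !mulr_ge0// exprn_ge0.
    exact: wle.
  have a3 : `|Z N x - Z N y| <= e / 3.
    by near: y; have /cvgrPdist_le := Zc N x; exact.
  rewrite (_ : _ - _ = (Z N x - Z N y) - (Z N x - Z' x) + (Z N y - Z' y)); last by ring.
  apply: le_trans (ler_normD _ _) _; apply: le_trans (lerD (ler_normB _ _) (lexx _)) _.
  lra.
have Xc' : continuous X' by apply: (unif X) => // n; case: (XYc n).
have Yc' : continuous Y' by apply: (unif Y) => // n; case: (XYc n).
have cc x : (fun n => 4 * L * D * 2^-1 ^+ n * W x) @ \oo --> 0.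
  rewrite -(mul0r (W x)) -(mulr0 (4 * L * D)); apply: cvgMl; apply: cvgMr.
  by apply: cvg_expr; rewrite ger0_norm// invf_lt1// ltr1n.
have bnd x n t : `|t - x| < 1 -> L * (`|X n t - X' t| + `|Y n t - Y' t|) <=
    4 * L * D * 2^-1 ^+ n * W x.
  move=> tx; have h1 := proj2 (HX t) n; have h2 := proj2 (HY t) n.
  have h3 := wle _ _ tx.
  apply: le_trans (_ : L * (4 * D * 2^-1 ^+ n * w t) <= _); first by rewrite ler_pM2l//; lra.
  rewrite (_ : 4 * L * D * 2^-1 ^+ n * W x = L * (4 * D * 2^-1 ^+ n * W x)); last by ring.
  by rewrite ler_pM2l// ler_wpM2l// ?mulr_ge0// exprn_ge0.
have shift (Z : nat -> R -> R) (Z' : R -> R) : (forall t, Z ^~ t @ \oo --> Z' t) ->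
   forall t, (fun n => Z n.+1 t) @ \oo --> Z' t.
  by move=> h t; rewrite (cvg_shiftS (Z ^~ t)).
exists X', Y'; split.
- move=> x; split.
  + apply: (@der_lim _ (fun n => X n.+1) (fun n t => F1 t (X n t) (Y n t)) X'
      (fun t => F1 t (X' t) (Y' t)) x 1 (fun n => 4 * L * D * 2^-1 ^+ n * W x)) => //.
    * by move=> t _; apply: shift => s; case: (HX s).
    * by move=> n t tx; apply: le_trans (F1L _ _ _ _ _) _; exact: bnd.
    * exact: F1c.
  + apply: (@der_lim _ (fun n => Y n.+1) (fun n t => F2 t (X n t) (Y n t)) Y'
      (fun t => F2 t (X' t) (Y' t)) x 1 (fun n => 4 * L * D * 2^-1 ^+ n * W x)) => //.
    * by move=> t _; apply: shift => s; case: (HY s).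
    * by move=> n t tx; apply: le_trans (F2L _ _ _ _ _) _; exact: bnd.
    * exact: F2c.
- have [h _] := HX t0; rewrite -(cvg_lim _ h)//.
  by rewrite (_ : X ^~ t0 = cst x0) ?lim_cst//; apply/funext => n; rewrite X0.
- have [h _] := HY t0; rewrite -(cvg_lim _ h)//.
  by rewrite (_ : Y ^~ t0 = cst y0) ?lim_cst//; apply/funext => n; rewrite Y0.
Unshelve. all: by end_near. Qed.

End existence.
End picard.

(** * An Emden-Fowler equation on the unit interval *)

(** [Fp] is the primitive of [nl] vanishing at [0]. Locking keeps the powers opaque to
    simplification and unification. *)
HB.lock Definition nl {R : realType} (p x : R) := `|x| `^ (p - 1) * x.
HB.lock Definition Fp {R : realType} (p x : R) := `|x| `^ (p + 1) / (p + 1).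
HB.lock Definition W {R : realType} (a b s : R) := s `^ a * (1 - s) `^ b.

Section powers.
Context {R : realType}.
Implicit Types (a b s x p : R).

Lemma powRB1 s a : 0 < s -> s `^ (a - 1) = s `^ a / s.
Proof.
move=> s0; have s0' : s != 0 by rewrite gt_eqF.
by rewrite powRB ?s0' ?implybT// powRr1// ltW.
Qed.

Lemma powRDpos s a b : 0 < s -> s `^ (a + b) = s `^ a * s `^ b.
Proof.
move=> s0; have s0' : s != 0 by rewrite gt_eqF.
by rewrite powRD ?s0' ?implybT.
Qed.

Lemma powR_bounds (c : R) a : 0 < c -> c <= 1 ->
  forall s, c <= s <= 1 -> c `^ `|a| <= s `^ a <= c `^ (- `|a|).
Proof.
move=> c0 c1 s /andP[cs s1]; have s0 : 0 < s by exact: lt_le_trans cs.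
rewrite /powR !gt_eqF// !ler_expR mulNr.
have h : ln c <= ln s by rewrite ler_ln.
have h0 : ln s <= 0 by rewrite ln_le0.
have [a0|a0] := leP 0 a.
- rewrite ger0_norm// ler_wpM2l//=.
  by rewrite (@le_trans _ _ 0)// ?mulr_ge0_le0// oppr_ge0 mulr_ge0_le0// (le_trans h).
- rewrite ltr0_norm// mulNr opprK; apply/andP; split; last by rewrite ler_wnM2l// ltW.
  rewrite (@le_trans _ _ 0)//; last by rewrite mulr_le0// ltW.
  by rewrite oppr_le0 mulr_le0 ?(ltW a0)// (le_trans h).
Qed.


Section nl.
Variable p : R.
Hypothesis p1 : 1 < p.

Let p10 : 0 < p + 1. Proof. by move: p1; lra. Qed.

Lemma nlx x : nl p x * x = (p + 1) * Fp p x.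
Proof.
have -> : (p + 1) * Fp p x = `|x| `^ (p + 1) by rewrite Fp.unlock; field; rewrite gt_eqF.
rewrite nl.unlock -mulrA -expr2 -real_normK ?num_real//.
rewrite (_ : p + 1 = (p - 1) + 2); last by ring.
rewrite -powR_mulrn// [RHS]powRD//.
by apply/implyP => /eqP h; move: p1; lra.
Qed.

Lemma FpE x : (p + 1) * Fp p x = `|x| `^ (p + 1).
Proof. by rewrite Fp.unlock; field; rewrite gt_eqF. Qed.

Lemma Fp_ge0 x : 0 <= Fp p x.
Proof. by rewrite Fp.unlock divr_ge0// ?powR_ge0// ltW. Qed.

Lemma sqr_le_Fp x : x ^+ 2 <= (p + 1) * Fp p x + 1.
Proof.
have -> : (p + 1) * Fp p x = `|x| `^ (p + 1) by rewrite Fp.unlock; field; rewrite gt_eqF.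
rewrite -real_normK ?num_real//.
have [h|h] := leP `|x| 1.
  have : `|x| ^+ 2 <= 1 by rewrite expr_le1.
  by have := powR_ge0 `|x| (p + 1); lra.
rewrite -powR_mulrn// (le_trans (ler_powR (ltW h) _ : _ <= `|x| `^ (p + 1)))//; last lra.
by move: p1; lra.
Qed.

Lemma norm_nl x : `|nl p x| = `|x| `^ p.
Proof.
rewrite nl.unlock normrM ger0_norm ?powR_ge0// mulrC mulr_powRB1//.
by move: p1; lra.
Qed.

Lemma der_Fp x : is_derive x 1 (Fp p) (nl p x).
Proof.
have [x0|x0|->] := ltgtP x 0.
- apply: (@near_eq_is_derive _ _ _ (fun y => (- y) `^ (p + 1) / (p + 1))).
    near=> y; rewrite Fp.unlock ltr0_norm//; near: y; exact: lt_nbhsl.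
  derby; first by rewrite oppr_gt0.
  rewrite nl.unlock ltr0_norm// mulr0 addr0 addrK.
  rewrite [in LHS](_ : p = (p - 1) + 1); last by ring.
  rewrite powRDpos ?oppr_gt0// powRr1 ?oppr_ge0 ?(ltW x0)// subrK.
  by field; rewrite gt_eqF.
- apply: (@near_eq_is_derive _ _ _ (fun y => y `^ (p + 1) / (p + 1))).
    near=> y; rewrite Fp.unlock gtr0_norm//; near: y; exact: lt_nbhsr.
  derby; first by [].
  rewrite nl.unlock gtr0_norm// mulr0 addr0 addrK.
  rewrite [in LHS](_ : p = (p - 1) + 1); last by ring.
  rewrite powRDpos// powRr1 ?(ltW x0)// subrK.
  by field; rewrite gt_eqF.
- apply/der_eps => r r0; exists (Num.min 1 r); first by rewrite lt_min ltr01.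
  move=> y; rewrite subr0 lt_min => /andP[y1 yr].
  rewrite nl.unlock mulr0 mul0r subr0 {2}Fp.unlock normr0 powR0 ?gt_eqF// mul0r subr0.
  rewrite ger0_norm ?Fp_ge0// Fp.unlock.
  have [->|y0] := eqVneq y 0; first by rewrite normr0 powR0 ?gt_eqF// mul0r mulr0.
  have yy : 0 < `|y| by rewrite normr_gt0.
  apply: (@le_trans _ _ (`|y| ^+ 2)); last by rewrite expr2 ler_pM2r// ltW.
  rewrite ler_pdivrMr// -powR_mulrn//.
  apply: (@le_trans _ _ (`|y| `^ 2)).
    by apply: ger_powR; [rewrite yy ltW|move: p1; lra].
  by rewrite ler_peMr ?powR_ge0//; move: p1; lra.
Unshelve. all: by end_near. Qed.

Lemma der_nl x : is_derive x 1 (nl p) (p * `|x| `^ (p - 1)).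
Proof.
have p0 : 0 < p - 1 by rewrite subr_gt0.
have [x0|x0|->] := ltgtP x 0.
- apply: (@near_eq_is_derive _ _ _ (fun y => (- y) `^ (p - 1) * y)).
    near=> y; rewrite nl.unlock ltr0_norm//; near: y; exact: lt_nbhsl.
  have x00 : 0 < - x by rewrite oppr_gt0.
  derby; first by [].
  rewrite ltr0_norm// [X in (p - 1) * X]powRB1//.
  by field; rewrite lt_eqF.
- apply: (@near_eq_is_derive _ _ _ (fun y => y `^ (p - 1) * y)).
    near=> y; rewrite nl.unlock gtr0_norm//; near: y; exact: lt_nbhsr.
  derby; first by [].
  rewrite gtr0_norm// [X in (p - 1) * X]powRB1//.
  by field; rewrite gt_eqF.
- apply/der_eps => r r0; exists (r `^ ((p - 1)^-1)); first by rewrite powR_gt0.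
  move=> y; rewrite subr0 => yr.
  rewrite normr0 powR0 ?gt_eqF// mulr0 mul0r subr0 {2}nl.unlock mulr0 subr0 nl.unlock normrM.
  rewrite ger0_norm ?powR_ge0// ler_wpM2r//.
  rewrite (_ : r = (r `^ ((p - 1)^-1)) `^ (p - 1)); last first.
    by rewrite -powRrM mulVf ?gt_eqF// powRr1// ltW.
  by apply: ge0_ler_powR; rewrite ?nnegrE ?powR_ge0// ltW.
Unshelve. all: by end_near. Qed.

Lemma Fp_le_norm x (c : R) : 0 <= c -> (p + 1) * Fp p x <= c `^ (p + 1) -> `|x| <= c.
Proof.
move=> c0; have -> : (p + 1) * Fp p x = `|x| `^ (p + 1) by rewrite Fp.unlock; field; rewrite gt_eqF.
move=> h; rewrite leNgt; apply/negP => cx.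
have : c `^ (p + 1) < `|x| `^ (p + 1) by rewrite gt0_ltr_powR// nnegrE.
by rewrite ltNge h.
Qed.

End nl.


Lemma W_gt0 a b s : 0 < s < 1 -> 0 < W a b s.
Proof. by move=> /andP[s0 s1]; rewrite W.unlock mulr_gt0// powR_gt0// subr_gt0. Qed.

Lemma der_W a b s : 0 < s < 1 -> is_derive s 1 (W a b) (W a b s * (a / s - b / (1 - s))).
Proof.
move=> /andP[s0 s1]; have s1' : 0 < 1 - s by rewrite subr_gt0.
rewrite W.unlock; derby => //; rewrite !powRB1//.
by field; rewrite !gt_eqF.
Qed.

Lemma WM a b a' b' s : 0 < s < 1 -> W a b s * W a' b' s = W (a + a') (b + b') s.
Proof.
move=> /andP[s0 s1]; have s1' : 0 < 1 - s by rewrite subr_gt0.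
by rewrite W.unlock !powRDpos//; ring.
Qed.

Lemma W1 a b s : 0 < s < 1 -> W (a - 1) (b - 1) s = W a b s / (s * (1 - s)).
Proof.
move=> /andP[s0 s1]; have s1' : 0 < 1 - s by rewrite subr_gt0.
by rewrite W.unlock !powRB1//; field; rewrite !gt_eqF.
Qed.

Lemma W_refl a b s : W a b (1 - s) = W b a s.
Proof. by rewrite W.unlock opprB addrCA subrr addr0 mulrC. Qed.

Lemma W_bd a b (c : R) : 0 < c -> c <= 1 -> exists2 M : R, 0 < M &
  forall s, c <= s <= 1 - c -> M^-1 <= W a b s <= M.
Proof.
move=> c0 c1; exists ((c `^ (- `|a|)) * (c `^ (- `|b|))); first by rewrite mulr_gt0 ?powR_gt0.
move=> s /andP[cs sc].
have /andP[h1 h2] : c `^ `|a| <= s `^ a <= c `^ (- `|a|).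
  by apply: powR_bounds => //; rewrite cs (le_trans sc)// lerBlDr lerDl ltW.
have /andP[h3 h4] : c `^ `|b| <= (1 - s) `^ b <= c `^ (- `|b|).
  apply: powR_bounds => //; rewrite lerBrDr addrC -lerBrDr sc lerBlDr lerDl.
  exact: le_trans (ltW c0) cs.
rewrite W.unlock; apply/andP; split; last by rewrite ler_pM ?powR_ge0.
by rewrite invfM !powRN !invrK ler_pM ?powR_ge0.
Qed.

(** On the left half the factor in [1 - s] lies between two powers of [1 / 2], so only the singular
    factor remains. *)
Lemma W_left a b : exists2 M : R, 1 <= M &
  forall s, 0 < s <= 2^-1 -> M^-1 * s `^ a <= W a b s <= M * s `^ a.
Proof.
exists (2^-1 `^ (- `|b|)).
  by rewrite powRN -powR_inv1 ?invr_ge0// -powRAC powR_inv1// invrK -{1}(powRr0 2) ler_powR ?ler1n.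
move=> s /andP[s0 s1].
have /andP[h3 h4] : 2^-1 `^ `|b| <= (1 - s) `^ b <= 2^-1 `^ (- `|b|).
  apply: powR_bounds => //; first by rewrite invf_le1// ler1n.
  apply/andP; split; lra.
rewrite -(powRN _ (- `|b|)) opprK W.unlock ![_ * s `^ a]mulrC.
by rewrite !ler_wpM2l ?powR_ge0.
Qed.

End powers.

Section emden.
Context {R : realType}.
Implicit Types (f q : R -> R) (s : R).

(** Exponents of the two weights at one end of the interval; the last condition
    is subcriticality. *)
Definition end_exponents (e d p : R) :=
  [/\ 0 < e, -1 < d, 0 < d + 2 - e & 0 < e - d] /\
  0 <= e + d /\ (e - 1) / 2 < (d + 1) / (p + 1).

Variables (e e' d d' k0 p : R).

(** First-order form of [(A f')' = k0 B f - C |f|^(p-1) f], where [A = W e e'],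
    [B = A / (s (1 - s))] and [C = W d d']. *)
Definition emden_flow (lo hi : R) f q := forall s : R, lo <= s <= hi ->
  is_derive s 1 f (q s / W e e' s) /\
  is_derive s 1 q (k0 * W (e - 1) (e' - 1) s * f s - W d d' s * nl p (f s)).

(** With [A f' = q], dividing the kinetic part by [A * C] makes the two contributions of the
    nonlinearity to the derivative cancel: one is [- q * nl p f / A], the other
    [+ nl p f * q / A]. *)
Definition mech_energy f q s := q s ^+ 2 / (2 * (W e e' s * W d d' s)) + Fp p (f s).

Local Notation emden := emden_flow.
Local Notation En := mech_energy.

Lemma emden_sub lo hi lo' hi' f q : lo <= lo' -> hi' <= hi ->
  emden lo hi f q -> emden lo' hi' f q.
Proof.
move=> h1 h2 S s /andP[s1 s2]; apply: S.
by rewrite (le_trans h1 s1) (le_trans s2 h2).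
Qed.

Hypothesis p1 : 1 < p.
Hypothesis k00 : 0 < k0.
Hypothesis He : end_exponents e d p.
Hypothesis He' : 0 <= e' + d'.

Let p10 : 0 < p + 1. Proof. by move: p1; lra. Qed.

Lemma kinetic_ge0 f q s : 0 < s < 1 -> 0 <= q s ^+ 2 / (2 * (W e e' s * W d d' s)).
Proof.
move=> s01; have A0 := W_gt0 e e' s01; have C0 := W_gt0 d d' s01.
by pos.
Qed.

Lemma En_ge0 f q s : 0 < s < 1 -> 0 <= En f q s.
Proof. by move=> s01; rewrite addr_ge0 ?Fp_ge0// kinetic_ge0. Qed.

Lemma Fp_le_En f q s : 0 < s < 1 -> Fp p (f s) <= En f q s.
Proof. by move=> s01; rewrite lerDr kinetic_ge0. Qed.

Lemma sqr_f_le_En f q s : 0 < s < 1 -> f s ^+ 2 <= (p + 1) * (En f q s + 1).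
Proof.
move=> s01; apply: le_trans (sqr_le_Fp p1 _) _.
have : (p + 1) * Fp p (f s) <= (p + 1) * En f q s by rewrite ler_pM2l// Fp_le_En.
by move: p10 p1; lra.
Qed.

Lemma sqr_q_le_En f q s : 0 < s < 1 -> q s ^+ 2 <= 2 * (W e e' s * W d d' s) * En f q s.
Proof.
move=> s01; have A0 := W_gt0 e e' s01; have C0 := W_gt0 d d' s01.
have w0 : 0 < 2 * (W e e' s * W d d' s) by pos.
by rewrite mulrC -ler_pdivrMr// lerDl Fp_ge0.
Qed.

Let S s := W ((e + d) / 2) ((e' + d') / 2) s.

Let SS s : 0 < s < 1 -> S s ^+ 2 = W e e' s * W d d' s.
Proof. by move=> s01; rewrite expr2 !WM//; congr W; field. Qed.

(** The arithmetic-geometric inequality for [q] and [S * f], where [S] is the square root of the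
    product of the two weights. *)
Lemma fq_le_En f q s : 0 < s < 1 -> `|f s * q s| <= S s * ((p + 1) * (En f q s + 1)).
Proof.
move=> s01; have S0 : 0 < S s by exact: W_gt0.
rewrite normrM.
have h1 := sqr_f_le_En f q s01; have h2 := sqr_q_le_En f q s01.
rewrite -SS// in h2.
have h3 : 0 <= (`|q s| - S s * `|f s|) ^+ 2 by exact: sqr_ge0.
have h4 : `|q s| ^+ 2 = q s ^+ 2 by rewrite real_normK ?num_real.
have h5 : `|f s| ^+ 2 = f s ^+ 2 by rewrite real_normK ?num_real.
have E0 := En_ge0 f q s01.
have h6 : S s ^+ 2 * f s ^+ 2 <= S s ^+ 2 * ((p + 1) * (En f q s + 1)).
  by rewrite ler_wpM2l ?sqr_ge0.
have h7 : S s * (`|f s| * `|q s|) <= S s * (S s * ((p + 1) * (En f q s + 1))); last first.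
  by rewrite ler_pM2l in h7.
have h8 : S s ^+ 2 * En f q s * (p + 1) >= S s ^+ 2 * En f q s * 2.
  by apply: ler_wpM2l; [rewrite mulr_ge0 ?sqr_ge0|move: p1; lra].
have h9 : 0 <= S s ^+ 2 * (p + 1) by rewrite mulr_ge0 ?sqr_ge0// ltW.
nra.
Qed.

(** The linear term is written as [f * q / S], which the energy controls, times a weight of exponent
    [(e - d) / 2 - 1] at [0]. Since [d < e], this weight is integrable there. *)
Lemma der_En f q (s : R) : 0 < s < 1 -> emden s s f q ->
  is_derive s 1 (En f q) (k0 * (f s * q s) * W ((e - d) / 2 - 1) ((e' - d') / 2 - 1) s / S s
    - q s ^+ 2 / (2 * (W e e' s * W d d' s)) * ((e + d) / s - (e' + d') / (1 - s))).
Proof.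
move=> s01 Hs; have ss : s <= s <= s by rewrite lexx.
have [hf hq] := Hs s ss.
have hA := der_W e e' s01; have hC := der_W d d' s01.
have A0 := W_gt0 e e' s01; have C0 := W_gt0 d d' s01.
have S0 : 0 < S s by exact: W_gt0.
have hF := derComp (der_Fp p1 (f s)) hf.
have /andP[s0 s1] := s01; have s1' : 0 < 1 - s by rewrite subr_gt0.
have SC : W ((e - d) / 2 - 1) ((e' - d') / 2 - 1) s = S s / (s * (1 - s) * W d d' s).
  have -> : S s = W ((e - d) / 2) ((e' - d') / 2) s * W d d' s.
    by rewrite WM// /S; congr W; field.
  by rewrite W1//; field; rewrite !gt_eqF.
rewrite SC /En; derby; first by rewrite gt_eqF//; pos.
rewrite W1//; move: A0 C0 S0; move: (W e e' s) (W d d' s) (S s) => A C S0 A0 C0 S00.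
by field; rewrite !gt_eqF.
Qed.

(** The constant does not see [a]: the only coefficient not integrable at [0] is [(e + d) / s],
    which enters with a minus sign because [0 <= e + d], and the rest has the primitive
    [K1 * s ^ sg + K2 * s]. *)
Lemma En_left : exists2 K : R, 1 <= K & forall (a s : R) f q, 0 < a -> a <= s -> s <= 2^-1 ->
  emden a s f q -> En f q s + 1 <= K * (En f q a + 1).
Proof.
have [[e0 d0 ed2 ed] [edp sub]] := He.
pose sg := (e - d) / 2; have sg0 : 0 < sg by rewrite divr_gt0.
have [M M1 HM] := W_left (sg - 1) ((e' - d') / 2 - 1).
pose K1 := k0 * (p + 1) * M / sg; pose K2 := 2 * (e' + d').
have M0 : 0 < M by apply: lt_le_trans M1.
have K10 : 0 <= K1 by rewrite /K1; pos.
have K20 : 0 <= K2 by rewrite /K2; pos.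
exists (expR (K1 * 2^-1 `^ sg + K2 * 2^-1)).
  by rewrite -expR0 ler_expR; pos.
move=> a s f q a0 as_ s2 Hs.
have s01 t : a <= t <= s -> 0 < t < 1.
  by move=> /andP[at_ ts]; rewrite (lt_le_trans a0 at_)/= (le_lt_trans (le_trans ts s2))// invf_lt1// ltr1n.
have aas : a <= a <= s by rewrite lexx as_.
apply: (@le_trans _ _ ((En f q a + 1) * expR ((K1 * s `^ sg + K2 * s) - (K1 * a `^ sg + K2 * a)))).
- have hE t : a <= t <= s -> is_derive t 1 (fun t => En f q t + 1) (
    k0 * (f t * q t) * W ((e - d) / 2 - 1) ((e' - d') / 2 - 1) t / S t
    - q t ^+ 2 / (2 * (W e e' t * W d d' t)) * ((e + d) / t - (e' + d') / (1 - t))).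
    move=> tas; have h : emden t t f q by apply: emden_sub Hs; move: tas => /andP[].
    have h' := der_En (s01 t tas) h; derby; ring.
  have kd (t : R) : a <= t <= s ->
      is_derive t 1 (fun t : R => K1 * t `^ sg + K2 * t) (K1 * (sg * t `^ (sg - 1)) + K2).
    move=> tas; have /andP[t0 _] := s01 t tas; derby; [by []|ring].
  apply: (gronwall as_ hE kd).
  move=> t tas; have t01 := s01 t tas; have /andP[t0 t1] := t01.
    have S0 : 0 < S t by exact: W_gt0.
    have E0 := En_ge0 f q t01.
    have w0 : 0 < W ((e - d) / 2 - 1) ((e' - d') / 2 - 1) t by exact: W_gt0.
    have t2 : t <= 2^-1 by rewrite (le_trans _ s2)//; move: tas => /andP[].
    have /andP[_ hM] : M^-1 * t `^ (sg - 1) <= W ((e - d) / 2 - 1) ((e' - d') / 2 - 1) t <= M * t `^ (sg - 1).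
      by apply: HM; rewrite t0.
    have h1 : f t * q t / S t <= (p + 1) * (En f q t + 1).
      by rewrite ler_pdivrMr// [leRHS]mulrC (le_trans (ler_norm _))// fq_le_En.
    have h2 : k0 * (f t * q t) * W ((e - d) / 2 - 1) ((e' - d') / 2 - 1) t / S t <=
       K1 * (sg * t `^ (sg - 1)) * (En f q t + 1).
      rewrite (_ : _ / S t = k0 * W ((e - d) / 2 - 1) ((e' - d') / 2 - 1) t * (f t * q t / S t)); last by ring.
      apply: (@le_trans _ _ (k0 * W ((e - d) / 2 - 1) ((e' - d') / 2 - 1) t * ((p + 1) * (En f q t + 1)))).
        by rewrite ler_wpM2l// mulr_ge0// ltW.
      rewrite (_ : K1 * _ * _ = k0 * (M * t `^ (sg - 1)) * ((p + 1) * (En f q t + 1))); last first.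
        by rewrite /K1; field; rewrite gt_eqF.
      apply: ler_wpM2r; first by pos.
      by apply: ler_wpM2l => //; pos.
    have Y0 := kinetic_ge0 f q t01; have YE : q t ^+ 2 / (2 * (W e e' t * W d d' t)) <= En f q t.
      by rewrite lerDl Fp_ge0.
    set Y := q t ^+ 2 / _ in Y0 YE *.
    have h3 : - (Y * ((e + d) / t - (e' + d') / (1 - t))) <= K2 * (En f q t + 1).
      have g1 : 0 <= Y * ((e + d) / t) by rewrite mulr_ge0// divr_ge0// ltW.
      have g2 : (e' + d') / (1 - t) <= K2.
        rewrite /K2 mulrC ler_wpM2r// -[leRHS]invrK lef_pV2 ?posrE ?invr_gt0//; first lra.
        by rewrite subr_gt0.
      have g3 : Y * ((e' + d') / (1 - t)) <= Y * K2 by rewrite ler_wpM2l.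
      have g4 : Y * K2 <= (En f q t + 1) * K2 by rewrite ler_wpM2r//; lra.
      lra.
    by rewrite [leRHS]mulrDl; exact: lerD.
- rewrite mulrC; apply: ler_wpM2r; first by rewrite addr_ge0 ?En_ge0 ?s01.
  rewrite ler_expR.
  have g1 : s `^ sg <= 2^-1 `^ sg.
    by rewrite ge0_ler_powR ?nnegrE ?(ltW sg0)// ltW// (lt_le_trans a0).
  have g2 := ler_wpM2l K10 g1; have g3 := ler_wpM2l K20 s2.
  have g4 : 0 <= K1 * a `^ sg by rewrite mulr_ge0 ?powR_ge0.
  have g5 : 0 <= K2 * a by rewrite mulr_ge0// ltW.
  lra.
Qed.

(** Away from the ends all coefficients are bounded, so Gronwall compares the energies in both
    directions. The forward estimate of [En_left] alone could not carry a lower bound to the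
    right. *)
Lemma En_mid (c : R) : 0 < c -> c <= 2^-1 -> exists2 K : R, 1 <= K & forall (s t : R) f q,
  c <= s -> s <= t -> t <= 1 - c -> emden s t f q ->
  En f q t + 1 <= K * (En f q s + 1) /\ En f q s + 1 <= K * (En f q t + 1).
Proof.
move=> c0 c2; have [_ [edp _]] := He.
have c1 : c <= 1 by apply: le_trans c2 _; rewrite invf_le1// ler1n.
have [M M0 HM] := W_bd ((e - d) / 2 - 1) ((e' - d') / 2 - 1) c0 c1.
pose K1 := k0 * (p + 1) * M + (e + d + (e' + d')) / c.
have K10 : 0 <= K1.
  by rewrite /K1; pos.
exists (expR K1); first by rewrite -expR0 ler_expR.
move=> s t f q cs st tc Hs.
have u01 u : s <= u <= t -> 0 < u < 1.
  by move=> /andP[su ut]; rewrite (lt_le_trans c0 (le_trans cs su))/= (le_lt_trans (le_trans ut tc))// ltrBlDr ltrDl.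
have key u : s <= u <= t -> `|k0 * (f u * q u) * W ((e - d) / 2 - 1) ((e' - d') / 2 - 1) u / S u
    - q u ^+ 2 / (2 * (W e e' u * W d d' u)) * ((e + d) / u - (e' + d') / (1 - u))| <= K1 * (En f q u + 1).
  move=> ust; have w01 := u01 u ust; have /andP[u0 u1] := w01.
  have S0 : 0 < S u by exact: W_gt0.
  have E0 := En_ge0 f q w01.
  have w0 : 0 < W ((e - d) / 2 - 1) ((e' - d') / 2 - 1) u by exact: W_gt0.
  have cu : c <= u <= 1 - c by move: ust => /andP[su ut]; rewrite (le_trans cs su) (le_trans ut tc).
  have /andP[_ hM] := HM u cu; have /andP[cu1 cu2] := cu.
  have Y0 := kinetic_ge0 f q w01; have YE : q u ^+ 2 / (2 * (W e e' u * W d d' u)) <= En f q u.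
    by rewrite lerDl Fp_ge0.
  set Y := q u ^+ 2 / _ in Y0 YE *.
  apply: le_trans (ler_normB _ _) _; rewrite /K1 [leRHS]mulrDl; apply: lerD.
  - rewrite !normrM normfV (gtr0_norm S0) (gtr0_norm k00) (gtr0_norm w0) -normrM.
    rewrite ler_pdivrMr//.
    have g1 := fq_le_En f q w01.
    have g2 : k0 * `|f u * q u| * W ((e - d) / 2 - 1) ((e' - d') / 2 - 1) u <=
       k0 * (S u * ((p + 1) * (En f q u + 1))) * M.
      by apply: ler_pM; rewrite ?mulr_ge0 ?(ltW k00) ?(ltW w0)// ler_pM2l.
    by apply: le_trans g2 _; rewrite le_eqVlt; apply/orP; left; apply/eqP; ring.
  - rewrite normrM (ger0_norm Y0) mulrC ler_pM//; last lra.
    apply: le_trans (ler_normB _ _) _; rewrite [leRHS]mulrDl; apply: lerD.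
    + rewrite ger0_norm ?divr_ge0 ?(ltW u0)// ler_wpM2l//.
      by rewrite lef_pV2 ?posrE.
    + have u1' : 0 < 1 - u by rewrite subr_gt0.
      rewrite ger0_norm ?divr_ge0 ?(ltW u1')// ler_wpM2l// lef_pV2 ?posrE//.
      by move: cu2; lra.
have hE u : s <= u <= t -> is_derive u 1 (fun u => En f q u + 1)
    (k0 * (f u * q u) * W ((e - d) / 2 - 1) ((e' - d') / 2 - 1) u / S u
    - q u ^+ 2 / (2 * (W e e' u * W d d' u)) * ((e + d) / u - (e' + d') / (1 - u))).
  move=> ust; have h : emden u u f q by apply: emden_sub Hs; move: ust => /andP[].
  have h' := der_En (u01 u ust) h; derby; ring.
have kd (u : R) : s <= u <= t -> is_derive u 1 (fun u : R => K1 * u) K1 by move=> _; derby; ring.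
have ex : expR (K1 * t - K1 * s) <= expR K1.
  rewrite ler_expR -mulrBr ler_piMr// lerBlDr (le_trans tc)// lerD2l.
  by rewrite (le_trans _ (le_trans (ltW c0) cs))// oppr_le0 ltW.
have E0 u : s <= u <= t -> 0 <= En f q u + 1 by move=> ust; rewrite addr_ge0 ?En_ge0 ?u01.
split.
- apply: le_trans (gronwall st hE kd _) _.
    by move=> u ust; apply: le_trans (ler_norm _) _; exact: key.
  by rewrite mulrC; apply: ler_wpM2r => //; apply: E0; rewrite lexx.
- apply: le_trans (gronwall_rev st hE kd _) _.
    by move=> u ust; have := key u ust; rewrite ler_norml => /andP[].
  by rewrite mulrC; apply: ler_wpM2r => //; apply: E0; rewrite lexx andbT.
Qed.

End emden.

Section emden_left.
Context {R : realType}.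
Implicit Types (f q : R -> R) (s t : R).
Variables (e e' d d' k0 p : R).
Local Notation emden := (emden_flow e e' d d' k0 p).
Local Notation En := (mech_energy e e' d d' p).
Hypothesis p1 : 1 < p.
Hypothesis k00 : 0 < k0.
Hypothesis He : end_exponents e d p.
Hypothesis He' : 0 <= e' + d'.

Let p10 : 0 < p + 1. Proof. by move: p1; lra. Qed.

(** Zero flux at [a] allows two integrations with a constant independent of [a]: [q'] gives the
    powers [e] and [d + 1], and division by [A] followed by a second integration gives [1] and
    [d + 2 - e]. *)
Lemma layer : exists2 K : R, 0 < K & forall (a t : R) f q (F N : R), 0 < a -> t <= 2^-1 ->
  emden a t f q -> q a = 0 ->
  (forall s, a <= s <= t -> `|f s| <= F /\ `|nl p (f s)| <= N) ->
  forall s, a <= s <= t ->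
    `|q s| <= K * (F * s `^ e + N * s `^ (d + 1)) /\
    `|f s - f a| <= K * (F * s + N * s `^ (d + 2 - e)).
Proof.
have [[e0 d0 ed2 ed] [edp sub]] := He.
have [MB MB1 HB] := W_left (e - 1) (e' - 1).
have [MC MC1 HC] := W_left d d'.
have [MA MA1 HA] := W_left e e'.
have [MB0 MC0 MA0] : [/\ 0 < MB, 0 < MC & 0 < MA] by split; apply: lt_le_trans ltr01 _.
pose tau := d + 2 - e; have tau0 : 0 < tau by [].
have d10 : 0 < d + 1 by lra.
pose K1 := k0 * MB / e + MC / (d + 1).
pose K2 := MA * K1 * (1 + tau^-1).
have K10 : 0 < K1 by rewrite /K1; pos.
have K20 : 0 < K2 by rewrite /K2; pos.
exists (K1 + K2); first by pos.
move=> a t f q F N a0 t2 Hs qa Hb s ast.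
have aat : a <= a <= t by move: ast => /andP[h1 h2]; rewrite lexx (le_trans h1 h2).
have F0 : 0 <= F by have [h _] := Hb _ aat; apply: le_trans h.
have N0 : 0 <= N by have [_ h] := Hb _ aat; apply: le_trans h.
have u0 u : a <= u <= t -> 0 < u by move=> /andP[au _]; exact: lt_le_trans au.
have u02 u : a <= u <= t -> 0 < u <= 2^-1.
  by move=> aut; rewrite (u0 u aut) (le_trans _ t2)//; case/andP: aut.
have u01 u : a <= u <= t -> 0 < u < 1.
  by move=> /u02/andP[h1 h2]; rewrite h1 (le_lt_trans h2)// invf_lt1// ltr1n.
pose g u := k0 * MB * F * (u `^ e / e) + MC * N * (u `^ (d + 1) / (d + 1)).
have gd (u : R) : a <= u <= t -> is_derive u 1 g (k0 * MB * F * u `^ (e - 1) + MC * N * u `^ d).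
  move=> aut; rewrite /g; have h := u0 u aut; derby => //.
  by rewrite addrK; field; rewrite !gt_eqF.
have gle u : a <= u <= t -> 0 <= g u.
  by move=> aut; rewrite /g; pos.
have gK u : a <= u <= t -> g u <= K1 * (F * u `^ e + N * u `^ (d + 1)).
  move=> aut; have x0 := powR_ge0 u e; have y0 := powR_ge0 u (d + 1).
  have z1 : 0 <= MC / (d + 1) * (F * u `^ e) by pos.
  have z2 : 0 <= k0 * MB / e * (N * u `^ (d + 1)) by pos.
  rewrite /K1 /g; lra.
have qb u : a <= u <= t -> `|q u| <= g u.
  move=> aut; have au : a <= u by case/andP: aut.
  have sub_ v : a <= v <= u -> a <= v <= t.
    by move=> /andP[h1 h2]; rewrite h1 (le_trans h2)//; case/andP: aut.
  have := @dist_of_der _ q g (fun v => k0 * W (e - 1) (e' - 1) v * f v - W d d' v * nl p (f v))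
    (fun v => k0 * MB * F * v `^ (e - 1) + MC * N * v `^ d) a u au.
  rewrite qa subr0 => /(_ (fun v h => proj2 (Hs v (sub_ v h)))) /(_ (fun v h => gd v (sub_ v h))) H.
  apply: le_trans (H _) _; last by rewrite lerBlDr lerDl gle.
  move=> v /sub_ avt; have [h1 h2] := Hb v avt.
  have /andP[_ b1] := HB v (u02 v avt); have /andP[_ b2] := HC v (u02 v avt).
  have w1 := W_gt0 (e - 1) (e' - 1) (u01 v avt); have w2 := W_gt0 d d' (u01 v avt).
  apply: le_trans (ler_normB _ _) _; rewrite !normrM (gtr0_norm k00) (gtr0_norm w1) (gtr0_norm w2).
  apply: lerD.
  - rewrite (_ : k0 * MB * F * _ = k0 * (MB * v `^ (e - 1)) * F); last by ring.
    apply: ler_pM => //; first by pos.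
    by apply: ler_wpM2l => //; pos.
  - rewrite (_ : MC * N * _ = (MC * v `^ d) * N); last by ring.
    by apply: ler_pM => //; pos.
have qb' u : a <= u <= t -> `|q u| <= K1 * (F * u `^ e + N * u `^ (d + 1)).
  by move=> aut; apply: le_trans (qb u aut) (gK u aut).
split.
  apply: le_trans (qb' s ast) _; apply: ler_wpM2r; last by rewrite lerDl ltW.
  have x0 := powR_ge0 s e; have y0 := powR_ge0 s (d + 1); pos.
pose G u := MA * K1 * (F * u + N * (u `^ tau / tau)).
have Gd (u : R) : a <= u <= t -> is_derive u 1 G (MA * K1 * (F + N * u `^ (tau - 1))).
  move=> aut; rewrite /G; have h := u0 u aut; derby => //.
  by field; rewrite gt_eqF.
have sub_ v : a <= v <= s -> a <= v <= t.
  by move=> /andP[h1 h2]; rewrite h1 (le_trans h2)//; case/andP: ast.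
have as_ : a <= s by case/andP: ast.
have := @dist_of_der _ f G (fun v => q v / W e e' v)
    (fun v => MA * K1 * (F + N * v `^ (tau - 1))) a s as_
    (fun v h => proj1 (Hs v (sub_ v h))) (fun v h => Gd v (sub_ v h)) => H.
apply: le_trans (H _) _.
- move=> v /sub_ avt.
  have w1 := W_gt0 e e' (u01 v avt); have /andP[b1 _] := HA v (u02 v avt).
  have v0 := u0 v avt; have ve : 0 < v `^ e by rewrite powR_gt0.
  rewrite normrM normfV (gtr0_norm w1) ler_pdivrMr//.
  apply: le_trans (qb' v avt) _.
  rewrite (_ : v `^ (d + 1) = v `^ (tau - 1) * v `^ e); last first.
    by rewrite -powRDpos//; congr powR; rewrite /tau; ring.
  rewrite (_ : K1 * _ = MA * K1 * (F + N * v `^ (tau - 1)) * (MA^-1 * v `^ e)); last first.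
    by field; rewrite gt_eqF.
  apply: ler_wpM2l => //.
  have y0 := powR_ge0 v (tau - 1); pos.
- have s0 := u0 s ast; have y0 := powR_ge0 s tau.
  have Ga : 0 <= G a.
    rewrite /G; have z0 := powR_ge0 a tau; pos.
  apply: (@le_trans _ _ (G s)); first by rewrite lerBlDr lerDl.
  apply: (@le_trans _ _ (K2 * (F * s + N * s `^ tau))).
    rewrite /G /K2 -[leRHS]mulrA; apply: ler_wpM2l; first by pos.
    have it : 0 < tau^-1 by rewrite invr_gt0.
    have z1 : 0 <= tau^-1 * (F * s) by pos.
    have z2 : 0 <= N * s `^ tau by pos.
    lra.
  apply: ler_wpM2r; last by rewrite lerDr ltW.
  pos.
Qed.

(* The multiplier s(1-s) f' + kappa f, with kappa strictly between the two
   values at which one of the two leading terms degenerates. *)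
Lemma pohozaev : exists s1 : R, exists c0 : R, exists kap : R,
  [/\ 0 < s1, s1 <= 2^-1, 0 < c0, 0 < kap & forall f q s, 0 < s -> s <= s1 ->
  emden s s f q ->
  exists2 dH, is_derive s 1 (fun t : R => t * (1 - t) * W d d' t * En f q t + kap * (q t * f t)) dH &
    c0 * (W d d' s * ((p + 1) * Fp p (f s))) <= dH].
Proof.
have [[e0 d0 ed2 ed] [edp sub]] := He.
(* The coefficient of [q ^+ 2 / A] is positive above [(e - 1) / 2], that of [C * Fp] below [hi]; the
   maximum with [0] keeps the multiplier positive. *)
pose lo := Num.max 0 ((e - 1) / 2); pose hi := (d + 1) / (p + 1).
have hi0 : 0 < hi by rewrite /hi divr_gt0//; lra.
have lohi : lo < hi by rewrite /lo gt_max hi0.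
pose kap := (lo + hi) / 2.
have lo0 : 0 <= lo by rewrite le_max lexx.
have lo1 : (e - 1) / 2 <= lo by rewrite le_max lexx orbT.
have kap0 : 0 < kap by rewrite /kap; lra.
pose d1 := (kap - (e - 1) / 2) / 2; have d10 : 0 < d1 by rewrite /d1 /kap; lra.
pose d2 := (hi - kap) / 2; have d20 : 0 < d2 by rewrite /d2 /kap; lra.
pose c1 := 1 + `|- 1 + (e + e') / 2|; have c10 : 0 < c1 by rewrite /c1; have := normr_ge0 (- 1 + (e + e') / 2); lra.
pose c2 := 1 + `|2 + d + d'|; have c20 : 0 < c2 by rewrite /c2; have := normr_ge0 (2 + d + d'); lra.
(* The second bound lets a square absorb the cross term [k0 * f * q]; the last two keep the
   corrections of order [s] below half of each margin. *)
pose s1 := Num.min (Num.min 2^-1 (4 * d1 * kap / k0)) (Num.min (d1 / c1) (d2 * (p + 1) / c2)).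
have s10 : 0 < s1.
  rewrite /s1 !lt_min invr_gt0 ltr0n/=; apply/andP; split; first by pos.
  by apply/andP; split; pos.
exists s1, d2, kap; split => //; first by rewrite /s1 !ge_min lexx.
move=> f q s s0 ss1 Hs.
have [sA sB] : s <= 2^-1 /\ s <= 4 * d1 * kap / k0.
  by split; apply: le_trans ss1 _; rewrite /s1 !ge_min lexx ?orbT.
have [sC sD] : s <= d1 / c1 /\ s <= d2 * (p + 1) / c2.
  by split; apply: le_trans ss1 _; rewrite /s1 !ge_min lexx ?orbT.
have s11 : s < 1 by lra.
have s01 : 0 < s < 1 by rewrite s0.
have ss : s <= s <= s by rewrite lexx.
have [hf hq] := Hs s ss.
have hE := der_En p1 s01 Hs.
have hC := der_W d d' s01.
pose dH := q s ^+ 2 / W e e' s * ((2^-1 - e / 2 + kap) + s * (- 1 + (e + e') / 2))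
  + W d d' s * Fp p (f s) * (1 + d - s * (2 + d + d')) - kap * W d d' s * (nl p (f s) * f s)
  + kap * k0 * W e e' s / (s * (1 - s)) * f s ^+ 2 + k0 * f s * q s.
have A0 := W_gt0 e e' s01; have C0 := W_gt0 d d' s01.
have s1' : 0 < 1 - s by rewrite subr_gt0.
exists dH.
- derby.
  have SC : W ((e - d) / 2 - 1) ((e' - d') / 2 - 1) s = W ((e + d) / 2) ((e' + d') / 2) s / (s * (1 - s) * W d d' s).
    have -> : W ((e + d) / 2) ((e' + d') / 2) s = W ((e - d) / 2) ((e' - d') / 2) s * W d d' s.
      by rewrite WM//; congr W; field.
    by rewrite W1//; field; rewrite !gt_eqF.
  have S0 : 0 < W ((e + d) / 2) ((e' + d') / 2) s by exact: W_gt0.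
  rewrite SC /dH /mech_energy W1//.
  move: S0 A0 C0; move: (W e e' s) (W d d' s) (W ((e + d) / 2) ((e' + d') / 2) s) (nl p (f s)) (Fp p (f s)).
  move=> A C SS n P S0 A0 C0.
  by field; rewrite !gt_eqF.
rewrite /dH (nlx p1).
have P0 := Fp_ge0 p1 (f s).
have h1 : s * `|- 1 + (e + e') / 2| <= d1.
  have : s * c1 <= d1 by rewrite -ler_pdivlMr.
  rewrite /c1; lra.
have h2 : s * `|2 + d + d'| <= d2 * (p + 1).
  have : s * c2 <= d2 * (p + 1) by rewrite -ler_pdivlMr.
  rewrite /c2; lra.
have h1' : - d1 <= s * (- 1 + (e + e') / 2).
  have : s * (- (- 1 + (e + e') / 2)) <= s * `|- 1 + (e + e') / 2|.
    by apply: ler_wpM2l; [exact: ltW|rewrite -normrN ler_norm].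
  lra.
have h2' : s * (2 + d + d') <= d2 * (p + 1).
  by apply: le_trans h2; apply: ler_wpM2l; [exact: ltW|exact: ler_norm].
have g1 : d1 <= (2^-1 - e / 2 + kap) + s * (- 1 + (e + e') / 2) by rewrite /d1 in h1' *; lra.
have hip : hi * (p + 1) = d + 1 by rewrite /hi; field; rewrite gt_eqF.
have g2 : d2 * (p + 1) <= (1 + d - s * (2 + d + d')) - kap * (p + 1).
  have : d2 * (p + 1) = hi * (p + 1) / 2 - kap * (p + 1) / 2 by rewrite /d2; field.
  by rewrite hip; lra.
have k1 : d2 * (W d d' s * ((p + 1) * Fp p (f s))) <=
    W d d' s * Fp p (f s) * (1 + d - s * (2 + d + d')) - kap * W d d' s * ((p + 1) * Fp p (f s)).
  rewrite (_ : d2 * _ = W d d' s * Fp p (f s) * (d2 * (p + 1))); last by ring.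
  rewrite (_ : _ - _ = W d d' s * Fp p (f s) * ((1 + d - s * (2 + d + d')) - kap * (p + 1))); last by ring.
  by apply: ler_wpM2l => //; pos.
have k2 : 0 <= q s ^+ 2 / W e e' s * ((2^-1 - e / 2 + kap) + s * (- 1 + (e + e') / 2)) +
   kap * k0 * W e e' s / (s * (1 - s)) * f s ^+ 2 + k0 * f s * q s.
  have g3 : q s ^+ 2 / W e e' s * d1 <= q s ^+ 2 / W e e' s * ((2^-1 - e / 2 + kap) + s * (- 1 + (e + e') / 2)).
    by apply: ler_wpM2l => //; pos.
  have g4 : W e e' s * (k0 ^+ 2 / (4 * d1)) * f s ^+ 2 <= kap * k0 * W e e' s / (s * (1 - s)) * f s ^+ 2.
    apply: ler_wpM2r; first by pos.
    rewrite (_ : kap * k0 * _ / _ = W e e' s * (kap * k0 / (s * (1 - s)))); last by ring.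
    apply: ler_wpM2l; first exact: ltW.
    rewrite ler_pdivlMr; last by pos.
    rewrite -ler_pdivlMl; last by pos.
    apply: (@le_trans _ _ s).
      by rewrite ler_piMr ?(ltW s0)//; lra.
    have -> : (k0 ^+ 2 / (4 * d1))^-1 * (kap * k0) = 4 * d1 * kap / k0 by field; rewrite !gt_eqF.
    by [].
  (* The part of the [f ^+ 2] term that is kept is exactly what completes the square. *)
  apply: (@le_trans _ _ (q s ^+ 2 / W e e' s * d1 + W e e' s * (k0 ^+ 2 / (4 * d1)) * f s ^+ 2 + k0 * f s * q s)); last first.
    by rewrite lerD2r; apply: lerD.
  rewrite (_ : _ + _ = d1 / W e e' s * (q s + k0 * W e e' s * f s / (2 * d1)) ^+ 2); first by pos.
  by field; rewrite !gt_eqF.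
lra.
Qed.

End emden_left.

(** * A large initial value forces a large energy *)

Section emden_end.
Context {R : realType}.
Implicit Types (f q : R -> R) (s t : R).
Variables (e e' d d' k0 p : R).
Local Notation emden := (emden_flow e e' d d' k0 p).
Local Notation En := (mech_energy e e' d d' p).
Hypothesis p1 : 1 < p.
Hypothesis k00 : 0 < k0.
Hypothesis He : end_exponents e d p.
Hypothesis He' : 0 <= e' + d'.

Ltac keep H := first [constr_eq H R | constr_eq H e | constr_eq H e' | constr_eq H d | constr_eq H d' | constr_eq H k0 | constr_eq H p | constr_eq H p1 | constr_eq H k00 | constr_eq H He | constr_eq H He'].
Ltac tidy := repeat match goal with H : _ |- _ => tryif keep H then fail else clear H end.

Let p10 : 0 < p + 1. Proof. by move: p1; lra. Qed.

(* Subcriticality makes eta positive. On [a, sa] the solution stays above half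
   its initial value A, which feeds at least A^eta into the increasing Pohozaev
   quantity. *)
Lemma large_start : exists2 s1 : R, 0 < s1 <= 2^-1 & forall Lam : R, exists2 a0 : R, 0 < a0 &
  forall (a : R) f q, 0 < a -> a <= s1 -> emden a s1 f q -> q a = 0 -> a0 <= `|f a| ->
  Lam <= En f q s1.
Proof.
have [[e0 d0 ed2 ed] [edp sub]] := He.
have [s1 [c0 [kap [s10 s12 c00 kap0 HP]]]] := pohozaev e' d' p1 k00 He.
have [KL KL1 HL] := En_left p1 k00 He He'.
have [KY KY0 HY] := layer e' d' k00 He.
have [MC MC1 HC] := W_left d d'.
have [KL0 MC0] : 0 < KL /\ 0 < MC by split; apply: lt_le_trans ltr01 _.
pose tau := d + 2 - e; have tau0 : 0 < tau by [].
have d10 : 0 < d + 1 by move: d0; tidy; lra.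
have p0 : 0 < p by move: p1; tidy; lra.
have pm0 : 0 < p - 1 by move: p1; tidy; lra.
(* A solution starting at height [A] moves by a fraction of [A] when [A ^ p * s ^ tau] reaches the
   order of [A], that is for [s] of order [A ^ (- r)]. Then [A ^ (p + 1) * s ^ (d + 1)] is of order
   [A ^ eta]. *)
pose r := (p - 1) / tau; have r0 : 0 < r by rewrite divr_gt0.
pose eta := p + 1 - r * (d + 1).
have eta0 : 0 < eta.
  have h : (e - 1) * (p + 1) < 2 * (d + 1).
    move: sub; rewrite ltr_pdivrMr// [_ / (p + 1) * 2]mulrC mulrA ltr_pdivlMr//.
  rewrite /eta /r subr_gt0 mulrAC ltr_pdivrMr// /tau.
  have -> : (p + 1) * (d + 2 - e) = (p - 1) * (d + 1) + (2 * (d + 1) - (e - 1) * (p + 1)) by ring.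
  by move: h; tidy; lra.
(* Gives [|f| <= K2 * A] from the energy estimate, once [1 <= A] absorbs its additive constant. *)
pose K2 := (KL * (p + 2)) `^ (p + 1)^-1.
have K20 : 0 < K2 by rewrite /K2; pos.
have K2p : 0 < K2 `^ p by pos.
(* Makes the nonlinear part of the layer estimate equal to [A / 4] at the end of the layer. *)
pose c1 := (4 * KY * K2 `^ p)^-1 `^ tau^-1.
have c10 : 0 < c1 by rewrite /c1; pos.
have c1tau : c1 `^ tau = (4 * KY * K2 `^ p)^-1.
  by rewrite /c1 -powRrM mulVf ?gt_eqF// powRr1//; pos.
(* [c31] belongs to the value of the Pohozaev quantity at [a], [c32] to its growth while
   [A / 2 <= |f|]. *)
pose c31 := (2 * MC * (p + 1))^-1; pose c32 := c0 / (MC * 2 `^ (p + 1) * (d + 1)).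
pose c3 := Num.min c31 c32.
have c30 : 0 < c3 by rewrite /c3 lt_min; apply/andP; split; rewrite /c31 /c32; pos.
pose K3 := W d d' s1 + kap * W ((e + d) / 2) ((e' + d') / 2) s1 * (p + 1).
have s101 : 0 < s1 < 1 by rewrite s10 (le_lt_trans s12)// invf_lt1// ltr1n.
have S0 := W_gt0 ((e + d) / 2) ((e' + d') / 2) s101; have C0 := W_gt0 d d' s101.
have K30 : 0 < K3 by rewrite /K3; pos.
exists s1; first by rewrite s10.
move=> Lam.
(* The second entry keeps the linear part of the layer estimate below [A / 4]. *)
pose m := Num.min s1 (4 * KY * K2)^-1.
have m0 : 0 < m by rewrite /m lt_min s10/=; pos.
pose X := (`|Lam| + 1) * K3 / (c3 * c1 `^ (d + 1)).
have X0 : 0 < X by rewrite /X; have := normr_ge0 Lam => h; pos.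
(* The three summands ensure [1 <= A], [X <= A ^ eta] and [sa <= m]. *)
exists (1 + X `^ eta^-1 + (c1 / m) `^ r^-1).
  by have h1 := powR_ge0 X eta^-1; have h2 := powR_ge0 (c1 / m) r^-1; move: h1 h2; tidy; lra.
move=> a f q a0 as1 Hs qa HA.
set A := `|f a| in HA.
have [A1 AX Ac] : [/\ 1 <= A, X `^ eta^-1 <= A & (c1 / m) `^ r^-1 <= A].
  have h1 := powR_ge0 X eta^-1; have h2 := powR_ge0 (c1 / m) r^-1.
  by split; apply: le_trans HA; move: h1 h2; tidy; lra.
have A0 : 0 < A by exact: lt_le_trans ltr01 A1.
pose sa := c1 * A `^ (- r).
have sa0 : 0 < sa by rewrite /sa; pos.
have sam : sa <= m.
  rewrite /sa powRN ler_pdivrMr; last by pos.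
  rewrite mulrC -ler_pdivrMr//.
  rewrite [leLHS](_ : _ = ((c1 / m) `^ r^-1) `^ r); last first.
    by rewrite -powRrM mulVf ?gt_eqF// powRr1//; pos.
  by apply: ge0_ler_powR; rewrite ?nnegrE ?powR_ge0// ltW.
have sas1 : sa <= s1 by apply: le_trans sam _; rewrite /m ge_min lexx.
have saK : KY * K2 * sa <= 4^-1.
  have : sa <= (4 * KY * K2)^-1 by apply: le_trans sam _; rewrite /m ge_min lexx orbT.
  rewrite -[(4 * KY * K2)^-1]mul1r ler_pdivlMr; last by pos.
  by tidy; lra.
have sub_ u v : a <= u -> v <= s1 -> emden u v f q by move=> h1 h2; exact: emden_sub Hs.
have x01 x : a <= x <= s1 -> 0 < x < 1.
  by move=> /andP[h1 h2]; rewrite (lt_le_trans a0 h1)/= (le_lt_trans h2)//; case/andP: s101.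
pose H t := t * (1 - t) * W d d' t * En f q t + kap * (q t * f t).
have /choice[D HD] : forall t, exists y, a <= t <= s1 -> is_derive t 1 H y /\
    c0 * (W d d' t * `|f t| `^ (p + 1)) <= y.
  move=> t; have [ht|ht] := boolP (a <= t <= s1); last by exists 0.
  have /andP[h1 h2] := ht.
  have [y hy1 hy2] := HP f q t (lt_le_trans a0 h1) h2 (sub_ t t h1 h2).
  by exists y; rewrite -FpE.
have D0 t : a <= t <= s1 -> 0 <= D t.
  move=> ht; have [_ h] := HD t ht; apply: le_trans h.
  have w := W_gt0 d d' (x01 t ht); pos.
have Hmono u v : a <= u -> u <= v -> v <= s1 -> H u <= H v.
  move=> au uv vs; apply: (le_of_der uv (df := D)).
  - by move=> t /andP[h1 h2]; apply: (proj1 (HD t _)); rewrite (le_trans au h1) (le_trans h2 vs).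
  - by move=> t /andP[h1 h2]; apply: D0; rewrite (le_trans au h1) (le_trans h2 vs).
have a02 : 0 < a <= 2^-1 by rewrite a0 (le_trans as1).
have Ha : c31 * (A `^ (p + 1) * a `^ (d + 1)) <= H a.
  have aas : a <= a <= s1 by rewrite lexx.
  have w := W_gt0 d d' (x01 a aas).
  have /andP[b _] := HC a a02.
  rewrite /H qa mul0r mulr0 addr0 /mech_energy qa expr0n/= mul0r add0r.
  have -> : Fp p (f a) = A `^ (p + 1) / (p + 1) by rewrite -FpE//; field; rewrite gt_eqF.
  have -> : a `^ (d + 1) = a `^ d * a by rewrite powRDpos// powRr1// ltW.
  rewrite /c31.
  rewrite [leLHS](_ : _ = a * 2^-1 * (MC^-1 * a `^ d) * (A `^ (p + 1) / (p + 1))); last first.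
    by field; rewrite !gt_eqF.
  apply: ler_wpM2r; first by pos.
  apply: ler_pM => //; [by pos|by pos|].
  by apply: ler_wpM2l; [exact: ltW|move: a02 => /andP[_]; tidy; lra].
have key : c3 * (A `^ (p + 1) * sa `^ (d + 1)) <= H s1.
  (* If the start already lies beyond the layer, the initial Pohozaev quantity is large enough and
     monotonicity suffices; otherwise its growth across the layer is added. *)
  have [saa|asa] := leP sa a.
  - apply: (@le_trans _ _ (H a)); last by apply: Hmono.
    apply: le_trans Ha; apply: ler_pM; [by pos|by pos|by rewrite /c3 ge_min lexx|].
    apply: ler_wpM2l; first by pos.
    by apply: ge0_ler_powR; rewrite ?nnegrE ?(ltW d10)// ltW.
  - apply: (@le_trans _ _ (H sa)); last by apply: Hmono => //; exact: ltW.
    have fup t : a <= t <= sa -> `|f t| <= K2 * A.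
      move=> /andP[h1 h2].
      have t2 : t <= 2^-1 by apply: le_trans (le_trans h2 sas1) s12.
      have := HL a t f q a0 h1 t2 (sub_ a t (lexx a) (le_trans h2 sas1)) => hE.
      apply: (Fp_le_norm p1); first by pos.
      rewrite powRM ?(ltW K20) ?(ltW A0)// /K2 -powRrM mulVf ?gt_eqF// powRr1; last by pos.
      have t01 : 0 < t < 1 by apply: x01; rewrite h1 (le_trans h2).
      have h3 := Fp_le_En e e' d d' p f q t01.
      have Ap : 1 <= A `^ (p + 1).
        by have := ler_powR A1 (ltW p10); rewrite powRr0.
      have Ea : (p + 1) * En f q a = A `^ (p + 1).
        by rewrite /mech_energy qa expr0n/= mul0r add0r FpE.
      have h4 : (p + 1) * (En f q t + 1) <= (p + 1) * (KL * (En f q a + 1)) by apply: ler_wpM2l; [exact: ltW|].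
      have h5 : (p + 1) * (KL * (En f q a + 1)) = KL * (A `^ (p + 1) + (p + 1)) by rewrite -Ea; ring.
      have h6 : KL * (A `^ (p + 1) + (p + 1)) <= KL * ((p + 2) * A `^ (p + 1)).
        apply: ler_wpM2l; first exact: ltW.
        have : (p + 1) * 1 <= (p + 1) * A `^ (p + 1) by apply: ler_wpM2l; [exact: ltW|].
        by tidy; lra.
      have h7 : (p + 1) * Fp p (f t) <= (p + 1) * En f q t by apply: ler_wpM2l; [exact: ltW|].
      by move: h4 h5 h6 h7 p10; tidy; lra.
    have flow t : a <= t <= sa -> A / 2 <= `|f t|.
      move=> ht; have /andP[h1 h2] := ht.
      have sa2 : sa <= 2^-1 by apply: le_trans sas1 s12.
      have bnd u : a <= u <= sa -> `|f u| <= K2 * A /\ `|nl p (f u)| <= (K2 * A) `^ p.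
        move=> hu; split; first exact: fup.
        rewrite (norm_nl p1); apply: ge0_ler_powR; rewrite ?nnegrE ?(ltW p0)//; last exact: fup.
        by pos.
      have [_] := HY a sa f q _ _ a0 sa2 (sub_ a sa (lexx a) sas1) qa bnd t ht.
      have t0 : 0 < t by apply: lt_le_trans h1.
      have g1 : KY * (K2 * A * t) <= A / 4.
        apply: (@le_trans _ _ ((KY * K2 * sa) * A)).
          rewrite (_ : KY * _ = KY * K2 * t * A); last by ring.
          apply: ler_wpM2r; first exact: ltW.
          by apply: ler_wpM2l => //; pos.
        by rewrite [leRHS]mulrC; apply: ler_wpM2r => //; exact: ltW.
      have g2 : KY * ((K2 * A) `^ p * t `^ tau) <= A / 4.
        apply: (@le_trans _ _ (KY * ((K2 * A) `^ p * sa `^ tau))).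
          apply: ler_wpM2l; first exact: ltW.
          apply: ler_wpM2l; first by pos.
          by apply: ge0_ler_powR; rewrite ?nnegrE ?(ltW tau0)// ltW.
        have e1 : (K2 * A) `^ p = K2 `^ p * A `^ p by rewrite powRM//; exact: ltW.
        have e2 : sa `^ tau = c1 `^ tau * (A `^ (- r)) `^ tau by rewrite /sa powRM ?powR_ge0// ltW.
        rewrite e1 e2 c1tau -powRrM.
        have -> : A `^ (- r * tau) = A / A `^ p.
          have -> : - r * tau = 1 - p by rewrite /r; field; rewrite gt_eqF.
          by rewrite powRDpos// powRr1 ?(ltW A0)// powRN.
        have Ap0 : 0 < A `^ p by pos.
        rewrite le_eqVlt; apply/orP; left; apply/eqP.
        by field; rewrite !gt_eqF.
      move=> hd.
      have : `|f a| <= `|f t| + `|f t - f a|.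
        by have := ler_normB (f t) (f t - f a); rewrite opprB addrCA subrr addr0.
      rewrite -/A -/tau in hd *; rewrite mulrDr in hd.
      by move: hd g1 g2; tidy; lra.
    (* The comparison function includes the contribution of [[0, a]], which the value at [a] covers
       through [c31]. *)
    pose g t := c3 * A `^ (p + 1) * t `^ (d + 1).
    have gd t : a <= t <= sa -> is_derive t 1 g (c3 * A `^ (p + 1) * ((d + 1) * t `^ d)).
      move=> /andP[h1 h2]; have t0 : 0 < t by apply: lt_le_trans h1.
      by rewrite /g; derby => //; rewrite addrK; ring.
    suff : H a - g a <= H sa - g sa.
      have h : g a <= H a.
        apply: le_trans Ha; rewrite /g -mulrA; apply: ler_wpM2r; first by pos.
        by rewrite /c3 ge_min lexx.
      by move: h; rewrite /g; tidy; lra.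
    apply: (@le_of_der _ (fun t => H t - g t) (fun t => D t - c3 * A `^ (p + 1) * ((d + 1) * t `^ d))).
    + exact: ltW.
    + move=> t ht; have /andP[h1 h2] := ht.
      have hts : a <= t <= s1 by rewrite h1 (le_trans h2).
      have hD := proj1 (HD t hts); have hg := gd t ht.
      by derby.
    + move=> t ht; have /andP[h1 h2] := ht.
      have hts : a <= t <= s1 by rewrite h1 (le_trans h2).
      rewrite subr_ge0; apply: le_trans (proj2 (HD t hts)).
      have t0 : 0 < t by apply: lt_le_trans h1.
      have t2 : 0 < t <= 2^-1 by rewrite t0 (le_trans _ s12)//; case/andP: hts.
      have /andP[b _] := HC t t2.
      have w := W_gt0 d d' (x01 t hts).
      apply: (@le_trans _ _ (c0 * ((MC^-1 * t `^ d) * (A / 2) `^ (p + 1)))); last first.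
        apply: ler_wpM2l; first exact: ltW.
        apply: ler_pM => //; [by pos|by pos|].
        by apply: ge0_ler_powR; rewrite ?nnegrE ?(ltW p10)//; [pos|exact: flow].
      have hA2 : A `^ (p + 1) = (A / 2) `^ (p + 1) * 2 `^ (p + 1).
        by rewrite -powRM ?divfK//; pos.
      apply: (@le_trans _ _ (c32 * A `^ (p + 1) * ((d + 1) * t `^ d))).
        apply: ler_wpM2r; first by pos.
        by apply: ler_wpM2r; [pos|rewrite /c3 ge_min lexx orbT].
      have two : 0 < 2 `^ (p + 1) :> R by pos.
      rewrite hA2 /c32 le_eqVlt; apply/orP; left; apply/eqP.
      by field; rewrite !gt_eqF.
have s1s : a <= s1 <= s1 by rewrite as1 lexx.
have E0 := En_ge0 e e' d d' p1 f q s101.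
have Hup : H s1 <= K3 * (En f q s1 + 1).
  rewrite /H /K3 [leRHS]mulrDl; apply: lerD.
    have /andP[_ s1lt] := s101.
    have s1c : 0 <= 1 - s1 by rewrite subr_ge0 ltW.
    have s1p : s1 * (1 - s1) <= 1.
      by apply: mulr_ile1 => //; [exact: ltW|exact: ltW|rewrite lerBlDr lerDl ltW].
    apply: ler_pM => //; [by pos| |by rewrite lerDl].
    by rewrite ler_piMl// ltW.
  have h := fq_le_En e e' d d' p1 f q s101.
  rewrite -[leRHS]mulrA -[leRHS]mulrA; apply: ler_wpM2l; first exact: ltW.
  by apply: le_trans h; rewrite mulrC ler_norm.
have low := le_trans key Hup.
have Aeta : A `^ (p + 1) * sa `^ (d + 1) = c1 `^ (d + 1) * A `^ eta.
  have -> : sa `^ (d + 1) = c1 `^ (d + 1) * (A `^ (- r)) `^ (d + 1) by rewrite /sa powRM ?powR_ge0// ltW.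
  rewrite -powRrM mulrCA -powRDpos//; congr (_ * _ `^ _).
  by rewrite /eta; ring.
rewrite Aeta in low.
have XA : X <= A `^ eta.
  rewrite [leLHS](_ : _ = (X `^ eta^-1) `^ eta); last first.
    by rewrite -powRrM mulVf ?gt_eqF// powRr1// ltW.
  by apply: ge0_ler_powR; rewrite ?nnegrE ?powR_ge0// ltW.
have c1d : 0 < c1 `^ (d + 1) by pos.
have : (`|Lam| + 1) * K3 <= K3 * (En f q s1 + 1).
  apply: le_trans low; rewrite mulrA.
  have -> : (`|Lam| + 1) * K3 = c3 * c1 `^ (d + 1) * X by rewrite /X; field; rewrite !gt_eqF.
  by apply: ler_wpM2l => //; pos.
rewrite mulrC ler_pM2l// lerD2r; apply: le_trans; exact: ler_norm.
Qed.

End emden_end.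

(** * Zeros: frequent at high energy, absent near a zero-flux end *)

Section emden_osc.
Context {R : realType}.
Implicit Types (f q : R -> R) (s t : R).
Variables (e e' d d' k0 p : R).
Local Notation emden := (emden_flow e e' d d' k0 p).
Local Notation En := (mech_energy e e' d d' p).
Hypothesis p1 : 1 < p.
Hypothesis k00 : 0 < k0.
Hypothesis He : end_exponents e d p.
Hypothesis He' : 0 <= e' + d'.

Ltac keep H := first [constr_eq H R | constr_eq H e | constr_eq H e' | constr_eq H d | constr_eq H d' | constr_eq H k0 | constr_eq H p | constr_eq H p1 | constr_eq H k00 | constr_eq H He | constr_eq H He'].
Ltac tidy := repeat match goal with H : _ |- _ => tryif keep H then fail else clear H end.

Let p10 : 0 < p + 1. Proof. by move: p1; lra. Qed.

(** Moves the conclusion to [1 / 2], the point shared by the estimates from the two ends. *)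
Lemma large_start_mid : exists2 s1 : R, 0 < s1 <= 2^-1 & forall Lam : R, exists2 a0 : R, 0 < a0 &
  forall (a : R) f q, 0 < a -> a <= s1 -> emden a 2^-1 f q -> q a = 0 -> a0 <= `|f a| ->
  Lam <= En f q 2^-1.
Proof.
have [s1 /andP[s10 s12] H] := large_start p1 k00 He He'.
have [K K1 HK] := En_mid p1 k00 He He' s10 s12.
have K0 : 0 < K by apply: lt_le_trans ltr01 _.
exists s1; first by rewrite s10.
move=> Lam; have [a0 a00 Ha] := H (K * (Lam + 1) - 1); exists a0 => //.
move=> a f q ap as1 Hs qa fa.
have h1 : emden a s1 f q by apply: emden_sub Hs.
have h2 : emden s1 2^-1 f q by apply: emden_sub Hs.
have h3 := Ha a f q ap as1 h1 qa fa.
have h12 : 2^-1 <= 1 - s1 by move: s12; tidy; lra.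
have [_ h4] := HK s1 2^-1 f q (lexx _) s12 h12 h2.
rewrite -(lerD2r 1) -(ler_pM2l K0); apply: le_trans h4.
by move: h3; tidy; lra.
Qed.

(* Along a zero-free stretch the scaled angle arctan(q / (lam f)) rotates at
   speed at least c lam, so that the stretch is short once lam may be taken
   large. *)
Lemma short_nodal (s1 s2 l : R) : 0 < s1 -> s2 < 1 -> 0 < l -> exists Lam : R, forall f q (x : R),
  s1 <= x -> x + l <= s2 -> emden x (x + l) f q ->
  (forall s, x <= s <= x + l -> Lam <= En f q s) ->
  ~ (forall s, x <= s <= x + l -> f s != 0).
Proof.
move=> s10 s21 l0.
pose c := Num.min s1 (1 - s2).
have c0 : 0 < c by rewrite /c lt_min s10 subr_gt0.
have cs1 : c <= s1 by rewrite /c ge_min lexx.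
have cs2 : s2 <= 1 - c.
  have : c <= 1 - s2 by rewrite /c ge_min lexx orbT.
  by tidy; lra.
have [c1|c1] := leP c 1; last first.
  exists 0 => f q x h1 h2 _ _ _.
  have := le_lt_trans h2 s21; have := lt_le_trans c1 (le_trans cs1 h1).
  by move: l0; tidy; lra.
have [MA MA0 HA] := W_bd e e' c0 c1.
have [MB MB0 HB] := W_bd (e - 1) (e' - 1) c0 c1.
have [MC MC0 HC] := W_bd d d' c0 c1.
pose cc := (2 * MA)^-1; have cc0 : 0 < cc by rewrite /cc; pos.
have pi0 := pi_gt0 R.
(* At speed [cc * lam] the angle falls by [pi] over the length [l], more than the range of the
   arctangent permits. *)
pose lam := pi / (cc * l); have lam0 : 0 < lam by rewrite /lam; pos.
(* What the rotation has to beat: the linear term plus the part of the target speed proportional to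
   [f ^+ 2]. Above the height [F0] the nonlinearity does it; below, high energy makes [q ^+ 2]
   large, and [Y] is the kinetic energy then required. *)
pose N := k0 * MB + cc * lam ^+ 2; have N0 : 0 < N by rewrite /N; pos.
have pm0 : 0 < p - 1 by move: p1; tidy; lra.
pose F0 := (N * MC) `^ (p - 1)^-1; have F00 : 0 < F0 by rewrite /F0; pos.
pose Y := N * F0 ^+ 2 * MA * MC / (2 * cc); have Y0 : 0 < Y by rewrite /Y; pos.
exists (F0 `^ (p + 1) / (p + 1) + Y) => f q x sx xs Hs HE Hf.
have x01 s : x <= s <= x + l -> c <= s <= 1 - c /\ 0 < s < 1.
  move=> /andP[h1 h2].
  have h3 : c <= s by apply: le_trans cs1 (le_trans sx h1).
  have h4 : s <= 1 - c by apply: le_trans h2 (le_trans xs cs2).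
  by rewrite h3 h4 (lt_le_trans c0 h3)/= (le_lt_trans h4)// ltrBlDr ltrDl.
pose th s := atan (q s / (lam * f s)).
pose D s := lam * ((k0 * W (e - 1) (e' - 1) s * f s - W d d' s * nl p (f s)) * f s - q s ^+ 2 / W e e' s)
  / (lam ^+ 2 * f s ^+ 2 + q s ^+ 2).
have den0 s : f s != 0 -> 0 < lam ^+ 2 * f s ^+ 2 + q s ^+ 2.
  move=> fs; apply: ltr_pwDl; last exact: sqr_ge0.
  by apply: mulr_gt0; [pos|rewrite exprn_even_gt0].
have thd (s : R) : x <= s <= x + l -> is_derive s 1 th (D s).
  move=> hs; have [hf hq] := Hs s hs; have fs := Hf s hs; have [_ s01] := x01 s hs.
  have A0 := W_gt0 e e' s01; have dn := den0 s fs.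
  have lf : lam * f s != 0 by rewrite mulf_neq0// gt_eqF.
  rewrite /th; derby; first by [].
  rewrite /D; move: A0; move: (W e e' s) (W d d' s * nl p (f s)) (k0 * W (e - 1) (e' - 1) s) => A n B A0.
  field.
  have -> : (lam * f s) ^+ 2 + q s ^+ 2 = lam ^+ 2 * f s ^+ 2 + q s ^+ 2 by ring.
  by rewrite fs andTb (gt_eqF A0) (gt_eqF dn) (gt_eqF lam0).
have Dle s : x <= s <= x + l -> D s <= - (cc * lam).
  move=> hs; have fs := Hf s hs; have [sc s01] := x01 s hs.
  have A0 := W_gt0 e e' s01; have C0 := W_gt0 d d' s01; have B0 := W_gt0 (e - 1) (e' - 1) s01.
  have /andP[A1 A2] := HA s sc; have /andP[_ B2] := HB s sc; have /andP[C1 C2] := HC s sc.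
  rewrite /D ler_pdivrMr ?den0//.
  have Ai : 2 * cc <= (W e e' s)^-1.
    have -> : 2 * cc = MA^-1 by rewrite /cc; field; rewrite gt_eqF.
    by rewrite lef_pV2 ?posrE.
  have q20 : 0 <= q s ^+ 2 by exact: sqr_ge0.
  have f20 : 0 <= f s ^+ 2 by exact: sqr_ge0.
  have g1 : q s ^+ 2 * (2 * cc) <= q s ^+ 2 / W e e' s by apply: ler_wpM2l.
  have g2 : k0 * W (e - 1) (e' - 1) s * f s ^+ 2 <= k0 * MB * f s ^+ 2.
    by apply: ler_wpM2r => //; apply: ler_wpM2l => //; exact: ltW.
  have nf : nl p (f s) * f s = `|f s| `^ (p - 1) * f s ^+ 2 by rewrite nl.unlock expr2 mulrA.
  have g3 : N * f s ^+ 2 <= W d d' s * (nl p (f s) * f s) + cc * q s ^+ 2.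
    have [fF|fF] := leP F0 `|f s|.
      have h1 : N * MC <= `|f s| `^ (p - 1).
        rewrite [leLHS](_ : _ = F0 `^ (p - 1)); last first.
          by rewrite /F0 -powRrM mulVf ?gt_eqF// powRr1//; pos.
        by apply: ge0_ler_powR; rewrite ?nnegrE ?(ltW pm0) ?(ltW F00).
      have h2 : N <= W d d' s * `|f s| `^ (p - 1).
        apply: (@le_trans _ _ (MC^-1 * (N * MC))).
          by rewrite mulrCA mulVf ?gt_eqF// mulr1.
        by apply: ler_pM => //; pos.
      have h3 : N * f s ^+ 2 <= W d d' s * (nl p (f s) * f s).
        by rewrite nf mulrA; apply: ler_wpM2r.
      have h4 : 0 <= cc * q s ^+ 2 by pos.
      by move: h3 h4; tidy; lra.
    have h1 : Fp p (f s) <= F0 `^ (p + 1) / (p + 1).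
      rewrite ler_pdivlMr// mulrC FpE//; apply: ge0_ler_powR; rewrite ?nnegrE ?(ltW p10) ?(ltW F00)//.
      exact: ltW.
    have h2 := HE s hs.
    have h3 : Y <= q s ^+ 2 / (2 * (W e e' s * W d d' s)).
      by move: h1 h2; rewrite /mech_energy; tidy; lra.
    have h4 : Y * (2 * (MA^-1 * MC^-1)) <= q s ^+ 2.
      apply: (@le_trans _ _ (Y * (2 * (W e e' s * W d d' s)))).
        apply: ler_wpM2l; first exact: ltW.
        by rewrite ler_pM2l//; apply: ler_pM => //; pos.
      by rewrite -ler_pdivlMr//; pos.
    have h5 : N * F0 ^+ 2 <= cc * q s ^+ 2.
      rewrite -ler_pdivrMl//; apply: le_trans h4; rewrite /Y le_eqVlt; apply/orP; left; apply/eqP.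
      by field; rewrite !gt_eqF.
    have h6 : N * f s ^+ 2 <= N * F0 ^+ 2.
      apply: ler_wpM2l; first exact: ltW.
      by rewrite -(real_normK (num_real (f s))) lerXn2r ?nnegrE// ltW.
    have h7 : 0 <= W d d' s * (nl p (f s) * f s).
      by rewrite nf; pos.
    by move: h5 h6 h7; tidy; lra.
  rewrite (_ : - (cc * lam) * _ = lam * (- (cc * (lam ^+ 2 * f s ^+ 2 + q s ^+ 2)))); last by ring.
  rewrite ler_pM2l//.
  have : (k0 * W (e - 1) (e' - 1) s * f s - W d d' s * nl p (f s)) * f s =
     k0 * W (e - 1) (e' - 1) s * f s ^+ 2 - W d d' s * (nl p (f s) * f s) by ring.
  by move: g1 g2 g3; rewrite /N => g1 g2 g3 ->; move: g1 g2 g3; tidy; lra.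
have xl : x <= x + l by rewrite lerDl ltW.
have : th (x + l) + cc * lam * (x + l) <= th x + cc * lam * x.
  apply: (@ge_of_der _ (fun s => th s + cc * lam * s) (fun s => D s + cc * lam)) => //.
  - by move=> t ht; have h := thd t ht; derby; ring.
  - by move=> t ht; rewrite -lerBrDr sub0r Dle.
have e1 : cc * lam * (x + l) = cc * lam * x + pi by rewrite /lam; field; rewrite !gt_eqF.
have a1 := atan_gtNpi2 (q (x + l) / (lam * f (x + l))).
have a2 := atan_ltpi2 (q x / (lam * f x)).
by rewrite e1 /th; move: a1 a2; tidy; lra.
Qed.

(** On a short interval whose length depends only on [M], the layer estimate bounds the oscillation
    of [f] by a quarter of its own maximum. A zero would force [|f a|] below that quarter, hence the
    maximum below half of itself. *)
Lemma no_zero_start (M : R) : exists2 dl : R, 0 < dl <= 2^-1 & forall (a : R) f q, 0 < a -> a <= dl ->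
  emden a dl f q -> q a = 0 -> f a != 0 -> (forall s, a <= s <= dl -> `|f s| <= M) ->
  forall s, a <= s <= dl -> f s != 0.
Proof.
have [[e0 d0 ed2 ed] [edp sub]] := He.
have [K K0 HK] := layer e' d' k00 He.
pose tau := d + 2 - e; have tau0 : 0 < tau by [].
pose M1 := `|M| `^ (p - 1).
have M10 : 0 <= M1 by exact: powR_ge0.
pose dl := Num.min 2^-1 (Num.min (8 * K)^-1 ((8 * K * (M1 + 1))^-1 `^ tau^-1)).
have dl0 : 0 < dl by rewrite /dl !lt_min invr_gt0 ltr0n/=; apply/andP; split; pos.
have dl1 : K * dl <= 8^-1.
  have : dl <= (8 * K)^-1 by rewrite /dl !ge_min lexx orbT.
  by rewrite -[(8 * K)^-1]mul1r ler_pdivlMr; [tidy; lra|pos].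
have dl2 : K * (M1 * dl `^ tau) <= 8^-1.
  have h1 : dl `^ tau <= (8 * K * (M1 + 1))^-1.
    rewrite [leRHS](_ : _ = ((8 * K * (M1 + 1))^-1 `^ tau^-1) `^ tau); last first.
      by rewrite -powRrM mulVf ?gt_eqF// powRr1//; pos.
    apply: ge0_ler_powR; rewrite ?nnegrE ?powR_ge0 ?(ltW tau0) ?(ltW dl0)//.
    by rewrite /dl !ge_min lexx !orbT.
  have : K * ((M1 + 1) * dl `^ tau) <= 8^-1.
    rewrite -[_^-1]mul1r ler_pdivlMr in h1; last by pos.
    by move: h1; tidy; lra.
  have : 0 <= K * dl `^ tau by pos.
  by tidy; lra.
exists dl; first by rewrite dl0 /dl !ge_min lexx.
move=> a f q a0 adl Hs qa fa HM s0 hs0; apply/eqP => fs0.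
have /andP[as0 s0dl] := hs0.
have fc : {within `[a, s0], continuous (fun t => `|f t|)}.
  apply: continuous_in_subspaceT => t; rewrite inE/= in_itv/= => /andP[h1 h2].
  apply: continuous_comp; last exact: norm_continuous.
  by apply: der_cont (proj1 (Hs t _)); rewrite h1 (le_trans h2).
have [m + Hm] := EVT_max as0 fc; rewrite in_itv/= => /andP[am ms].
have mm : forall s, a <= s <= s0 -> `|f s| <= `|f m|.
  by move=> s hs; apply: Hm; rewrite in_itv.
pose F := `|f m|.
have F0 : 0 < F.
  by apply: lt_le_trans (mm a _); [rewrite normr_gt0|rewrite lexx].
(* The nonlinearity is bounded linearly in the actual maximum [F], which makes the estimate
   relative, however small the solution. *)
have bnd s : a <= s <= s0 -> `|f s| <= F /\ `|nl p (f s)| <= M1 * F.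
  move=> hs; split; first exact: mm.
  rewrite nl.unlock normrM ger0_norm ?powR_ge0//; apply: ler_pM; [by pos|by pos| |exact: mm].
  apply: ge0_ler_powR; rewrite ?nnegrE//; first by move: p1; tidy; lra.
  apply: le_trans (HM s _) (ler_norm _).
  by case/andP: hs => h1 h2; rewrite h1 (le_trans h2).
have s02 : s0 <= 2^-1 by apply: le_trans s0dl _; rewrite /dl !ge_min lexx.
have Hs' : emden a s0 f q by apply: emden_sub Hs.
have hb := HK a s0 f q F (M1 * F) a0 s02 Hs' qa bnd.
have up s : a <= s <= s0 -> `|f s - f a| <= F / 4.
  move=> hs; have [_ h] := hb s hs; apply: le_trans h _.
  have /andP[h1 h2] := hs.
  have sdl : s <= dl by apply: le_trans h2 s0dl.
  have s00 : 0 < s by apply: lt_le_trans h1.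
  have g1 : K * s <= K * dl by rewrite ler_pM2l.
  have g2 : K * (M1 * s `^ tau) <= K * (M1 * dl `^ tau).
    rewrite ler_pM2l//; apply: ler_wpM2l => //.
    by apply: ge0_ler_powR; rewrite ?nnegrE ?(ltW tau0) ?(ltW s00) ?(ltW dl0).
  have -> : K * (F * s + M1 * F * s `^ (d + 2 - e)) = (K * s + K * (M1 * s `^ tau)) * F.
    by rewrite -/tau; ring.
  have g3 : K * s + K * (M1 * s `^ tau) <= 4^-1 by move: g1 g2 dl1 dl2; tidy; lra.
  by rewrite [leRHS]mulrC; apply: ler_wpM2r; [exact: ltW|].
have g1 := up m; rewrite am ms in g1; have {}g1 := g1 isT.
have g2 := up s0; rewrite lexx as0 fs0 sub0r normrN in g2; have {}g2 := g2 isT.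
have := ler_normD (f m - f a) (f a); rewrite subrK -/F.
by move: g1 g2 F0; tidy; lra.
Qed.

End emden_osc.

(** * Globally Lipschitz right-hand sides *)

Section lipschitz.
Context {R : realType}.

Lemma lipschitz_of_der (f df : R -> R) (L : R) : (forall t : R, is_derive t 1 f (df t)) ->
  (forall t, `|df t| <= L) -> forall x y, `|f x - f y| <= L * `|x - y|.
Proof.
move=> fd dL.
have key a b : a <= b -> `|f b - f a| <= L * (b - a).
  move=> ab; rewrite mulrBr.
  apply: (dist_of_der ab (fun t _ => fd t) (dg := fun=> L)) => t _ //.
  by derby; ring.
move=> x y; have [xy|/ltW yx] := leP x y.
- by rewrite distrC [`|x - y|]distrC (ger0_norm (_ : 0 <= y - x)) ?subr_ge0// key.
- by rewrite (ger0_norm (_ : 0 <= x - y)) ?subr_ge0// key.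
Qed.

(** The hitting time is the infimum of the closed set where [L <= z]; a jump past [L] is excluded by
    continuity from the left. *)
Lemma first_hit (z : R -> R) (a b L : R) : (forall t, a <= t <= b -> {for t, continuous z}) ->
  a <= b -> z a < L -> L <= z b ->
  exists2 c, a <= c <= b & z c = L /\ forall t, a <= t <= c -> z t <= L.
Proof.
move=> zc ab za zb.
pose S := [set t | a <= t <= b /\ L <= z t].
have Sb : S b by split => //; rewrite lexx ab.
have hS : has_inf S by split; [exists b|exists a => t [/andP[]]].
pose c := inf S.
have ac : a <= c by apply: lb_le_inf; [exists b|move=> t [/andP[]]].
have cb : c <= b by apply: inf_lbound => //; case: hS.
have cab : a <= c <= b by rewrite ac cb.
have zc1 : L <= z c.
  rewrite leNgt; apply/negP => h.
  have d0 : 0 < L - z c by rewrite subr_gt0.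
  have /cvgrPdist_lt/(_ _ d0)[r /= r0 Hr] := zc c cab.
  have [t [tab Lt] tc] := inf_adherent r0 hS.
  have ct : c <= t by apply: inf_lbound => //; case: hS.
  have := Hr t; rewrite /= distrC ger0_norm ?subr_ge0// ltrBlDr.
  rewrite addrC in tc => /(_ tc); rewrite distrC => /ltr_normlP[_].
  by move: Lt; clear; lra.
have below t : a <= t -> t < c -> z t < L.
  move=> at_ tc; rewrite ltNge; apply/negP => h.
  have : c <= t.
    apply: inf_lbound; first by case: hS.
    by split => //; rewrite at_ (le_trans (ltW tc)).
  by rewrite leNgt tc.
have zc2 : z c <= L.
  rewrite leNgt; apply/negP => h.
  have d0 : 0 < z c - L by rewrite subr_gt0.
  have /cvgrPdist_lt/(_ _ d0)[r /= r0 Hr] := zc c cab.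
  have ac' : a < c.
    rewrite lt_neqAle ac andbT; apply/negP => /eqP ea.
    by move: za; rewrite ea ltNge (ltW h).
  pose t := Num.max a (c - r / 2).
  have ta : a <= t by rewrite /t le_max lexx.
  have tc : t < c by rewrite /t gt_max ac' ltrBlDr ltrDl divr_gt0.
  have := Hr t; rewrite /= ger0_norm ?subr_ge0 ?(ltW tc)//.
  have tr : c - t < r.
    have : c - r / 2 <= t by rewrite /t le_max lexx orbT.
    by move: r0; clear; lra.
  move=> /(_ tr) /ltr_normlP[_].
  by have := below t ta tc; clear; lra.
exists c => //; split; first by apply/eqP; rewrite eq_le zc1 zc2.
move=> t /andP[h1]; rewrite le_eqVlt => /orP[/eqP -> //|h2].
by apply/ltW/below.
Qed.

(* The right-hand sides accepted by Picard's theorem. *)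
Definition lipb (g : R -> R -> R -> R) :=
  (exists2 M : R, 0 <= M & forall t x y x' y',
    `|g t x y| <= M /\ `|g t x y - g t x' y'| <= M * (`|x - x'| + `|y - y'|)) /\
  (forall x y : R -> R, continuous x -> continuous y -> continuous (fun t => g t (x t) (y t))).

Lemma lipbM g1 g2 : lipb g1 -> lipb g2 -> lipb (fun t x y => g1 t x y * g2 t x y).
Proof.
move=> [[M1 M10 H1] c1] [[M2 M20 H2] c2]; split; last first.
  by move=> x y xc yc t; apply: cvgM; [exact: c1|exact: c2].
exists (2 * M1 * M2 + M1 * M2); first by pos.
move=> t x y x' y'.
have [a1 a2] := H1 t x y x' y'; have [b1 b2] := H2 t x y x' y'.
have [a3 _] := H1 t x' y' x y.
have mm : 0 <= M1 * M2 by pos.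
split.
  rewrite normrM; apply: le_trans (ler_pM _ _ a1 b1) _ => //.
  by move: mm; clear; lra.
set dd := `|x - x'| + `|y - y'|.
have dd0 : 0 <= dd by rewrite addr_ge0.
have -> : g1 t x y * g2 t x y - g1 t x' y' * g2 t x' y' =
   (g1 t x y - g1 t x' y') * g2 t x y + g1 t x' y' * (g2 t x y - g2 t x' y') by ring.
apply: le_trans (ler_normD _ _) _; rewrite !normrM.
have h1 := ler_pM (normr_ge0 _) (normr_ge0 _) a2 b1.
have h2 := ler_pM (normr_ge0 _) (normr_ge0 _) a3 b2.
apply: le_trans (lerD h1 h2) _.
have : 0 <= M1 * M2 * dd by pos.
by rewrite -/dd; clear; lra.
Qed.

Lemma lipbD g1 g2 : lipb g1 -> lipb g2 -> lipb (fun t x y => g1 t x y + g2 t x y).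
Proof.
move=> [[M1 M10 H1] c1] [[M2 M20 H2] c2]; split; last first.
  by move=> x y xc yc t; apply: cvgD; [exact: c1|exact: c2].
exists (M1 + M2); first by pos.
move=> t x y x' y'.
have [a1 a2] := H1 t x y x' y'; have [b1 b2] := H2 t x y x' y'.
split; first by apply: le_trans (ler_normD _ _) _; exact: lerD.
have -> : g1 t x y + g2 t x y - (g1 t x' y' + g2 t x' y') =
   (g1 t x y - g1 t x' y') + (g2 t x y - g2 t x' y') by ring.
by apply: le_trans (ler_normD _ _) _; rewrite mulrDl; exact: lerD.
Qed.

Lemma lipb_coef (c : R -> R) (M : R) : continuous c -> (forall t, `|c t| <= M) ->
  lipb (fun t _ _ => c t).
Proof.
move=> cc cM; split => //; exists M.
  by apply: le_trans (cM 0).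
move=> t x y x' y'; split => //; rewrite subrr normr0.
by rewrite mulr_ge0 ?addr_ge0// (le_trans _ (cM 0)).
Qed.

Lemma lipb_cst (c : R) : lipb (fun _ _ _ => c).
Proof. by apply: (@lipb_coef (fun=> c) `|c|) => // t; exact: cvg_cst. Qed.

Lemma lipb_x (g : R -> R) (M L : R) : continuous g -> 0 <= L -> (forall x, `|g x| <= M) ->
  (forall x x', `|g x - g x'| <= L * `|x - x'|) -> lipb (fun _ x _ => g x).
Proof.
move=> gc L0 gM gL; have M0 : 0 <= M by apply: le_trans (gM 0).
split; last by move=> x y xc yc t; apply: continuous_comp; [exact: xc|exact: gc].
exists (M + L); first by rewrite addr_ge0.
move=> t x y x' y'; split; first by rewrite (le_trans (gM x))// lerDl.
apply: le_trans (gL _ _) _; apply: ler_pM => //; first by rewrite lerDr.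
by rewrite lerDl.
Qed.

Lemma lipb_y (g : R -> R) (M L : R) : continuous g -> 0 <= L -> (forall x, `|g x| <= M) ->
  (forall x x', `|g x - g x'| <= L * `|x - x'|) -> lipb (fun _ _ y => g y).
Proof.
move=> gc L0 gM gL; have M0 : 0 <= M by apply: le_trans (gM 0).
split; last by move=> x y xc yc t; apply: continuous_comp; [exact: yc|exact: gc].
exists (M + L); first by rewrite addr_ge0.
move=> t x y x' y'; split; first by rewrite (le_trans (gM y))// lerDl.
apply: le_trans (gL _ _) _; apply: ler_pM => //; first by rewrite lerDr.
by rewrite lerDr.
Qed.

Lemma lipb_sin : lipb (fun _ x _ => sin x).
Proof.
apply: (@lipb_x sin 1 1) => //; [exact: continuous_sin|exact: sin_max|].
by apply: (@lipschitz_of_der sin cos) => t; exact: cos_max.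
Qed.

Lemma lipb_cos : lipb (fun _ x _ => cos x).
Proof.
apply: (@lipb_x cos 1 1) => //; [exact: continuous_cos|exact: cos_max|].
by apply: (@lipschitz_of_der cos (fun t => - sin t)) => t; rewrite normrN; exact: sin_max.
Qed.

Lemma lipb_nl_cos (p : R) : 1 < p -> lipb (fun _ x _ => nl p (cos x)).
Proof.
move=> p1; have p0 : 0 <= p by move: p1; lra.
have pm : 0 <= p - 1 by move: p1; lra.
have cp (r : R) t : 0 <= r -> `|cos t| `^ r <= 1 :> R.
  by move=> r0; rewrite [leRHS](_ : 1 = 1 `^ r); [|by rewrite powR1]; apply: ge0_ler_powR; rewrite ?nnegrE//; exact: cos_max.
have d (t : R) : is_derive t 1 (fun x => nl p (cos x)) (p * `|cos t| `^ (p - 1) * (- sin t)).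
  by have h := derComp (der_nl p1 (cos t)) (derCos (derI t)); notypeclasses refine (derE h _); ring.
apply: (@lipb_x (fun x => nl p (cos x)) 1 p) => //.
- by move=> t; exact: der_cont (d t).
- by move=> x; rewrite norm_nl// cp.
- apply: (lipschitz_of_der d) => t; rewrite !normrM normrN (ger0_norm p0) -mulrA ler_piMr//.
  by rewrite ger0_norm ?powR_ge0// mulr_ile1 ?powR_ge0// ?cp// sin_max.
Qed.

(** In logarithmic polar coordinates the nonlinearity grows exponentially in the radius; truncation
    at [T] makes it globally Lipschitz. *)
Lemma lipb_exp_min (r T : R) : 0 <= r -> lipb (fun _ _ y => expR (r * Num.min y T)).
Proof.
move=> r0.
have minL y y' : `|Num.min y T - Num.min y' T| <= `|y - y'|.
  by have [h1|h1] := leP y T; have [h2|h2] := leP y' T; rewrite ?subrr ?normr0//;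
    rewrite ler_norml; apply/andP; split; (try (have := ler_norm (y - y')));
    (try (have := ler_norm (y' - y))); rewrite distrC //; move: h1 h2; clear; lra.
apply: (@lipb_y (fun y => expR (r * Num.min y T)) (expR (r * T)) (r * expR (r * T))).
- move=> y; apply: (@continuous_comp _ _ _ (fun y => r * Num.min y T) expR); last exact: continuous_expR.
  apply: cvgMr; apply/cvgrPdist_lt => e e0; near=> z.
  apply: le_lt_trans (minL _ _) _; near: z.
  by exists e.
- by rewrite mulr_ge0 ?expR_ge0.
- by move=> x; rewrite ger0_norm ?expR_ge0// ler_expR ler_wpM2l// ge_min lexx orbT.
- move=> x x'.
  have key a b : a <= b -> b <= T -> `|expR (r * b) - expR (r * a)| <= r * expR (r * T) * (b - a).
    move=> ab bT; rewrite mulrBr.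
    have hf (t : R) : a <= t <= b -> is_derive t 1 (fun t : R => expR (r * t)) (r * expR (r * t)).
      by move=> _; derby; ring.
    have hg (t : R) : a <= t <= b -> is_derive t 1 (fun t : R => r * expR (r * T) * t) (r * expR (r * T)).
      by move=> _; derby; ring.
    apply: (dist_of_der ab hf hg) => t /andP[_ tb].
    rewrite ger0_norm ?mulr_ge0 ?expR_ge0// ler_wpM2l// ler_expR ler_wpM2l//.
    exact: le_trans tb bT.
  apply: (@le_trans _ _ (r * expR (r * T) * `|Num.min x T - Num.min x' T|)).
    have [h|/ltW h] := leP (Num.min x T) (Num.min x' T).
    - have -> : `|Num.min x T - Num.min x' T| = Num.min x' T - Num.min x T by rewrite distrC ger0_norm ?subr_ge0.
      rewrite distrC.
      by apply: key => //; rewrite ge_min lexx orbT.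
    - rewrite [`|Num.min x T - Num.min x' T|]ger0_norm ?subr_ge0//.
      by apply: key => //; rewrite ge_min lexx orbT.
  by apply: ler_wpM2l; [rewrite mulr_ge0 ?expR_ge0|exact: minL].
Unshelve. all: by end_near. Qed.

(** Freezing the time variable outside [[c, 1 - c]] extends the weights to bounded continuous
    coefficients on the whole line. *)
Definition clamp (c s : R) := Num.max c (Num.min s (1 - c)).

Lemma clampP (c s : R) : c <= 2^-1 -> c <= clamp c s <= 1 - c.
Proof.
move=> c2; rewrite /clamp le_max lexx ge_max ge_min lexx orbT andbT/=.
by move: c2; clear; lra.
Qed.

Lemma clamp_id (c s : R) : c <= s <= 1 - c -> clamp c s = s.
Proof. by move=> /andP[h1 h2]; rewrite /clamp (min_idPl h2) (max_idPr h1). Qed.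

Lemma continuous_clamp (c : R) : continuous (clamp c).
Proof.
move=> s; apply: (@continuous_max _ _ (fun=> c) (fun s => Num.min s (1 - c))); first exact: cvg_cst.
by apply: (@continuous_min _ _ (fun s => s) (fun=> 1 - c)); [exact: cvg_id|exact: cvg_cst].
Qed.

Lemma lipb_W (a b c : R) : 0 < c -> c <= 2^-1 -> lipb (fun t _ _ => W a b (clamp c t)).
Proof.
move=> c0 c2; have c1 : c <= 1 by move: c2; lra.
have [M M0 HM] := W_bd a b c0 c1.
have cl01 t : 0 < clamp c t < 1.
  have /andP[h1 h2] := clampP t c2.
  by rewrite (lt_le_trans c0 h1) (le_lt_trans h2)// ltrBlDr ltrDl.
apply: (@lipb_coef _ M) => t; last first.
  by have /andP[_ h] := HM _ (clampP t c2); rewrite gtr0_norm// W_gt0.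
apply: (@continuous_comp _ _ _ (clamp c) (W a b)); first exact: continuous_clamp.
exact: der_cont (der_W a b (cl01 t)).
Qed.

Lemma lipb_WV (a b c : R) : 0 < c -> c <= 2^-1 -> lipb (fun t _ _ => (W a b (clamp c t))^-1).
Proof.
move=> c0 c2; have c1 : c <= 1 by move: c2; lra.
have [M M0 HM] := W_bd a b c0 c1.
have cl01 t : 0 < clamp c t < 1.
  have /andP[h1 h2] := clampP t c2.
  by rewrite (lt_le_trans c0 h1) (le_lt_trans h2)// ltrBlDr ltrDl.
apply: (@lipb_coef _ M) => t; last first.
  have /andP[h _] := HM _ (clampP t c2).
  by rewrite gtr0_norm ?invr_gt0 ?W_gt0// -[leRHS]invrK lef_pV2 ?posrE ?invr_gt0 ?W_gt0.
apply: cvgV; first by rewrite gt_eqF// W_gt0.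
apply: (@continuous_comp _ _ _ (clamp c) (W a b)); first exact: continuous_clamp.
exact: der_cont (der_W a b (cl01 t)).
Qed.

End lipschitz.

(** * Rotation of the solutions *)

Section prufer.
Context {R : realType}.
Implicit Types (f q : R -> R) (s t : R).
Variables (e e' d d' k0 p : R).
Local Notation emden := (emden_flow e e' d d' k0 p).
Local Notation En := (mech_energy e e' d d' p).
Hypothesis p1 : 1 < p.
Hypothesis k00 : 0 < k0.
Hypothesis He : end_exponents e d p.
Hypothesis He2 : end_exponents e' d' p.

Let p10 : 0 < p + 1. Proof. by move: p1; lra. Qed.
Let pm0 : 0 < p - 1. Proof. by rewrite subr_gt0. Qed.
Let He' : 0 <= e' + d'. Proof. by case: He2 => _ []. Qed.

Ltac keep H := first [constr_eq H R | constr_eq H e | constr_eq H e' | constr_eq H d | constr_eq H d' | constr_eq H k0 | constr_eq H p | constr_eq H p1 | constr_eq H k00 | constr_eq H He | constr_eq H He2 | constr_eq H p10 | constr_eq H pm0 | constr_eq H He'].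
Ltac tidy := repeat match goal with H : _ |- _ => tryif keep H then fail else clear H end.

Lemma emden_reflect lo hi f q : emden lo hi f q ->
  emden_flow e' e d' d k0 p (1 - hi) (1 - lo) (fun s => f (1 - s)) (fun s => - q (1 - s)).
Proof.
move=> S s /andP[s1 s2].
have hs : lo <= 1 - s <= hi by apply/andP; split; move: s1 s2; tidy; lra.
have [hf hq] := S _ hs; split.
- by notypeclasses refine (derE (reflect_der hf) _); rewrite W_refl mulNr.
- notypeclasses refine (derE (derN (reflect_der hq)) _).
  by rewrite opprK !W_refl.
Qed.

Lemma En_reflect f q s :
  mech_energy e' e d' d p (fun s => f (1 - s)) (fun s => - q (1 - s)) s = En f q (1 - s).
Proof. by rewrite /mech_energy sqrrN !W_refl. Qed.

Lemma nl_exp (x y : R) : nl p (expR y * x) = expR ((p - 1) * y) * expR y * nl p x.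
Proof.
rewrite nl.unlock normrM ger0_norm ?expR_ge0// powRM ?expR_ge0//.
have -> : expR y `^ (p - 1) = expR ((p - 1) * y) by rewrite /powR gt_eqF ?expR_gt0// expRK.
by ring.
Qed.

(** The field for [f = expR y * cos x], [q = expR y * sin x], with the logarithmic radius truncated
    at [T] inside the exponential only; it is the true field as long as [y <= T]. *)
Let rhs c T : {F : (R -> R -> R -> R) * (R -> R -> R -> R) |
  0 < c -> c <= 2^-1 -> [/\ lipb F.1, lipb F.2 &
  forall t x y, c <= t <= 1 - c ->
   F.1 t x y = k0 * W (e - 1) (e' - 1) t * cos x ^+ 2
     - W d d' t * expR ((p - 1) * Num.min y T) * (nl p (cos x) * cos x) - sin x ^+ 2 / W e e' t /\
   F.2 t x y = sin x * cos x * ((W e e' t)^-1 + k0 * W (e - 1) (e' - 1) t)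
     - W d d' t * expR ((p - 1) * Num.min y T) * (nl p (cos x) * sin x)]}.
Proof.
exists ((fun t x y => k0 * W (e - 1) (e' - 1) (clamp c t) * (cos x * cos x)
     + -1 * (W d d' (clamp c t) * expR ((p - 1) * Num.min y T) * (nl p (cos x) * cos x)) +
     -1 * (sin x * sin x * (W e e' (clamp c t))^-1)),
  (fun t x y => sin x * cos x * ((W e e' (clamp c t))^-1 + k0 * W (e - 1) (e' - 1) (clamp c t))
     + -1 * (W d d' (clamp c t) * expR ((p - 1) * Num.min y T) * (nl p (cos x) * sin x)))).
move=> c0 c2 /=.
have hs := @lipb_sin R; have hc := @lipb_cos R; have hn := lipb_nl_cos p1.
have hA := lipb_WV e e' c0 c2; have hB := lipb_W (e - 1) (e' - 1) c0 c2; have hC := lipb_W d d' c0 c2.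
have hE := lipb_exp_min T (ltW pm0).
have hk := @lipb_cst R.
split.
- apply: lipbD; first apply: lipbD.
  + exact: lipbM (lipbM (hk _) hB) (lipbM hc hc).
  + exact: lipbM (hk _) (lipbM (lipbM hC hE) (lipbM hn hc)).
  + exact: lipbM (hk _) (lipbM (lipbM hs hs) hA).
- apply: lipbD.
  + exact: lipbM (lipbM hs hc) (lipbD hA (lipbM (hk _) hB)).
  + exact: lipbM (hk _) (lipbM (lipbM hC hE) (lipbM hn hs)).
- by move=> t x y tc; rewrite clamp_id//; split; ring.
Qed.

Ltac keep2 H := first [constr_eq H R | constr_eq H e | constr_eq H e' | constr_eq H d | constr_eq H d' | constr_eq H k0 | constr_eq H p | constr_eq H p1 | constr_eq H k00 | constr_eq H He | constr_eq H He2 | constr_eq H p10 | constr_eq H pm0 | constr_eq H He' | constr_eq H rhs].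
Ltac tidy2 := repeat match goal with H : _ |- _ => tryif keep2 H then fail else clear H end.

Definition angle_speed (th l : R -> R) s :=
  (k0 * W (e - 1) (e' - 1) s - W d d' s * `|expR (l s) * cos (th s)| `^ (p - 1)) * cos (th s) ^+ 2
  - sin (th s) ^+ 2 / W e e' s.

(** The angle [0] at [c] encodes zero flux and the logarithmic radius is the shooting parameter. The
    cap [l1] bounds the initial energy, so one truncation level serves all parameters at once. The
    last item, a parameter whose final angle is nonnegative, is the upper end for the intermediate
    value argument. *)
Lemma prufer (c l1 : R) : 0 < c -> c <= 2^-1 -> exists th l : R -> R -> R,
  [/\ forall l0, th l0 c = 0 /\ l l0 c = l0,
      forall l0, l0 <= l1 -> emden c (1 - c) (fun s => expR (l l0 s) * cos (th l0 s))
        (fun s => expR (l l0 s) * sin (th l0 s)),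
      forall l0 s, l0 <= l1 -> c <= s <= 1 - c ->
        is_derive s 1 (th l0) (angle_speed (th l0) (l l0) s),
      continuous (fun l0 => th l0 (1 - c)) &
      exists2 l0, l0 <= l1 & 0 <= th l0 (1 - c)].
Proof.
move=> c0 c2.
have c1 : c <= 1 by move: c2; lra.
have cc : c <= 1 - c by move: c2; lra.
have [K K1 HK] := En_mid p1 k00 He He' c0 c2.
have [MA MA0 HA] := W_bd e e' c0 c1.
have [MB MB0 HB] := W_bd (e - 1) (e' - 1) c0 c1.
have [MC MC0 HC] := W_bd d d' c0 c1.
have K0 : 0 < K by apply: lt_le_trans ltr01 _.
pose E0 := Fp p (expR l1).
have E00 : 0 <= E0 by exact: Fp_ge0.
pose G := K * (E0 + 1); have G0 : 0 < G by rewrite /G; pos.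
(* A bound on [f ^+ 2 + q ^+ 2], the squared radius. Any [T] with [K' < expR (2 * T)] is out of
   reach; taking [K'] itself as a summand of [T] is a crude choice. *)
pose K' := (p + 1) * G + 2 * (MA * MC) * G; have K'0 : 0 < K' by rewrite /K'; pos.
pose T := K' + `|l1| + 1.
have [F HF] := rhs c T; have [F1b F2b FE] := HF c0 c2.
have [[M1 M10 H1] c1_] := F1b; have [[M2 M20 H2] c2_] := F2b.
pose L := M1 + M2 + 1; have L0 : 0 < L by rewrite /L; pos.
have Lb t x y x' y' : `|F.1 t x y - F.1 t x' y'| <= L * (`|x - x'| + `|y - y'|).
  have [_ h] := H1 t x y x' y'; apply: le_trans h _; apply: ler_wpM2r; first by pos.
  by rewrite /L -addrA lerDl; pos.
have Lb2 t x y x' y' : `|F.2 t x y - F.2 t x' y'| <= L * (`|x - x'| + `|y - y'|).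
  have [_ h] := H2 t x y x' y'; apply: le_trans h _; apply: ler_wpM2r; first by pos.
  by rewrite /L addrAC lerDr; pos.
have Bb t x y : `|F.1 t x y| <= L.
  by have [h _] := H1 t x y x y; apply: le_trans h _; rewrite /L -addrA lerDl; pos.
have Bb2 t x y : `|F.2 t x y| <= L.
  by have [h _] := H2 t x y x y; apply: le_trans h _; rewrite /L addrAC lerDr; pos.
have /choice[Z HZ] : forall l0, exists z : (R -> R) * (R -> R),
    [/\ ode_sol F.1 F.2 z.1 z.2, z.1 c = 0 & z.2 c = l0].
  move=> l0; have [X [Y H]] := ode_exists L0 (ltW L0) c1_ c2_ Lb Lb2 Bb Bb2 c 0 l0.
  by exists (X, Y).
pose th l0 := (Z l0).1; pose l l0 := (Z l0).2.
have thc l0 : th l0 c = 0 by case: (HZ l0).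
have lc l0 : l l0 c = l0 by case: (HZ l0).
have So l0 t : is_derive t 1 (th l0) (F.1 t (th l0 t) (l l0 t)) /\
    is_derive t 1 (l l0) (F.2 t (th l0 t) (l l0 t)).
  by case: (HZ l0) => h _ _; exact: h.
pose f l0 s := expR (l l0 s) * cos (th l0 s).
pose q l0 s := expR (l l0 s) * sin (th l0 s).
have x01 s : c <= s <= 1 - c -> 0 < s < 1.
  by move=> /andP[h1 h2]; rewrite (lt_le_trans c0 h1) (le_lt_trans h2)// ltrBlDr ltrDl.
have eqn l0 a b : c <= a -> b <= 1 - c -> (forall s, a <= s <= b -> l l0 s <= T) ->
    emden a b (f l0) (q l0).
  move=> ca bc HT s hs; have hT := HT s hs.
  have hcs : c <= s <= 1 - c.
    by case/andP: hs => h1 h2; rewrite (le_trans ca h1) (le_trans h2 bc).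
  have [h1 h2] := So l0 s.
  have [e1 e2] := FE s (th l0 s) (l l0 s) hcs.
  rewrite e1 (min_idPl hT) in h1; rewrite e2 (min_idPl hT) in h2.
  have A0 := W_gt0 e e' (x01 s hcs).
  have cs := cos2Dsin2 (th l0 s).
  rewrite /f /q nl_exp; move: A0 cs h1 h2.
  set A := W e e' s; set B := W (e - 1) (e' - 1) s; set C := W d d' s.
  set x := cos (th l0 s); set y := sin (th l0 s); set n := nl p x; set Ex := expR ((p - 1) * l l0 s).
  move=> A0 cs h1 h2; split.
  - derby; rewrite -/x -/y; set v := expR (l l0 s).
    rewrite [RHS](_ : _ = v * y / A * (x ^+ 2 + y ^+ 2)); last by rewrite cs mulr1.
    by field; rewrite gt_eqF.
  - derby; rewrite -/x -/y; set v := expR (l l0 s).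
    rewrite [RHS](_ : _ = (k0 * B * (v * x) - C * (Ex * v * n)) * (x ^+ 2 + y ^+ 2)); last by rewrite cs mulr1.
    by field; rewrite gt_eqF.
(* Up to the first time at which [T] is reached the true equation holds, so the energy bound applies
   there and contradicts the choice of [T]. *)
have lT l0 s : l0 <= l1 -> c <= s <= 1 - c -> l l0 s <= T.
  move=> l01 /andP[cs sc]; rewrite leNgt; apply/negP => Ts.
  have zc t : c <= t <= s -> {for t, continuous (l l0)}.
    by move=> _; exact: der_cont (proj2 (So l0 t)).
  have lcT : l l0 c < T.
    by rewrite lc /T (le_lt_trans l01)//; have := ler_norm l1; move: K'0; tidy2; lra.
  have [u /andP[cu us] [lu Hu]] := first_hit zc cs lcT (ltW Ts).
  have uc : u <= 1 - c by apply: le_trans us sc.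
  have cuc : c <= u <= 1 - c by rewrite cu uc.
  have Hem := eqn l0 c u (lexx c) uc Hu.
  have [hE _] := HK c u (f l0) (q l0) (lexx c) cu uc Hem.
  have Ec : En (f l0) (q l0) c <= E0.
    rewrite /mech_energy /q /f thc sin0 cos0 mulr0 mulr1 expr0n/= mul0r add0r lc /E0.
    rewrite -(ler_pM2l p10) !FpE// !ger0_norm ?expR_ge0//.
    by apply: ge0_ler_powR; rewrite ?nnegrE ?expR_ge0 ?ler_expR// ltW.
  have hE2 : En (f l0) (q l0) u + 1 <= G.
    by apply: le_trans hE _; rewrite ler_pM2l// lerD2r.
  have b1 := sqr_f_le_En e e' d d' p1 (f l0) (q l0) (x01 u cuc).
  have b2 := sqr_q_le_En e e' d d' p1 (f l0) (q l0) (x01 u cuc).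
  have En0 := En_ge0 e e' d d' p1 (f l0) (q l0) (x01 u cuc).
  have A0 := W_gt0 e e' (x01 u cuc); have C0 := W_gt0 d d' (x01 u cuc).
  have /andP[_ Ab] := HA u cuc; have /andP[_ Cb] := HC u cuc.
  have : f l0 u ^+ 2 + q l0 u ^+ 2 <= K'.
    apply: lerD.
      by apply: le_trans b1 _; rewrite ler_pM2l.
    apply: le_trans b2 _; apply: ler_pM => //; first by pos.
      by rewrite ler_pM2l//; apply: ler_pM => //; exact: ltW.
    by apply: le_trans hE2; rewrite lerDl.
  rewrite /f /q lu !exprMn -mulrDr cos2Dsin2 mulr1 -expRM_natl mulrC.
  have := expR_ge1Dx (2 * T); have := normr_ge0 l1.
  rewrite mulr_natl mulrC mulr_natl -[T *+ 2]mulr_natl /T; move: K'0; tidy2; lra.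
exists th, l; split => //.
- move=> l0 l01; apply: (eqn l0 c (1 - c)) => // s hs; exact: lT.
- move=> l0 s l01 hs; have [h1 _] := So l0 s.
  have [e1 _] := FE s (th l0 s) (l l0 s) hs.
  rewrite e1 (min_idPl (lT l0 s l01 hs)) in h1.
  notypeclasses refine (derE h1 _); rewrite /angle_speed.
  rewrite normrM [`|expR _|]ger0_norm ?expR_ge0// powRM ?expR_ge0//.
  have -> : expR (l l0 s) `^ (p - 1) = expR ((p - 1) * l l0 s).
    by rewrite /powR gt_eqF ?expR_gt0// expRK.
  by rewrite nl.unlock; ring.
- move=> l0; apply/cvgrPdist_lt => r r0.
  (* Square root of the factor in the dependence estimate, which is for squared distances. *)
  pose e2 := expR (2 * L * (1 - c - c)); have e20 : 0 < e2 by exact: expR_gt0.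
  near=> l0'.
  have [S1 _ _] := HZ l0; have [S2 _ _] := HZ l0'.
  have := ode_dep L0 Lb Lb2 cc S1 S2.
  rewrite -/(th l0) -/(th l0') -/(l l0) -/(l l0') !thc !lc subrr expr0n add0r => hd.
  have h : (th l0 (1 - c) - th l0' (1 - c)) ^+ 2 <= (`|l0 - l0'| * e2) ^+ 2.
    apply: le_trans (le_trans hd _); first by rewrite lerDl sqr_ge0.
    rewrite exprMn real_normK ?num_real// /e2 -expRM_natl.
    rewrite le_eqVlt; apply/orP; left; apply/eqP; congr (_ * expR _); ring.
  apply: le_lt_trans (_ : `|l0 - l0'| * e2 < r).
    rewrite -[`|_|]ger0_norm// -[_ * e2]ger0_norm; last by pos.
    by rewrite -ler_sqr ?nnegrE ?normr_ge0// !real_normK ?num_real// normr_id real_normK ?num_real.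
  rewrite -ltr_pdivlMr//; near: l0'.
  by exists (r / e2) => //=; rewrite divr_gt0.
- pose x0 := ln (k0 / (MB * MC)) / (p - 1) - L.
  pose l0 := Num.min l1 x0.
  have l01 : l0 <= l1 by rewrite ge_min lexx.
  exists l0 => //.
  have lup s : c <= s <= 1 - c -> l l0 s <= x0 + L.
    move=> /andP[cs sc].
    have := @le_of_der _ (fun t => L * t - l l0 t) (fun t => L - F.2 t (th l0 t) (l l0 t)) c s cs.
    rewrite lc => h.
    have : L * c - l0 <= L * s - l l0 s.
      apply: h => t _.
        by have [_ h2] := So l0 t; derby; ring.
      by rewrite subr_ge0; apply: le_trans (ler_norm _) (Bb2 _ _ _).
    have : l0 <= x0 by rewrite ge_min lexx orbT.
    have : L * (s - c) <= L * 1.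
      by rewrite ler_pM2l//; move: sc c0; tidy2; lra.
    by rewrite mulrBr; tidy2; lra.
  have Vpos s : c <= s <= 1 - c -> 0 <= k0 * W (e - 1) (e' - 1) s - W d d' s * `|f l0 s| `^ (p - 1).
    move=> hs; have s01 := x01 s hs.
    have B0 := W_gt0 (e - 1) (e' - 1) s01; have C0 := W_gt0 d d' s01.
    have /andP[Bb1 _] := HB s hs; have /andP[_ Cb] := HC s hs.
    have f1 : `|f l0 s| `^ (p - 1) <= k0 / (MB * MC).
      apply: (@le_trans _ _ (expR ((p - 1) * (x0 + L)))); last first.
        rewrite /x0 subrK mulrCA mulfV ?gt_eqF// mulr1 lnK// posrE; pos.
      rewrite mulrC expRM; apply: ge0_ler_powR; rewrite ?nnegrE ?expR_ge0 ?(ltW pm0)//.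
      rewrite /f normrM ger0_norm ?expR_ge0//.
      apply: (@le_trans _ _ (expR (l l0 s))).
        by rewrite ler_piMr ?expR_ge0// cos_max.
      by rewrite ler_expR lup.
    rewrite subr_ge0.
    apply: (@le_trans _ _ (MC * (k0 / (MB * MC)))).
      by apply: ler_pM => //; exact: ltW.
    have -> : MC * (k0 / (MB * MC)) = k0 * MB^-1 by field; rewrite !gt_eqF.
    by rewrite ler_pM2l.
  have dth s : c <= s <= 1 - c -> is_derive s 1 (th l0) (F.1 s (th l0 s) (l l0 s)).
    by move=> _; exact: (proj1 (So l0 s)).
  have F1E s : c <= s <= 1 - c -> - (MA * `|th l0 s|) <= F.1 s (th l0 s) (l l0 s).
    move=> hs; have [e1 _] := FE s (th l0 s) (l l0 s) hs.
    rewrite e1 (min_idPl (lT l0 s l01 hs)).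
    have V := Vpos s hs.
    rewrite /f normrM [`|expR _|]ger0_norm ?expR_ge0// powRM ?expR_ge0// in V.
    have e3 : expR (l l0 s) `^ (p - 1) = expR ((p - 1) * l l0 s).
      by rewrite /powR gt_eqF ?expR_gt0// expRK.
    rewrite e3 in V.
    have A0 := W_gt0 e e' (x01 s hs); have /andP[Ab _] := HA s hs.
    have s1 : `|sin (th l0 s)| <= `|th l0 s|.
      have := @lipschitz_of_der R sin cos 1 (fun t => is_derive_sin t) (fun t => cos_max t) (th l0 s) 0.
      by rewrite sin0 !subr0 mul1r.
    have s2 : sin (th l0 s) ^+ 2 <= `|th l0 s|.
      rewrite -real_normK ?num_real// expr2; apply: le_trans s1.
      by rewrite ler_piMr// sin_max.
    have s3 : sin (th l0 s) ^+ 2 / W e e' s <= `|th l0 s| * MA.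
      apply: ler_pM => //; [exact: sqr_ge0|pos|].
      by rewrite -[leRHS]invrK lef_pV2 ?posrE ?invr_gt0.
    have := mulr_ge0 V (sqr_ge0 (cos (th l0 s))).
    have -> : nl p (cos (th l0 s)) * cos (th l0 s) = `|cos (th l0 s)| `^ (p - 1) * cos (th l0 s) ^+ 2.
      by rewrite nl.unlock; ring.
    by move: s3; tidy2; lra.
  (* The remaining negative term is at most [MA * |th|], so a negative angle falls at most
     exponentially; the integrating factor turns this into a barrier at [0]. *)
  have := @barrier _ (fun s => - th l0 s * expR (- (MA * s)))
     (fun s => expR (- (MA * s)) * (- F.1 s (th l0 s) (l l0 s) + MA * th l0 s)) c (1 - c) cc.
  rewrite thc oppr0 mul0r lexx => hb.
  have : - th l0 (1 - c) * expR (- (MA * (1 - c))) <= 0.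
    apply: hb => // t ht.
      by have h := dth t ht; derby; ring.
    rewrite pmulr_lgt0 ?expR_gt0// oppr_gt0 => tn.
    have := F1E t ht; rewrite ltr0_norm// => h1.
    rewrite mulr_ge0_le0 ?expR_ge0//.
    by move: h1; tidy2; lra.
  by rewrite pmulr_lle0 ?expR_gt0// oppr_le0.
Unshelve. all: by end_near. Qed.

End prufer.

Section rotation.
Context {R : realType}.
Implicit Types (f q : R -> R) (s t : R).
Variables (e e' d d' k0 p : R).
Local Notation emden := (emden_flow e e' d d' k0 p).
Local Notation En := (mech_energy e e' d d' p).
Local Notation speed := (angle_speed e e' d d' k0 p).
Hypothesis p1 : 1 < p.
Hypothesis k00 : 0 < k0.

Ltac keep H := first [constr_eq H R | constr_eq H e | constr_eq H e' | constr_eq H d | constr_eq H d' | constr_eq H k0 | constr_eq H p | constr_eq H p1 | constr_eq H k00].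
Ltac tidy := repeat match goal with H : _ |- _ => tryif keep H then fail else clear H end.

Lemma cos_lipschitz (x y : R) : `|cos x - cos y| <= `|x - y|.
Proof.
have := @lipschitz_of_der R cos (fun t => - sin t) 1 (fun t => is_derive_cos t) _ x y.
by rewrite mul1r; apply => t; rewrite normrN sin_max.
Qed.

Lemma cos_node (j : nat) : cos (pi / 2 - pi *+ j) = 0 :> R.
Proof.
have := alternatingn (@cosDpi R) j (pi / 2 - pi *+ j); rewrite subrK cos_pihalf => /eqP.
by rewrite eq_sym mulf_eq0 signr_eq0/= => /eqP.
Qed.

Lemma cos_between_nodes (j : nat) (x : R) :
  pi / 2 - pi *+ j.+1 < x -> x < pi / 2 - pi *+ j -> cos x != 0.
Proof.
move=> h1 h2; have := alternatingn (@cosDpi R) j x => h.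
have : 0 < cos (x + pi *+ j).
  apply: cos_gt0_pihalf; apply/andP; split; last by rewrite -ltrBrDr.
  by move: h1; rewrite [pi *+ j.+1]mulrS; have := pi_gt0 R; move: (pi *+ j) => P; tidy; lra.
rewrite h => /gt_eqF/negbT; apply: contra => /eqP ->; by rewrite mulr0.
Qed.

(* The angle can only decrease through the zeros of the cosine. *)
Lemma node_barrier (th l : R -> R) (v a b : R) : 0 < a -> a <= b -> b < 1 -> cos v = 0 ->
  (forall s, a <= s <= b -> is_derive s 1 th (speed th l s)) ->
  th a <= v -> th b <= v.
Proof.
move=> a0 ab b1 cv Hth tav.
pose c := Num.min a (Num.min (1 - b) 2^-1).
have c0 : 0 < c by rewrite /c !lt_min a0 subr_gt0 b1 invr_gt0 ltr0n.
have ca : c <= a by rewrite /c ge_min lexx.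
have cb : b <= 1 - c.
  have : c <= 1 - b by rewrite /c !ge_min lexx orbT.
  by tidy; lra.
have c1 : c <= 1.
  have : c <= 2^-1 by rewrite /c !ge_min lexx !orbT.
  by tidy; lra.
have [MB MB0 HB] := W_bd (e - 1) (e' - 1) c0 c1.
have s01 s : a <= s <= b -> c <= s <= 1 - c /\ 0 < s < 1.
  move=> /andP[h1 h2]; rewrite (le_trans ca h1) (le_trans h2 cb).
  by rewrite (lt_le_trans a0 h1) (le_lt_trans h2 b1).
pose L := k0 * MB.
have := @barrier _ (fun s => (th s - v) * expR (- (L * s)))
   (fun s => expR (- (L * s)) * (speed th l s - L * (th s - v))) a b ab.
move=> hb; have : (th b - v) * expR (- (L * b)) <= 0; last first.
  by rewrite pmulr_lle0 ?expR_gt0// subr_le0.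
apply: hb.
- by move=> t ht; have h := Hth t ht; derby; ring.
- move=> t ht; rewrite pmulr_lgt0 ?expR_gt0// subr_gt0 => vt.
  rewrite pmulr_rle0 ?expR_gt0// subr_le0 /angle_speed.
  have [tc t01] := s01 t ht.
  have A0 := W_gt0 e e' t01; have C0 := W_gt0 d d' t01; have B0 := W_gt0 (e - 1) (e' - 1) t01.
  have /andP[_ Bb] := HB t tc.
  set c2 := cos (th t) ^+ 2.
  have c20 : 0 <= c2 by exact: sqr_ge0.
  have h1 : 0 <= sin (th t) ^+ 2 / W e e' t by pos.
  have h2 : 0 <= W d d' t * `|expR (l t) * cos (th t)| `^ (p - 1) * c2 by pos.
  have h3 : c2 <= th t - v.
    have h4 : `|cos (th t)| <= th t - v.
      have := cos_lipschitz (th t) v; rewrite cv subr0 => /le_trans; apply.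
      by rewrite ger0_norm// subr_ge0 ltW.
    apply: le_trans h4; rewrite /c2 -real_normK ?num_real// expr2 ler_piMr//.
    exact: cos_max.
  have h5 : k0 * W (e - 1) (e' - 1) t * c2 <= L * (th t - v).
    apply: ler_pM => //; first by pos.
    by rewrite ler_pM2l.
  by rewrite mulrBl; move: h1 h2 h5; tidy; lra.
- by rewrite pmulr_lle0 ?expR_gt0// subr_le0.
Qed.

(** At a zero of the cosine the speed is the negative number [- (W e e' b)^-1], so an angle reaching
    [v] at time [b] would have been above [v] just before. *)
Lemma node_strict (th l : R -> R) (v a b : R) : 0 < a -> a < b -> b < 1 -> cos v = 0 ->
  is_derive b 1 th (speed th l b) ->
  (forall s, a <= s <= b -> th s <= v) -> th b != v.
Proof.
move=> a0 ab b1 cv Hb Hv; apply/eqP => bv.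
have b01 : 0 < b < 1 by rewrite b1 (lt_trans a0).
have A0 := W_gt0 e e' b01.
have sv : sin v ^+ 2 = 1 by rewrite sin2cos2 cv expr0n subr0.
have sp : speed th l b = - (W e e' b)^-1.
  by rewrite /angle_speed bv cv sv expr0n/= mulr0 mul1r sub0r.
rewrite sp in Hb.
have r0 : 0 < (W e e' b)^-1 / 2 by pos.
have [r rp Hr] := (der_eps th b (- (W e e' b)^-1)).1 Hb _ r0.
pose y := Num.max a (b - r / 2).
have yb : y < b by rewrite /y gt_max ab ltrBlDr ltrDl divr_gt0.
have ya : a <= y by rewrite /y le_max lexx.
have ny : `|y - b| = b - y by rewrite distrC ger0_norm// subr_ge0 ltW.
have : `|y - b| < r.
  rewrite ny; have : b - r / 2 <= y by rewrite /y le_max lexx orbT.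
  by move: rp; tidy; lra.
move=> /Hr; rewrite ny bv ler_norml => /andP[h1 h2].
have h3 : th y <= v by apply: Hv; rewrite ya (ltW yb).
have h4 : 0 < (W e e' b)^-1 * (b - y) by rewrite mulr_gt0 ?invr_gt0// subr_gt0.
have h5 : (W e e' b)^-1 / 2 * (b - y) = (W e e' b)^-1 * (b - y) / 2 by ring.
have h6 : - (W e e' b)^-1 * (y - b) = (W e e' b)^-1 * (b - y) by ring.
by rewrite h5 h6 in h1 h2; move: h1 h2 h3 h4; tidy; lra.
Qed.

Let f_ (th l : R -> R) s := expR (l s) * cos (th s).
Let q_ (th l : R -> R) s := expR (l s) * sin (th s).

(** The interval is cut into [m.+1] windows, each of which loses a node. An angle that does not pass
    the next node stays between two nodes, and [f] would be free of zeros on a stretch that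
    [short_nodal] forbids. *)
Lemma many_turns (m : nat) : exists Lam : R, forall th l : R -> R,
  emden 4^-1 (3 / 4) (f_ th l) (q_ th l) ->
  (forall s, 4^-1 <= s <= 3 / 4 -> is_derive s 1 th (speed th l s)) ->
  (forall s, 4^-1 <= s <= 3 / 4 -> Lam <= En (f_ th l) (q_ th l) s) ->
  th 4^-1 <= pi / 2 -> th (3 / 4) <= pi / 2 - pi *+ m.+1.
Proof.
have q1 : 0 < 4^-1 :> R by rewrite invr_gt0.
have q3 : 3 / 4 < 1 :> R by lra.
(* Windows have length [2 * l0], and [m.+1] of them fill a half. The first half of a window serves
   only to leave the upper node strictly; the contradiction takes place on the second. *)
pose l0 : R := (4 * m.+1%:R)^-1.
have m0 : 0 < m.+1%:R :> R by [].
have l00 : 0 < l0 by rewrite /l0; pos.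
have [Lam HL] := short_nodal e e' d d' p1 k00 q1 q3 l00.
exists Lam => th l Hs Hth HE th0.
have pi0 := pi_gt0 R.
have tot : 4^-1 + 2 * l0 *+ m.+1 = 3 / 4.
  by rewrite -[2 * l0 *+ _]mulr_natr /l0; move: m0; move: (m.+1%:R : R) => M M0; field; rewrite gt_eqF.
suff H j : (j <= m.+1)%N -> th (4^-1 + 2 * l0 *+ j) <= pi / 2 - pi *+ j.
  by rewrite -tot; exact: H.
elim: j => [|j IH] jm; first by rewrite mulr0n addr0 mulr0n subr0.
have {}IH := IH (ltnW jm).
set t := 4^-1 + 2 * l0 *+ j in IH *.
have -> : 4^-1 + 2 * l0 *+ j.+1 = t + 2 * l0 by rewrite /t [2 * l0 *+ j.+1]mulrSr; ring.
have t4 : 4^-1 <= t by rewrite /t lerDl mulrn_wge0//; pos.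
have t3 : t + 2 * l0 <= 3 / 4.
  have -> : t + 2 * l0 = 4^-1 + 2 * l0 *+ j.+1 by rewrite /t [2 * l0 *+ j.+1]mulrSr; ring.
  by rewrite -tot lerD2l; apply: ler_wpMn2l => //; pos.
rewrite leNgt; apply/negP => hgt.
have rng s : t <= s <= t + 2 * l0 -> 4^-1 <= s <= 3 / 4.
  by move=> /andP[h1 h2]; rewrite (le_trans t4 h1) (le_trans h2 t3).
have upper s : t <= s <= t + 2 * l0 -> th s <= pi / 2 - pi *+ j.
  move=> hs; have /andP[h1 h2] := hs.
  apply: (@node_barrier th l _ t s) => //.
  - exact: lt_le_trans q1 t4.
  - exact: le_lt_trans (le_trans h2 t3) q3.
  - exact: cos_node.
  - move=> u /andP[h3 h4]; apply: Hth; apply: rng; rewrite h3; exact: le_trans h4 h2.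
have lower s : t <= s <= t + 2 * l0 -> pi / 2 - pi *+ j.+1 < th s.
  move=> hs; have /andP[h1 h2] := hs; rewrite ltNge; apply/negP => h.
  move: hgt; rewrite ltNge => /negP; apply.
  apply: (@node_barrier th l _ s (t + 2 * l0)) => //.
  - exact: lt_le_trans q1 (le_trans t4 h1).
  - exact: le_lt_trans t3 q3.
  - exact: cos_node.
  - by move=> u /andP[h3 h4]; apply: Hth; apply: rng; rewrite h4 (le_trans h1 h3).
have nz s : t + l0 <= s <= t + l0 + l0 -> f_ th l s != 0.
  move=> /andP[h1 h2].
  have h2' : s <= t + 2 * l0 by move: h2; tidy; lra.
  have ts : t < s by apply: lt_le_trans h1; rewrite ltrDl.
  have hs : t <= s <= t + 2 * l0 by rewrite (ltW ts).
  rewrite /f_; apply: mulf_neq0; first by rewrite gt_eqF ?expR_gt0.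
  apply: (cos_between_nodes (j := j)); first exact: lower.
  rewrite lt_neqAle upper// andbT.
  apply: (@node_strict th l _ t s) => //.
  - exact: lt_le_trans q1 t4.
  - exact: le_lt_trans (le_trans h2' t3) q3.
  - exact: cos_node.
  - by apply: Hth; apply: rng.
  - by move=> u /andP[h3 h4]; apply: upper; rewrite h3 (le_trans h4).
have sub_ : forall s, t + l0 <= s <= t + l0 + l0 -> 4^-1 <= s <= 3 / 4.
  move=> s /andP[h1 h2]; apply: rng; apply/andP; split; move: h1 h2 l00; tidy; lra.
apply: (HL (f_ th l) (q_ th l) (t + l0)) nz.
- by apply: le_trans t4 _; rewrite lerDl ltW.
- by move: t3; tidy; lra.
- move=> s hs; exact: Hs (sub_ s hs).
- by move=> s hs; exact: HE (sub_ s hs).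
Qed.

(** The cosine takes opposite values at [th a - pi] and [th a], so an angle falling that far passes
    one of its zeros. *)
Lemma no_turn (th : R -> R) (a b : R) : a <= b ->
  (forall s, a <= s <= b -> {for s, continuous th}) ->
  (forall s, a <= s <= b -> cos (th s) != 0) -> th a - pi < th b.
Proof.
move=> ab thc nz; rewrite ltNge; apply/negP => h.
have pi0 := pi_gt0 R.
have [v /andP[v1 v2] cv] : exists2 v, th a - pi <= v <= th a & cos v = 0.
  apply: ivt; first by rewrite lerBlDr lerDl ltW.
    by move=> t _; exact: continuous_cos.
  have -> : cos (th a - pi) = - cos (th a) by rewrite -[X in _ = - cos X](subrK pi) cosDpi opprK.
  have [c|c] := leP 0 (cos (th a)).
  - by rewrite ge_min le_max oppr_le0 c orbT.
  - by rewrite ge_min le_max oppr_ge0 (ltW c) !orbT.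
have vr : Num.min (th a) (th b) <= v <= Num.max (th a) (th b).
  by rewrite ge_min le_max (le_trans h v1) v2 !orbT.
have [s hs sv] := ivt ab thc vr.
by move/eqP: (nz s hs); apply; rewrite sv.
Qed.

End rotation.

Section start_bound.
Context {R : realType}.
Variables (e e' d d' k0 p : R).
Hypothesis p1 : 1 < p.
Hypothesis k00 : 0 < k0.
Hypothesis He : end_exponents e d p.
Hypothesis He' : 0 <= e' + d'.

(** At zero flux the energy is purely potential, hence bounded by the initial value, and [En_left]
    propagates it with a constant independent of [c]. *)
Lemma start_bound (a : R) : exists2 M : R, 0 <= M & forall (c : R) (f q : R -> R),
  0 < c -> c <= 2^-1 -> emden_flow e e' d d' k0 p c 2^-1 f q -> q c = 0 -> `|f c| <= a ->
  forall s, c <= s <= 2^-1 -> `|f s| <= M /\ mech_energy e e' d d' p f q s <= M.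
Proof.
have p10 : 0 < p + 1 by move: p1; lra.
have p11 : 1 <= p + 1 by move: p1; lra.
have [K K1 HK] := En_left p1 k00 He He'.
have K0 : 0 < K by apply: lt_le_trans ltr01 _.
pose a' := `|a| `^ (p + 1) / (p + 1).
have a'0 : 0 <= a' by rewrite /a'; pos.
pose X := (p + 1) * (K * (a' + 1)); have X0 : 0 < X by rewrite /X; pos.
exists (1 + X); first by pos.
move=> c f q c0 c2 Hs qc fc s /andP[cs s2].
have Hcs : emden_flow e e' d d' k0 p c s f q by apply: emden_sub Hs.
have hE := HK c s f q c0 cs s2 Hcs.
have s01 : 0 < s < 1.
  by rewrite (lt_le_trans c0 cs)/= (le_lt_trans s2)// invf_lt1// ltr1n.
have Ec : mech_energy e e' d d' p f q c <= a'.
  rewrite /mech_energy qc expr0n/= mul0r add0r /a' ler_pdivlMr// mulrC FpE//.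
  apply: ge0_ler_powR; rewrite ?nnegrE ?(ltW p10)//.
  by apply: le_trans fc (ler_norm _).
have hE2 : mech_energy e e' d d' p f q s + 1 <= K * (a' + 1).
  by apply: le_trans hE _; rewrite ler_pM2l// lerD2r.
have hX : K * (a' + 1) <= X.
  by rewrite /X ler_peMl//; pos.
split; last by move: hE2 hX; lra.
have h : f s ^+ 2 <= X.
  apply: le_trans (sqr_f_le_En e e' d d' p1 f q s01) _.
  by rewrite ler_pM2l.
rewrite -real_normK ?num_real// in h.
have := sqr_ge0 (`|f s| - 1); have : (`|f s| - 1) ^+ 2 = `|f s| ^+ 2 - 2 * `|f s| + 1 by ring.
by move: h X0; nra.
Qed.

End start_bound.

Section regularized.
Context {R : realType}.
Implicit Types (f q : R -> R) (s t : R).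
Variables (e e' d d' k0 p : R).
Local Notation emden := (emden_flow e e' d d' k0 p).
Local Notation En := (mech_energy e e' d d' p).
Local Notation speed := (angle_speed e e' d d' k0 p).
Hypothesis p1 : 1 < p.
Hypothesis k00 : 0 < k0.
Hypothesis He : end_exponents e d p.
Hypothesis He2 : end_exponents e' d' p.

Ltac keep H := first [constr_eq H R | constr_eq H e | constr_eq H e' | constr_eq H d | constr_eq H d' | constr_eq H k0 | constr_eq H p | constr_eq H p1 | constr_eq H k00 | constr_eq H He | constr_eq H He2].
Ltac tidy := repeat match goal with H : _ |- _ => tryif keep H then fail else clear H end.

Lemma reflectK (c : R) : 1 - (1 - c) = c.
Proof. by rewrite opprB addrCA subrr addr0. Qed.

(* The regularized problem on [c, 1 - c] has solutions with zero flux at both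
   ends and any number of half-turns; large ones are forced by asking for many
   half-turns. All bounds are uniform in c. *)
Lemma regularized (Lam : R) : exists M c0 : R, [/\ 0 < c0, c0 <= 2^-1 &
  forall c, 0 < c -> c <= c0 -> exists f q, [/\ emden c (1 - c) f q, q c = 0 & q (1 - c) = 0] /\
    [/\ `|f c| <= M, `|f (1 - c)| <= M & Lam <= En f q 2^-1]].
Proof.
have HL' : 0 <= e' + d' by case: He2 => _ [].
have HR' : 0 <= e + d by case: He => _ [].
have pi0 := pi_gt0 R.
have two : 2^-1 < 1 :> R by rewrite invf_lt1// ltr1n.
have [sL /andP[sL0 sL2] HL] := large_start_mid p1 k00 He HL'.
have [sR /andP[sR0 sR2] HR] := large_start_mid p1 k00 He2 HR'.
have [aL aL0 HaL] := HL Lam; have [aR aR0 HaR] := HR Lam.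
have [ML ML0 HML] := start_bound p1 k00 He HL' aL.
have [MR MR0 HMR] := start_bound p1 k00 He2 HR' aR.
have [dL /andP[dL0 dL2] HdL] := no_zero_start e' d' p1 k00 He ML.
have [dR /andP[dR0 dR2] HdR] := no_zero_start e d p1 k00 He2 MR.
pose dl := Num.min dL dR.
have dl0 : 0 < dl by rewrite /dl lt_min dL0.
have ddL : dl <= dL by rewrite /dl ge_min lexx.
have ddR : dl <= dR by rewrite /dl ge_min lexx orbT.
have dl2 : dl <= 2^-1 by apply: le_trans ddL dL2.
clearbody dl.
have dl1 : dl <= 1 by apply: le_trans dl2 (ltW two).
have [MA MA0 HA] := W_bd e e' dl0 dl1.
have [MB MB0 HB] := W_bd (e - 1) (e' - 1) dl0 dl1.
have [MC MC0 HC] := W_bd d d' dl0 dl1.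
pose Mf := Num.max ML MR.
have Mf0 : 0 <= Mf by rewrite /Mf le_max ML0.
(* The largest speed of rotation towards negative angles on [[dl, 1 - dl]] while [|f| <= Mf]; the
   interval has length at most [1]. *)
pose Kr := MC * Mf `^ (p - 1) + MA.
have Kr0 : 0 < Kr by rewrite /Kr; pos.
(* More half turns than a solution with both end values bounded can perform: less than one near each
   end and [Kr] in between. *)
pose m := (Num.truncn ((2 * pi + Kr) / pi)).+1.
have hm : 2 * pi + Kr < pi *+ m.
  rewrite -[pi *+ m]mulr_natl -ltr_pdivrMr//; exact: truncnS_gt.
have [LamT HT] := many_turns e e' d d' p1 k00 m.
have q1 : 0 < 4^-1 :> R by rewrite invr_gt0.
have q2 : 4^-1 <= 2^-1 :> R by lra.
have [K4 K41 HK4] := En_mid p1 k00 He HL' q1 q2.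
have K40 : 0 < K4 by apply: lt_le_trans ltr01 _.
(* Energy at [1 / 2] that guarantees at least [LamT] on the whole of [[1 / 4, 3 / 4]]. *)
pose LT := K4 * (`|LamT| + 1).
have [aL2 aL20 HaL2] := HL LT; have [aR2 aR20 HaR2] := HR LT.
pose c0 := Num.min (Num.min sL sR) (Num.min dl 4^-1).
exists (Num.max aL2 aR2), c0.
have c00 : 0 < c0 by rewrite /c0 !lt_min sL0 sR0 dl0 q1.
split => //; first by apply: le_trans dl2; rewrite /c0 !ge_min lexx !orbT.
move=> c cp cc0.
have [csL csR cdl c4] : [/\ c <= sL, c <= sR, c <= dl & c <= 4^-1].
  by split; apply: le_trans cc0 _; rewrite /c0 !ge_min lexx ?orbT.
have c2 : c <= 2^-1 by apply: le_trans c4 q2.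
have c12 : 2^-1 <= 1 - c by move: c4; tidy; lra.
have cc : c <= 1 - c by apply: le_trans c2 c12.
have [th [l [Hinit Hem Hth Hcont [lsm lsm1 Hsm]]]] := prufer p1 k00 He He2 (ln aL2) cp c2.
pose f l0 s := expR (l l0 s) * cos (th l0 s).
pose q l0 s := expR (l l0 s) * sin (th l0 s).
have fc l0 : f l0 c = expR l0 by have [h1 h2] := Hinit l0; rewrite /f h1 h2 cos0 mulr1.
have qc l0 : q l0 c = 0 by have [h1 h2] := Hinit l0; rewrite /q h1 sin0 mulr0.
have clt1 : 1 - c < 1 by rewrite ltrBlDr ltrDl.
have barr l0 v a b : l0 <= ln aL2 -> c <= a -> a <= b -> b <= 1 - c -> cos v = 0 ->
    th l0 a <= v -> th l0 b <= v.
  move=> l01 ca ab bc cv; apply: (node_barrier k00 (l := l l0) (lt_le_trans cp ca) ab (le_lt_trans bc clt1) cv).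
  by move=> s /andP[h1 h2]; apply: Hth => //; rewrite (le_trans ca h1) (le_trans h2 bc).
have cos2 : cos (pi / 2 - pi *+ m.+1) = 0 :> R by exact: cos_node.
have claimA l0 : l0 <= ln aL2 -> LT <= En (f l0) (q l0) 2^-1 -> th l0 (1 - c) < - (pi *+ m).
  move=> l01 hE.
  have h34 : 3 / 4 <= 1 - c by move: c4; tidy; lra.
  have t1 : th l0 4^-1 <= pi / 2.
    apply: (barr l0 (pi / 2) c) => //; [by apply: le_trans q2 c12|exact: cos_pihalf|].
    by have [h1 _] := Hinit l0; rewrite h1 divr_ge0// ltW.
  have sub_ s : 4^-1 <= s <= 3 / 4 -> c <= s <= 1 - c.
    by move=> /andP[h1 h2]; rewrite (le_trans c4 h1) (le_trans h2 h34).
  have : th l0 (3 / 4) <= pi / 2 - pi *+ m.+1.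
    apply: (HT _ (l l0)) => //.
    - by move=> s hs; apply: (Hem l0 l01); exact: sub_.
    - by move=> s hs; apply: Hth => //; exact: sub_.
    - move=> s /andP[h1 h2].
      have em a b : 4^-1 <= a -> b <= 3 / 4 -> emden a b (f l0) (q l0).
        by move=> ha hb; apply: (emden_sub _ _ (Hem l0 l01)); [apply: le_trans c4 ha|apply: le_trans hb h34].
      have hh : En (f l0) (q l0) 2^-1 + 1 <= K4 * (En (f l0) (q l0) s + 1).
        have [s2|/ltW s2] := leP s 2^-1.
        - have h3 : 2^-1 <= 1 - 4^-1 :> R by tidy; lra.
          have h4 : 2^-1 <= 3 / 4 :> R by tidy; lra.
          by have [] := HK4 s 2^-1 (f l0) (q l0) h1 s2 h3 (em _ _ h1 h4).
        - have h3 : s <= 1 - 4^-1 by move: h2; tidy; lra.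
          by have [] := HK4 2^-1 s (f l0) (q l0) q2 s2 h3 (em _ _ q2 h2).
      rewrite -[X in X <= _](addrK 1) lerBlDr -(ler_pM2l K40); apply: le_trans hh.
      apply: (@le_trans _ _ (LT + 1)); last by rewrite lerD2r.
      have : K4 * (LamT + 1) <= LT by rewrite /LT ler_pM2l// lerD2r ler_norm.
      by tidy; lra.
  move=> h3.
  (* A node once passed is not crossed back, and this one lies [pi / 2] below [- (pi *+ m)], whence
     the strict inequality. *)
  have h4 : th l0 (1 - c) <= pi / 2 - pi *+ m.+1.
    by apply: (barr l0 _ (3 / 4)) => //; move: c4; tidy; lra.
  apply: le_lt_trans h4 _; rewrite [pi *+ m.+1]mulrS.
  by move: pi0; move: (pi *+ m) => P; tidy; lra.
have el1 : expR (ln aL2) = aL2 by rewrite lnK// posrE.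
have emL l0 : l0 <= ln aL2 -> emden c 2^-1 (f l0) (q l0).
  by move=> l01; apply: (emden_sub _ c12 (Hem l0 l01)).
have emR l0 : l0 <= ln aL2 -> emden_flow e' e d' d k0 p c 2^-1 (fun s => f l0 (1 - s)) (fun s => - q l0 (1 - s)).
  move=> l01; have := emden_reflect (emden_sub c2 (lexx (1 - c)) (Hem l0 l01)).
  by rewrite reflectK// (_ : 1 - 2^-1 = 2^-1 :> R)//; lra.
have thl1 : th (ln aL2) (1 - c) < - (pi *+ m).
  apply: claimA => //; apply: (HaL2 c) => //; first exact: emL.
  by rewrite fc el1 ger0_norm// ltW.
(* An integer number of half turns means that the sine vanishes at [1 - c], which is zero flux
   there. *)
have [ls /andP[ls1 ls2] hls] : exists2 x, lsm <= x <= ln aL2 & th x (1 - c) = - (pi *+ m).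
  apply: ivt => //; first by move=> t _; exact: Hcont.
  rewrite ge_min le_max (ltW thl1) orbT/=.
  have : - (pi *+ m) <= 0 :> R by rewrite oppr_le0 mulrn_wge0// ltW.
  by move=> /le_trans/(_ Hsm) ->.
have half : 1 - 2^-1 = 2^-1 :> R by tidy; lra.
have qe : q ls (1 - c) = 0.
  rewrite /q hls; have := alternatingn (@sinDpi R) m (- (pi *+ m)).
  by rewrite addNr sin0 => /eqP; rewrite eq_sym mulf_eq0 signr_eq0/= => /eqP ->; rewrite mulr0.
have qR : - q ls (1 - c) = 0 by rewrite qe oppr0.
exists (f ls), (q ls); split; first by split => //; exact: Hem.
split.
- by rewrite fc ger0_norm ?expR_ge0// le_max -el1 ler_expR ls2.
(* Seen from the right end, a larger final value would force the energy [LT] at [1 / 2], hence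
   strictly more than [m] half turns. *)
- rewrite le_max; apply/orP; right; rewrite leNgt; apply/negP => h.
  have := HaR2 c _ _ cp csR (emR ls ls2) qR (ltW h).
  rewrite (En_reflect e e' d d' p) half => /(claimA ls ls2).
  by rewrite hls ltxx.
(* Low energy at [1 / 2] bounds both end values by the contrapositive of [large_start_mid], hence
   [f] everywhere; the turns are then counted on three pieces. *)
- rewrite leNgt; apply/negP => h.
  have fL : `|f ls c| <= aL.
    rewrite leNgt; apply/negP => g.
    have := HaL c _ _ cp csL (emL ls ls2) (qc ls) (ltW g).
    by rewrite leNgt h.
  have fR : `|f ls (1 - c)| <= aR.
    rewrite leNgt; apply/negP => g.
    have := HaR c _ _ cp csR (emR ls ls2) qR (ltW g).
    by rewrite (En_reflect e e' d d' p) half leNgt h.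
  have bL := HML c _ _ cp c2 (emL ls ls2) (qc ls) fL.
  have bR := HMR c _ _ cp c2 (emR ls ls2) qR fR.
  have fb s : c <= s <= 1 - c -> `|f ls s| <= Mf.
    move=> /andP[h1 h2]; rewrite /Mf le_max.
    have [s2|/ltW s2] := leP s 2^-1.
    - by have [|g _] := bL s; rewrite ?h1 ?s2 ?g.
    - have h3 : c <= 1 - s <= 2^-1 by apply/andP; split; move: h2 s2; tidy; lra.
      by have [g _] := bR _ h3; rewrite reflectK in g; rewrite g orbT.
  have rng a b s : c <= a -> b <= 1 - c -> a <= s <= b -> c <= s <= 1 - c.
    by move=> ca bc /andP[h1 h2]; rewrite (le_trans ca h1) (le_trans h2 bc).
  have thc s : c <= s <= 1 - c -> {for s, continuous (th ls)}.
    by move=> hs; apply: der_cont (Hth ls s ls2 hs).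
  have cosnz s : f ls s != 0 -> cos (th ls s) != 0.
    by apply: contra => /eqP h'; rewrite /f h' mulr0.
  have dl12 : 2^-1 <= 1 - dl by move: dl2; tidy; lra.
  have cdl1 : 1 - dl <= 1 - c by rewrite lerD2l lerN2.
  have dldl : dl <= 1 - dl by apply: le_trans dl2 dl12.
  have nzL s : c <= s <= dl -> cos (th ls s) != 0.
    move=> /andP[h1 h2]; apply: cosnz.
    have sdL : s <= dL by apply: le_trans h2 ddL.
    have cdL : c <= dL by apply: le_trans sdL.
    apply: (HdL c (f ls) (q ls) cp cdL (emden_sub (lexx c) _ (emL ls ls2)) (qc ls)) => //.
    - by rewrite fc gt_eqF ?expR_gt0.
    - by move=> t /andP[h3 h4]; have [|//] := bL t; rewrite h3 (le_trans h4 dL2).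
    - by rewrite h1.
  have nzR s : 1 - dl <= s <= 1 - c -> cos (th ls s) != 0.
    move=> /andP[h1 h2]; apply: cosnz.
    have cdR : c <= dR by apply: le_trans cdl ddR.
    rewrite -(reflectK s).
    apply: (HdR c (fun s => f ls (1 - s)) (fun s => - q ls (1 - s)) cp cdR (emden_sub (lexx c) _ (emR ls ls2)) qR) => //.
    - rewrite /f hls; apply: mulf_neq0; first by rewrite gt_eqF ?expR_gt0.
      apply/eqP => c0'; move: qe; rewrite /q hls => /eqP; rewrite mulf_eq0 gt_eqF ?expR_gt0//= => /eqP s0'.
      by have := cos2Dsin2 (- (pi *+ m) : R); rewrite c0' s0' expr0n addr0 => /eqP; rewrite eq_sym oner_eq0.
    - by move=> t /andP[h3 h4]; have [|//] := bR t; rewrite h3 (le_trans h4 dR2).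
    - by apply/andP; split; move: h1 h2 ddR; tidy; lra.
  have th0 : th ls c = 0 by have [] := Hinit ls.
  have T1 : th ls c - pi < th ls dl.
    apply: no_turn => // s hs; apply: thc.
    by apply: rng hs; rewrite ?lexx// (le_trans dldl cdl1).
  have T3 : th ls (1 - dl) - pi < th ls (1 - c).
    apply: no_turn => // s hs; apply: thc.
    by apply: rng hs; rewrite ?lexx// (le_trans cdl dldl).
  have T2 : th ls dl - Kr <= th ls (1 - dl).
    have : th ls dl + Kr * dl <= th ls (1 - dl) + Kr * (1 - dl).
      have Hd t : dl <= t <= 1 - dl -> is_derive t 1 (fun s => th ls s + Kr * s) (speed (th ls) (l ls) t + Kr).
        move=> ht; have h' := Hth ls t ls2 (rng _ _ _ cdl cdl1 ht).
        by derby; ring.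
      apply: (le_of_der dldl Hd) => t ht.
      have t01 : 0 < t < 1.
        have /andP[h1 h2] := ht; rewrite (lt_le_trans dl0 h1)/=.
        by apply: le_lt_trans h2 _; rewrite ltrBlDr ltrDl.
      have A0 := W_gt0 e e' t01; have C0 := W_gt0 d d' t01; have B0 := W_gt0 (e - 1) (e' - 1) t01.
      have /andP[Ab _] := HA t ht; have /andP[_ Cb] := HC t ht.
      rewrite /angle_speed /Kr.
      have g1 : sin (th ls t) ^+ 2 / W e e' t <= MA.
        have h1 : (W e e' t)^-1 <= MA by rewrite -[MA]invrK lef_pV2 ?posrE ?invr_gt0.
        apply: le_trans h1; rewrite ler_piMl ?invr_ge0 ?(ltW A0)// sin2_le1.
      have c21 : cos (th ls t) ^+ 2 <= 1 by rewrite -(cos2Dsin2 (th ls t)) lerDl sqr_ge0.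
      have g2 : W d d' t * `|expR (l ls t) * cos (th ls t)| `^ (p - 1) <= MC * Mf `^ (p - 1).
        apply: ler_pM => //; first by apply: ltW.
        apply: ge0_ler_powR; rewrite ?nnegrE ?subr_ge0 ?(ltW p1)//.
        exact: (fb t (rng _ _ _ cdl cdl1 ht)).
      have g0 : 0 <= W d d' t * `|expR (l ls t) * cos (th ls t)| `^ (p - 1) by pos.
      have g3 : 0 <= k0 * W (e - 1) (e' - 1) t * cos (th ls t) ^+ 2 by pos.
      have g4 : W d d' t * `|expR (l ls t) * cos (th ls t)| `^ (p - 1) * cos (th ls t) ^+ 2 <= MC * Mf `^ (p - 1).
        by apply: le_trans g2; rewrite ler_piMr.
      by rewrite mulrBl; move: g1 g4 g3; tidy; lra.
    have h1 : Kr * (1 - dl) <= Kr.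
      by rewrite ler_piMr ?(ltW Kr0)// lerBlDr lerDl ltW.
    have h2 : 0 <= Kr * dl by pos.
    by move: h1 h2; tidy; lra.
  by rewrite th0 hls in T1 T3; move: T1 T2 T3 hm; move: (pi *+ m) => P; tidy; lra.
Qed.

End regularized.

(** * Removing the regularization *)

Section limits.
Context {R : realType}.
Implicit Types (f g h : R -> R).

(** One ultrafilter makes all bounded sequences converge at once, so pointwise limits at every [s]
    exist with no extraction of subsequences. *)
Lemma ultra_seq : exists U : set_system nat, ProperFilter U /\ \oo `<=` U /\
  forall (u : nat -> R) (K : R), (forall n : nat, (`|u n| <= K)%R) -> exists l : R, u @ U --> l.
Proof.
have [U [UF sU]] := @ultraFilterLemma nat \oo _.
exists U; split; first exact: ultra_proper.
split => // u K uK.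
have cK := @segment_compact R (- K) K.
have [|p [_ clp]] := cK (u @ U) _.
  by apply: nearW => n /=; rewrite in_itv/= -ler_norml.
exists p => A pA; have [//|nA] := in_ultra_setVsetC (u @^-1` A) UF.
by have [z [h1 h2]] := clp (~` A) A nA pA.
Qed.

Lemma taylor2 f g h (K a b x y : R) :
  (forall t, a <= t <= b -> is_derive t 1 f (g t) /\ is_derive t 1 g (h t) /\ `|h t| <= K) ->
  a <= x <= b -> a <= y <= b -> `|f y - f x - g x * (y - x)| <= K * (y - x) ^+ 2.
Proof.
move=> H hx hy.
have gl s t : a <= s -> s <= t -> t <= b -> `|g t - g s| <= K * (t - s).
  move=> as_ st tb; rewrite mulrBr.
  have r u : s <= u <= t -> a <= u <= b by move=> /andP[h1 h2]; rewrite (le_trans as_ h1) (le_trans h2 tb).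
  apply: (@dist_of_der _ g (fun t => K * t) h (fun=> K) s t st) => u /r/H[h1 [h2 h3]] //.
  by derby; ring.
have K0 : 0 <= K by have [_ [_ h3]] := H x hx; apply: le_trans h3.
have key s t : a <= s -> s <= t -> t <= b -> forall z, s <= z <= t ->
    `|f t - f s - g z * (t - s)| <= K * (t - s) * (t - s).
  move=> as_ st tb z /andP[sz zt].
  have r u : s <= u <= t -> a <= u <= b by move=> /andP[h1 h2]; rewrite (le_trans as_ h1) (le_trans h2 tb).
  have -> : f t - f s - g z * (t - s) = (f t - g z * t) - (f s - g z * s) by ring.
  rewrite [leRHS]mulrBr.
  apply: (@dist_of_der _ (fun t => f t - g z * t) (fun u => K * (t - s) * u) (fun t => g t - g z) (fun=> K * (t - s)) s t st) => u hu.
  - by have [h1 _] := H u (r u hu); derby; ring.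
  - by derby; ring.
  have /andP[su ut] := hu.
  have [zu|/ltW uz] := leP z u.
  - apply: le_trans (gl z u _ zu (le_trans ut tb)) _; first exact: le_trans as_ sz.
    by apply: ler_wpM2l => //; apply: lerB.
  - rewrite distrC; apply: le_trans (gl u z _ uz (le_trans zt tb)) _; first exact: le_trans as_ su.
    by apply: ler_wpM2l => //; apply: lerB.
have /andP[x1 x2] := hx; have /andP[y1 y2] := hy.
have [xy|/ltW yx] := leP x y.
- by rewrite expr2 mulrA; apply: key => //; rewrite lexx.
- have -> : f y - f x - g x * (y - x) = - (f x - f y - g x * (x - y)) by ring.
  have -> : K * (y - x) ^+ 2 = K * (x - y) * (x - y) by ring.
  by rewrite normrN; apply: key => //; rewrite lexx andbT.
Qed.

(** A common bound on the second derivatives makes the first-order Taylor remainder uniform in [n];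
    that inequality passes to pointwise limits and is the differentiability of [f]. *)
Lemma lim_der (U : set_system nat) (fn gn hn : nat -> R -> R) f g (K a b x : R) : ProperFilter U ->
  a < x < b ->
  (\forall n \near U, forall t, a <= t <= b ->
     is_derive t 1 (fn n) (gn n t) /\ is_derive t 1 (gn n) (hn n t) /\ `|hn n t| <= K) ->
  (forall t, a <= t <= b -> fn n t @[n --> U] --> f t) ->
  gn n x @[n --> U] --> g x -> is_derive x 1 f (g x).
Proof.
move=> UF /andP[ax xb] H fl gl; apply/der_eps => ep ep0.
have K1 : 0 < `|K| + 1 by rewrite ltr_wpDl.
exists (Num.min (ep / (`|K| + 1)) (Num.min (x - a) (b - x))).
  by rewrite !lt_min divr_gt0//= !subr_gt0 ax.
move=> y; rewrite !lt_min => /and3P[y1 y2 y3].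
have hy : a <= y <= b.
  by move: y2 y3; rewrite !ltr_norml => /andP[? ?] /andP[? ?]; apply/andP; split; lra.
have hx : a <= x <= b by rewrite !ltW.
have cv : (`|fn n y - fn n x - gn n x * (y - x)|) @[n --> U] --> `|f y - f x - g x * (y - x)|.
  apply: cvg_norm; apply: cvgB; first by apply: cvgB; apply: fl.
  by apply: cvgMl.
apply: (cvgr_to_le cv); apply: filterS H => n Hn.
apply: le_trans (taylor2 Hn hx hy) _.
rewrite -real_normK ?num_real// expr2 mulrA ler_wpM2r//.
apply: (@le_trans _ _ ((`|K| + 1) * `|y - x|)).
  by rewrite ler_wpM2r// ler_wpDr// ler_norm.
by move: (ltW y1); rewrite ler_pdivlMr// mulrC.
Qed.

(** The domain depends on [n] because the [n]-th solution lives on [[c n, 1 - c n]] only. *)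
Definition ubd (D : nat -> R -> Prop) (u : nat -> R -> R) :=
  exists K : R, forall n t, D n t -> `|u n t| <= K.

Lemma ubdD D u v : ubd D u -> ubd D v -> ubd D (fun n t => u n t + v n t).
Proof.
move=> [K1 H1] [K2 H2]; exists (K1 + K2) => n t h; apply: le_trans (ler_normD _ _) _.
by apply: lerD; [exact: H1|exact: H2].
Qed.

Lemma ubdN D u : ubd D u -> ubd D (fun n t => - u n t).
Proof. by move=> [K1 H1]; exists K1 => n t h; rewrite normrN; exact: H1. Qed.

Lemma ubdM D u v : ubd D u -> ubd D v -> ubd D (fun n t => u n t * v n t).
Proof.
move=> [K1 H1] [K2 H2]; exists (K1 * K2) => n t h; rewrite normrM.
by apply: ler_pM => //; [exact: H1|exact: H2].
Qed.

Lemma ubd_cst D (c : R) : ubd D (fun _ _ => c).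
Proof. by exists `|c|. Qed.

Lemma holder_cont f (x A B tau : R) : 0 < tau -> 0 <= A -> 0 <= B ->
  (forall s, `|s - x| <= 2^-1 -> `|f s - f x| <= A * `|s - x| + B * `|s - x| `^ tau) ->
  {for x, continuous f}.
Proof.
move=> tau0 A0 B0 H; apply/cvgrPdist_le => ep ep0.
have A1 : 0 < 2 * (A + 1) by rewrite mulr_gt0// ltr_wpDl.
have B1 : 0 < 2 * (B + 1) by rewrite mulr_gt0// ltr_wpDl.
pose r := Num.min 2^-1 (Num.min (ep / (2 * (A + 1))) ((ep / (2 * (B + 1))) `^ tau^-1)).
have r0 : 0 < r by rewrite /r !lt_min invr_gt0 ltr0n powR_gt0 ?divr_gt0.
near=> s.
have sr : `|s - x| <= r.
  by near: s; exists r => //= s /=; rewrite distrC => /ltW.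
have [h1 h2 h3] : [/\ `|s - x| <= 2^-1, `|s - x| <= ep / (2 * (A + 1)) &
    `|s - x| <= (ep / (2 * (B + 1))) `^ tau^-1].
  by split; apply: le_trans sr _; rewrite /r !ge_min lexx ?orbT.
rewrite distrC; apply: le_trans (H s h1) _.
have g1 : A * `|s - x| <= ep / 2.
  apply: (@le_trans _ _ ((A + 1) * (ep / (2 * (A + 1))))).
    by apply: ler_pM => //; rewrite lerDl.
  have A10 : 0 < A + 1 by rewrite ltr_wpDl.
  by rewrite le_eqVlt; apply/orP; left; apply/eqP; field; rewrite gt_eqF.
have g2 : B * `|s - x| `^ tau <= ep / 2.
  apply: (@le_trans _ _ ((B + 1) * (ep / (2 * (B + 1))))).
    apply: ler_pM => //; first by rewrite lerDl.
    have : `|s - x| `^ tau <= ((ep / (2 * (B + 1))) `^ tau^-1) `^ tau.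
      by apply: ge0_ler_powR => //; rewrite ?nnegrE ?powR_ge0// ltW.
    by rewrite -powRrM mulVf ?gt_eqF// powRr1// divr_ge0// ltW.
  have B10 : 0 < B + 1 by rewrite ltr_wpDl.
  by rewrite le_eqVlt; apply/orP; left; apply/eqP; field; rewrite gt_eqF.
by move: g1 g2; lra.
Unshelve. all: by end_near. Qed.

End limits.

Section passage.
Context {R : realType}.
Implicit Types (f q : R -> R) (s t : R).
Variables (e e' d d' k0 p : R).
Local Notation emden := (emden_flow e e' d d' k0 p).
Local Notation En := (mech_energy e e' d d' p).
Hypothesis p1 : 1 < p.
Hypothesis k00 : 0 < k0.
Hypothesis He : end_exponents e d p.
Hypothesis He2 : end_exponents e' d' p.

Ltac keep H := first [constr_eq H R | constr_eq H e | constr_eq H e' | constr_eq H d | constr_eq H d' | constr_eq H k0 | constr_eq H p | constr_eq H p1 | constr_eq H k00 | constr_eq H He | constr_eq H He2].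
Ltac tidy := repeat match goal with H : _ |- _ => tryif keep H then fail else clear H end.

Section family.
Variables (U : set_system nat) (fn qn : nat -> R -> R) (c : nat -> R) (f q : R -> R) (F G : R).
Hypothesis UF : ProperFilter U.
Hypothesis c_gt0 : forall n, 0 < c n.
Hypothesis c_cvg : forall a, 0 < a -> \forall n \near U, c n <= a.
Hypothesis em : forall n, emden (c n) (1 - c n) (fn n) (qn n).
Hypothesis fF : forall n t, c n <= t <= 1 - c n -> `|fn n t| <= F.
Hypothesis qG : forall n t, c n <= t <= 1 - c n -> `|qn n t| <= G.
Hypothesis fl : forall t, 0 < t < 1 -> fn n t @[n --> U] --> f t.
Hypothesis ql : forall t, 0 < t < 1 -> qn n t @[n --> U] --> q t.

Let AV s := (W e e' s)^-1.
Let B s := W (e - 1) (e' - 1) s.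
Let C s := W d d' s.
Let q1 n t := k0 * B t * fn n t - C t * nl p (fn n t).
Let dlog (a b s : R) := a / s - b / (1 - s).
(** [f2] and [q2] are the second derivatives of [fn n] and [qn n], written as sums of products of
    bounded factors. *)
Let f2 n t := q1 n t * AV t - qn n t * (AV t * dlog e e' t).
Let q2 n t := k0 * (B t * dlog (e - 1) (e' - 1) t * fn n t + B t * (qn n t * AV t))
  - (C t * dlog d d' t * nl p (fn n t) + C t * (p * `|fn n t| `^ (p - 1) * (qn n t * AV t))).

Let D (a : R) n t := c n <= a /\ a <= t <= 1 - a.

Let DI a n t : D a n t -> c n <= t <= 1 - c n.
Proof.
move=> [h /andP[h1 h2]]; rewrite (le_trans h h1)/=; apply: le_trans h2 _.
by rewrite lerD2l lerN2.
Qed.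

Let D01 a n t : 0 < a -> D a n t -> 0 < t < 1.
Proof.
move=> a0 [_ /andP[h1 h2]]; rewrite (lt_le_trans a0 h1)/=; apply: le_lt_trans h2 _.
by rewrite ltrBlDr ltrDl.
Qed.

Let der_f n t : c n <= t <= 1 - c n -> is_derive t 1 (fn n) (qn n t * AV t).
Proof. by move=> h; have [] := em h. Qed.

Let der_q n t : c n <= t <= 1 - c n -> is_derive t 1 (qn n) (q1 n t).
Proof. by move=> h; have [] := em h. Qed.

Let der_f1 a n t : 0 < a -> D a n t -> is_derive t 1 (fun t => qn n t * AV t) (f2 n t).
Proof.
move=> a0 h; have t01 := D01 a0 h; have hq := der_q (DI h).
have hA := der_W e e' t01; have A0 := W_gt0 e e' t01.
rewrite /AV; derby; first by rewrite gt_eqF.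
rewrite /f2 /AV /dlog; move: A0 t01 => A0 /andP[t0 t1]; have t1' : 0 < 1 - t by rewrite subr_gt0.
move: (q1 n t) (qn n t) (W e e' t) A0 => x y A A0; field.
by rewrite !gt_eqF.
Qed.

Let der_q1 a n t : 0 < a -> D a n t -> is_derive t 1 (q1 n) (q2 n t).
Proof.
move=> a0 h; have t01 := D01 a0 h; have hf := der_f (DI h).
have hB := der_W (e - 1) (e' - 1) t01; have hC := der_W d d' t01.
have hn := derComp (der_nl p1 (fn n t)) hf.
rewrite /q1 /B /C; derby.
by rewrite /q2 /B /C /dlog; ring.
Qed.

Let ubd_W a x y : 0 < a -> a <= 2^-1 -> ubd (D a) (fun _ t => W x y t).
Proof.
move=> a0 a2; have a1 : a <= 1 by move: a2; lra.
have [M M0 HM] := W_bd x y a0 a1; exists M => n t h.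
have t01 := D01 a0 h; case: h => _ /HM/andP[_ h].
by rewrite ger0_norm// ltW// W_gt0.
Qed.

Let ubd_AV a : 0 < a -> a <= 2^-1 -> ubd (D a) (fun _ t => AV t).
Proof.
move=> a0 a2; have a1 : a <= 1 by move: a2; lra.
have [M M0 HM] := W_bd e e' a0 a1; exists M => n t h.
have t01 := D01 a0 h; case: h => _ /HM/andP[h _].
have A0 := W_gt0 e e' t01.
by rewrite ger0_norm ?invr_ge0 ?(ltW A0)// /AV -[M]invrK lef_pV2 ?posrE ?invr_gt0.
Qed.

Let ubd_dlog a x y : 0 < a -> a <= 2^-1 -> ubd (D a) (fun _ t => dlog x y t).
Proof.
move=> a0 a2; apply: ubdD; last apply: ubdN; apply: ubdM; try exact: ubd_cst; exists a^-1 => n t h;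
  have /andP[t0 t1] := D01 a0 h; case: h => _ /andP[h1 h2].
- by rewrite ger0_norm ?invr_ge0 ?(ltW t0)// lef_pV2 ?posrE.
- have t1' : 0 < 1 - t by rewrite subr_gt0.
  rewrite ger0_norm ?invr_ge0 ?(ltW t1')// lef_pV2 ?posrE//.
  by move: h2; lra.
Qed.

Let ubd_fn a : ubd (D a) fn.
Proof. by exists F => n t h; apply: fF; exact: DI h. Qed.

Let ubd_qn a : ubd (D a) qn.
Proof. by exists G => n t h; apply: qG; exact: DI h. Qed.

Let ubd_pow a r : 0 <= r -> ubd (D a) (fun n t => `|fn n t| `^ r).
Proof.
move=> r0; exists (F `^ r) => n t h; have hF := fF (DI h).
rewrite ger0_norm ?powR_ge0//; apply: ge0_ler_powR => //; rewrite nnegrE//.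
exact: le_trans hF.
Qed.

Let ubd_nl a : ubd (D a) (fun n t => nl p (fn n t)).
Proof.
have [|K HK] := @ubd_pow a p; first by move: p1; lra.
by exists K => n t h; rewrite norm_nl//; have := HK n t h; rewrite ger0_norm ?powR_ge0.
Qed.

Let ubd_f2 a : 0 < a -> a <= 2^-1 -> ubd (D a) f2.
Proof.
move=> a0 a2; have hA := ubd_AV a0 a2; have hD := ubd_dlog e e' a0 a2.
have hB := ubd_W (e - 1) (e' - 1) a0 a2; have hC := ubd_W d d' a0 a2.
have hf := @ubd_fn a; have hq := @ubd_qn a; have hn := @ubd_nl a.
apply: ubdD; last apply: ubdN.
- apply: ubdM => //; apply: ubdD; first by apply: ubdM => //; apply: ubdM => //; exact: ubd_cst.
  by apply: ubdN; exact: ubdM.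
- by apply: ubdM => //; exact: ubdM.
Qed.

Let ubd_q2 a : 0 < a -> a <= 2^-1 -> ubd (D a) q2.
Proof.
move=> a0 a2; have hA := ubd_AV a0 a2.
have hDB := ubd_dlog (e - 1) (e' - 1) a0 a2; have hDC := ubd_dlog d d' a0 a2.
have hB := ubd_W (e - 1) (e' - 1) a0 a2; have hC := ubd_W d d' a0 a2.
have hf := @ubd_fn a; have hq := @ubd_qn a; have hn := @ubd_nl a.
have hp : ubd (D a) (fun n t => `|fn n t| `^ (p - 1)) by apply: ubd_pow; rewrite subr_ge0 ltW.
have hqA := ubdM hq hA.
apply: ubdD.
  apply: ubdM; first exact: ubd_cst.
  by apply: ubdD; apply: ubdM => //; exact: ubdM.
apply: ubdN; apply: ubdD; first by apply: ubdM => //; exact: ubdM.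
by apply: ubdM => //; apply: ubdM => //; apply: ubdM => //; exact: ubd_cst.
Qed.

(** Each equation is one application of [lim_der] on an interval [[a, 1 - a]] with room around the
    point, which eventually lies inside [[c n, 1 - c n]]. *)
Lemma emden_limit (lo hi : R) : 0 < lo -> hi < 1 -> emden lo hi f q.
Proof.
move=> lo0 hi1 x /andP[x1 x2].
pose a := Num.min (lo / 2) (Num.min ((1 - hi) / 2) 4^-1).
have a0 : 0 < a by rewrite /a !lt_min !divr_gt0 ?subr_gt0//= invr_gt0.
have [al ah a4] : [/\ a <= lo / 2, a <= (1 - hi) / 2 & a <= 4^-1].
  by split; rewrite /a !ge_min lexx ?orbT.
have a2 : a <= 2^-1 by move: a4; lra.
have xa : a < x < 1 - a by apply/andP; split; move: al ah a0 x1 x2 lo0 hi1; lra.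
have t01 t : a <= t <= 1 - a -> 0 < t < 1.
  move=> /andP[h1 h2]; rewrite (lt_le_trans a0 h1)/=; apply: le_lt_trans h2 _.
  by rewrite ltrBlDr ltrDl.
have xx : a <= x <= 1 - a by have /andP[/ltW-> /ltW->] := xa.
have x01 := t01 x xx.
have [K1 HK1] := ubd_f2 a0 a2; have [K2 HK2] := ubd_q2 a0 a2.
have ca := c_cvg a0.
split.
- apply: (@lim_der _ U fn (fun n t => qn n t * AV t) f2 f (fun t => q t * AV t) K1 a (1 - a)) => //.
  + apply: filterS ca => n h t ht; have hD : D a n t by [].
    by split; [exact: der_f (DI hD)|split; [exact: der_f1 hD|exact: HK1]].
  + by move=> t /t01; exact: fl.
  + by apply: cvgMl; exact: ql.
- apply: (@lim_der _ U qn q1 q2 q (fun t => k0 * B t * f t - C t * nl p (f t)) K2 a (1 - a)) => //.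
  + apply: filterS ca => n h t ht; have hD : D a n t by [].
    by split; [exact: der_q (DI hD)|split; [exact: der_q1 hD|exact: HK2]].
  + by move=> t /t01; exact: ql.
  + apply: cvgB; first by apply: cvgMr; exact: fl.
    apply: cvgMr; apply: continuous_cvg; last exact: fl.
    exact: der_cont (der_nl p1 (f x)).
Qed.

Lemma En_limit s : 0 < s < 1 -> En (fn n) (qn n) s @[n --> U] --> En f q s.
Proof.
move=> s01; rewrite /En; apply: cvgD.
  by apply: cvgMl; rewrite expr2; under eq_fun do rewrite expr2; apply: cvgM; exact: ql.
apply: continuous_cvg; last exact: fl.
exact: der_cont (der_Fp p1 (f s)).
Qed.

End family.

End passage.

Section passage.
Context {R : realType}.
Implicit Types (f q : R -> R) (s t : R).
Variables (e e' d d' k0 p : R).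
Local Notation emden := (emden_flow e e' d d' k0 p).
Local Notation En := (mech_energy e e' d d' p).
Hypothesis p1 : 1 < p.
Hypothesis k00 : 0 < k0.
Hypothesis He : end_exponents e d p.
Hypothesis He2 : end_exponents e' d' p.

Ltac keep H := first [constr_eq H R | constr_eq H e | constr_eq H e' | constr_eq H d | constr_eq H d' | constr_eq H k0 | constr_eq H p | constr_eq H p1 | constr_eq H k00 | constr_eq H He | constr_eq H He2].
Ltac tidy := repeat match goal with H : _ |- _ => tryif keep H then fail else clear H end.

(** The zero-flux conditions disappear with [c]; what survives is the layer estimate, whose
    constants are uniform. It gives the decay of [q] at both ends and, through Hoelder bounds,
    continuity of [f] up to the ends. *)
Lemma emden_solutions (Lam : R) : exists (f q : R -> R) (M : R),
  [/\ 0 < M,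
      forall lo hi : R, 0 < lo -> hi < 1 -> emden lo hi f q,
      continuous f /\ forall s, `|f s| <= M,
      (forall s, 0 < s <= 2^-1 -> `|q s| <= M * (s `^ e + s `^ (d + 1))) /\
      (forall s, 0 < s <= 2^-1 -> `|q (1 - s)| <= M * (s `^ e' + s `^ (d' + 1))) &
      forall s, 4^-1 <= s <= 3 / 4 -> Lam <= En f q s].
Proof.
have HL' : 0 <= e' + d' by case: He2 => _ [].
have HR' : 0 <= e + d by case: He => _ [].
have q1 : 0 < 4^-1 :> R by rewrite invr_gt0.
have q2 : 4^-1 <= 2^-1 :> R by tidy; lra.
have q3 : 3 / 4 < 1 :> R by tidy; lra.
have half : 1 - 2^-1 = 2^-1 :> R by tidy; lra.
have h01 : 0 < (2^-1 : R) < 1 by apply/andP; split; tidy; lra.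
have [K4 K41 HK4] := En_mid p1 k00 He HL' q1 q2.
have K40 : 0 < K4 by apply: lt_le_trans ltr01 _.
(* Energy demanded at [1 / 2] so that at least [Lam] remains on [[1 / 4, 3 / 4]] after the factor
   [K4]. *)
have [M0 [c0 [c00 c02 Hreg]]] := regularized p1 k00 He He2 (K4 * (`|Lam| + 1)).
pose c (n : nat) : R := c0 / n.+1%:R.
have cp n : 0 < c n by rewrite /c divr_gt0.
have cc0 n : c n <= c0 by rewrite /c ler_pdivrMr// ler_peMr ?(ltW c00)// ler1n.
have c2 n : c n <= 2^-1 by apply: le_trans (cc0 n) c02.
have [fq Hfq] := choice (fun n => let: ex_intro f (ex_intro q H) := Hreg (c n) (cp n) (cc0 n) in ex_intro (fun fq : (R -> R) * (R -> R) =>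
   [/\ emden (c n) (1 - c n) fq.1 fq.2, fq.2 (c n) = 0 & fq.2 (1 - c n) = 0] /\
   [/\ `|fq.1 (c n)| <= M0, `|fq.1 (1 - c n)| <= M0 & K4 * (`|Lam| + 1) <= En fq.1 fq.2 2^-1]) (f, q) H).
pose fn n := (fq n).1; pose qn n := (fq n).2.
have em n : emden (c n) (1 - c n) (fn n) (qn n) by have [[]] := Hfq n.
have c12 n : 2^-1 <= 1 - c n by move: (c2 n); move: (c n) => x; tidy; lra.
have cc n : c n <= 1 - c n by apply: le_trans (c2 n) (c12 n).
have emL n : emden (c n) 2^-1 (fn n) (qn n) by apply: (emden_sub _ (c12 n) (em n)).
have emR n : emden_flow e' e d' d k0 p (c n) 2^-1 (fun s => fn n (1 - s)) (fun s => - qn n (1 - s)).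
  by have := emden_reflect (emden_sub (c2 n) (lexx (1 - c n)) (em n)); rewrite reflectK half.
have qL n : qn n (c n) = 0 by have [[]] := Hfq n.
have qR n : - qn n (1 - c n) = 0 by have [[_ _ h] _] := Hfq n; rewrite /qn h oppr0.
have [ML ML0 HML] := start_bound p1 k00 He HL' M0.
have [MR MR0 HMR] := start_bound p1 k00 He2 HR' M0.
have bL n s : c n <= s <= 2^-1 -> `|fn n s| <= ML.
  by move=> h; have [_ [h1 _ _]] := Hfq n; have [] := HML _ _ _ (cp n) (c2 n) (emL n) (qL n) h1 s h.
have bR n s : c n <= s <= 2^-1 -> `|fn n (1 - s)| <= MR.
  by move=> h; have [_ [_ h1 _]] := Hfq n; have [] := HMR _ _ _ (cp n) (c2 n) (emR n) (qR n) h1 s h.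
pose F := Num.max ML MR.
have F0 : 0 <= F by rewrite /F le_max ML0.
have MLF : ML <= F by rewrite /F le_max lexx.
have MRF : MR <= F by rewrite /F le_max lexx orbT.
clearbody F.
have split_ n s : c n <= s <= 1 - c n -> c n <= s <= 2^-1 \/ c n <= 1 - s <= 2^-1.
  move=> /andP[h1 h2]; have [s2|/ltW s2] := leP s 2^-1; [by left; rewrite h1|right].
  by apply/andP; split; move: h2 s2; move: (c n) => x; tidy; lra.
have fF n s : c n <= s <= 1 - c n -> `|fn n s| <= F.
  move=> /split_[h|h]; first by apply: le_trans (bL n s h) _.
  by rewrite -(reflectK s); apply: le_trans (bR n _ h) _.
pose N := F `^ p; have N0 : 0 <= N by exact: powR_ge0.
have p0 : 0 <= p by move: p1; tidy; lra.
have nN x : `|x| <= F -> `|nl p x| <= N.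
  by move=> h; rewrite norm_nl//; apply: ge0_ler_powR.
have [K1 K10 HK1] := layer e' d' k00 He.
have [K2 K20 HK2] := layer e d k00 He2.
have lL n s : c n <= s <= 2^-1 -> `|qn n s| <= K1 * (F * s `^ e + N * s `^ (d + 1)) /\
    `|fn n s - fn n (c n)| <= K1 * (F * s + N * s `^ (d + 2 - e)).
  apply: (HK1 (c n) 2^-1 _ _ F N (cp n) (lexx _) (emL n) (qL n)) => t ht.
  have h : `|fn n t| <= F by apply: le_trans (bL n t ht) _.
  by split => //; exact: nN.
have lR n s : c n <= s <= 2^-1 -> `|- qn n (1 - s)| <= K2 * (F * s `^ e' + N * s `^ (d' + 1)) /\
    `|fn n (1 - s) - fn n (1 - c n)| <= K2 * (F * s + N * s `^ (d' + 2 - e')).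
  apply: (HK2 (c n) 2^-1 (fun s => fn n (1 - s)) (fun s => - qn n (1 - s)) F N (cp n) (lexx _) (emR n) (qR n)) => t ht.
  have h : `|fn n (1 - t)| <= F by apply: le_trans (bR n t ht) _.
  by split => //; exact: nN.
have [[e0 d0 ed2 _] _] := He; have [[e'0 d'0 ed2' _] _] := He2.
have pw1 (s r : R) : 0 < s -> s <= 2^-1 -> 0 <= r -> s `^ r <= 1.
  move=> s0 s2 r0; apply: (@le_trans _ _ (1 `^ r)); last (by rewrite powR1); apply: ge0_ler_powR => //; rewrite ?nnegrE ?(ltW s0)//.
  by move: s2; tidy; lra.
have [dd dd'] : 0 <= d + 1 /\ 0 <= d' + 1 by move: d0 d'0; tidy; lra.
pose G := K1 * (F + N) + K2 * (F + N).
have G0 : 0 <= G by rewrite /G; pos.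
have qG n s : c n <= s <= 1 - c n -> `|qn n s| <= G.
  move=> /split_[h|h].
  - have [h1 _] := lL n s h; apply: le_trans h1 _; have /andP[h2 h3] := h.
    have s0 : 0 < s by apply: lt_le_trans h2.
    apply: (@le_trans _ _ (K1 * (F + N))); last by rewrite /G lerDl; pos.
    apply: ler_wpM2l; first exact: ltW.
    by apply: lerD; rewrite ler_piMr// pw1// ltW.
  - have [h1 _] := lR n _ h; rewrite normrN reflectK in h1; apply: le_trans h1 _; have /andP[h2 h3] := h.
    have s0 : 0 < 1 - s by apply: lt_le_trans h2.
    apply: (@le_trans _ _ (K2 * (F + N))); last by rewrite /G lerDr; pos.
    apply: ler_wpM2l; first exact: ltW.
    by apply: lerD; rewrite ler_piMr// pw1// ltW.
have [U [UF [sU HU]]] := @ultra_seq R.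
(* Clamping keeps the sequence bounded at every real [s] and extends the limit by its end values,
   the limits of [fn n (c n)] and [fn n (1 - c n)]. *)
have [f Hf] := choice (fun s => HU (fun n => fn n (clamp (c n) s)) F (fun n => fF n _ (clampP s (c2 n)))).
have [q Hq] := choice (fun s => HU (fun n => qn n (clamp (c n) s)) G (fun n => qG n _ (clampP s (c2 n)))).
have c_cvg (a : R) : 0 < a -> \forall n \near U, c n <= a.
  move=> a0; apply: sU; near=> n.
  rewrite /c ler_pdivrMr// mulrC -ler_pdivrMr//.
  apply: le_trans (_ : n%:R <= _); last by rewrite ler_nat.
  near: n; exact: nbhs_infty_ger.
have cl_near s : 0 < s < 1 -> \forall n \near U, c n <= s <= 1 - c n.
  move=> /andP[s0 s1]; have h1 := c_cvg s s0; have h2 : \forall n \near U, c n <= 1 - s by apply: c_cvg; rewrite subr_gt0.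
  by apply: filterS2 h1 h2 => n -> h /=; rewrite lerBrDr addrC -lerBrDr.
have fl s : 0 < s < 1 -> fn n s @[n --> U] --> f s.
  move=> s01; apply: cvg_trans (Hf s); apply: near_eq_cvg.
  by apply: filterS (cl_near s s01) => n /clamp_id ->.
have ql s : 0 < s < 1 -> qn n s @[n --> U] --> q s.
  move=> s01; apply: cvg_trans (Hq s); apply: near_eq_cvg.
  by apply: filterS (cl_near s s01) => n /clamp_id ->.
have emf lo hi : 0 < lo -> hi < 1 -> emden lo hi f q.
  by move=> h1 h2; apply: (emden_limit p1 UF c_cvg em fF qG fl ql).
have s_half s : 0 < s <= 2^-1 -> 0 < s < 1.
  by move=> /andP[-> h] /=; apply: le_lt_trans h _; case/andP: h01.
have leftn s : 0 < s <= 2^-1 -> \forall n \near U, c n <= s <= 2^-1.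
  move=> h; apply: filterS (cl_near s (s_half s h)) => n /andP[-> _].
  by case/andP: h.
have qlim s : 0 < s <= 2^-1 -> `|q s| <= K1 * (F * s `^ e + N * s `^ (d + 1)).
  move=> h; apply: (cvgr_to_le (cvg_norm (ql s (s_half s h)))).
  by apply: filterS (leftn s h) => n /lL[].
have r_half s : 0 < s <= 2^-1 -> 0 < 1 - s < 1.
  by move=> /s_half/andP[s0 s1]; rewrite subr_gt0 s1 ltrBlDr ltrDl.
have qlim' s : 0 < s <= 2^-1 -> `|q (1 - s)| <= K2 * (F * s `^ e' + N * s `^ (d' + 1)).
  move=> h; apply: (cvgr_to_le (cvg_norm (ql _ (r_half s h)))).
  by apply: filterS (leftn s h) => n /lR[]; rewrite normrN.
have cl_lo n (s : R) : s <= 0 -> clamp (c n) s = c n.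
  move=> h; rewrite /clamp (min_idPl _) ?(max_idPl _)//; first by apply: le_trans h (ltW _).
  by apply: le_trans h _; apply: le_trans (cc n); exact: ltW.
have cl_hi n (s : R) : 1 <= s -> clamp (c n) s = 1 - c n.
  move=> h; have h' : 1 - c n <= s by apply: le_trans h; rewrite lerBlDr lerDl ltW.
  by rewrite /clamp (min_idPr h') (max_idPr _).
have f_lo s : s <= 0 -> f s = f 0.
  move=> h; have := Hf s; have := Hf 0; under eq_fun do rewrite cl_lo//.
  move=> h1; under eq_fun do rewrite cl_lo//.
  by move=> h2; apply: (cvg_unique _ h2 h1).
have f_hi s : 1 <= s -> f s = f 1.
  move=> h; have := Hf s; have := Hf 1; under eq_fun do rewrite cl_hi//.
  move=> h1; under eq_fun do rewrite cl_hi//.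
  by move=> h2; apply: (cvg_unique _ h2 h1).
have f0l : fn n (c n) @[n --> U] --> f 0 by have := Hf 0; under eq_fun do rewrite cl_lo//.
have f1l : fn n (1 - c n) @[n --> U] --> f 1 by have := Hf 1; under eq_fun do rewrite cl_hi//.
have hold0 s : 0 < s <= 2^-1 -> `|f s - f 0| <= K1 * (F * s + N * s `^ (d + 2 - e)).
  move=> h; have h' := s_half s h.
  have cv : (fn n s - fn n (c n)) @[n --> U] --> f s - f 0 by apply: cvgB => //; exact: fl.
  apply: (cvgr_to_le (cvg_norm cv)).
  by apply: filterS (leftn s h) => n /lL[].
have hold1 s : 0 < s <= 2^-1 -> `|f (1 - s) - f 1| <= K2 * (F * s + N * s `^ (d' + 2 - e')).
  move=> h; have h' := r_half s h.
  have cv : (fn n (1 - s) - fn n (1 - c n)) @[n --> U] --> f (1 - s) - f 1 by apply: cvgB => //; exact: fl.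
  apply: (cvgr_to_le (cvg_norm cv)).
  by apply: filterS (leftn s h) => n /lR[].
have fM s : `|f s| <= F.
  apply: (cvgr_to_le (cvg_norm (Hf s))).
  by apply: nearW => n; apply: fF; exact: clampP.
have cont0 : {for 0, continuous f}.
  apply: (@holder_cont _ f 0 (K1 * F) (K1 * N) _ ed2); [by pos|by pos|] => s; rewrite subr0 => hs.
  have [s0|s0] := leP s 0; first by rewrite f_lo// subrr normr0; pos.
  have hs' := hs; rewrite (ger0_norm (ltW s0)) in hs' *.
  by have := hold0 s; rewrite s0 hs' => /(_ isT) /le_trans; apply; rewrite mulrDr !mulrA.
have cont1 : {for 1, continuous f}.
  apply: (@holder_cont _ f 1 (K2 * F) (K2 * N) _ ed2'); [by pos|by pos|] => s hs.
  have [s1|s1] := leP 1 s; first by rewrite f_hi// subrr normr0; pos.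
  have s1' : 0 < 1 - s by rewrite subr_gt0.
  have hs' := hs; rewrite distrC (ger0_norm (ltW s1')) in hs' *.
  by have := hold1 (1 - s); rewrite s1' hs' reflectK => /(_ isT) /le_trans; apply; rewrite mulrDr !mulrA.
have cf : continuous f.
  move=> s; have [s0|s0|->] := ltgtP s 0; last exact: cont0.
  - rewrite /continuous_at (f_lo s (ltW s0)); apply: cvg_near_cst; near=> t.
    by apply: f_lo; apply: ltW; near: t; exact: lt_nbhsl.
  have [s1|s1|->] := ltgtP s 1; last exact: cont1.
  - have [] := emf s s s0 s1 s; first by rewrite lexx.
    by move=> h _; exact: der_cont h.
  - rewrite /continuous_at (f_hi s (ltW s1)); apply: cvg_near_cst; near=> t.
    by apply: f_hi; apply: ltW; near: t; exact: lt_nbhsr.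
have [a1 a2 a3 a4] : [/\ 0 <= K1 * F, 0 <= K1 * N, 0 <= K2 * F & 0 <= K2 * N] by split; pos.
pose M := 1 + F + (K1 * F + K1 * N + K2 * F + K2 * N).
have [b0 b1 b2 b3 b4] : [/\ F <= M, K1 * F <= M, K1 * N <= M, K2 * F <= M & K2 * N <= M].
  rewrite /M; move: (K1 * F) (K1 * N) (K2 * F) (K2 * N) a1 a2 a3 a4 F0 => x1 x2 x3 x4; tidy.
  by move=> *; split; lra.
exists f, q, M; split.
- by rewrite /M; pos.
- exact: emf.
- by split => // s; apply: le_trans (fM s) _.
- split => s hs.
  + apply: le_trans (qlim s hs) _; rewrite !mulrDr !mulrA.
    by apply: lerD; apply: ler_wpM2r => //; exact: powR_ge0.
  + apply: le_trans (qlim' s hs) _; rewrite !mulrDr !mulrA.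
    by apply: lerD; apply: ler_wpM2r => //; exact: powR_ge0.
- move=> s /andP[h1 h2].
  have hE : K4 * (`|Lam| + 1) <= En f q 2^-1.
    apply: (cvgr_to_ge (En_limit p1 UF fl ql h01)).
    by apply: nearW => n; have [_ []] := Hfq n.
  have hh : En f q 2^-1 + 1 <= K4 * (En f q s + 1).
    have [s2|/ltW s2] := leP s 2^-1.
    - have h3 : 2^-1 <= 1 - 4^-1 :> R by tidy; lra.
      have s0 : 0 < s by apply: lt_le_trans h1.
      by have [] := HK4 s 2^-1 f q h1 s2 h3 (emf _ _ s0 _); first by case/andP: h01.
    - have h3 : s <= 1 - 4^-1 by move: h2; tidy; lra.
      have h00 : 0 < 2^-1 :> R by case/andP: h01.
      by have [] := HK4 2^-1 s f q q2 s2 h3 (emf _ _ h00 (le_lt_trans h2 q3)).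
  rewrite -[X in X <= _](addrK 1) lerBlDr -(ler_pM2l K40); apply: le_trans hh.
  apply: (@le_trans _ _ (K4 * (`|Lam| + 1) + 1)); last by rewrite lerD2r.
  have : K4 * (Lam + 1) <= K4 * (`|Lam| + 1) by rewrite ler_pM2l// lerD2r ler_norm.
  by tidy; lra.
Unshelve. all: by end_near. Qed.

End passage.

(** * Profiles *)

Section profile.
Context {R : realType}.
Implicit Types (f q : R -> R) (s t : R).
Variables (e e' d d' k0 p : R).
Local Notation emden := (emden_flow e e' d d' k0 p).
Local Notation En := (mech_energy e e' d d' p).
Hypothesis p1 : 1 < p.
Hypothesis k00 : 0 < k0.
Hypothesis He : end_exponents e d p.
Hypothesis He2 : end_exponents e' d' p.
Hypothesis de : d + 1 = e.

Ltac keep H := first [constr_eq H R | constr_eq H e | constr_eq H e' | constr_eq H d | constr_eq H d' | constr_eq H k0 | constr_eq H p | constr_eq H p1 | constr_eq H k00 | constr_eq H He | constr_eq H He2 | constr_eq H de].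
Ltac tidy := repeat match goal with H : _ |- _ => tryif keep H then fail else clear H end.

Lemma pow_small (a ep : R) : 0 < a -> 0 < ep -> exists2 r : R, 0 < r &
  forall x : R, 0 <= x -> x <= r -> x `^ a <= ep.
Proof.
move=> a0 ep0; exists (ep `^ a^-1); first exact: powR_gt0.
move=> x x0 h; have : x `^ a <= (ep `^ a^-1) `^ a.
  by apply: ge0_ler_powR => //; rewrite ?nnegrE ?powR_ge0// ltW.
by rewrite -powRrM mulVf ?gt_eqF// powRr1// ltW.
Qed.

Let flux f q s := q s + k0 / e' * (W e e' s * f s).

(* The leading terms of q' and of (A f)' cancel at s = 1. *)
Lemma der_flux f q s : emden s s f q -> 0 < s < 1 ->
  is_derive s 1 (flux f q) (W e e' s * f s * ((k0 + k0 / e' * e) / s) - W d d' s * nl p (f s) + k0 / e' * q s).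
Proof.
have [[e'0 _ _ _] _] := He2.
move=> S s01; have [|hf hq] := S s; first by rewrite lexx.
have hA := der_W e e' s01; have A0 := W_gt0 e e' s01.
rewrite /flux; derby; rewrite W1//.
move: s01 => /andP[s0 s1]; have s1' : 0 < 1 - s by rewrite subr_gt0.
move: (W e e' s) A0 (f s) (q s) (nl p (f s)) (W d d' s) => A A0 x y z C.
by field; rewrite !gt_eqF.
Qed.

(** In [x = 1 - s] the derivative of [flux] is of order [x ^ e' + x ^ d'] and [flux] tends to [0];
    integrating from [0] gains one power. Divided by [A] this says that [f'] is close to
    [- k0 / e' * f] at [s = 1], as for the regular branch of the equation. *)
Lemma flux_bound f q (M : R) : 0 <= M ->
  (forall lo hi : R, 0 < lo -> hi < 1 -> emden lo hi f q) -> (forall s, `|f s| <= M) ->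
  (forall s, 0 < s <= 2^-1 -> `|q (1 - s)| <= M * (s `^ e' + s `^ (d' + 1))) ->
  exists2 K : R, 0 <= K & forall x : R, 0 < x <= 2^-1 ->
    `|flux f q (1 - x)| <= K * (x `^ (e' + 1) + x `^ (d' + 1)).
Proof.
move=> M0 em fM qM.
have [[e'0 d'0 _ _] _] := He2; have [[e0 _ _ _] _] := He.
have [MA MA1 HA] := W_left e' e; have [MC MC1 HC] := W_left d' d.
have [MA0 MC0] : 0 < MA /\ 0 < MC by split; apply: lt_le_trans ltr01 _.
have p0 : 0 <= p by move: p1; tidy; lra.
pose kap := k0 / e'; have kap0 : 0 <= kap by rewrite /kap; pos.
pose K1 := MA * M * (2 * (k0 + kap * e)) + kap * M.
pose K2 := MC * M `^ p + kap * M.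
have K10 : 0 <= K1 by rewrite /K1; pos.
have K20 : 0 <= K2 by rewrite /K2; pos.
pose G (x : R) := K1 / (e' + 1) * x `^ (e' + 1) + K2 / (d' + 1) * x `^ (d' + 1).
have e'1 : 0 < e' + 1 by move: e'0; tidy; lra.
have d'1 : 0 < d' + 1 by move: d'0; tidy; lra.
have half (x : R) : 0 < x <= 2^-1 -> 0 < x < 1.
  by move=> /andP[-> h]; apply: le_lt_trans h _; tidy; lra.
have norm_f2 (x : R) : `|nl p (f x)| <= M `^ p.
  by rewrite norm_nl//; apply: ge0_ler_powR; rewrite ?nnegrE.
have dF (x : R) : 0 < x <= 2^-1 -> exists2 D, is_derive x 1 (fun x => flux f q (1 - x)) D &
    `|D| <= K1 * x `^ e' + K2 * x `^ d'.
  move=> hx; have /andP[x0 x1] := half x hx; have /andP[_ x2] := hx.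
  have s01 : 0 < 1 - x < 1 by rewrite subr_gt0 x1 ltrBlDr ltrDl.
  have /andP[s0 s1] := s01.
  have hd := reflect_der (der_flux (em _ _ s0 s1) s01).
  eexists; first exact: hd.
  rewrite normrN !W_refl.
  have /andP[_ hA] := HA x hx; have /andP[_ hC] := HC x hx.
  have A0 := W_gt0 e' e (half x hx); have C0 := W_gt0 d' d (half x hx).
  have pe : 0 < x `^ e' by exact: powR_gt0.
  have pd : 0 < x `^ d' by exact: powR_gt0.
  have pd1 : x `^ (d' + 1) <= x `^ d'.
    by rewrite powRDpos// powRr1 ?(ltW x0)// ler_piMr ?(ltW pd)// ltW.
  have h1 : `|W e' e x * f (1 - x) * ((k0 + k0 / e' * e) / (1 - x))| <= MA * M * (2 * (k0 + kap * e)) * x `^ e'.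
    rewrite 2!normrM (ger0_norm (ltW A0)).
    have -> : MA * M * (2 * (k0 + kap * e)) * x `^ e' = (MA * x `^ e') * M * (2 * (k0 + kap * e)) by ring.
    apply: ler_pM => //; first by pos.
      by apply: ler_pM => //; exact: ltW.
    have nn : 0 <= k0 + kap * e by pos.
    rewrite ger0_norm; last by apply: divr_ge0 => //; exact: ltW.
    rewrite mulrC ler_wpM2r//.
    by rewrite -[2]invrK lef_pV2 ?posrE ?invr_gt0//; move: x2; tidy; lra.
  have h2 : `|W d' d x * nl p (f (1 - x))| <= MC * M `^ p * x `^ d'.
    rewrite normrM (ger0_norm (ltW C0)) [leRHS]mulrAC.
    by apply: ler_pM => //; exact: ltW.
  have h3 : `|kap * q (1 - x)| <= kap * M * x `^ e' + kap * M * x `^ d'.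
    rewrite normrM (ger0_norm kap0) -mulrDr -mulrA ler_wpM2l//.
    apply: le_trans (qM x hx) _; apply: ler_wpM2l => //.
    by rewrite lerD2l.
  apply: le_trans (ler_normD _ _) _.
  have := ler_normB (W e' e x * f (1 - x) * ((k0 + k0 / e' * e) / (1 - x))) (W d' d x * nl p (f (1 - x))).
  have -> : K1 * x `^ e' + K2 * x `^ d' = MA * M * (2 * (k0 + kap * e)) * x `^ e' + MC * M `^ p * x `^ d' +
    (kap * M * x `^ e' + kap * M * x `^ d') by rewrite /K1 /K2; ring.
  move: h1 h2 h3; rewrite -/kap.
  by tidy; move: (MA * M * _ * _) (MC * _ * _) (kap * M * _ + _) => *; lra.
have dG (x : R) : 0 < x -> is_derive x 1 G (K1 * x `^ e' + K2 * x `^ d').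
  move=> x0; rewrite /G; derby => //; rewrite !addrK !mul0r !add0r !mulr1.
  by field; rewrite !gt_eqF.
have small (x y : R) : 0 < x -> x <= y -> y <= 2^-1 -> `|flux f q (1 - y)| <= `|flux f q (1 - x)| + G y.
  move=> x0 xy y2.
  have r t : x <= t <= y -> 0 < t <= 2^-1 by move=> /andP[h1 h2]; rewrite (lt_le_trans x0 h1) (le_trans h2 y2).
  pose Fl (t : R) := flux f q (1 - t).
  have hd t : x <= t <= y -> is_derive t 1 Fl ('D_1 Fl t) /\
     `|'D_1 Fl t| <= K1 * t `^ e' + K2 * t `^ d'.
    move=> /r/dF[D hD hb]; have hv : 'D_1 Fl t = D by exact: derive_val.
    by rewrite hv.
  have hh : `|flux f q (1 - y) - flux f q (1 - x)| <= G y - G x.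
    apply: (@dist_of_der _ Fl G _ (fun t => K1 * t `^ e' + K2 * t `^ d') x y xy (fun t ht => (hd t ht).1)).
      by move=> t /r/andP[t0 _]; exact: dG.
    by move=> t ht; exact: (hd t ht).2.
  have Gx : 0 <= G x by rewrite /G; pos.
  have := ler_normD (flux f q (1 - y) - flux f q (1 - x)) (flux f q (1 - x)); rewrite subrK.
  by move: hh Gx; tidy; move: (`|flux f q (1 - y) - flux f q (1 - x)|) (flux f q (1 - y)) (flux f q (1 - x)) (G x) (G y) => *; lra.
have flux0 (ep : R) : 0 < ep -> exists2 r : R, 0 < r & forall x : R, 0 < x -> x <= r -> x <= 2^-1 -> `|flux f q (1 - x)| <= ep.
  move=> ep0.
  pose K3 := M + kap * (MA * M) + 1; have K30 : 0 < K3 by rewrite /K3; pos.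
  have ep2 : 0 < ep / 2 / K3 by rewrite !divr_gt0.
  have [r1 r10 H1] := pow_small e'0 ep2; have [r2 r20 H2] := pow_small d'1 ep2.
  exists (Num.min r1 r2); first by rewrite lt_min r10.
  move=> x x0; rewrite le_min => /andP[x1 x2'] x2.
  have hx : 0 < x <= 2^-1 by rewrite x0.
  have h1 := H1 x (ltW x0) x1; have h2 := H2 x (ltW x0) x2'.
  have /andP[_ hA] := HA x hx; have A0 := W_gt0 e' e (half x hx).
  rewrite /flux W_refl; apply: le_trans (ler_normD _ _) _.
  have g1 := qM x hx.
  have g2 : `|k0 / e' * (W e' e x * f (1 - x))| <= kap * (MA * M) * x `^ e'.
    rewrite normrM (ger0_norm kap0) -mulrA ler_wpM2l//.
    rewrite normrM (ger0_norm (ltW A0)) [leRHS]mulrAC.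
    by apply: ler_pM => //; exact: ltW.
  have px1 := powR_ge0 x e'; have px2 := powR_ge0 x (d' + 1).
  have g3 : K3 * x `^ e' <= ep / 2 by rewrite mulrC -ler_pdivlMr.
  have g4 : K3 * x `^ (d' + 1) <= ep / 2 by rewrite mulrC -ler_pdivlMr.
  have g5 : M * (x `^ e' + x `^ (d' + 1)) + kap * (MA * M) * x `^ e' <= K3 * x `^ e' + K3 * x `^ (d' + 1).
    have c0 : 0 <= kap * (MA * M) * x `^ (d' + 1) by pos.
    have -> : K3 * x `^ e' + K3 * x `^ (d' + 1) = M * (x `^ e' + x `^ (d' + 1)) + kap * (MA * M) * x `^ e' +
      (kap * (MA * M) * x `^ (d' + 1) + x `^ e' + x `^ (d' + 1)) by rewrite /K3; ring.
    by rewrite lerDl !addr_ge0.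
  by move: g1 g2 g3 g4 g5; tidy; move: (K3 * _) (K3 * _) (kap * _ * _) (M * _) `|q (1 - x)| `|k0 / e' * _| => *; lra.
have key (y : R) : 0 < y <= 2^-1 -> `|flux f q (1 - y)| <= G y.
  move=> /andP[y0 y2]; apply/ler_addgt0Pl => ep ep0.
  have [r r0 Hr] := flux0 ep ep0.
  pose x := Num.min r y; have x0 : 0 < x by rewrite /x lt_min r0.
  have xy : x <= y by rewrite /x ge_min lexx orbT.
  apply: le_trans (small x y x0 xy y2) _; rewrite lerD2r; apply: Hr => //.
    by rewrite /x ge_min lexx.
  exact: le_trans xy y2.
exists (K1 / (e' + 1) + K2 / (d' + 1)); first by pos.
move=> y hy; apply: le_trans (key y hy) _; rewrite /G.
have -> : (K1 / (e' + 1) + K2 / (d' + 1)) * (y `^ (e' + 1) + y `^ (d' + 1)) =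
  K1 / (e' + 1) * y `^ (e' + 1) + K2 / (d' + 1) * y `^ (d' + 1) +
  (K1 / (e' + 1) * y `^ (d' + 1) + K2 / (d' + 1) * y `^ (e' + 1)) by move: (K1 / _) (K2 / _) => *; ring.
by rewrite lerDl; pos.
Qed.

(** The equation solved for [f''] after division by [A]. For [d = e - 1] the quotient of the weights
    is [(1 - s) ^ w / (s * (1 - s))]. *)
Definition profile_der2 w (f g : R -> R) (s : R) :=
  (k0 * f s - (1 - s) `^ w * nl p (f s) - (e * (1 - s) - e' * s) * g s) / (s * (1 - s)).

Lemma sign_change f (a D r : R) : is_derive a 1 f D -> D != 0 -> f a = 0 -> 0 < r ->
  exists b c : R, [/\ `|b - a| <= r, `|c - a| <= r, 0 < f b & f c < 0].
Proof.
wlog D0 : f D / 0 < D => [hw|] hf Dn0 fa r0.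
  have [D0|D0|D0] := ltgtP 0 D; [exact: (hw f D)| |by rewrite -D0 eqxx in Dn0].
  have [|||b [c [h1 h2 h3 h4]]] := hw (fun t => - f t) (- D) _ (derN hf) _ _ r0.
  - by rewrite oppr_gt0.
  - by rewrite oppr_eq0.
  - by rewrite fa oppr0.
  by exists c, b; split => //; [rewrite -oppr_lt0|rewrite -oppr_gt0].
have D2 : 0 < D / 2 by rewrite divr_gt0.
have [x x0 Hx] := (der_eps f a D).1 hf _ D2.
pose y := Num.min r (x / 2); have y0 : 0 < y by rewrite /y lt_min r0 divr_gt0.
have yr : y <= r by rewrite /y ge_min lexx.
have yx : y < x.
  have : y <= x / 2 by rewrite /y ge_min lexx orbT.
  by move: x0; lra.
have ny : `|y| = y by rewrite ger0_norm ?ltW.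
have hp : 0 < D * y by rewrite mulr_gt0.
exists (a + y), (a - y); split.
- by rewrite addrC addKr ny.
- by rewrite addrC addKr normrN ny.
- have := Hx (a + y); rewrite [a + y - a]addrC addKr ny fa subr0 => /(_ yx).
  rewrite ler_norml mulrAC => /andP[h _]; move: h hp; move: (D * y) => z; lra.
- have := Hx (a - y); rewrite [a - y - a]addrC addKr normrN ny fa subr0 => /(_ yx).
  rewrite ler_norml mulrN mulrAC => /andP[_ h]; move: h hp; move: (D * y) => z; lra.
Qed.

(* The exponents of the two weights of the equation satisfy d = e - 1, so that
   s = 0 is a regular point of the derivative. *)
Lemma profile (Lam : R) : exists (f g : R -> R) (M : R),
  [/\ 0 < M,
      continuous f /\ (forall s, `|f s| <= M),
      forall s, 0 < s < 1 -> [/\ is_derive s 1 f (g s),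
        is_derive s 1 g (profile_der2 (d' + 1 - e') f g s) &
        `|g s + k0 / e' * f s| <= M * ((1 - s) + (1 - s) `^ (d' + 1 - e'))],
      exists s0 s1 : R, [/\ 4^-1 <= s0 <= 3 / 4, 4^-1 <= s1 <= 3 / 4, f s0 = 0 & Lam <= `|f s1|] &
      exists a b : R, [/\ 0 < a < 1, 0 < b < 1, 0 < f a & f b < 0]].
Proof.
have [[e'0 d'0 ed2' _] _] := He2; have [[e0 _ _ _] _] := He.
have p10 : 0 < p + 1 by move: p1; tidy; lra.
have q1 : 0 < 4^-1 :> R by rewrite invr_gt0.
have q3 : 3 / 4 < 1 :> R by tidy; lra.
have q8 : 0 < 8^-1 :> R by rewrite invr_gt0.
have [Lam1 HL1] := short_nodal e e' d d' p1 k00 q1 q3 q8.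
(* The [1] makes zeros of [f] simple, [Lam1] makes zeros frequent, and the last entry is the
   potential energy of the height [Lam]. *)
pose L2 := Num.max 1 (Num.max Lam1 (`|Lam| `^ (p + 1) / (p + 1))).
have L21 : 1 <= L2 by rewrite /L2 le_max lexx.
have L2L : Lam1 <= L2 by rewrite /L2 !le_max lexx !orbT.
have L2p : `|Lam| `^ (p + 1) / (p + 1) <= L2 by rewrite /L2 !le_max lexx !orbT.
have [f [q [M [M0 em [cf fM] [qM qM'] hE]]]] := emden_solutions p1 k00 He He2 L2.
have [K K0 HK] := flux_bound (ltW M0) em fM qM'.
pose g s := q s / W e e' s.
have emi s : 0 < s < 1 -> is_derive s 1 f (g s) /\
    is_derive s 1 q (k0 * W (e - 1) (e' - 1) s * f s - W d d' s * nl p (f s)).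
  by move=> /andP[s0 s1]; apply: (em s s s0 s1); rewrite lexx.
have [MA MA1 HA] := W_left e e'; have [MB MB1 HB] := W_left e' e.
have [MA0 MB0] : 0 < MA /\ 0 < MB by split; apply: lt_le_trans ltr01 _.
pose kap := k0 / e'; have kap0 : 0 <= kap by rewrite /kap; pos.
pose w := d' + 1 - e'.
pose M2 := M + MB * K + 2 * (2 * M * MA + kap * M).
have M20 : 0 < M2 by rewrite /M2; pos.
have M2M : M <= M2.
  have : 0 <= MB * K by pos.
  have : 0 <= 2 * (2 * M * MA + kap * M) by pos.
  by rewrite /M2; tidy; lra.
have half (x : R) : 0 < x <= 2^-1 -> 0 < x < 1.
  by move=> /andP[-> h]; apply: le_lt_trans h _; tidy; lra.
have E34 s : 4^-1 <= s <= 3 / 4 -> 0 < s < 1.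
  by move=> /andP[h1 h2]; rewrite (lt_le_trans q1 h1) (le_lt_trans h2 q3).
have zero x : 4^-1 <= x -> x + 8^-1 <= 3 / 4 -> exists2 a, x <= a <= x + 8^-1 & f a = 0.
  move=> h1 h2; have := HL1 f q x h1 h2 => H.
  apply: contrapT => hn; apply: H.
  - by move=> s /andP[s1 s2]; apply: emi; apply: E34; rewrite (le_trans h1 s1) (le_trans s2 h2).
  - by move=> s /andP[s1 s2]; apply: (le_trans L2L); apply: hE; rewrite (le_trans h1 s1) (le_trans s2 h2).
  - by move=> s hs; apply/eqP => fs; apply: hn; exists s.
have [a /andP[a1 a2] fa] : exists2 a, 4^-1 <= a <= 4^-1 + 8^-1 & f a = 0 by apply: zero; tidy; lra.
have [b /andP[b1 b2] fb] : exists2 b, 2^-1 <= b <= 2^-1 + 8^-1 & f b = 0 by apply: zero; tidy; lra.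
have ab : a < b by move: a2 b1; tidy; lra.
have ha : 4^-1 <= a <= 3 / 4 by rewrite a1; move: a2; tidy; lra.
have hab t : a <= t <= b -> 4^-1 <= t <= 3 / 4.
  by move=> /andP[h1 h2]; apply/andP; split; move: a1 b2 h1 h2; tidy; lra.
(* At a critical point between two zeros all the energy is potential, so [f] is large there. *)
have [c hc gc] : exists2 c, a <= c <= b & g c = 0.
  have [|||c + hc] := @Rolle R f a b ab; last first.
  - rewrite in_itv/= => /andP[h1 h2].
    have hc' : a <= c <= b by rewrite !ltW.
    exists c => //; have [h3 _] := emi c (E34 c (hab c hc')).
    have := @derive_val _ _ _ _ _ _ _ h3; have := @derive_val _ _ _ _ _ _ _ hc.
    by move=> -> ->.
  - by rewrite fa fb.
  - by apply: continuous_subspaceT => t; exact: cf.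
  - move=> t; rewrite in_itv/= => /andP[h1 h2].
    have ht : a <= t <= b by rewrite !ltW.
    by have [h3 _] := emi t (E34 t (hab t ht)); exact: ex_derive.
have hc34 := hab c hc; have c01 := E34 c hc34.
have qc : q c = 0.
  by move/eqP: gc; rewrite /g mulf_eq0 invr_eq0 [W _ _ _ == 0]gt_eqF ?W_gt0// orbF => /eqP.
exists f, g, M2; split => //.
- by split => // s; apply: le_trans M2M.
- move=> s s01; have [hf hq] := emi s s01; have A0 := W_gt0 e e' s01.
  have hA := der_W e e' s01.
  have /andP[s0 s1] := s01; have s1' : 0 < 1 - s by rewrite subr_gt0.
  split => //.
  + rewrite /g; derby; first by rewrite gt_eqF.
    have -> : W d d' s = W e e' s * (1 - s) `^ w / (s * (1 - s)).
      have -> : d = e - 1 by move: de; tidy; lra.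
      have -> : d' = e' + w - 1 by rewrite /w; ring.
      rewrite W1// W.unlock powRDpos//; field; rewrite !gt_eqF//.
    rewrite W1// /profile_der2 -/w.
    move: (W e e' s) A0 (f s) (q s) (nl p (f s)) ((1 - s) `^ w) => A A0 x y z C.
    by field; rewrite !gt_eqF.
  + have pw : 0 < (1 - s) `^ w by exact: powR_gt0.
    (* On the left half the right-hand side is at least [M2 / 2], so boundedness of [f] and [g] is
       enough. *)
    have [s2|/ltW s2] := leP s 2^-1.
    * have hs : 0 < s <= 2^-1 by rewrite s0.
      have /andP[hA1 _] := HA s hs; have pe : 0 < s `^ e by exact: powR_gt0.
      have h1 : `|g s| <= 2 * M * MA.
        rewrite /g normrM [`|_^-1|]ger0_norm ?invr_ge0 ?(ltW A0)// ler_pdivrMr//.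
        apply: le_trans (qM s hs) _; rewrite de.
        have -> : M * (s `^ e + s `^ e) = 2 * M * MA * (MA^-1 * s `^ e) by field; rewrite gt_eqF.
        by apply: ler_wpM2l => //; pos.
      have h2 : `|k0 / e' * f s| <= kap * M by rewrite normrM (ger0_norm kap0) ler_wpM2l.
      apply: le_trans (ler_normD _ _) _; apply: le_trans (lerD h1 h2) _.
      apply: (@le_trans _ _ (M2 * 2^-1)).
        have : 0 <= MB * K by pos.
        by rewrite /M2; move: M0; tidy; lra.
      apply: ler_wpM2l; first exact: ltW.
      by move: s2 pw; tidy; lra.
    * have hx : 0 < 1 - s <= 2^-1 by rewrite s1'/=; move: s2; tidy; lra.
      have /andP[hB1 _] := HB _ hx; have := HK _ hx; rewrite reflectK => hr.
      have hB : MB^-1 * (1 - s) `^ e' <= W e e' s by rewrite -W_refl.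
      have -> : g s + k0 / e' * f s = flux f q s / W e e' s.
        by rewrite /g /flux; field; rewrite !gt_eqF.
      rewrite normrM [`|_^-1|]ger0_norm ?invr_ge0 ?(ltW A0)// ler_pdivrMr//.
      apply: le_trans hr _.
      have px : 0 < (1 - s) `^ e' by exact: powR_gt0.
      have -> : K * ((1 - s) `^ (e' + 1) + (1 - s) `^ (d' + 1)) =
         MB * K * ((1 - s) + (1 - s) `^ w) * (MB^-1 * (1 - s) `^ e').
        rewrite powRDpos// powRr1 ?(ltW s1')//.
        have -> : d' + 1 = e' + w by rewrite /w; ring.
        by rewrite powRDpos//; field; rewrite gt_eqF.
      apply: ler_pM => //; [by pos|by pos|].
      apply: ler_wpM2r; first by pos.
      have h5 : 0 <= 2 * (2 * M * MA + kap * M) by pos.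
      by rewrite /M2; move: M0 h5; tidy; lra.
- exists a, c; split => //.
  have := hE c hc34; rewrite /En qc expr0n/= mul0r add0r => h.
  have := le_trans L2p h; rewrite Fp.unlock ler_pM2r ?invr_gt0// => h2.
  apply: le_trans (ler_norm Lam) _; rewrite leNgt; apply/negP => h3.
  move: h2; rewrite leNgt => /negP; apply.
  by apply: gt0_ltr_powR; rewrite ?nnegrE.
(* At a zero of [f] the energy is purely kinetic and at least [1], so the zero is simple and [f]
   changes sign there. *)
- have ga : g a != 0.
    have a01 := E34 a ha; have A0 := W_gt0 e e' a01.
    apply/eqP => ga; have qa : q a = 0.
      by move/eqP: ga; rewrite /g mulf_eq0 invr_eq0 [W _ _ _ == 0]gt_eqF// orbF => /eqP.
    have := hE a ha; rewrite /En qa expr0n/= mul0r add0r fa Fp.unlock normr0 powR0 ?gt_eqF// mul0r.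
    by move=> /(le_trans L21); rewrite ler10.
  have [hfa _] := emi a (E34 a ha).
  have [b' [c' [h1 h2 h3 h4]]] := sign_change hfa ga fa q8.
  exists b', c'; split => //.
  + by move: h1; rewrite ler_norml => /andP[g1 g2]; apply/andP; split; move: a1 a2 g1 g2; tidy; lra.
  + by move: h2; rewrite ler_norml => /andP[g1 g2]; apply/andP; split; move: a1 a2 g1 g2; tidy; lra.
Qed.

End profile.

(** * Integration on R^k x R^h *)

Section invariance.
Context {R : realType}.

Lemma measurable_translate (t : R) : measurable_fun setT (fun x : measurableTypeR R => (x + t : measurableTypeR R)).
Proof. by apply: measurable_realfun.measurable_funD => //; exact: measurable_cst. Qed.

Lemma lebesgue_translate (t : R) (A : set (measurableTypeR R)) : measurable A ->
  lebesgue_measure ((fun x : measurableTypeR R => (x + t : measurableTypeR R)) @^-1` A) = lebesgue_measure A.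
Proof.
move=> mA.
have mf := measurable_translate t.
pose F : {mfun measurableTypeR R >-> measurableTypeR R} :=
  HB.pack (fun x : measurableTypeR R => (x + t : measurableTypeR R)) (isMeasurableFun.Build _ _ _ _ _ mf).
suff : lebesgue_measure A = pushforward (@lebesgue_measure R) F A by [].
apply: (lebesgue_measure_unique _ mA) => _ [[a b]] _ <- /=.
rewrite /pushforward /= (_ : _ @^-1` _ = `](a - t), (b - t)]%classic); last first.
  by apply/seteqP; split => x /=; rewrite !in_itv/= ltrBlDr lerBrDr.
by rewrite !lebesgue_measure_itv/= !lte_fin ltrD2r !EFinB; case: ifP => // _; rewrite -!EFinB opprB addrA subrK.
Qed.

Section product.
Context d1 d2 (T1 : measurableType d1) (T2 : measurableType d2).
Variables (m1 : {measure set T1 -> \bar R}) (m2 : {sigma_finite_measure set T2 -> \bar R}).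

Lemma product_invariant1 (F : T1 -> T1) : measurable_fun setT F ->
  (forall A, measurable A -> m1 (F @^-1` A) = m1 A) ->
  forall A, measurable A -> (m1 \x m2)%E ((fun p : T1 * T2 => (F p.1, p.2)) @^-1` A) = (m1 \x m2)%E A.
Proof.
move=> mF inv A mA; rewrite /product_measure1.
pose G : {mfun T1 >-> T1} := HB.pack F (isMeasurableFun.Build _ _ _ _ _ mF).
transitivity (\int[m1]_(x in F @^-1` setT) ((m2 \o xsection A) \o G) x)%E.
  rewrite preimage_setT; apply: eq_integral => x _.
  by rewrite /= /xsection.
rewrite -(@ge0_integral_pushforward _ _ _ _ _ F mF m1 setT)//; last exact: measurable_fun_xsection.
apply: eq_measure_integral => B mB _.
exact: inv.
Qed.

Lemma product_invariant2 (F : T2 -> T2) :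
  (forall A, measurable A -> m2 (F @^-1` A) = m2 A) ->
  forall A, measurable A -> (m1 \x m2)%E ((fun p : T1 * T2 => (p.1, F p.2)) @^-1` A) = (m1 \x m2)%E A.
Proof.
move=> inv A mA; rewrite /product_measure1; apply: eq_integral => x _ /=.
rewrite -[RHS]inv; last exact: measurable_xsection.
rewrite (_ : xsection _ x = F @^-1` xsection A x)//.
Qed.

End product.

Definition shift_rV n (i : 'I_n) (t : R) (x : 'rV[R]_n) : 'rV[R]_n := x + t *: delta_mx ord0 i.

Lemma shift_rVE n (i j : 'I_n) (t : R) (x : 'rV[R]_n) : shift_rV i t x ord0 j = x ord0 j + t * (j == i)%:R.
Proof. by rewrite /shift_rV !mxE eqxx. Qed.

Lemma measurable_shift_rV n (i : 'I_n) (t : R) : measurable_fun setT (shift_rV i t).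
Proof.
apply: measurable_fun_rV => j.
rewrite (_ : _ \o _ = fun x => (rV_coord j x + t * (j == i)%:R : measurableTypeR R)).
  by apply: measurableT_comp (measurable_translate _) (measurable_rV_coord j).
by apply/funext => x; rewrite /rV_coord/= shift_rVE.
Qed.

(** Peeling off the first coordinate turns the shift into a shift of one factor of a product
    measure. *)
Lemma lebesgue_rV_shift n (i : 'I_n) (t : R) (A : set 'rV[R]_n) : measurable A ->
  lebesgue_rV R n (shift_rV i t @^-1` A) = lebesgue_rV R n A.
Proof.
elim: n i A => [[]//|n IH] i A mA.
rewrite /= /lebesgue_rV_step /pushforward.
have mB : measurable (@cons_rV R n @^-1` A).
  by rewrite -[_ @^-1` _]setTI; exact: measurable_cons_rV.
case: (unliftP ord0 i) => [j|] ->.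
- have -> : @cons_rV R n @^-1` (shift_rV (lift ord0 j) t @^-1` A) =
      (fun p => (p.1, shift_rV j t p.2)) @^-1` (@cons_rV R n @^-1` A); last first.
    exact: (product_invariant2 _ (IH j) mB).
  suff H : forall p, shift_rV (lift ord0 j) t (cons_rV p) = cons_rV (p.1, shift_rV j t p.2).
    by apply/seteqP; split => p /=; rewrite H.
  move=> [a x].
  apply/rowP => l; rewrite shift_rVE !mxE.
  case: (unliftP ord0 l) => [l'|] -> /=; last first.
    by rewrite mulr0 addr0.
  by rewrite shift_rVE (inj_eq lift_inj).
- have -> : @cons_rV R n @^-1` (shift_rV ord0 t @^-1` A) =
      (fun p => (p.1 + t : measurableTypeR R, p.2)) @^-1` (@cons_rV R n @^-1` A); last first.
    exact: (product_invariant1 _ (measurable_translate t) (@lebesgue_translate t) mB).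
  suff H : forall p : measurableTypeR R * 'rV[R]_n, shift_rV ord0 t (cons_rV p) = cons_rV (p.1 + t : measurableTypeR R, p.2).
    by apply/seteqP; split => p /=; rewrite H.
  move=> [a x].
  apply/rowP => l; rewrite shift_rVE !mxE.
  case: (unliftP ord0 l) => [l'|] -> /=; last by rewrite mulr1.
  by rewrite mulr0 addr0.
Qed.

Section boxes.
Local Open Scope ereal_scope.

Definition box_rV n (X : 'I_n -> set (measurableTypeR R)) : set 'rV[R]_n :=
  [set x | forall i, X i (rV_coord i x)].

Lemma measurable_box_rV n (X : 'I_n -> set (measurableTypeR R)) :
  (forall i, measurable (X i)) -> measurable (box_rV X).
Proof.
move=> mX; rewrite (_ : box_rV X = \bigcap_(i in [set: 'I_n]) (rV_coord i @^-1` X i)).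
  apply: fin_bigcap_measurable => //.
  by move=> i _; rewrite -[X in measurable X]setTI; apply: measurable_rV_coord.
by apply/seteqP; split => x h i; [move=> _; exact: h|exact: h].
Qed.

Lemma lebesgue_rV_box n (X : 'I_n.+1 -> set (measurableTypeR R)) : (forall i, measurable (X i)) ->
  lebesgue_rV R n.+1 (box_rV X) = lebesgue_measure (X ord0) * lebesgue_rV R n (box_rV (fun i => X (lift ord0 i))).
Proof.
move=> mX; rewrite -product_measure1E//; last exact: measurable_box_rV.
rewrite /= /lebesgue_rV_step /pushforward.
rewrite (_ : _ @^-1` _ = X ord0 `*` box_rV (fun i => X (lift ord0 i)))//.
apply/seteqP; split => -[a x] /=.
- move=> h; split; first by have := h ord0; rewrite /rV_coord mxE unlift_none.
  by move=> i; have := h (lift ord0 i); rewrite /rV_coord mxE liftK.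
- move=> [h1 h2] i; rewrite /rV_coord mxE; by case: (unliftP ord0 i) => [j|] -> /=; [exact: h2|].
Qed.

Lemma box_rV_fin n (X : 'I_n -> set (measurableTypeR R)) : (forall i, measurable (X i)) ->
  (forall i, lebesgue_measure (X i) < +oo) -> lebesgue_rV R n (box_rV X) < +oo.
Proof.
elim: n X => [|n IH] X mX fX.
  by rewrite /= diracE; case: (_ \in _); rewrite ltry.
rewrite lebesgue_rV_box//; apply: lte_mul_pinfty => //; first by rewrite ge0_fin_numE.
exact: IH.
Qed.

Lemma box_rV_gt0 n (X : 'I_n -> set (measurableTypeR R)) : (forall i, measurable (X i)) ->
  (forall i, 0 < lebesgue_measure (X i)) -> 0 < lebesgue_rV R n (box_rV X).
Proof.
elim: n X => [|n IH] X mX fX.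
  have h : box_rV X (0%R : 'rV[R]_0) by case.
  by rewrite /= diracE mem_set.
by rewrite lebesgue_rV_box//; apply: mule_gt0 => //; exact: IH.
Qed.

Lemma box_rV_null n (X : 'I_n -> set (measurableTypeR R)) (i : 'I_n) : (forall i, measurable (X i)) ->
  lebesgue_measure (X i) = 0 -> lebesgue_rV R n (box_rV X) = 0.
Proof.
elim: n X i => [X []//|n IH] X i mX; rewrite lebesgue_rV_box//.
case: (unliftP ord0 i) => [j|] -> h; last by rewrite h mul0e.
by rewrite (IH _ j)// mule0.
Qed.

End boxes.

End invariance.

Section product_space.
Context {R : realType} {k h : nat}.
Local Notation E := ('rV[R]_k * 'rV[R]_h)%type.
Local Notation I := ('I_k + 'I_h)%type.
Local Notation mu := (@lebesgue_kh R k h).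
Implicit Types (x : E) (i : I) (t : R).

(** Indexing the coordinates by the disjoint sum treats the two blocks alike, so each fact about
    lines and boxes is proved once. *)
Definition crd i x : R :=
  match i with inl i => x.1 ord0 i | inr j => x.2 ord0 j end.

Definition base i : E :=
  match i with inl i => (delta_mx ord0 i, 0) | inr j => (0, delta_mx ord0 j) end.

Lemma crdD i x y : crd i (x + y) = crd i x + crd i y.
Proof. by case: i => i; rewrite /crd mxE. Qed.

Lemma crdZ i t x : crd i (t *: x) = t * crd i x.
Proof. by case: i => i; rewrite /crd mxE. Qed.

Lemma crd_base i j : crd i (base j) = (i == j)%:R.
Proof.
by case: i j => i [] j; rewrite /crd/= mxE ?eqxx.
Qed.

Lemma crd_shift i j t x : crd i (x + t *: base j) = crd i x + t * (i == j)%:R.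
Proof. by rewrite crdD crdZ crd_base. Qed.

Lemma crd_inj x y : (forall i, crd i x = crd i y) -> x = y.
Proof.
move=> H; rewrite (surjective_pairing x) (surjective_pairing y); congr (_, _); apply/rowP => i.
  exact: (H (inl i)).
exact: (H (inr i)).
Qed.

Lemma measurable_coord i : measurable_fun setT (crd i).
Proof.
case: i => i.
  by apply: (measurableT_comp (measurable_rV_coord i)); exact: measurable_fst.
by apply: (measurableT_comp (measurable_rV_coord i)); exact: measurable_snd.
Qed.

Lemma nbhs_coordP x (A : set E) : nbhs x A -> exists2 r : R, 0 < r &
  forall y, (forall i, `|crd i y - crd i x| < r) -> A y.
Proof.
move=> /nbhs_ballP[r r0 rA]; exists r => // y yx; apply: rA.
split; split => // i j; rewrite /= !ord1 /ball/= distrC.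
  exact: (yx (inl j)).
exact: (yx (inr j)).
Qed.

Lemma nbhs_coord x (r : R) : 0 < r -> \forall y \near x, forall i, `|crd i y - crd i x| < r.
Proof.
move=> r0; apply/nbhs_ballP; exists r => // y [[_ h1] [_ h2]] [] i; rewrite distrC; [exact: h1|exact: h2].
Qed.

Lemma continuous_crd i : continuous (crd i).
Proof.
move=> x; apply/cvgrPdist_lt => e e0; near=> y.
rewrite distrC; move: i; near: y; exact: nbhs_coord.
Unshelve. all: by end_near. Qed.

Definition box (X : I -> set (measurableTypeR R)) : set E := [set x | forall i, X i (crd i x)].

Lemma boxE (X : I -> set (measurableTypeR R)) :
  box X = box_rV (fun i : 'I_k => X (inl i)) `*` box_rV (fun i : 'I_h => X (inr i)).
Proof.
apply/seteqP; split => x /=.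
  by move=> H; split => i; [exact: (H (inl i))|exact: (H (inr i))].
by move=> [h1 h2] [] i; [exact: h1|exact: h2].
Qed.

Lemma measurable_box (X : I -> set (measurableTypeR R)) :
  (forall i, measurable (X i)) -> measurable (box X).
Proof. by move=> mX; rewrite boxE; apply: measurableX; apply: measurable_box_rV. Qed.

Lemma lebesgue_box (X : I -> set (measurableTypeR R)) : (forall i, measurable (X i)) ->
  mu (box X) = (lebesgue_rV R k (box_rV (fun i : 'I_k => X (inl i))) * lebesgue_rV R h (box_rV (fun i : 'I_h => X (inr i))))%E.
Proof. by move=> mX; rewrite boxE; apply: product_measure1E; apply: measurable_box_rV. Qed.

Lemma box_fin (X : I -> set (measurableTypeR R)) : (forall i, measurable (X i)) ->
  (forall i, (lebesgue_measure (X i) < +oo)%E) -> (mu (box X) < +oo)%E.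
Proof.
move=> mX fX; rewrite lebesgue_box//; apply: lte_mul_pinfty => //; last exact: box_rV_fin.
by rewrite ge0_fin_numE//; exact: box_rV_fin.
Qed.

Lemma box_gt0 (X : I -> set (measurableTypeR R)) : (forall i, measurable (X i)) ->
  (forall i, (0 < lebesgue_measure (X i))%E) -> (0 < mu (box X))%E.
Proof. by move=> mX fX; rewrite lebesgue_box//; apply: mule_gt0; exact: box_rV_gt0. Qed.

(** A hyperplane is a box with one degenerate side and unbounded others; the convention that zero
    times infinity is zero settles its measure. *)
Lemma coord_null i (c : R) : mu [set x | crd i x = c] = 0%E.
Proof.
pose X (j : I) : set (measurableTypeR R) := if j == i then [set c] else setT.
have mX j : measurable (X j) by rewrite /X; case: ifP.
have -> : [set x | crd i x = c] = box X.
  apply/seteqP; split => x /=.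
    by move=> xc j; rewrite /X; case: ifP => // /eqP ->.
  by move=> /(_ i); rewrite /X eqxx.
have c0 : lebesgue_measure (X i) = 0%E by rewrite /X eqxx lebesgue_measure_set1.
rewrite lebesgue_box//; case: i @X mX c0 => i X mX c0.
  by rewrite (@box_rV_null _ _ _ i)// mul0e.
by rewrite (@box_rV_null _ _ (fun j : 'I_h => X (inr j)) i)// mule0.
Qed.

(** The measurable structure is generated by coordinates, so an open set has to be exhibited as a
    countable union of rational boxes. *)
Lemma open_measurable_kh (O : set E) : open O -> measurable O.
Proof.
move=> oO.
pose B (q : {ffun I -> rat * rat}) := box (fun i => `]ratr (q i).1, ratr (q i).2[%classic).
have mB q : measurable (B q) by apply: measurable_box => i; exact: measurable_itv.
pose F q := if `[< B q `<=` O >] then B q else set0.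
have -> : O = \bigcup_q F q.
  apply/seteqP; split => x.
    move=> Ox; have /nbhs_coordP[r r0 Hr] := open_nbhs_nbhs (conj oO Ox).
    have q1 (i : I) : exists q : rat, crd i x - r < ratr q < crd i x.
      have [|q] := @rat_in_itvoo R (crd i x - r) (crd i x); first by rewrite ltrBlDr ltrDl.
      by rewrite in_itv; exists q.
    have q2 (i : I) : exists q : rat, crd i x < ratr q < crd i x + r.
      have [|q] := @rat_in_itvoo R (crd i x) (crd i x + r); first by rewrite ltrDl.
      by rewrite in_itv; exists q.
    have [a Ha] := choice q1; have [b Hb] := choice q2.
    pose q : {ffun I -> rat * rat} := [ffun i => (a i, b i)].
    have Bx : B q x by move=> i /=; rewrite /q ffunE in_itv/=; have /andP[_ ->] := Ha i; have /andP[-> _] := Hb i.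
    exists q => //; rewrite /F; case: asboolP => // nB; exfalso; apply: nB.
    move=> y By; apply: Hr => i; have := By i; rewrite /= /q ffunE in_itv/= => /andP[h1 h2].
    have /andP[h3 _] := Ha i; have /andP[_ h4] := Hb i.
    rewrite ltr_norml; apply/andP; split.
      by rewrite ltrBrDr addrC; exact: lt_trans h1.
    by rewrite ltrBlDr addrC; exact: lt_trans h4.
  by move=> [q _]; rewrite /F; case: asboolP => // + Bx; exact.
apply: countable_bigcupT_measurable; first exact: countableP.
by move=> q; rewrite /F; case: ifP.
Qed.

Lemma continuous_measurable_kh (f : E -> R) : continuous f -> measurable_fun setT f.
Proof.
move=> cf; apply: (measurability _ (RGenOInfty.measurableE R)) => _ [_ [a ->] <-].
rewrite setTI; apply: open_measurable_kh.
by apply: open_comp.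
Qed.

Lemma compact_coord_bounded (K : set E) : compact K -> exists2 r : R, 0 < r &
  forall x, K x -> forall i, `|crd i x| <= r.
Proof.
move=> cK.
have H i : exists r : R, forall x, K x -> `|crd i x| <= r.
  have cI : compact (crd i @` K).
    by apply: continuous_compact => //; apply: continuous_subspaceT => x; exact: continuous_crd.
  have [M [_ HM]] := @compact_bounded R R^o _ cI.
  exists (M + 1) => x Kx; apply: (HM (M + 1)); first by rewrite ltrDl.
  by exists x.
have [r Hr] := choice H.
exists (1 + \sum_i `|r i|); first by rewrite ltr_pwDl// sumr_ge0.
move=> x Kx i; apply: le_trans (Hr i x Kx) _; apply: le_trans (ler_norm _) _.
by rewrite (bigD1 i)//= addrCA lerDl addr_ge0// sumr_ge0.
Qed.

Definition cube (r : R) : set E := box (fun=> `[(- r), r]%classic).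

Lemma cubeP (r : R) x : cube r x <-> forall i, `|crd i x| <= r.
Proof.
split=> H i; have := H i; first by rewrite /= in_itv/= ler_norml.
by rewrite /= in_itv/= ler_norml.
Qed.

Lemma measurable_cube (r : R) : measurable (cube r).
Proof. by apply: measurable_box => i; exact: measurable_itv. Qed.

Lemma cube_fin (r : R) : (mu (cube r) < +oo)%E.
Proof.
apply: box_fin => i; first exact: measurable_itv.
by rewrite lebesgue_measure_itv/=; case: ifP => // _; rewrite -EFinB ltry.
Qed.

Lemma shift_invariant i t (A : set E) : measurable A ->
  mu ((fun x => x + t *: base i) @^-1` A) = mu A.
Proof.
move=> mA; case: i => i.
- have -> : (fun x => x + t *: base (inl i)) @^-1` A = (fun x => (shift_rV i t x.1, x.2)) @^-1` A.
    suff H : forall x, x + t *: base (inl i) = (shift_rV i t x.1, x.2) by apply/seteqP; split => x /=; rewrite H.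
    by move=> [x1 x2]; apply: crd_inj => -[] j; rewrite crd_shift/= ?shift_rVE// mulr0 addr0.
  exact: (product_invariant1 _ (measurable_shift_rV i t) (@lebesgue_rV_shift _ _ i t) mA).
- have -> : (fun x => x + t *: base (inr i)) @^-1` A = (fun x => (x.1, shift_rV i t x.2)) @^-1` A.
    suff H : forall x, x + t *: base (inr i) = (x.1, shift_rV i t x.2) by apply/seteqP; split => x /=; rewrite H.
    by move=> [x1 x2]; apply: crd_inj => -[] j; rewrite crd_shift/= ?shift_rVE// mulr0 addr0.
  exact: (product_invariant2 _ (@lebesgue_rV_shift _ _ i t) mA).
Qed.

Lemma measurable_shift i t : measurable_fun setT (fun x : E => x + t *: base i).
Proof.
apply/measurable_fun_pairP; split; apply: measurable_fun_rV => j.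
- rewrite (_ : _ \o _ = fun x => crd (inl j) x + t * (inl j == i)%:R).
    by apply: measurable_funD; [exact: measurable_coord|exact: measurable_cst].
  by apply/funext => x; rewrite /rV_coord -crd_shift.
- rewrite (_ : _ \o _ = fun x => crd (inr j) x + t * (inr j == i)%:R).
    by apply: measurable_funD; [exact: measurable_coord|exact: measurable_cst].
  by apply/funext => x; rewrite /rV_coord -crd_shift.
Qed.

Lemma integral_shift i t (f : E -> R) : measurable_fun setT f -> mu.-integrable setT (EFin \o f) ->
  mu.-integrable setT (EFin \o (fun x => f (x + t *: base i))) /\
  (\int[mu]_x (f (x + t *: base i))%:E = \int[mu]_x (f x)%:E)%E.
Proof.
move=> mf fi.
have mg := measurable_shift i t.
have mF : measurable_fun setT (EFin \o f : E -> \bar R) by apply/measurable_EFinP.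
have fi2 : mu.-integrable setT (EFin \o (fun x => f (x + t *: base i))).
  apply/integrableP; split; first by apply/measurable_EFinP; apply: measurableT_comp mf mg.
  move/integrableP : fi => [_]; apply: le_lt_trans.
  have H := @ge0_integral_pushforward _ _ _ _ _ _ mg mu setT (fun y : E => `|(f y)%:E|)%E measurableT.
  rewrite preimage_setT in H.
  suff -> : (\int[mu]_x `|(EFin \o (fun y : E => f (y + t *: base i)%R)) x| = \int[mu]_x `|(EFin \o f) x|)%E by [].
  apply: etrans (esym (H _ _)) _ => //; first by apply: measurableT_comp.
  by apply: eq_measure_integral => A mA _; exact: shift_invariant.
split => //.
have := @integral_pushforward _ _ _ _ _ _ mg mu setT (EFin \o f) mF.
rewrite preimage_setT => <-//.
by apply: eq_measure_integral => A mA _; exact: shift_invariant.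
Qed.

End product_space.

Section divergence.
Context {R : realType} {k h : nat}.
Local Notation E := ('rV[R]_k * 'rV[R]_h)%type.
Local Notation I := ('I_k + 'I_h)%type.
Local Notation mu := (@lebesgue_kh R k h).

Lemma integrable_cube (f : E -> R) (r C : R) : measurable_fun setT f ->
  (forall x, `|f x| <= C) -> (forall x, ~ cube r x -> f x = 0) ->
  mu.-integrable setT (EFin \o f).
Proof.
move=> mf fC f0.
have -> : EFin \o f = (EFin \o f) \_ (cube r).
  apply/funext => x; rewrite patchE; case: ifPn => //.
  by rewrite notin_setE => /f0 h0; rewrite /= h0.
apply/(integrable_mkcond _ (measurable_cube r)).1.
apply: measurable_bounded_integrable => //.
- exact: measurable_cube.
- exact: cube_fin.
- exact: measurable_funTS.
- exists C; split; first exact: num_real.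
  by move=> M CM x _; apply: le_trans (fC x) (ltW CM).
Qed.

(* The difference quotients of a compactly supported function integrate to zero
   by translation invariance; dominated convergence passes this to the
   divergence, which need only exist almost everywhere. *)
Lemma integral_divergence (f : I -> E -> R) (F : E -> R) (r C K : R) :
  (forall i, measurable_fun setT (f i)) ->
  (forall i x, `|f i x| <= C) ->
  (forall i x, ~ cube r x -> f i x = 0) ->
  (forall i x (t : R), 0 < t -> t <= 1 -> `|f i (x + t *: base i) - f i x| <= K * t) ->
  measurable_fun setT F ->
  {ae mu, forall x, (\sum_i n.+1%:R * (f i (x + n.+1%:R^-1 *: base i) - f i x)) @[n --> \oo] --> F x} ->
  mu.-integrable setT (EFin \o F) /\ \int[mu]_x F x = 0.
Proof.
move=> mf fC f0 fK mF FF.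
have fi i : mu.-integrable setT (EFin \o f i) by exact: (integrable_cube (mf i) (fC i) (f0 i)).
pose g n x := \sum_i n.+1%:R * (f i (x + n.+1%:R^-1 *: base i) - f i x).
have mfs i t : measurable_fun setT (fun x : E => f i (x + t *: base i)).
  by apply: measurableT_comp (mf i) (measurable_shift i t).
have mg n : measurable_fun setT (g n).
  apply: measurable_sum => i; apply: measurable_funM; first exact: measurable_cst.
  by apply: measurable_funB.
have t1 n : 0 < (n.+1%:R^-1 : R) /\ (n.+1%:R^-1 : R) <= 1.
  by split; [rewrite invr_gt0|rewrite invf_le1// ler1n].
have n1 n : 0 <= n.+1%:R :> R by [].
pose D := \sum_(i : I) `|K|.
have gD n x : `|g n x| <= D.
  apply: le_trans (ler_norm_sum _ _ _) _; apply: ler_sum => i _.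
  have [t0 tt] := t1 n.
  rewrite normrM ger0_norm// -ler_pdivlMl// mulrC.
  apply: le_trans (fK i x _ t0 tt) _.
  by apply: ler_wpM2r; [exact: ltW|exact: ler_norm].
(* The shifts have length at most [1], so a cube larger by [1] carries all the quotients and the
   dominating function. *)
have g0 n x : ~ cube (`|r| + 1) x -> g n x = 0.
  move=> nx; rewrite /g big1// => i _.
  have [t0 tt] := t1 n.
  rewrite !f0 ?subrr ?mulr0//; apply: contra_not nx => /cubeP cx; apply/cubeP => j.
    by apply: le_trans (cx j) _; apply: le_trans (ler_norm r) _; rewrite lerDl.
  have := cx j; rewrite crd_shift => hj.
  rewrite -[crd j x](addrK (n.+1%:R^-1 * (j == i)%:R)).
  apply: le_trans (ler_normB _ _) _; apply: lerD; first by apply: le_trans hj (ler_norm _).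
  rewrite ger0_norm ?mulr_ge0 ?(ltW t0)//; apply: le_trans tt.
  by rewrite ler_piMr ?(ltW t0)//; case: (j == i).
have gi n : mu.-integrable setT (EFin \o g n) by exact: (integrable_cube (mg n) (gD n) (g0 n)).
have int_g n : (\int[mu]_x (g n x)%:E = 0)%E.
  rewrite /g; under eq_integral do rewrite -sumEFin.
  rewrite integral_sum//; last first.
    move=> i; rewrite [X in mu.-integrable setT X](_ : _ = (fun x => n.+1%:R%:E * ((f i (x + n.+1%:R^-1 *: base i))%:E - (f i x)%:E))%E); last first.
      by apply/funext => x; rewrite EFinM EFinB.
    apply: integrableZl => //; apply: integrableB => //; last exact: (fi i).
    by have [] := integral_shift i n.+1%:R^-1 (mf i) (fi i).
  rewrite big1// => i _.
  have [h1 h2] := integral_shift i n.+1%:R^-1 (mf i) (fi i).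
  under eq_integral do rewrite EFinM EFinB.
  rewrite integralZl//; last by apply: integrableB => //; exact: (fi i).
  rewrite integralB_EFin//.
  by rewrite h2 subee ?mule0//; exact: (integrable_fin_num measurableT (fi i)).
pose G x := D * \1_(cube (`|r| + 1) : set E) x.
have mG : measurable_fun setT G.
  by apply: measurable_funM; [exact: measurable_cst|apply: measurable_indic; exact: measurable_cube].
have D0 : 0 <= D by apply: sumr_ge0.
have Gi : mu.-integrable setT (EFin \o G).
  apply: (@integrable_cube G (`|r| + 1) D) => // x.
    by rewrite /G normrM (ger0_norm D0) ler_piMr// indicE; case: (_ \in _); rewrite ?normr1 ?normr0.
  by rewrite /G indicE => nx; rewrite memNset// mulr0.
have [|||||Fi _ lim] := @dominated_convergence _ _ _ mu setT measurableT (fun n => EFin \o g n) (EFin \o F) (EFin \o G).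
- by move=> n; apply/measurable_EFinP.
- exact/measurable_EFinP.
- apply: filterS FF => x hx _; apply: cvg_EFin => //; exact: nearW.
- exact: Gi.
- apply: aeW => x n _; rewrite /= lee_fin /G indicE.
  case: (boolP (x \in _)); first by rewrite mulr1.
  by rewrite notin_setE => /g0 ->; rewrite normr0 mulr0.
split => //; rewrite /Rintegral.
have -> : (\int[mu]_x (F x)%:E = 0)%E; last by [].
apply: (cvg_unique _ lim) => //.
by apply: cvg_near_cst; apply: nearW => n; exact: int_g.
Qed.

End divergence.

(** * Calculus along coordinate lines, integration by parts, the weak equation *)

Section line_calculus.
Context {R : realType}.
Implicit Types (f df : R -> R) (s : seq R).

(** Induction on the exceptional points: each splits the interval, and continuity joins the
    pieces. *)
Lemma lip_except f df s (K a b : R) : a <= b ->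
  (forall t, a <= t <= b -> {for t, continuous f}) ->
  (forall t, a < t < b -> t \notin s -> is_derive t 1 f (df t) /\ `|df t| <= K) -> 0 <= K ->
  `|f b - f a| <= K * (b - a).
Proof.
elim: s a b => [|c s IH] a b ab fc fd K0.
  have wc : {within `[a, b], continuous f}.
    by apply: continuous_in_subspaceT => t; rewrite inE/= in_itv/= => /fc.
  have Kc (c : R) : {within `[a, b], continuous (fun t => c * t)}.
    by apply: continuous_subspaceT => t; apply: cvgMr; exact: cvg_id.
  rewrite ler_norml; apply/andP; split.
  - suff : f a + K * a <= f b + K * b by lra.
    apply: (@le_of_der_oo _ (fun t => f t + K * t) (fun t => df t + K) a b ab).
    + by move=> t ht; have [h1 _] := fd t ht isT; derby; ring.
    + by move=> t; apply: cvgD; [exact: wc|exact: Kc].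
    + by move=> t ht; have [_] := fd t ht isT; rewrite ler_norml => /andP[h _]; move: h; clear; lra.
  - suff : - f a + K * a <= - f b + K * b by lra.
    apply: (@le_of_der_oo _ (fun t => - f t + K * t) (fun t => - df t + K) a b ab).
    + by move=> t ht; have [h1 _] := fd t ht isT; derby; ring.
    + by move=> t; apply: cvgD; [apply: cvgN; exact: wc|exact: Kc].
    + by move=> t ht; have [_] := fd t ht isT; rewrite ler_norml => /andP[_ h]; move: h; clear; lra.
have [/andP[ac cb]|hc] := boolP (a < c < b); last first.
  apply: IH => // t ht ts; apply: fd => //; rewrite inE negb_or ts andbT.
  by apply: contra hc => /eqP <-.
have h1 : `|f c - f a| <= K * (c - a).
  apply: IH => //; first exact: ltW.
  - by move=> t /andP[h1 h2]; apply: fc; rewrite h1 (le_trans h2 (ltW cb)).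
  - move=> t /andP[h1 h2] ts; apply: fd; first by rewrite h1 (lt_trans h2 cb).
    by rewrite inE negb_or ts lt_eqF.
have h2 : `|f b - f c| <= K * (b - c).
  apply: IH => //; first exact: ltW.
  - by move=> t /andP[h2 h3]; apply: fc; rewrite h3 (le_trans (ltW ac) h2).
  - move=> t /andP[h2 h3] ts; apply: fd; first by rewrite h3 (lt_trans ac h2).
    by rewrite inE negb_or ts gt_eqF.
have -> : f b - f a = (f b - f c) + (f c - f a) by ring.
apply: le_trans (ler_normD _ _) _; have -> : K * (b - a) = K * (b - c) + K * (c - a) by ring.
exact: lerD.
Qed.

Lemma der_quot f (D : R) : is_derive (0 : R) 1 f D ->
  n.+1%:R * (f n.+1%:R^-1 - f 0) @[n --> \oo] --> D.
Proof.
move=> fd; apply/cvgrPdist_le => ep ep0.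
have [r r0 Hr] := (der_eps f 0 D).1 fd _ ep0.
near=> n.
have n0 : 0 < (n.+1%:R : R) by [].
have nr : `|n.+1%:R^-1 - 0| < r.
  rewrite subr0 ger0_norm ?invr_ge0 ?ltW// -[r]invrK ltf_pV2 ?posrE ?invr_gt0//.
  apply: lt_trans (_ : n%:R < _); last by rewrite ltr_nat.
  by near: n; exact: nbhs_infty_gtr.
have := Hr _ nr; rewrite subr0 [`|n.+1%:R^-1|]ger0_norm ?invr_ge0 ?(ltW n0)// => h.
have -> : D - n.+1%:R * (f n.+1%:R^-1 - f 0) = - (n.+1%:R * (f n.+1%:R^-1 - f 0 - D * n.+1%:R^-1)).
  by field; rewrite gt_eqF.
rewrite normrN normrM ger0_norm ?(ltW n0)// -ler_pdivlMl// [leRHS]mulrC.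
exact: h.
Unshelve. all: by end_near. Qed.

End line_calculus.

Section test_functions.
Context {R : realType} {k h : nat}.
Local Notation E := ('rV[R]_k * 'rV[R]_h)%type.
Local Notation I := ('I_k + 'I_h)%type.
Implicit Types (phi : E -> R) (x : E).

Definition partial phi (i : I) x : R := 'D_(base i) phi x.

Lemma der_line phi (i : I) x (t : R) : derivable phi (x + t *: base i) (base i) ->
  is_derive t 1 (fun t => phi (x + t *: base i)) (partial phi i (x + t *: base i)).
Proof.
move=> d.
have H (r : R) : (fun s : R => phi (x + s *: base i)) (r *: 1 + t) = phi (r *: base i + (x + t *: base i)).
  by congr phi; rewrite scalerDl [r *: 1]mulr1 addrCA addrC -addrA [t *: _ + _]addrC addrA.
have Q : (fun r : R => r^-1 *: ((phi \o shift (x + t *: base i)) (r *: base i) - phi (x + t *: base i))) =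
         (fun r : R => r^-1 *: (((fun s : R => phi (x + s *: base i)) \o shift t) (r *: 1) - phi (x + t *: base i))).
  by apply/funext => r; rewrite /= H.
split.
  by move: d; rewrite /derivable Q.
by rewrite /partial /derive Q.
Qed.

Lemma der_line0 phi (i : I) x (d : R) : is_derive (0 : R) 1 (fun t => phi (x + t *: base i)) d ->
  forall y t, x = y + t *: base i -> is_derive t 1 (fun t => phi (y + t *: base i)) d.
Proof.
move=> hd y t xy.
have H : is_derive (t - t) 1 (fun s => phi (x + s *: base i)) d by rewrite subrr.
have G : is_derive t 1 (fun s : R => s - t) 1 by derby; ring.
have := @derComp R (fun s => phi (x + s *: base i)) (fun s => s - t) t d 1 H G; rewrite mulr1.
rewrite (_ : (fun s : R => phi (x + (s - t) *: base i)) = (fun s => phi (y + s *: base i)))//.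
by apply/funext => s; congr phi; rewrite xy -addrA -scalerDl [t + _]addrC subrK.
Qed.

(** Everything used of a test function; of smoothness, only the lists of at most one direction
    enter. *)
Lemma test_fun_facts phi : test_fun phi ->
  [/\ continuous phi,
      forall i, continuous (partial phi i),
      forall i x (t : R), is_derive t 1 (fun t => phi (x + t *: base i)) (partial phi i (x + t *: base i)) &
      exists r M : R, [/\ 0 < r, 0 < M,
        forall x, `|phi x| <= M, forall i x, `|partial phi i x| <= M &
        forall x, ~ cube r x -> phi x = 0 /\ forall i, partial phi i x = 0]].
Proof.
move=> [sm cK].
have c0 : continuous phi by have [] := sm [::].
have c1 i : continuous (partial phi i) by have [] := sm [:: base i].
split => //.
  by move=> i x t; apply: der_line; have [_] := sm [::]; apply.
pose K := closure [set x | phi x != 0].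
have z0 x : ~ K x -> phi x = 0.
  by move=> nK; apply/eqP/negPn/negP => px; apply: nK; exact: subset_closure.
have z1 i x : ~ K x -> partial phi i x = 0.
  move=> nK; have oK : open (~` K) by apply: closed_openC; exact: closed_closure.
  have nb : \forall y \near x, phi y = 0.
    by have := open_nbhs_nbhs (conj oK nK); apply: filterS => y; exact: z0.
  rewrite /partial -(derive_cst (0 : R) x (base i)).
  by apply: near_eq_derive; apply: filterS nb => y ->.
have bd (f : E -> R) : continuous f -> (forall x, ~ K x -> f x = 0) -> exists M : R, forall x, `|f x| <= M.
  move=> cf fz.
  have cI : compact (f @` K).
    by apply: continuous_compact => //; apply: continuous_subspaceT => x; exact: cf.
  have [M [_ HM]] := @compact_bounded R R^o _ cI.
  exists (`|M| + 1) => x; have [Kx|nK] := pselect (K x).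
    apply: (HM (`|M| + 1)); last by exists x.
    by apply: le_lt_trans (ler_norm M) _; rewrite ltrDl.
  by rewrite fz// normr0 addr_ge0.
have [M0 HM0] := bd phi c0 z0.
have [M1 HM1] := choice (fun i => bd (partial phi i) (c1 i) (z1 i)).
have [r r0 Hr] := compact_coord_bounded cK.
have s0 : 0 <= \sum_i `|M1 i| by exact: sumr_ge0.
exists r, (1 + `|M0| + \sum_i `|M1 i|); split => //.
- by rewrite -addrA ltr_pwDl// addr_ge0.
- move=> x; apply: le_trans (HM0 x) _; apply: le_trans (ler_norm _) _.
  by move: s0; lra.
- move=> i x; apply: le_trans (HM1 i x) _; apply: le_trans (ler_norm _) _.
  have : 0 <= \sum_(j | j != i) `|M1 j| by exact: sumr_ge0.
  have := normr_ge0 M0.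
  by rewrite [\sum_i _](bigD1 i)//=; move: (\sum_(_ | _) _) => a; lra.
- move=> x nx; have nK : ~ K x by move=> Kx; apply: nx; apply/cubeP => i; exact: Hr.
  by split; [exact: z0|move=> i; exact: z1].
Qed.

End test_functions.

Section weak.
Context {R : realType} {k h : nat}.
Local Notation E := ('rV[R]_k * 'rV[R]_h)%type.
Local Notation I := ('I_k + 'I_h)%type.
Local Notation mu := (@lebesgue_kh R k h).
Implicit Types (phi : E -> R) (x : E) (i : I).

Lemma loc_integrable_bounded (f : E -> R) (C : R) : measurable_fun setT f ->
  (forall x, `|f x| <= C) -> loc_integrable f.
Proof.
move=> mf fC; split => // K cK.
have C0 : 0 <= C by apply: le_trans (fC 0).
have mK : measurable K.
  rewrite -[K]setCK; apply: measurableC; apply: open_measurable_kh; apply: closed_openC.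
  by apply: compact_closed => //; exact: norm_hausdorff.
have [r r0 Hr] := compact_coord_bounded cK.
apply: le_lt_trans (@integral_le_bound _ _ _ mu K (EFin \o f) C%:E mK _ _ _) _.
- by apply/measurable_EFinP; exact: measurable_funTS.
- by rewrite lee_fin.
- by apply: aeW => x _; rewrite lee_fin.
apply: lte_mul_pinfty => //.
apply: le_lt_trans (cube_fin (k := k) (h := h) r).
by apply: le_measure; rewrite ?inE//; [exact: measurable_cube|move=> x Kx; apply/cubeP; exact: Hr].
Qed.

Lemma cvg_fsum (J : finType) (T : Type) (G : set_system T) (FG : Filter G) (f : J -> T -> R) (l : J -> R) :
  (forall j, f j n @[n --> G] --> l j) -> \sum_j f j n @[n --> G] --> \sum_j l j.
Proof.
move=> H; elim: (index_enum J) => [|j s IH].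
  by rewrite big_nil; under eq_fun do rewrite big_nil; exact: cvg_cst.
by rewrite big_cons; under eq_fun do rewrite big_cons; apply: cvgD.
Qed.

Lemma measurable_enorm : measurable_fun setT (fun x : E => enorm x.1).
Proof.
rewrite /enorm; apply: (measurableT_comp (f := @Num.sqrt R)).
  by apply: continuous_measurable_fun; exact: sqrt_continuous.
by apply: measurable_sum => i; apply: measurable_funX; exact: (measurable_coord (inl i)).
Qed.

Lemma enorm_cube (r : R) x : cube r x -> enorm x.1 <= Num.sqrt (\sum_(i < k) r ^+ 2).
Proof.
move=> /cubeP H; rewrite /enorm ler_sqrt ?sumr_ge0// => [|i _]; last exact: sqr_ge0.
apply: ler_sum => i _; have := H (inl i); rewrite /= => h'.
by rewrite -real_normK ?num_real// lerXn2r// ?nnegrE//; exact: le_trans h'.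
Qed.

Lemma enorm_shift (j : 'I_h) x (t : R) : enorm (x + t *: base (inr j)).1 = enorm x.1.
Proof. by congr (enorm _); rewrite /= scaler0 addr0. Qed.

Variables (alpha : R) (u : E -> R) (g : I -> E -> R) (C : R).
Hypothesis alpha_gt0 : 0 < alpha.
Hypothesis mu_ : measurable_fun setT u.
Hypothesis u_bd : forall x, `|u x| <= C.
Hypothesis der_u : forall i x, is_derive (0 : R) 1 (fun t => u (x + t *: base i)) (g i x).
Hypothesis gy_bd : forall (i : 'I_k) x, `|g (inl i) x| <= C.
Hypothesis gz_bd : forall (j : 'I_h) x, `|enorm x.1 `^ alpha * g (inr j) x| <= C.

Definition grad_of_y (x : E) : 'rV[R]_k := \row_i g (inl i) x.
Definition grad_of_z (x : E) : 'rV[R]_h := \row_j g (inr j) x.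

(** A pointwise limit of difference quotients of a measurable function. *)
Lemma measurable_grad i : measurable_fun setT (g i).
Proof.
apply: (measurable_fun_cvg (h := fun n x => n.+1%:R * (u (x + n.+1%:R^-1 *: base i) - u x))) => [n|x _].
  apply: measurable_funM; first exact: measurable_cst.
  by apply: measurable_funB => //; apply: measurableT_comp mu_ (measurable_shift i _).
have := der_quot (der_u i x); rewrite scale0r addr0; exact.
Qed.

Lemma measurable_weight (r : R) : measurable_fun setT (fun x : E => enorm x.1 `^ r).
Proof. exact: measurableT_comp (measurable_powR _) measurable_enorm. Qed.

Lemma der_u_line i x (t : R) : is_derive t 1 (fun t => u (x + t *: base i)) (g i (x + t *: base i)).
Proof. exact: (der_line0 (der_u i (x + t *: base i))). Qed.

(** The divergence theorem for the field whose only component is [v * u * phi] in the direction [i].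
    The weight [v] is constant in that direction, so it passes through the derivative; [v = 1]
    serves the [y] directions and [v = |y| ^ alpha] the [z] directions. *)
Lemma by_parts phi i (v : E -> R) : test_fun phi -> measurable_fun setT v ->
  (forall x (t : R), v (x + t *: base i) = v x) ->
  (forall r : R, exists B : R, forall x, cube r x -> `|v x| <= B) ->
  (forall x, `|v x * g i x| <= C) ->
  \int[mu]_x (u x * (v x * partial phi i x)) = - \int[mu]_x (v x * g i x * phi x).
Proof.
move=> tphi mv vs vB gC.
have [cphi cd dphi [r [M [r0 M0 phiM dphiM phi0]]]] := test_fun_facts tphi.
have mphi := continuous_measurable_kh cphi; have mdphi := continuous_measurable_kh (cd i).
have mg := measurable_grad i.
have [B HB] := vB r.
have C0 : 0 <= C by apply: le_trans (u_bd 0).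
have BC0 : 0 <= `|B| * C * M by rewrite !mulr_ge0// ltW.
have H1M x : `|v x * g i x * phi x| <= C * M.
  by rewrite normrM; apply: ler_pM.
have H2M x : `|u x * (v x * partial phi i x)| <= `|B| * C * M.
  have [cx|ncx] := pselect (cube r x); last first.
    by have [_ h0] := phi0 x ncx; rewrite h0 !mulr0 normr0.
  rewrite mulrCA mulrA normrM; apply: ler_pM => //; rewrite normrM; apply: ler_pM => //.
  by apply: le_trans (HB x cx) (ler_norm B).
pose f j x := if j == i then v x * (u x * phi x) else 0.
pose F x := v x * g i x * phi x + u x * (v x * partial phi i x).
have mF1 : measurable_fun setT (fun x => v x * g i x * phi x).
  by apply: measurable_funM => //; exact: measurable_funM.
have mF2 : measurable_fun setT (fun x => u x * (v x * partial phi i x)).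
  by apply: measurable_funM => //; exact: measurable_funM.
have [_ IF] : mu.-integrable setT (EFin \o F) /\ \int[mu]_x F x = 0.
  apply: (@integral_divergence R k h f F r (`|B| * C * M) (C * M + `|B| * C * M)).
  - move=> j; rewrite /f; case: (j == i); last exact: measurable_cst.
    by apply: measurable_funM => //; exact: measurable_funM.
  - move=> j x; rewrite /f; case: (j == i); last by rewrite normr0.
    have [cx|ncx] := pselect (cube r x); last first.
      by have [h0 _] := phi0 x ncx; rewrite h0 !mulr0 normr0.
    rewrite mulrA normrM; apply: ler_pM => //; rewrite normrM; apply: ler_pM => //.
    by apply: le_trans (HB x cx) (ler_norm B).
  - by move=> j x ncx; rewrite /f; case: (j == i) => //; have [-> _] := phi0 x ncx; rewrite !mulr0.
  - move=> j x t t0 t1; rewrite /f; case: eqVneq => [->|_]; last first.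
      by rewrite subrr normr0 mulr_ge0 ?(ltW t0)// addr_ge0// mulr_ge0// ltW.
    rewrite vs.
    pose L s := v x * (u (x + s *: base i) * phi (x + s *: base i)).
    have dL (s : R) : is_derive s 1 L (F (x + s *: base i)).
      have h1 := der_u_line i x s; have h2 := dphi i x s.
      by rewrite /L; derby; rewrite /F !vs; ring.
    have := @dist_of_der _ L (fun s => (C * M + `|B| * C * M) * s) (fun s => F (x + s *: base i)) (fun=> C * M + `|B| * C * M) 0 t (ltW t0) (fun s _ => dL s).
    rewrite /L scale0r addr0 mulr0 subr0; apply.
      by move=> s _; derby; ring.
    move=> s _; apply: le_trans (ler_normD _ _) _; apply: lerD; [exact: H1M|exact: H2M].
  - by apply: measurable_funD.
  - apply: aeW => x.
    have -> : F x = \sum_j (if j == i then F x else 0) by rewrite -big_mkcond big_pred1_eq.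
    apply: cvg_fsum => j; rewrite /f; case: eqVneq => [->|_]; last first.
      by apply: cvg_near_cst; apply: nearW => n; rewrite subrr mulr0.
    have h1 := der_u i x; have h2 := dphi i x 0; rewrite scale0r addr0 in h2.
    have hd : is_derive (0 : R) 1 (fun s => v x * (u (x + s *: base i) * phi (x + s *: base i))) (F x).
      by derby; rewrite /F !scale0r !addr0; ring.
    have := der_quot hd; rewrite scale0r addr0.
    by move=> H; under eq_fun do rewrite vs; exact: H.
have F1i : mu.-integrable setT (EFin \o (fun x => v x * g i x * phi x)).
  apply: (integrable_cube (r := r) mF1 H1M) => x ncx.
  by have [-> _] := phi0 x ncx; rewrite mulr0.
have F2i : mu.-integrable setT (EFin \o (fun x => u x * (v x * partial phi i x))).
  apply: (integrable_cube (r := r) mF2 H2M) => x ncx.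
  by have [_ ->] := phi0 x ncx; rewrite !mulr0.
by move: IF; rewrite /F RintegralD// addrC => /eqP; rewrite addr_eq0 => /eqP.
Qed.

Lemma classical_weak_grad : weak_grad alpha u grad_of_y grad_of_z.
Proof.
split.
- exact: loc_integrable_bounded u_bd.
- move=> i; apply: (loc_integrable_bounded (C := C)); last by move=> x; rewrite mxE; exact: gy_bd.
  by under eq_fun do rewrite mxE; exact: measurable_grad.
- move=> j; apply: (loc_integrable_bounded (C := C)); last by move=> x; rewrite mxE; exact: gz_bd.
  under eq_fun do rewrite mxE; apply: measurable_funM; first exact: measurable_weight.
  exact: measurable_grad.
- move=> phi tphi; split => [i|j].
  + transitivity (\int[mu]_x (u x * (1 * partial phi (inl i) x))).
      by apply: eq_Rintegral => x _; rewrite mul1r.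
    rewrite (@by_parts phi (inl i) (fun=> 1))//.
    * by congr (- _); apply: eq_Rintegral => x _; rewrite mul1r mxE.
    * by move=> r; exists 1 => x _; rewrite normr1.
    * by move=> x; rewrite mul1r.
  + rewrite (@by_parts phi (inr j) (fun x => enorm x.1 `^ alpha))//.
    * by congr (- _); apply: eq_Rintegral => x _; rewrite mxE.
    * exact: measurable_weight.
    * by move=> x t; rewrite enorm_shift.
    * move=> r; exists (Num.sqrt (\sum_(i < k) r ^+ 2) `^ alpha) => x cx.
      rewrite ger0_norm ?powR_ge0//; apply: ge0_ler_powR; rewrite ?nnegrE ?sqrtr_ge0 ?(ltW alpha_gt0)//.
      exact: enorm_cube.
Qed.

Section equation.
Variables (r0 : R) (p dp : I -> E -> R) (bad : I -> E -> Prop).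
Hypothesis pE : forall x, (forall i : 'I_k, p (inl i) x = g (inl i) x) /\
  forall j : 'I_h, p (inr j) x = (1 + alpha) ^+ 2 * enorm x.1 `^ (2 * alpha) * g (inr j) x.
Hypothesis p_cont : forall i x (t : R), {for t, continuous (fun t : R => p i (x + t *: base i))}.
Hypothesis p_der : forall i x, ~ bad i x -> is_derive (0 : R) 1 (fun t => p i (x + t *: base i)) (dp i x).
Hypothesis p_bd : forall r : R, exists B : R, forall i x, cube r x -> `|p i x| <= B.
Hypothesis dp_bd : forall r : R, exists B : R, forall i x, cube r x -> ~ bad i x -> `|dp i x| <= B.
Hypothesis bad_line : forall i x, exists s : seq R, forall t : R, bad i (x + t *: base i) -> t \in s.
Hypothesis bad_null : {ae mu, forall x, forall i, ~ bad i x}.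
Hypothesis r0_ge0 : 0 <= r0.
Hypothesis pde : forall x, (forall i, ~ bad i x) -> \sum_i dp i x = - (`|u x| `^ r0 * u x).

(** The divergence theorem for [p i * phi]. The flux may fail to be differentiable at [bad] points,
    but these are finitely many on each line and the flux is continuous along lines, so the product
    is still Lipschitz along them. *)
Lemma classical_weak_eq phi : test_fun phi ->
  \int[mu]_x (dot (grad_of_y x) (grad_y phi x) +
       (1 + alpha) ^+ 2 * enorm x.1 `^ (2 * alpha) * dot (grad_of_z x) (grad_z phi x))
    = \int[mu]_x (`|u x| `^ r0 * u x * phi x).
Proof.
move=> tphi.
have [cphi cd dphi [r [M [rr0 M0 phiM dphiM phi0]]]] := test_fun_facts tphi.
have mphi := continuous_measurable_kh cphi; have mdphi i := continuous_measurable_kh (cd i).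
have C0 : 0 <= C by apply: le_trans (u_bd 0).
have mp i : measurable_fun setT (p i).
  case: i => i.
    by rewrite (_ : p (inl i) = g (inl i)); [exact: measurable_grad|apply/funext => x; have [-> _] := pE x].
  rewrite (_ : p (inr i) = fun x => (1 + alpha) ^+ 2 * enorm x.1 `^ (2 * alpha) * g (inr i) x); last first.
    by apply/funext => x; have [_ ->] := pE x.
  apply: measurable_funM; last exact: measurable_grad.
  by apply: measurable_funM; [exact: measurable_cst|exact: measurable_weight].
have [B HB] := p_bd r; have [B' HB'] := dp_bd r.
pose A x := \sum_i p i x * partial phi i x.
pose G x := `|u x| `^ r0 * u x * phi x.
have mA : measurable_fun setT A by apply: measurable_sum => i; exact: measurable_funM.
have mG : measurable_fun setT G.
  apply: measurable_funM => //; apply: measurable_funM => //.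
  apply: (measurableT_comp (measurable_powR r0)).
  exact: measurableT_comp.
have pM i x : `|p i x * partial phi i x| <= `|B| * M.
  have [cx|ncx] := pselect (cube r x); last first.
    by have [_ ->] := phi0 x ncx; rewrite mulr0 normr0 mulr_ge0// ltW.
  by rewrite normrM; apply: ler_pM => //; apply: le_trans (HB i x cx) (ler_norm B).
have dpM i x : ~ bad i x -> `|dp i x * phi x| <= `|B'| * M.
  move=> nb; have [cx|ncx] := pselect (cube r x); last first.
    by have [-> _] := phi0 x ncx; rewrite mulr0 normr0 mulr_ge0// ltW.
  by rewrite normrM; apply: ler_pM => //; apply: le_trans (HB' i x cx nb) (ler_norm B').
have fM i x : `|p i x * phi x| <= `|B| * M.
  have [cx|ncx] := pselect (cube r x); last first.
    by have [-> _] := phi0 x ncx; rewrite mulr0 normr0 mulr_ge0// ltW.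
  by rewrite normrM; apply: ler_pM => //; apply: le_trans (HB i x cx) (ler_norm B).
have AM x : `|A x| <= \sum_(i : I) `|B| * M.
  by apply: le_trans (ler_norm_sum _ _ _) _; apply: ler_sum => i _; exact: pM.
have GM x : `|G x| <= C `^ r0 * C * M.
  rewrite /G 2!normrM ger0_norm ?powR_ge0//; apply: ler_pM => //.
  apply: ler_pM => //.
  by apply: ge0_ler_powR; rewrite ?nnegrE//; exact: le_trans (u_bd x).
have Ai : mu.-integrable setT (EFin \o A).
  apply: (integrable_cube (r := r) mA AM) => x ncx; rewrite /A big1// => i _.
  by have [_ ->] := phi0 x ncx; rewrite mulr0.
have Gi : mu.-integrable setT (EFin \o G).
  apply: (integrable_cube (r := r) mG GM) => x ncx; rewrite /G.
  by have [-> _] := phi0 x ncx; rewrite mulr0.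
pose K := `|B'| * M + `|B| * M.
have K0 : 0 <= K by rewrite addr_ge0// mulr_ge0// ltW.
have line i x (t : R) : ~ bad i (x + t *: base i) ->
    is_derive t 1 (fun t => p i (x + t *: base i) * phi (x + t *: base i))
      (dp i (x + t *: base i) * phi (x + t *: base i) + p i (x + t *: base i) * partial phi i (x + t *: base i)).
  move=> nb; have h1 := der_line0 (p_der nb) (erefl (x + t *: base i)); have h2 := dphi i x t.
  by derby.
have [_ IF] : mu.-integrable setT (EFin \o (fun x => A x - G x)) /\ \int[mu]_x (A x - G x) = 0.
  apply: (@integral_divergence R k h (fun i x => p i x * phi x) _ r (`|B| * M) K).
  - by move=> i; exact: measurable_funM.
  - exact: fM.
  - by move=> i x ncx; have [-> _] := phi0 x ncx; rewrite mulr0.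
  - move=> i x t t0 t1; have [s Hs] := bad_line i x.
    have := @lip_except _ (fun t => p i (x + t *: base i) * phi (x + t *: base i))
      (fun t => dp i (x + t *: base i) * phi (x + t *: base i) + p i (x + t *: base i) * partial phi i (x + t *: base i))
      s K 0 t (ltW t0).
    rewrite scale0r addr0 subr0; apply => //.
    + move=> y _; apply: continuousM; first exact: p_cont.
      exact: der_cont (dphi i x y).
    + move=> y _ ys; have nb : ~ bad i (x + y *: base i) by move=> /Hs; exact/negP.
      split; first exact: line.
      by apply: le_trans (ler_normD _ _) _; apply: lerD; [exact: dpM|exact: pM].
  - exact: measurable_funB.
  (* Off the null set the directional derivatives sum to the pointwise equation times [phi] plus the
     flux paired with the gradient of [phi]. *)
  - apply: filterS bad_null => x nb.
    have -> : A x - G x = \sum_i (dp i x * phi x + p i x * partial phi i x).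
      rewrite big_split/= -mulr_suml pde// /A /G mulNr addrC//.
    apply: cvg_fsum => i.
    have := line i x 0; rewrite scale0r addr0 => /(_ (nb i))/der_quot.
    by rewrite scale0r addr0.
rewrite RintegralB// in IF; move/eqP: IF; rewrite subr_eq0 => /eqP <-.
apply: eq_Rintegral => x _; rewrite /A big_sumType/=; congr (_ + _).
  by apply: eq_bigr => i _; have [-> _] := pE x; rewrite !mxE.
rewrite mulr_sumr; apply: eq_bigr => j _; have [_ ->] := pE x.
by rewrite !mxE mulrA.
Qed.

End equation.

End weak.

(** * The ansatz *)

Section radial.
Context {R : realType}.
Variables (gam a hh w M : R) (f g g2 n : R -> R).

(** The ansatz: with [r = |y|^(1+alpha)] and [T = |z|^2], [V] is [Dn^(-gam) f(S)]
    for [S = Ss r T] in [0, 1], and [Xx] is [1 - S]. Indices denote partial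
    derivatives; [g] and [g2] are the first two derivatives of [f]. *)
Definition Dn (r T : R) := (1 + r) ^+ 2 + T.
Definition Xx (r T : R) := 4 * r / Dn r T.
Definition Ss (r T : R) := 1 - Xx r T.
Definition Sr (r T : R) := - (4 * (1 - r ^+ 2 + T) / Dn r T ^+ 2).
Definition Srr (r T : R) := 8 * r / Dn r T ^+ 2 + 16 * (1 - r ^+ 2 + T) * (1 + r) / Dn r T ^+ 3.
Definition PP (r T : R) := Dn r T `^ (- gam).
Definition V (r T : R) := PP r T * f (Ss r T).
Definition Vr (r T : R) := PP r T * (- (2 * gam * (1 + r) / Dn r T) * f (Ss r T) + g (Ss r T) * Sr r T).
Definition VT (r T : R) := PP r T / Dn r T * (Xx r T * g (Ss r T) - gam * f (Ss r T)).
Definition Vrr (r T : R) := PP r T *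
  ((4 * gam * (gam + 1) * (1 + r) ^+ 2 / Dn r T ^+ 2 - 2 * gam / Dn r T) * f (Ss r T)
   + (Srr r T - 4 * gam * (1 + r) / Dn r T * Sr r T) * g (Ss r T) + Sr r T ^+ 2 * g2 (Ss r T)).
Definition VTT (r T : R) := PP r T / Dn r T ^+ 2 *
  ((gam + 1) * gam * f (Ss r T) - 2 * (gam + 1) * Xx r T * g (Ss r T) + Xx r T ^+ 2 * g2 (Ss r T)).

Lemma Dn_ge1 r T : 0 <= r -> 0 <= T -> 1 <= Dn r T.
Proof. by rewrite /Dn => r0 T0; nra. Qed.

Lemma Dn_gt0 r T : 0 <= r -> 0 <= T -> 0 < Dn r T.
Proof. by move=> r0 T0; apply: lt_le_trans (Dn_ge1 r0 T0). Qed.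

Lemma SsE r T : 0 <= r -> 0 <= T -> Ss r T = ((1 - r) ^+ 2 + T) / Dn r T.
Proof.
move=> r0 T0; rewrite /Ss /Xx; have := Dn_gt0 r0 T0.
by rewrite /Dn => D0; field; rewrite gt_eqF.
Qed.

Lemma Xx_ge0 r T : 0 <= r -> 0 <= T -> 0 <= Xx r T.
Proof. by move=> r0 T0; rewrite /Xx divr_ge0 ?mulr_ge0 ?(ltW (Dn_gt0 _ _)). Qed.

Lemma Ss_ge0 r T : 0 <= r -> 0 <= T -> 0 <= Ss r T.
Proof.
move=> r0 T0; rewrite SsE// divr_ge0 ?(ltW (Dn_gt0 r0 T0))//.
by rewrite addr_ge0// sqr_ge0.
Qed.

Lemma T_le_SD r T : 0 <= r -> 0 <= T -> T <= Ss r T * Dn r T.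
Proof.
move=> r0 T0; rewrite SsE// divfK ?gt_eqF ?Dn_gt0//.
by rewrite lerDr sqr_ge0.
Qed.

Lemma Ss01 r T : 0 < r -> 0 <= T -> ~ (r = 1 /\ T = 0) -> 0 < Ss r T < 1.
Proof.
move=> r0 T0 nb; have D0 := Dn_gt0 (ltW r0) T0; apply/andP; split; last first.
  by rewrite /Ss ltrBlDr ltrDl /Xx divr_gt0// mulr_gt0.
rewrite SsE ?(ltW r0)// divr_gt0// lt_neqAle addr_ge0 ?sqr_ge0// andbT.
rewrite eq_sym paddr_eq0 ?sqr_ge0// sqrf_eq0 subr_eq0 eq_sym.
by apply/negP => /andP[/eqP h1 /eqP h2]; apply: nb; split.
Qed.

Lemma Dn_ineq (r T : R) : 0 <= r -> 0 <= T ->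
  [/\ 1 + r <= Dn r T, - Dn r T <= 1 - r ^+ 2 + T, 1 - r ^+ 2 + T <= Dn r T & r ^+ 2 <= Dn r T].
Proof. by rewrite /Dn => r0 T0; split; nra. Qed.

Hypothesis gam_gt0 : 0 < gam.
Hypothesis a_gt0 : 0 < a.
Hypothesis hh_ge0 : 0 <= hh.
Hypothesis gamE : 2 * gam = a + hh - 1.
Hypothesis w1 : -1 < w.
Hypothesis w_lt1 : w < 1.
Hypothesis M0 : 0 < M.
Hypothesis fM : forall s, `|f s| <= M.
Hypothesis nM : forall s, `|n s| <= M.
Hypothesis ode : forall s : R, 0 < s < 1 -> [/\ is_derive s 1 f (g s), is_derive s 1 g (g2 s),
  s * (1 - s) * g2 s = a * gam / 2 * f s - (1 - s) `^ w * n s - ((hh + 1) / 2 * (1 - s) - a * s) * g s &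
  `|g s + gam / 2 * f s| <= M * ((1 - s) + (1 - s) `^ w)].

Hypothesis g_out : forall s : R, ~ 0 < s < 1 -> g s = 0.

Lemma der_V_r (r T : R) : 0 < r -> 0 <= T -> ~ (r = 1 /\ T = 0) ->
  is_derive r 1 (fun r => V r T) (Vr r T) /\ is_derive r 1 (fun r => Vr r T) (Vrr r T).
Proof.
move=> r0 T0 nb; have D0 := Dn_gt0 (ltW r0) T0; have S01 := Ss01 r0 T0 nb.
have [hf hg _ _] := ode S01.
have dD : is_derive r 1 (fun r => Dn r T) (2 * (1 + r)) by rewrite /Dn; derby; ring.
have dS : is_derive r 1 (fun r => Ss r T) (Sr r T).
  rewrite /Ss /Xx; derby; first by rewrite gt_eqF.
  rewrite /Sr; move: D0; rewrite /Dn => D0; field; rewrite ?gt_eqF//.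
have dSr : is_derive r 1 (fun r => Sr r T) (Srr r T).
  rewrite /Sr; derby; first by rewrite expf_neq0// gt_eqF.
  rewrite /Srr; move: D0; rewrite /Dn => D0; field; rewrite ?gt_eqF//.
have dP : is_derive r 1 (fun r => PP r T) (- (2 * gam * (1 + r) / Dn r T) * PP r T).
  rewrite /PP; derby => //; rewrite powRB1//; field; by rewrite gt_eqF.
have df := @derComp R f (fun r => Ss r T) r _ _ hf dS.
have dg := @derComp R g (fun r => Ss r T) r _ _ hg dS.
split.
- by rewrite /V; derby; rewrite /Vr; ring.
- rewrite /Vr; derby; first by rewrite gt_eqF.
  by rewrite /Vrr; move: D0 => D0; field; rewrite ?gt_eqF.
Qed.

(** The value [r = 0] has to be included, since lines in a [z] direction may lie in [y = 0]. There
    [S] is constantly [1] and the factor [Xx] removes [g], so no differentiability of [f] at [1] is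
    involved. *)
Lemma der_V_T (r T : R) : 0 <= r -> 0 <= T -> ~ (r = 1 /\ T = 0) ->
  is_derive T 1 (V r) (VT r T) /\ is_derive T 1 (VT r) (VTT r T).
Proof.
move=> r0 T0 nb; have D0 := Dn_gt0 r0 T0.
have dD : is_derive T 1 (fun T => Dn r T) 1 by rewrite /Dn; derby; ring.
have dP : is_derive T 1 (fun T => PP r T) (- (gam / Dn r T) * PP r T).
  rewrite /PP; derby => //; rewrite powRB1//; field; by rewrite gt_eqF.
have dX : is_derive T 1 (fun T => Xx r T) (- (Xx r T / Dn r T)).
  rewrite /Xx; derby; first by rewrite gt_eqF.
  by field; rewrite gt_eqF.
have [r00|rn0] := eqVneq r 0.
  have X0 t : Xx r t = 0 by rewrite /Xx r00 mulr0 mul0r.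
  have S1 t : Ss r t = 1 by rewrite /Ss X0 subr0.
  split.
  - rewrite (_ : V r = fun t => PP r t * f 1); last by apply/funext => t; rewrite /V S1.
    by derby; rewrite /VT X0 S1; field; rewrite gt_eqF.
  - rewrite (_ : VT r = fun t => PP r t / Dn r t * (- (gam * f 1))); last first.
      by apply/funext => t; rewrite /VT X0 S1 mul0r sub0r.
    derby; first by rewrite gt_eqF.
    by rewrite /VTT X0 S1; field; rewrite gt_eqF.
have rp : 0 < r by rewrite lt_neqAle eq_sym rn0.
have S01 := Ss01 rp T0 nb.
have [hf hg _ _] := ode S01.
have dS : is_derive T 1 (fun T => Ss r T) (Xx r T / Dn r T) by rewrite /Ss; derby; ring.
have df := @derComp R f (fun T => Ss r T) T _ _ hf dS.
have dg := @derComp R g (fun T => Ss r T) T _ _ hg dS.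
split.
- by rewrite /V; derby; rewrite /VT; field; rewrite gt_eqF.
- rewrite /VT; derby; first by rewrite gt_eqF.
  by rewrite /VTT; field; rewrite gt_eqF.
Qed.

(** The conformal change of variables: for the exponent fixed by [gamE] the operator in [r] and [T]
    collapses to [4 * PP / Dn] times an operator in [S] alone, to which the equation of the profile
    applies. *)
Lemma pde_radial (r T : R) : 0 < r -> 0 <= T -> ~ (r = 1 /\ T = 0) ->
  r * Vrr r T + a * Vr r T + r * (2 * hh * VT r T + 4 * T * VTT r T) =
  - (4 * PP r T / Dn r T * Xx r T `^ w * n (Ss r T)).
Proof.
move=> r0 T0 nb; have D0 := Dn_gt0 (ltW r0) T0; have S01 := Ss01 r0 T0 nb.
have [_ _ ho _] := ode S01.
have X1 : 1 - Ss r T = Xx r T by rewrite /Ss opprB addrC subrK.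
have hE : a = 2 * gam - hh + 1 by move: gamE; lra.
rewrite X1 in ho.
transitivity (4 * PP r T / Dn r T * (Ss r T * Xx r T * g2 (Ss r T) +
   ((hh + 1) / 2 * Xx r T - a * Ss r T) * g (Ss r T) - a * gam / 2 * f (Ss r T))).
  rewrite /Vrr /Vr /VT /VTT /Srr /Sr; move: (PP r T) (f (Ss r T)) (g (Ss r T)) (g2 (Ss r T)) => p x y z.
  rewrite hE /Ss /Xx; move: D0; rewrite /Dn => D0; field.
  by rewrite gt_eqF.
by rewrite ho; ring.
Qed.

Lemma Xx_le1 (r T : R) : 0 <= r -> 0 <= T -> Xx r T <= 1.
Proof. by move=> r0 T0; rewrite -subr_ge0; exact: Ss_ge0. Qed.

Lemma PP_le1 (r T : R) : 0 <= r -> 0 <= T -> PP r T <= 1.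
Proof.
move=> r0 T0; rewrite /PP -(powRr0 (Dn r T)); apply: ler_powR; first exact: Dn_ge1.
by rewrite oppr_le0 ltW.
Qed.

Lemma PPD_le1 (r T : R) : 0 <= r -> 0 <= T -> 0 <= PP r T / Dn r T <= 1.
Proof.
move=> r0 T0; have D1 := Dn_ge1 r0 T0; have D0 := Dn_gt0 r0 T0.
rewrite divr_ge0 ?powR_ge0 ?(ltW D0)//= ler_pdivrMr// mul1r.
exact: le_trans (PP_le1 r0 T0) D1.
Qed.

Let M1 := M * (1 + gam).
Let M10 : 0 <= M1. Proof. by rewrite /M1; pos. Qed.

Let pw_le1 (x : R) : 0 <= x -> x <= 1 -> x * x `^ w <= 1.
Proof.
move=> x0 x1; have [->|xn0] := eqVneq x 0; first by rewrite mul0r.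
have xp : 0 < x by rewrite lt_neqAle eq_sym xn0.
rewrite -[X in X * _]powRr1// -powRD; last by rewrite xn0 implybT.
have w10 : 0 <= 1 + w by move: w1; lra.
apply: (@le_trans _ _ (1 `^ (1 + w))); last by rewrite powR1.
by apply: ge0_ler_powR => //; rewrite nnegrE.
Qed.

(** The exponent [w] may be negative, so [g] may blow up at [S = 1]; the power of [Xx] records how
    fast. *)
Lemma g_bound (r T : R) : 0 < r -> 0 <= T ->
  `|g (Ss r T)| <= M1 * (1 + Xx r T `^ w).
Proof.
move=> r0 T0; have [S01|nS] := pselect (0 < Ss r T < 1); last first.
  by rewrite g_out// normr0 mulr_ge0// addr_ge0// powR_ge0.
have [_ _ _ hb] := ode S01.
have X1 : 1 - Ss r T = Xx r T by rewrite /Ss opprB addrC subrK.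
rewrite X1 in hb; have x1 := Xx_le1 (ltW r0) T0; have x0 := Xx_ge0 (ltW r0) T0.
have p0 := powR_ge0 (Xx r T) w.
have h1 : `|gam / 2 * f (Ss r T)| <= gam / 2 * M.
  by rewrite normrM ger0_norm ?divr_ge0 ?(ltW gam_gt0)// ler_wpM2l// divr_ge0// ltW.
have := ler_normB (g (Ss r T) + gam / 2 * f (Ss r T)) (gam / 2 * f (Ss r T)); rewrite addrK => h2.
apply: le_trans h2 _; apply: le_trans (lerD hb h1) _.
have h3 : M * (Xx r T + Xx r T `^ w) <= M * (1 + Xx r T `^ w) by rewrite ler_pM2l// lerD2r.
apply: le_trans (lerD h3 (lexx _)) _; rewrite /M1.
have -> : M * (1 + gam) * (1 + Xx r T `^ w) = M * (1 + Xx r T `^ w) + gam * M * (1 + Xx r T `^ w) by ring.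
rewrite lerD2l; have gM : 0 < gam * M by rewrite mulr_gt0.
have : 0 <= gam * M * Xx r T `^ w by pos.
by rewrite mulrDr mulr1 mulrAC; move: gM; lra.
Qed.

Lemma Xg_bound (r T : R) : 0 <= r -> 0 <= T ->
  `|Xx r T * g (Ss r T)| <= 2 * M1.
Proof.
move=> r0 T0; have x1 := Xx_le1 r0 T0; have x0 := Xx_ge0 r0 T0.
have [->|rn0] := eqVneq r 0; first by rewrite /Xx mulr0 mul0r mul0r normr0 mulr_ge0.
have rp : 0 < r by rewrite lt_neqAle eq_sym rn0.
rewrite normrM ger0_norm//; apply: le_trans (ler_wpM2l x0 (g_bound rp T0)) _.
have h := pw_le1 x0 x1.
have -> : Xx r T * (M1 * (1 + Xx r T `^ w)) = M1 * (Xx r T + Xx r T * Xx r T `^ w) by ring.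
by rewrite [leRHS]mulrC ler_wpM2l//; move: h x1; lra.
Qed.

Lemma VT_bound (r T : R) : 0 <= r -> 0 <= T ->
  `|VT r T| <= 2 * M1 + gam * M.
Proof.
move=> r0 T0; have /andP[h0 h1] := PPD_le1 r0 T0.
rewrite /VT normrM ger0_norm// -[leRHS]mul1r; apply: ler_pM => //.
apply: le_trans (ler_normB _ _) _; apply: lerD; first exact: Xg_bound.
by rewrite normrM ger0_norm ?(ltW gam_gt0)// ler_pM2l.
Qed.

(** The equation controls only [S * Xx * g2]. The missing factor [S] is supplied by [T <= S * Dn],
    and a remaining factor [Xx] tames the singular power, since [-1 < w]. *)
Lemma TVTT_bound : exists K : R, forall r T : R, 0 <= r -> 0 <= T -> ~ (r = 1 /\ T = 0) ->
  `|T * VTT r T| <= K.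
Proof.
pose K1 := (gam + 1) * gam * M + 2 * (gam + 1) * (2 * M1).
pose K2 := a * gam / 2 * M + M + ((hh + 1) / 2 + a) * (2 * M1).
have K10 : 0 <= K1 by rewrite /K1; pos.
have K20 : 0 <= K2 by rewrite /K2; pos.
exists (K1 + K2) => r T r0 T0 nb.
have D1 := Dn_ge1 r0 T0; have D0 := Dn_gt0 r0 T0; have TD := T_le_SD r0 T0.
have x1 := Xx_le1 r0 T0; have x0 := Xx_ge0 r0 T0; have S0 := Ss_ge0 r0 T0.
have S1 : Ss r T <= 1 by rewrite /Ss lerBlDr lerDl.
have TD' : T <= Dn r T by apply: le_trans TD _; rewrite ler_piMl ?(ltW D0).
have xg := Xg_bound r0 T0; have /andP[h0 h1] := PPD_le1 r0 T0.
have key : `|T * (Xx r T ^+ 2 * g2 (Ss r T))| <= Dn r T * K2.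
  have [rz|rn0] := eqVneq r 0.
    have X0 : Xx r T = 0 by rewrite /Xx rz mulr0 mul0r.
    by rewrite X0 expr0n/= mul0r mulr0 normr0 mulr_ge0// ltW.
  have rp : 0 < r by rewrite lt_neqAle eq_sym rn0.
  have [_ _ ho _] := ode (Ss01 rp T0 nb).
  have X1 : 1 - Ss r T = Xx r T by rewrite /Ss opprB addrC subrK.
  rewrite X1 in ho.
  rewrite normrM ger0_norm//; apply: le_trans (ler_wpM2r (normr_ge0 _) TD) _.
  have -> : Ss r T * Dn r T * `|Xx r T ^+ 2 * g2 (Ss r T)| = Dn r T * `|Xx r T * (Ss r T * Xx r T * g2 (Ss r T))|.
    have -> : Xx r T * (Ss r T * Xx r T * g2 (Ss r T)) = Ss r T * (Xx r T ^+ 2 * g2 (Ss r T)) by ring.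
    by rewrite [in RHS]normrM (ger0_norm S0); ring.
  apply: ler_wpM2l; first exact: ltW.
  rewrite ho.
  have -> : Xx r T * (a * gam / 2 * f (Ss r T) - Xx r T `^ w * n (Ss r T) -
     ((hh + 1) / 2 * Xx r T - a * Ss r T) * g (Ss r T)) =
     a * gam / 2 * (Xx r T * f (Ss r T)) - (Xx r T * Xx r T `^ w) * n (Ss r T) -
     ((hh + 1) / 2 * Xx r T - a * Ss r T) * (Xx r T * g (Ss r T)) by ring.
  have c0 : 0 <= a * gam / 2 by pos.
  have hh1 : 0 <= (hh + 1) / 2 by pos.
  apply: le_trans (ler_normB _ _) _; apply: lerD; [apply: le_trans (ler_normB _ _) _; apply: lerD|].
  - rewrite normrM ger0_norm// ler_wpM2l// normrM ger0_norm// -[leRHS]mul1r.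
    by apply: ler_pM.
  - rewrite normrM [`|_ * _ `^ _|]ger0_norm; last by rewrite mulr_ge0 ?powR_ge0.
    by rewrite -[leRHS]mul1r; apply: ler_pM => //; [rewrite mulr_ge0 ?powR_ge0|exact: pw_le1].
  - rewrite normrM; apply: ler_pM => //.
    apply: le_trans (ler_normB _ _) _; apply: lerD.
      by rewrite normrM !ger0_norm// ler_piMr.
    by rewrite normrM !ger0_norm ?(ltW a_gt0)// ler_piMr ?(ltW a_gt0).
have -> : T * VTT r T = PP r T / Dn r T * ((T * ((gam + 1) * gam * f (Ss r T) -
   2 * (gam + 1) * (Xx r T * g (Ss r T))) + T * (Xx r T ^+ 2 * g2 (Ss r T))) / Dn r T).
  by rewrite /VTT; field; rewrite gt_eqF.
rewrite normrM ger0_norm// -[leRHS]mul1r; apply: ler_pM => //.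
rewrite normrM [`|_^-1|]ger0_norm ?invr_ge0 ?(ltW D0)// ler_pdivrMr// [leRHS]mulrC [leRHS]mulrDr.
apply: le_trans (ler_normD _ _) _; apply: lerD => //.
rewrite normrM ger0_norm//; apply: ler_pM => //.
apply: le_trans (ler_normB _ _) _; apply: lerD.
- have c0 : 0 <= (gam + 1) * gam by pos.
  by rewrite normrM ger0_norm// ler_wpM2l.
- have c0 : 0 <= 2 * (gam + 1) by pos.
  by rewrite normrM ger0_norm// ler_wpM2l.
Qed.

(** At [r = 0] the two terms of [Vr] combine to a multiple of [g + gam / 2 * f], whose smallness is
    the boundary behaviour of the profile at [1]. This compensates the factor [r / |y| ^ 2] of the
    chain rule. *)
Lemma Vr_bound (r T : R) : 0 < r -> 0 <= T -> ~ (r = 1 /\ T = 0) ->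
  `|Vr r T| <= M * (6 * gam * r + 4 * (Xx r T + Xx r T `^ w)).
Proof.
move=> r0 T0 nb; have D1 := Dn_ge1 (ltW r0) T0; have D0 := Dn_gt0 (ltW r0) T0.
have [_ _ _ hb] := ode (Ss01 r0 T0 nb).
have X1 : 1 - Ss r T = Xx r T by rewrite /Ss opprB addrC subrK.
rewrite X1 in hb; have /andP[h0 h1] := PPD_le1 (ltW r0) T0.
have x0 := Xx_ge0 (ltW r0) T0; have p0 := powR_ge0 (Xx r T) w.
have q1 : 0 <= (1 + r) / Dn r T <= 1.
  rewrite divr_ge0 ?(ltW D0) ?addr_ge0 ?(ltW r0)//= ler_pdivrMr// mul1r.
  by have [] := Dn_ineq (ltW r0) T0.
have q2 : `|(1 - r ^+ 2 + T) / Dn r T| <= 1.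
  rewrite normrM [`|_^-1|]ger0_norm ?invr_ge0 ?(ltW D0)// ler_pdivrMr// mul1r ler_norml.
  by have [_ -> -> _] := Dn_ineq (ltW r0) T0.
have -> : Vr r T = PP r T / Dn r T * (- (2 * gam * r * (1 + 2 * ((1 + r) / Dn r T)) * f (Ss r T)) -
   4 * ((1 - r ^+ 2 + T) / Dn r T) * (g (Ss r T) + gam / 2 * f (Ss r T))).
  rewrite /Vr /Sr; move: (PP r T) (f (Ss r T)) (g (Ss r T)) => p x y.
  by move: D0; rewrite /Dn => D0; field; rewrite gt_eqF.
rewrite normrM ger0_norm// -[leRHS]mul1r; apply: ler_pM => //.
apply: le_trans (ler_normB _ _) _.
have -> : M * (6 * gam * r + 4 * (Xx r T + Xx r T `^ w)) = 2 * gam * r * 3 * M + 4 * 1 * (M * (Xx r T + Xx r T `^ w)) by ring.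
apply: lerD.
- rewrite normrN normrM; apply: ler_pM => //.
  have c0 : 0 <= 2 * gam * r by pos.
  move: q1 => /andP[q10 q11].
  rewrite normrM ger0_norm// ler_wpM2l// ger0_norm; first by move: q11; lra.
  by move: q10; lra.
- rewrite normrM; apply: ler_pM => //.
  by rewrite normrM ger0_norm// ler_pM2l.
Qed.

(** All powers of [r] are traded for powers of [Dn] by [r ^+ 2 <= Dn]. The contribution of [f]
    decides the exponent; those of [g] decay at least as fast. *)
Lemma energy_density_bound : exists2 K : R, 0 < K & forall r T : R, 0 < r -> 0 <= T ->
  r `^ (1 - w) * (Vr r T ^+ 2 + 4 * T * VT r T ^+ 2) <= K * Dn r T `^ (- (2 * gam + (1 + w) / 2)).
Proof.
pose c := 4 `^ (2 * w) : R; have c0 : 0 < c by rewrite /c powR_gt0.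
exists (8 * gam ^+ 2 * M ^+ 2 + 64 * M1 ^+ 2 * (1 + c) + 1); first by pos.
move=> r T r0 T0; have D1 := Dn_ge1 (ltW r0) T0; have D0 := Dn_gt0 (ltW r0) T0.
set ex := - (2 * gam + _); set D := Dn r T in D1 D0 *.
have S0 := Ss_ge0 (ltW r0) T0; have S1 : Ss r T <= 1 by rewrite /Ss lerBlDr lerDl Xx_ge0// ltW.
have x0 : 0 < Xx r T by rewrite /Xx divr_gt0// mulr_gt0.
have P2 : PP r T ^+ 2 = D `^ (- (2 * gam)).
  by rewrite /PP expr2 -powRDpos//; congr (_ `^ _); ring.
have De : 0 < D `^ ex by exact: powR_gt0.
have mono (y z : R) : y <= z -> D `^ y <= D `^ z by move=> h; apply: ler_powR.
have rD : r ^+ 2 <= D by have [] := Dn_ineq (ltW r0) T0.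
have rpow (y : R) : 0 <= y -> r `^ y <= D `^ (y / 2).
  move=> y0; have -> : r `^ y = (r ^+ 2) `^ (y / 2).
    by rewrite -powR_mulrn ?(ltW r0)// -powRrM; congr (_ `^ _); field.
  by apply: ge0_ler_powR; rewrite ?nnegrE ?divr_ge0 ?sqr_ge0 ?(ltW D0).
have PD : 0 < PP r T by exact: powR_gt0.
have w20 : 0 <= 1 - w by move: w_lt1; lra.
have w30 : 0 <= 1 + w by move: w1; lra.
set y := Xx r T `^ w.
have y0 : 0 < y by exact: powR_gt0.
have E1 : r `^ (1 - w) * (PP r T ^+ 2 / D) <= D `^ ex.
  rewrite P2 -powRB1//; apply: le_trans (ler_wpM2r (powR_ge0 _ _) (rpow _ w20)) _.
  by rewrite -powRDpos//; apply: mono; rewrite /ex; move: w1; lra.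
have DD : PP r T ^+ 2 / D ^+ 2 <= PP r T ^+ 2 / D.
  rewrite ler_pM2l ?exprn_gt0// lef_pV2 ?posrE ?exprn_gt0//.
  by rewrite expr2 ler_peMl// ltW.
have E2 : r `^ (1 - w) * (PP r T ^+ 2 / D ^+ 2) <= D `^ ex.
  by apply: le_trans E1; rewrite ler_wpM2l ?powR_ge0.
have E3 : r `^ (1 - w) * (y ^+ 2 * (PP r T ^+ 2 / D ^+ 2)) <= c * D `^ ex.
  have -> : y ^+ 2 = c * r `^ (2 * w) * D `^ (- (2 * w)).
    rewrite /y expr2 -powRDpos// (_ : w + w = 2 * w); last by ring.
    rewrite /Xx powRM ?mulr_ge0 ?invr_ge0 ?(ltW r0) ?(ltW D0)// powRM ?(ltW r0)// -/D /c.
    by rewrite powRN -powR_inv1 ?(ltW D0)// -powRrM mulN1r powRN.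
  have -> : r `^ (1 - w) * (c * r `^ (2 * w) * D `^ (- (2 * w)) * (PP r T ^+ 2 / D ^+ 2)) =
     c * (r `^ (1 - w) * r `^ (2 * w) * (D `^ (- (2 * w)) * (PP r T ^+ 2 / D ^+ 2))) by ring.
  rewrite ler_pM2l// -powRDpos// (_ : 1 - w + 2 * w = 1 + w); last by ring.
  have -> : PP r T ^+ 2 / D ^+ 2 = D `^ (- (2 * gam) - 1 - 1).
    by rewrite P2 !powRB1//; field; rewrite gt_eqF.
  rewrite -powRDpos//; apply: le_trans (ler_wpM2r (powR_ge0 _ _) (rpow _ w30)) _.
  by rewrite -powRDpos//; apply: mono; rewrite /ex; move: w1; lra.
have gb := g_bound r0 T0; rewrite -/y in gb.
have g2b : g (Ss r T) ^+ 2 <= M1 ^+ 2 * (2 + 2 * y ^+ 2).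
  rewrite -real_normK ?num_real//; apply: (@le_trans _ _ ((M1 * (1 + y)) ^+ 2)).
    by rewrite lerXn2r// nnegrE// mulr_ge0// addr_ge0// ltW.
  rewrite exprMn ler_wpM2l ?sqr_ge0//.
  have -> : 2 + 2 * y ^+ 2 = (1 + y) ^+ 2 + (1 - y) ^+ 2 by ring.
  by rewrite lerDl sqr_ge0.
have f2b : f (Ss r T) ^+ 2 <= M ^+ 2.
  by rewrite -real_normK ?num_real// lerXn2r// nnegrE// ltW.
(* The parallelogram inequality for the parts with [f] and with [g]: the squared gradients of [PP]
   and of [S] are [4 * gam ^+ 2 * PP ^+ 2 / Dn] and [16 * S / Dn ^+ 2], and the difference of the
   two sides is a sum of squares. *)
have A1 : Vr r T ^+ 2 + 4 * T * VT r T ^+ 2 <=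
   PP r T ^+ 2 / D * (8 * gam ^+ 2 * f (Ss r T) ^+ 2) + PP r T ^+ 2 / D ^+ 2 * (32 * Ss r T * g (Ss r T) ^+ 2).
  rewrite -subr_ge0.
  have -> : PP r T ^+ 2 / D * (8 * gam ^+ 2 * f (Ss r T) ^+ 2) + PP r T ^+ 2 / D ^+ 2 * (32 * Ss r T * g (Ss r T) ^+ 2) -
      (Vr r T ^+ 2 + 4 * T * VT r T ^+ 2) =
     PP r T ^+ 2 * ((- (2 * gam * (1 + r) / D * f (Ss r T)) - g (Ss r T) * Sr r T) ^+ 2 +
       4 * T * ((gam / D * f (Ss r T) + Xx r T / D * g (Ss r T)) ^+ 2)).
    rewrite /Vr /VT /Sr -/D; move: (PP r T) (f (Ss r T)) (g (Ss r T)) => p x z.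
    rewrite /Ss /Xx -/D; move: D0; rewrite /D /Dn => D0; field.
    by rewrite gt_eqF.
  by rewrite mulr_ge0 ?sqr_ge0// addr_ge0 ?sqr_ge0// mulr_ge0 ?sqr_ge0// mulr_ge0.
have A2 : Vr r T ^+ 2 + 4 * T * VT r T ^+ 2 <=
   PP r T ^+ 2 / D * (8 * gam ^+ 2 * M ^+ 2) + PP r T ^+ 2 / D ^+ 2 * (32 * (M1 ^+ 2 * (2 + 2 * y ^+ 2))).
  have PD0 : 0 <= PP r T ^+ 2 / D by rewrite divr_ge0 ?sqr_ge0// ltW.
  have PD2 : 0 <= PP r T ^+ 2 / D ^+ 2 by rewrite divr_ge0 ?sqr_ge0.
  apply: le_trans A1 _; apply: lerD; apply: ler_wpM2l => //.
    by apply: ler_wpM2l => //; rewrite mulr_ge0 ?sqr_ge0.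
  rewrite -mulrA; apply: ler_wpM2l => //; apply: le_trans g2b.
  by rewrite ler_piMl ?sqr_ge0.
apply: le_trans (ler_wpM2l (powR_ge0 _ _) A2) _.
have -> : r `^ (1 - w) * (PP r T ^+ 2 / D * (8 * gam ^+ 2 * M ^+ 2) +
    PP r T ^+ 2 / D ^+ 2 * (32 * (M1 ^+ 2 * (2 + 2 * y ^+ 2)))) =
  8 * gam ^+ 2 * M ^+ 2 * (r `^ (1 - w) * (PP r T ^+ 2 / D)) + 64 * M1 ^+ 2 *
  (r `^ (1 - w) * (PP r T ^+ 2 / D ^+ 2) + r `^ (1 - w) * (y ^+ 2 * (PP r T ^+ 2 / D ^+ 2))) by ring.
have -> : (8 * gam ^+ 2 * M ^+ 2 + 64 * M1 ^+ 2 * (1 + c) + 1) * D `^ ex =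
  8 * gam ^+ 2 * M ^+ 2 * D `^ ex + 64 * M1 ^+ 2 * (D `^ ex + c * D `^ ex) + D `^ ex by ring.
rewrite -[leLHS]addr0; apply: lerD; last exact: ltW.
have c1 : 0 <= 8 * gam ^+ 2 * M ^+ 2 by rewrite mulr_ge0 ?sqr_ge0// mulr_ge0 ?sqr_ge0.
have c2 : 0 <= 64 * M1 ^+ 2 by rewrite mulr_ge0 ?sqr_ge0.
apply: lerD; first by apply: ler_wpM2l.
by apply: ler_wpM2l => //; exact: lerD.
Qed.

End radial.

(** * The ansatz in the original variables *)

Section one_dim.
Context {R : realType}.
Implicit Types (F H : R -> R).

Lemma squeeze0 F H : F 0 = 0 -> H 0 = 0 -> {for 0, continuous H} ->
  (\forall t \near (0 : R), `|F t| <= H t) -> {for 0, continuous F}.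
Proof.
move=> F0 H0 cH FH; rewrite /prop_for /continuous_at F0; apply/cvgrPdist_le => e e0.
have cH2 : H t @[t --> (0 : R)] --> H 0 := cH.
rewrite H0 in cH2; have /cvgrPdist_le/(_ _ e0) cH' := cH2.
near=> t.
rewrite sub0r normrN; have h1 : `|F t| <= H t by near: t.
apply: le_trans h1 _; have : `|0 - H t| <= e by near: t.
by rewrite sub0r normrN; apply: le_trans; exact: ler_norm.
Unshelve. all: by end_near. Qed.

(** Removes an exceptional point: a derivative known off a finite set and extending continuously to
    [0] is the derivative at [0] as well. *)
Lemma der_of_cont F H (s : seq R) : (forall t : R, {for t, continuous F}) ->
  (forall t : R, t \notin s -> is_derive t 1 F (H t)) -> {for 0, continuous H} ->
  is_derive (0 : R) 1 F (H 0).
Proof.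
move=> cF dF cH; apply/der_eps => e e0.
have := cH; rewrite /continuous_at => /cvgrPdist_le/(_ _ e0)/nbhs_ballP[r r0 Hr].
exists r => // y; rewrite subr0 => yr.
have key a b : a <= b -> `|a| < r -> `|b| < r -> `|(F b - H 0 * b) - (F a - H 0 * a)| <= e * (b - a).
  move=> ab ar br.
  apply: (@lip_except _ (fun t => F t - H 0 * t) (fun t => H t - H 0) s e a b ab); last exact: ltW.
    move=> t _; apply: continuousB; first exact: cF.
    by apply: continuousM; [exact: cvg_cst|exact: cvg_id].
  move=> t /andP[ta tb] ts; split; first by have h := dF t ts; derby; ring.
  rewrite distrC; apply: Hr; rewrite /ball/= sub0r normrN.
  move: ar br; rewrite !ltr_norml => /andP[a1 a2] /andP[b1 b2].
  by rewrite (lt_trans a1 ta) (lt_trans tb b2).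
have [y0|/ltW y0] := leP 0 y.
- have := key 0 y y0; rewrite normr0 => /(_ r0 yr); rewrite mulr0 !subr0 (ger0_norm y0).
  by rewrite (_ : F y - H 0 * y - F 0 = F y - F 0 - H 0 * y)//; ring.
- have := key y 0 y0 yr; rewrite normr0 => /(_ r0); rewrite mulr0 subr0 sub0r (ler0_norm y0).
  by rewrite (_ : F 0 - (F y - H 0 * y) = - (F y - F 0 - H 0 * y)) ?normrN//; ring.
Qed.

Lemma continuous_normX (r : R) : 0 < r -> continuous (fun t : R => `|t| `^ r).
Proof.
move=> r0 x; have [->|xn0] := eqVneq x 0; last first.
  apply: (@continuous_comp _ _ _ (fun t : R => `|t|) (fun t => t `^ r)); first exact: norm_continuous.
  by apply: der_cont; apply: is_derive1_powR; rewrite normr_gt0.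
rewrite /continuous_at normr0 powR0 ?gt_eqF//; apply/cvgrPdist_le => e e0.
have [d d0 Hd] := pow_small r0 e0.
near=> t; rewrite sub0r normrN ger0_norm ?powR_ge0//.
have td : `|t| <= d by near: t; exists d => //= s /=; rewrite sub0r normrN => /ltW.
exact: Hd.
Unshelve. all: by end_near. Qed.

End one_dim.

Section geometry.
Context {R : realType} {k h : nat}.
Local Notation E := ('rV[R]_k * 'rV[R]_h)%type.
Local Notation I := ('I_k + 'I_h)%type.
Local Notation mu := (@lebesgue_kh R k h).
Implicit Types (x : E).

Definition sqy x : R := \sum_(i < k) (x.1 ord0 i) ^+ 2.
Definition sqz x : R := \sum_(j < h) (x.2 ord0 j) ^+ 2.

Lemma sqy_ge0 x : 0 <= sqy x. Proof. by apply: sumr_ge0 => i _; exact: sqr_ge0. Qed.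
Lemma sqz_ge0 x : 0 <= sqz x. Proof. by apply: sumr_ge0 => i _; exact: sqr_ge0. Qed.

Lemma sqy_ge x (i : 'I_k) : crd (inl i) x ^+ 2 <= sqy x.
Proof. by rewrite /sqy (bigD1 i)//= lerDl sumr_ge0// => j _; exact: sqr_ge0. Qed.

Lemma sqz_ge x (j : 'I_h) : crd (inr j) x ^+ 2 <= sqz x.
Proof. by rewrite /sqz (bigD1 j)//= lerDl sumr_ge0// => i _; exact: sqr_ge0. Qed.

Lemma enorm_sqy x (r : R) : enorm x.1 `^ (2 * r) = sqy x `^ r.
Proof.
rewrite /enorm -/(sqy x) powRrM powR_mulrn ?sqrtr_ge0//.
by rewrite sqr_sqrtr// sqy_ge0.
Qed.

Lemma sqy_liney x (i : 'I_k) (t : R) : sqy (x + t *: base (inl i)) = sqy x + 2 * t * crd (inl i) x + t ^+ 2.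
Proof.
rewrite /sqy (bigD1 i)//= [in RHS](bigD1 i)//=.
have H (l : 'I_k) : (x + t *: base (inl i)).1 ord0 l = x.1 ord0 l + t * (l == i)%:R.
  by have := crd_shift (inl l) (inl i) t x.
rewrite (eq_bigr (fun l => x.1 ord0 l ^+ 2)) => [|l /negbTE li]; last by rewrite H li mulr0 addr0.
by rewrite H eqxx mulr1; ring.
Qed.

Lemma sqz_liney x (i : 'I_k) (t : R) : sqz (x + t *: base (inl i)) = sqz x.
Proof. by apply: eq_bigr => l _; have := crd_shift (inr l) (inl i) t x; rewrite /= => ->; rewrite mulr0 addr0. Qed.

Lemma sqz_linez x (j : 'I_h) (t : R) : sqz (x + t *: base (inr j)) = sqz x + 2 * t * crd (inr j) x + t ^+ 2.
Proof.
rewrite /sqz (bigD1 j)//= [in RHS](bigD1 j)//=.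
have H (l : 'I_h) : (x + t *: base (inr j)).2 ord0 l = x.2 ord0 l + t * (l == j)%:R.
  by have := crd_shift (inr l) (inr j) t x.
rewrite (eq_bigr (fun l => x.2 ord0 l ^+ 2)) => [|l /negbTE li]; last by rewrite H li mulr0 addr0.
by rewrite H eqxx mulr1; ring.
Qed.

Lemma sqy_linez x (j : 'I_h) (t : R) : sqy (x + t *: base (inr j)) = sqy x.
Proof. by apply: eq_bigr => l _; have := crd_shift (inl l) (inr j) t x; rewrite /= => ->; rewrite mulr0 addr0. Qed.

Lemma continuous_sqy : continuous sqy.
Proof.
move=> x; apply: cvg_fsum => i; rewrite expr2; under eq_fun do rewrite expr2.
by apply: cvgM; exact: (@continuous_crd _ _ _ (inl i)).
Qed.

Lemma continuous_sqz : continuous sqz.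
Proof.
move=> x; apply: cvg_fsum => i; rewrite expr2; under eq_fun do rewrite expr2.
by apply: cvgM; exact: (@continuous_crd _ _ _ (inr i)).
Qed.

Lemma line_cont (u : E -> R) x (i : I) (t : R) : continuous u -> {for t, continuous (fun t : R => u (x + t *: base i))}.
Proof.
move=> cu; apply: (@continuous_comp _ _ _ (fun t : R => x + t *: base i)); last exact: cu.
by apply: cvgD; [exact: cvg_cst|apply: cvgZr_tmp; exact: cvg_id].
Qed.

End geometry.

Arguments crd : simpl never.
Arguments base : simpl never.

Lemma sum_affine (R : realType) (n : nat) (A B : R) (v : 'I_n -> R) :
  \sum_i (A + v i * B) = n%:R * A + (\sum_i v i) * B.
Proof. by rewrite big_split/= -mulr_suml sumr_const card_ord -[_ *+ n]mulr_natl. Qed.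

Section solution.
Context {R : realType} {k h : nat}.
Local Notation E := ('rV[R]_k * 'rV[R]_h)%type.
Local Notation I := ('I_k + 'I_h)%type.
Local Notation mu := (@lebesgue_kh R k h).
Implicit Types (x : E).
Variables (m gam a w N M r0 : R) (f g g2 n : R -> R).

Local Notation V := (V gam f).
Local Notation Vr := (Vr gam f g).
Local Notation VT := (VT gam f g).
Local Notation Vrr := (Vrr gam f g g2).
Local Notation VTT := (VTT gam f g g2).

(** [m] is [(1 + alpha) / 2], so that [rh x = |y|^(1+alpha)]. [Ue] and [Uee] are
    derivatives of [bubble] with respect to [sqy x = |y|^2]. [gg i] is the partial
    derivative of [bubble], [pp i] a component of the flux of the equation, and
    [dgg i], [dpp i] are their derivatives in the direction [base i], which may
    fail to exist only on [bad i], where [y = 0] or [S = 0]. *)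
Definition rh x : R := sqy x `^ m.
Definition bubble x : R := N * V (rh x) (sqz x).
Local Notation uu := bubble.
Definition Ue x : R := N * Vr (rh x) (sqz x) * (m * (rh x / sqy x)).
Definition Uee x : R := N * (Vrr (rh x) (sqz x) * (m * (rh x / sqy x)) ^+ 2 +
  Vr (rh x) (sqz x) * (m * (m - 1) * (rh x / sqy x ^+ 2))).
Definition gg (i : I) x : R :=
  match i with
  | inl i => 2 * crd (inl i) x * Ue x
  | inr j => 2 * crd (inr j) x * (N * VT (rh x) (sqz x))
  end.
Definition pp (i : I) x : R :=
  match i with
  | inl i => gg (inl i) x
  | inr j => (2 * m) ^+ 2 * sqy x `^ (2 * m - 1) * gg (inr j) x
  end.
Definition dgg (i : I) x : R :=
  match i with
  | inl i => 2 * Ue x + 4 * crd (inl i) x ^+ 2 * Uee x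
  | inr j => N * (2 * VT (rh x) (sqz x) + 4 * crd (inr j) x ^+ 2 * VTT (rh x) (sqz x))
  end.
Definition dpp (i : I) x : R :=
  match i with
  | inl i => dgg (inl i) x
  | inr j => (2 * m) ^+ 2 * sqy x `^ (2 * m - 1) * dgg (inr j) x
  end.
Definition bad (i : I) x : Prop :=
  (if i is inl _ then sqy x = 0 else False) \/ (rh x = 1 /\ sqz x = 0).

Hypothesis m2 : 1 / 2 < m.
Hypothesis gam_gt0 : 0 < gam.
Hypothesis a_gt0 : 0 < a.
Hypothesis aE : a = 1 + (k%:R - 2) / (2 * m).
Hypothesis gamE : 2 * gam = a + h%:R - 1.
Hypothesis wE : w = m^-1 - 1.
Hypothesis M_gt0 : 0 < M.
Hypothesis fM : forall s, `|f s| <= M.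
Hypothesis nM : forall s, `|n s| <= M.
Hypothesis cf : continuous f.
Hypothesis ode : forall s : R, 0 < s < 1 -> [/\ is_derive s 1 f (g s), is_derive s 1 g (g2 s),
  s * (1 - s) * g2 s = a * gam / 2 * f s - (1 - s) `^ w * n s - ((h%:R + 1) / 2 * (1 - s) - a * s) * g s &
  `|g s + gam / 2 * f s| <= M * ((1 - s) + (1 - s) `^ w)].
(* This choice of the value of [g] at [S = 0] and [S = 1] makes [gg] the gradient
   there as well. *)
Hypothesis g_out : forall s : R, ~ 0 < s < 1 -> g s = 0.
Hypothesis r0_gt0 : 0 < r0.
Hypothesis gamr0 : gam * r0 = m^-1.
Hypothesis N_gt0 : 0 < N.
Hypothesis Nr0 : N `^ r0 = 4 * m ^+ 2 * 4 `^ m^-1.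
Hypothesis nE : forall s, n s = `|f s| `^ r0 * f s.

Let m0 : 0 < m. Proof. by apply: lt_trans m2; rewrite divr_gt0. Qed.
Let w1 : -1 < w. Proof. by rewrite wE ltrBrDr addNr invr_gt0. Qed.
Let w_lt1 : w < 1.
Proof.
rewrite wE ltrBlDr; rewrite -[X in _ < X]invrK ltf_pV2 ?posrE ?invr_gt0//.
by move: m2; rewrite div1r.
Qed.
Let h0 : 0 <= h%:R :> R. Proof. by []. Qed.

Lemma rh_ge0 x : 0 <= rh x. Proof. exact: powR_ge0. Qed.
Lemma rh_gt0 x : 0 < sqy x -> 0 < rh x. Proof. exact: powR_gt0. Qed.

Lemma continuous_rh : continuous rh.
Proof.
move=> x; rewrite (_ : rh = fun x => `|sqy x| `^ m); last first.
  by apply/funext => y; rewrite ger0_norm ?sqy_ge0.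
apply: (@continuous_comp _ _ _ sqy (fun t => `|t| `^ m)); first exact: continuous_sqy.
exact: continuous_normX.
Qed.

Lemma continuous_uu : continuous uu.
Proof.
move=> x; have D0 := Dn_gt0 (rh_ge0 x) (sqz_ge0 x).
have cD : Dn (rh y) (sqz y) @[y --> x] --> Dn (rh x) (sqz x).
  rewrite /Dn; apply: cvgD; last exact: continuous_sqz.
  rewrite expr2; under eq_fun do rewrite expr2.
  by apply: cvgM; (apply: cvgD; [exact: cvg_cst|exact: continuous_rh]).
apply: cvgM; first exact: cvg_cst.
apply: cvgM.
  apply: (cvg_comp _ (fun t : R => t `^ (- gam)) cD).
  have c : {for Dn (rh x) (sqz x), continuous (fun t : R => t `^ (- gam))}.
    by apply: der_cont; exact: is_derive1_powR.
  exact: c.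
have cS : Ss (rh y) (sqz y) @[y --> x] --> Ss (rh x) (sqz x); last first.
  by apply: (cvg_comp _ f cS); exact: cf.
apply: cvgB; first exact: cvg_cst.
apply: cvgM; first by apply: cvgM; [exact: cvg_cst|exact: continuous_rh].
by apply: cvgV => //; rewrite gt_eqF.
Qed.

Lemma cvg_sqr (T : Type) (F : set_system T) (FF : Filter F) (G : T -> R) (l : R) :
  G t @[t --> F] --> l -> G t ^+ 2 @[t --> F] --> l ^+ 2.
Proof. by move=> H; rewrite expr2; exact: cvgM. Qed.

Let line0 x (i : I) : x + (0 : R) *: base i = x.
Proof. by rewrite scale0r addr0. Qed.

Lemma der_comp0 (F G : R -> R) (z d b : R) : is_derive z 1 F d -> G 0 = z -> is_derive (0 : R) 1 G b ->
  is_derive (0 : R) 1 (fun t => F (G t)) (d * b).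
Proof. by move=> hF Gz hG; rewrite -Gz in hF; exact: derComp. Qed.

Lemma der_sqy x (i : 'I_k) : is_derive (0 : R) 1 (fun t : R => sqy (x + t *: base (inl i))) (2 * crd (inl i) x).
Proof.
rewrite (_ : (fun t : R => _) = fun t => sqy x + 2 * t * crd (inl i) x + t ^+ 2); last first.
  by apply/funext => t; rewrite sqy_liney.
by derby; ring.
Qed.

Lemma der_sqz x (j : 'I_h) : is_derive (0 : R) 1 (fun t : R => sqz (x + t *: base (inr j))) (2 * crd (inr j) x).
Proof.
rewrite (_ : (fun t : R => _) = fun t => sqz x + 2 * t * crd (inr j) x + t ^+ 2); last first.
  by apply/funext => t; rewrite sqz_linez.
by derby; ring.
Qed.

Lemma der_crd x (i : I) : is_derive (0 : R) 1 (fun t : R => crd i (x + t *: base i)) 1.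
Proof.
rewrite (_ : (fun t : R => _) = fun t => crd i x + t); last first.
  by apply/funext => t; rewrite crd_shift eqxx mulr1.
by derby; ring.
Qed.

Lemma der_rh x (i : 'I_k) : 0 < sqy x ->
  is_derive (0 : R) 1 (fun t : R => rh (x + t *: base (inl i))) (m * (rh x / sqy x) * (2 * crd (inl i) x)).
Proof.
move=> e0; have := @der_comp0 (fun s => s `^ m) (fun t => sqy (x + t *: base (inl i))) (sqy x) _ _
  (is_derive1_powR m e0) _ (der_sqy x i).
rewrite line0 => /(_ erefl) H; rewrite /rh; notypeclasses refine (derE H _).
by rewrite powRB1//; ring.
Qed.

Lemma der_uu_good (i : I) x : ~ bad i x ->
  is_derive (0 : R) 1 (fun t => uu (x + t *: base i)) (gg i x) /\
  is_derive (0 : R) 1 (fun t => gg i (x + t *: base i)) (dgg i x).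
Proof.
case: i => i nb.
- have e0 : 0 < sqy x.
    by rewrite lt_neqAle sqy_ge0 andbT eq_sym; apply/eqP => e0; apply: nb; left.
  have nb' : ~ (rh x = 1 /\ sqz x = 0) by move=> H; apply: nb; right.
  have [hV hVr] := der_V_r ode (rh_gt0 e0) (sqz_ge0 x) nb'.
  have dr := der_rh i e0; have de := der_sqy x i; have dc := der_crd x (inl i).
  have hV' := @der_comp0 _ (fun t => rh (x + t *: base (inl i))) _ _ _ hV (congr1 rh (line0 x (inl i))) dr.
  have hVr' := @der_comp0 _ (fun t => rh (x + t *: base (inl i))) _ _ _ hVr (congr1 rh (line0 x (inl i))) dr.
  split.
  + rewrite /uu; under eq_fun do rewrite sqz_liney.
    by derby; rewrite /Ue; ring.
  + rewrite /gg /Ue; under eq_fun do rewrite sqz_liney.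
    derby; first by rewrite !line0 gt_eqF.
    rewrite !line0 /Ue /Uee; move: (crd _ x) (rh x) (Vr _ _) (Vrr _ _) => c r A B; field.
    by rewrite gt_eqF.
- have nb' : ~ (rh x = 1 /\ sqz x = 0) by move=> H; apply: nb; right.
  have [hV hVT] := der_V_T ode (rh_ge0 x) (sqz_ge0 x) nb'.
  have de := der_sqz x i; have dc := der_crd x (inr i).
  have hV' := @der_comp0 _ (fun t => sqz (x + t *: base (inr i))) _ _ _ hV (congr1 sqz (line0 x (inr i))) de.
  have hVT' := @der_comp0 _ (fun t => sqz (x + t *: base (inr i))) _ _ _ hVT (congr1 sqz (line0 x (inr i))) de.
  have rl t : rh (x + t *: base (inr i)) = rh x by rewrite /rh sqy_linez.
  split.
  + rewrite /uu; under eq_fun do rewrite rl.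
    by derby; ring.
  + rewrite /gg; under eq_fun do rewrite rl.
    by derby; rewrite !line0; ring.
Qed.

(** Along a line in a [y] direction [|y| ^ 2] is a quadratic polynomial, with one possible root for
    the value [0] and two for the value [1]. Along a [z] direction [z = 0] fixes the parameter. *)
Lemma bad_line (i : I) x : exists s : seq R, forall t : R, bad i (x + t *: base i) -> t \in s.
Proof.
have rh1 y : rh y = 1 -> sqy y = 1.
  move=> r1; have : (rh y) `^ m^-1 = 1 by rewrite r1 powR1.
  by rewrite /rh -powRrM mulfV ?gt_eqF// powRr1// sqy_ge0.
case: i => i.
- pose c := crd (inl i) x.
  have E t : sqy (x + t *: base (inl i)) = (sqy x - c ^+ 2) + (t + c) ^+ 2.
    by rewrite sqy_liney /c; ring.
  pose s := Num.sqrt (1 - (sqy x - c ^+ 2)).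
  exists [:: - c; s - c; - s - c] => t [h1|[/rh1 h1 _]]; rewrite !inE.
  + have h2 := sqy_ge x i; rewrite -/c in h2.
    have h3 : (t + c) ^+ 2 = 0.
      by apply/eqP; rewrite eq_le sqr_ge0 andbT; move: h1 h2; rewrite E; lra.
    by move/eqP: h3; rewrite sqrf_eq0 addr_eq0 => ->.
  + have h3 : (t + c) ^+ 2 = 1 - (sqy x - c ^+ 2) by move: h1; rewrite E => <-; ring.
    have h4 : s = `|t + c| by rewrite /s -h3 sqrtr_sqr.
    rewrite h4; have [tc|tc] := ger0P (t + c); first by rewrite addrK eqxx orbT.
    by rewrite opprK addrK eqxx !orbT.
- exists [:: - crd (inr i) x] => t [//|[_ h1]]; rewrite inE -addr_eq0.
  have := sqz_ge (x + t *: base (inr i)) i; rewrite h1 crd_shift eqxx mulr1 => h2.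
  by rewrite addrC -sqrf_eq0 eq_le sqr_ge0 andbT.
Qed.

(** Since [w + 1 = 1 / m], the power [r ^ (w + 1)] is exactly [|y| ^ 2], so the possible singularity
    of [Xx ^ w] at [y = 0] cancels against the chain rule. *)
Lemma Xw_eq x : 0 < sqy x ->
  Xx (rh x) (sqz x) `^ w * (rh x / sqy x) = (4 / Dn (rh x) (sqz x)) `^ w.
Proof.
move=> e0; have rp := rh_gt0 e0; have D0 := Dn_gt0 (ltW rp) (sqz_ge0 x).
rewrite /Xx mulrAC powRM ?divr_ge0 ?(ltW D0) ?(ltW rp)//.
suff one : rh x `^ w * (rh x / sqy x) = 1 by rewrite -mulrA one mulr1.
rewrite /rh -powRrM (_ : m * w = 1 - m); last by rewrite wE mulrBr divff ?gt_eqF ?mulr1.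
by rewrite mulrA -powRDpos// subrK powRr1 ?divff ?gt_eqF// ltW.
Qed.

Lemma rr_eq x : 0 < sqy x -> rh x * (rh x / sqy x) = sqy x `^ (2 * m - 1).
Proof.
by move=> e0; rewrite powRB1// /rh (_ : 2 * m = m + m) ?powRDpos ?mulrA//; ring.
Qed.

(** Of the three terms from [Vr_bound], two carry an extra factor [r], bounded through [rr_eq]; the
    third is handled by [Xw_eq], with [|w|] covering both signs of the exponent. *)
Lemma Ue_bound (B : R) : exists2 K : R, 0 <= K & forall x, 0 < sqy x -> sqy x <= B -> sqz x <= B ->
  ~ (rh x = 1 /\ sqz x = 0) -> `|Ue x| <= K.
Proof.
pose B1 := `|B|; pose DB := (1 + B1 `^ m) ^+ 2 + B1.
pose c := B1 `^ (2 * m - 1).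
pose K := 4 * (4 * DB) `^ `|w|.
have B10 : 0 <= B1 by exact: normr_ge0.
have c0 : 0 <= c by exact: powR_ge0.
have K0 : 0 <= K by rewrite mulr_ge0// powR_ge0.
exists (N * M * m * (6 * gam * c + 16 * c + K)); first by pos.
move=> x e0 eB tB nb; have rp := rh_gt0 e0; have t0 := sqz_ge0 x.
have D1 := Dn_ge1 (ltW rp) t0; have D0 := Dn_gt0 (ltW rp) t0.
have hV := Vr_bound gam_gt0 fM ode rp t0 nb.
have eB1 : sqy x <= B1 by apply: le_trans eB (ler_norm _).
have rr : rh x * (rh x / sqy x) <= c.
  rewrite rr_eq//; apply: ge0_ler_powR; rewrite ?nnegrE ?(ltW e0)//.
  by move: m2; lra.
have Xr : Xx (rh x) (sqz x) <= 4 * rh x.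
  by rewrite /Xx ler_pdivrMr// ler_peMr// mulr_ge0// ltW.
have q0 : 0 <= rh x / sqy x by rewrite divr_ge0 ?ltW.
have DD : Dn (rh x) (sqz x) <= DB.
  rewrite /Dn /DB; apply: lerD; last by apply: le_trans tB (ler_norm _).
  have rb : rh x <= B1 `^ m by apply: ge0_ler_powR; rewrite ?nnegrE ?(ltW e0)// ltW.
  by rewrite lerXn2r ?nnegrE ?addr_ge0 ?powR_ge0 ?rh_ge0// lerD2l.
have Xw : Xx (rh x) (sqz x) `^ w * (rh x / sqy x) <= (4 * DB) `^ `|w|.
  rewrite Xw_eq//.
  have DB1 : 1 <= DB by apply: le_trans D1 DD.
  have DB0 : 0 < 4 * DB by rewrite mulr_gt0// (lt_le_trans ltr01).
  have z0 : 0 < 4 / Dn (rh x) (sqz x) by rewrite divr_gt0.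
  have [w0|w0] := ger0P w.
    apply: ge0_ler_powR; rewrite ?nnegrE ?(ltW z0) ?(ltW DB0)//.
    rewrite ler_pdivrMr// -mulrA ler_peMr// mulr_ege1//.
  have w0' : 0 <= - w by rewrite oppr_ge0 ltW.
  rewrite -[X in _ `^ X <= _]opprK powRN -[(4 * DB) `^ _]invrK lef_pV2 ?posrE ?invr_gt0 ?powR_gt0//.
  have -> : ((4 * DB) `^ (- w))^-1 = ((4 * DB)^-1) `^ (- w).
    by rewrite -powRN -powR_inv1 ?(ltW DB0)// -powRrM mulN1r.
  apply: ge0_ler_powR; rewrite ?nnegrE ?invr_ge0 ?(ltW DB0) ?(ltW z0)//.
  rewrite -[leRHS]invrK lef_pV2 ?posrE ?invr_gt0// invf_div ler_pdivrMr//.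
  apply: (@le_trans _ _ DB) => //; rewrite [4 * DB]mulrC -mulrA ler_peMr//.
    by rewrite (le_trans ler01).
  by lra.
have -> : `|Ue x| = N * m * (`|Vr (rh x) (sqz x)| * (rh x / sqy x)).
  have -> : Ue x = N * m * (Vr (rh x) (sqz x) * (rh x / sqy x)) by rewrite /Ue; ring.
  by rewrite normrM [`|_ * (_ / _)|]normrM (ger0_norm q0) ger0_norm// mulr_ge0// ltW.
have -> : N * M * m * (6 * gam * c + 16 * c + K) = N * m * (M * (6 * gam * c + 16 * c + K)) by ring.
have Nm : 0 <= N * m by rewrite mulr_ge0 ?ltW.
apply: ler_wpM2l => //; apply: le_trans (ler_wpM2r q0 hV) _.
rewrite -[leLHS]mulrA ler_pM2l//.
have -> : (6 * gam * rh x + 4 * (Xx (rh x) (sqz x) + Xx (rh x) (sqz x) `^ w)) * (rh x / sqy x) =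
  6 * gam * (rh x * (rh x / sqy x)) + 4 * (Xx (rh x) (sqz x) * (rh x / sqy x)) +
  4 * (Xx (rh x) (sqz x) `^ w * (rh x / sqy x)) by ring.
have g6 : 0 <= 6 * gam by rewrite mulr_ge0// ltW.
apply: lerD; [apply: lerD|].
- exact: ler_wpM2l.
- have -> : 16 * c = 4 * (4 * c) by ring.
  rewrite ler_pM2l//; apply: le_trans (ler_wpM2r q0 Xr) _.
  by rewrite -mulrA ler_pM2l.
- by rewrite /K ler_pM2l.
Qed.

Lemma rh_small x : 0 <= sqy x -> sqy x < 1 -> rh x < 1.
Proof.
move=> e0 e1; have -> : 1 = 1 `^ m :> R by rewrite powR1.
by apply: gt0_ltr_powR; rewrite ?nnegrE.
Qed.

(** At a bad point the gradient component vanishes for one of two reasons: a coordinate factor tends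
    to [0] while the other factor stays bounded, or, in the [y] direction on the sphere, the unknown
    [g] is multiplied by [Sr], which vanishes there. *)
Lemma gg_cont (i : I) x : {for 0, continuous (fun t : R => gg i (x + t *: base i))}.
Proof.
have [nb|b] := pselect (~ bad i x).
  by have [_ hg] := der_uu_good nb; exact: der_cont hg.
have {b}/contrapT b := b.
case: i b => i b; last first.
  case: b => [//|[r1 t0]].
  have c0 : crd (inr i) x = 0.
    by apply/eqP; rewrite -sqrf_eq0 eq_le sqr_ge0 andbT -t0 sqz_ge.
  pose K := 2 * (N * (2 * (M * (1 + gam)) + gam * M)).
  apply: (@squeeze0 _ _ (fun t => K * `|t|)).
  - by rewrite /gg line0 c0 mulr0 mul0r.
  - by rewrite normr0 mulr0.
  - by apply: cvgMr; exact: norm_continuous.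
  - exists 1 => //= t _; rewrite crd_shift c0 eqxx mulr1 add0r.
    have := VT_bound gam_gt0 w1 M_gt0 fM ode g_out (rh_ge0 (x + t *: base (inr i))) (sqz_ge0 (x + t *: base (inr i))).
    move: (VT _ _) => v hV; rewrite !normrM (ger0_norm (ltW N_gt0)) [`|2|]ger0_norm// /K.
    by rewrite mulrAC ler_wpM2r// ler_pM2l// ler_pM2l.
have [e0|en0] := eqVneq (sqy x) 0.
  have c0 : crd (inl i) x = 0.
    by apply/eqP; rewrite -sqrf_eq0 eq_le sqr_ge0 andbT -e0 sqy_ge.
  have [K K0 HK] := Ue_bound (1 + sqz x).
  apply: (@squeeze0 _ _ (fun t => 2 * K * `|t|)).
  - by rewrite /gg line0 c0 mulr0 mul0r.
  - by rewrite normr0 mulr0.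
  - by apply: cvgMr; exact: norm_continuous.
  - exists 1 => //= t /=; rewrite sub0r normrN => t1.
    rewrite crd_shift c0 eqxx mulr1 add0r.
    have [->|tn0] := eqVneq t 0; first by rewrite mulr0 mul0r normr0 mulr0.
    rewrite normrM normrM [`|2|]ger0_norm// [leRHS]mulrAC ler_wpM2l//.
    have et : sqy (x + t *: base (inl i)) = t ^+ 2 by rewrite sqy_liney e0 c0 mulr0 !add0r.
    have t21 : t ^+ 2 < 1 by rewrite -real_normK ?num_real// expr_lt1.
    apply: HK; rewrite ?et ?sqz_liney.
    + by rewrite exprn_even_gt0.
    + by apply: le_trans (ltW t21) _; rewrite lerDl sqz_ge0.
    + by rewrite lerDr.
    + move=> [r1 _]; have := @rh_small (x + t *: base (inl i)).
      by rewrite et r1 ltxx => /(_ (sqr_ge0 _) t21).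
case: b => [/eqP|[r1 t0]]; first by rewrite (negbTE en0).
pose r (t : R) := rh (x + t *: base (inl i)).
have cr : {for 0, continuous r} by apply: line_cont; exact: continuous_rh.
have ce : {for 0, continuous (fun t : R => sqy (x + t *: base (inl i)))} by apply: line_cont; exact: continuous_sqy.
have cc : {for 0, continuous (fun t : R => crd (inl i) (x + t *: base (inl i)))} by apply: line_cont; exact: continuous_crd.
have r01 : r 0 = 1 by rewrite /r line0.
have D10 : Dn 1 0 != 0 :> R by rewrite /Dn addr0 expf_neq0// gt_eqF.
have cD : {for 0, continuous (fun t : R => Dn (r t) 0)}.
  apply: cvgD; last exact: cvg_cst.
  by apply: cvg_sqr; apply: cvgD; [exact: cvg_cst|exact: cr].
have cDV : {for 0, continuous (fun t : R => (Dn (r t) 0)^-1)}.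
  by apply: cvgV => //; rewrite r01.
have cX : {for 0, continuous (fun t : R => Xx (r t) 0)}.
  by apply: cvgM => //; apply: cvgM; [exact: cvg_cst|exact: cr].
have cS : {for 0, continuous (fun t : R => Ss (r t) 0)} by apply: cvgB; [exact: cvg_cst|exact: cX].
have cSr : {for 0, continuous (fun t : R => Sr (r t) 0)}.
  apply: cvgN; apply: cvgM.
    apply: cvgM; first exact: cvg_cst.
    apply: cvgD; last exact: cvg_cst.
    apply: cvgB; first exact: cvg_cst.
    exact: cvg_sqr.
  apply: cvgV; first by rewrite r01 expf_neq0.
  exact: cvg_sqr.
have cP : {for 0, continuous (fun t : R => PP gam (r t) 0)}.
  apply: (cvg_comp _ (fun t : R => t `^ (- gam)) cD).
  have D0 : 0 < Dn (r 0) 0 by apply: Dn_gt0 => //; exact: rh_ge0.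
  have c : {for Dn (r 0) 0, continuous (fun t : R => t `^ (- gam))}.
    by apply: der_cont; exact: is_derive1_powR.
  exact: c.
have cfS : {for 0, continuous (fun t : R => f (Ss (r t) 0))}.
  by apply: (cvg_comp _ f cS); exact: cf.
have Sr0 : Sr (r 0) 0 = 0 by rewrite /Sr r01 expr1n subrr addr0 mulr0 mul0r oppr0.
(* No continuity of [g] at [S = 0] is available, only its bound, since [Xx] is close to [1]
   there. *)
have cgS : {for 0, continuous (fun t : R => g (Ss (r t) 0) * Sr (r t) 0)}.
  apply: (@squeeze0 _ _ (fun t => M * (1 + gam) * (1 + Xx (r t) 0 `^ w) * `|Sr (r t) 0|)).
  - by rewrite Sr0 mulr0.
  - by rewrite Sr0 normr0 mulr0.
  - apply: cvgM; last by apply: cvg_norm; exact: cSr.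
    apply: cvgM; first exact: cvg_cst.
    apply: cvgD; first exact: cvg_cst.
    apply: (cvg_comp _ (fun t : R => t `^ w) cX).
    have X0 : 0 < Xx (r 0) 0 by rewrite r01 /Xx divr_gt0//; exact: Dn_gt0.
    have c : {for Xx (r 0) 0, continuous (fun t : R => t `^ w)}.
      by apply: der_cont; exact: is_derive1_powR.
    exact: c.
  - have near_pos : \forall t \near (0 : R), 0 < r t.
      by apply: (cvgr_gt _ cr); rewrite r01.
    apply: filterS near_pos => t rt; rewrite normrM ler_wpM2r//.
    exact: (g_bound gam_gt0 M_gt0 fM ode g_out rt (lexx 0)).
rewrite (_ : (fun t : R => _) = fun t => 2 * crd (inl i) (x + t *: base (inl i)) *
  (N * (PP gam (r t) 0 * (- (2 * gam * (1 + r t) * (Dn (r t) 0)^-1) * f (Ss (r t) 0) + g (Ss (r t) 0) * Sr (r t) 0)) *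
  (m * (r t * (sqy (x + t *: base (inl i)))^-1)))); last first.
  by apply/funext => t; rewrite /gg /Ue sqz_liney t0.
apply: cvgM; first by apply: cvgM; [exact: cvg_cst|exact: cc].
apply: cvgM; last first.
  apply: cvgM; first exact: cvg_cst.
  by apply: cvgM; [exact: cr|apply: cvgV; [rewrite line0|exact: ce]].
apply: cvgM; first exact: cvg_cst.
apply: cvgM; first exact: cP.
apply: cvgD; last exact: cgS.
apply: cvgM; last exact: cfS.
apply: cvgN; apply: cvgM; last exact: cDV.
apply: cvgM; first exact: cvg_cst.
by apply: cvgD; [exact: cvg_cst|exact: cr].
Qed.

Lemma gg_cont_line (i : I) x (t : R) : {for t, continuous (fun t : R => gg i (x + t *: base i))}.
Proof.
have H := @gg_cont i (x + t *: base i).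
have c : {for t, continuous (fun s : R => s - t)}.
  by apply: cvgB; [exact: cvg_id|exact: cvg_cst].
rewrite (_ : (fun s : R => _) = (fun s : R => gg i (x + t *: base i + (s - t) *: base i))); last first.
  by apply/funext => s; rewrite -addrA -scalerDl [t + _]addrC subrK.
apply: (@continuous_comp _ _ _ (fun s : R => s - t) (fun s : R => gg i (x + t *: base i + s *: base i))); first exact: c.
by rewrite subrr; exact: H.
Qed.

Lemma der_uu (i : I) x : is_derive (0 : R) 1 (fun t => uu (x + t *: base i)) (gg i x).
Proof.
have [s Hs] := bad_line i x.
have := @der_of_cont _ (fun t => uu (x + t *: base i)) (fun t => gg i (x + t *: base i)) s.
rewrite line0; apply; last exact: gg_cont.
  by move=> t; apply: line_cont; exact: continuous_uu.
move=> t ts; have nb : ~ bad i (x + t *: base i) by move=> /Hs; exact/negP.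
by have [h1 _] := der_uu_good nb; exact: (der_line0 h1).
Qed.

Hypothesis k_ge1 : (1 <= k)%N.
Hypothesis h_ge1 : (1 <= h)%N.

Lemma sqy_ge0_cases x : sqy x = 0 \/ 0 < sqy x.
Proof. by have := sqy_ge0 x; rewrite le_eqVlt => /orP[/eqP|]; [left|right]. Qed.

(** The weight [r ^ (1 - w)] of the radial bound is [r * (r / |y| ^ 2)], the factor common to the
    [y] and [z] parts of the energy density. *)
Lemma density_bound : exists2 K : R, 0 < K & forall x,
  \sum_i gg (inl i) x ^+ 2 + (2 * m) ^+ 2 * sqy x `^ (2 * m - 1) * \sum_j gg (inr j) x ^+ 2 <=
  K * Dn (rh x) (sqz x) `^ (- (2 * gam + (1 + w) / 2)).
Proof.
have [K K0 HK] := energy_density_bound gam_gt0 w1 w_lt1 M_gt0 fM ode g_out.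
exists (4 * m ^+ 2 * N ^+ 2 * K); first by pos.
move=> x.
have sy : \sum_i gg (inl i) x ^+ 2 = 4 * sqy x * Ue x ^+ 2.
  rewrite (eq_bigr (fun i => (x.1 ord0 i) ^+ 2 * (4 * Ue x ^+ 2))) => [|i _].
    by rewrite -mulr_suml; rewrite -/(sqy x); ring.
  by rewrite /gg /crd; ring.
have sz : \sum_j gg (inr j) x ^+ 2 = 4 * sqz x * N ^+ 2 * VT (rh x) (sqz x) ^+ 2.
  rewrite (eq_bigr (fun j => (x.2 ord0 j) ^+ 2 * (4 * N ^+ 2 * VT (rh x) (sqz x) ^+ 2))) => [|j _].
    by rewrite -mulr_suml; rewrite -/(sqz x); ring.
  by rewrite /gg /crd; ring.
rewrite sy sz; have [e0|e0] := sqy_ge0_cases x.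
  rewrite e0 powR0; last by rewrite gt_eqF//; move: m2; lra.
  by rewrite !mulr0 !mul0r addr0; pos.
have := HK _ _ (rh_gt0 e0) (sqz_ge0 x).
have -> : rh x `^ (1 - w) = rh x * (rh x / sqy x).
  by rewrite rr_eq// /rh -powRrM wE; congr (_ `^ _); field; rewrite gt_eqF.
rewrite -rr_eq// -(ler_pM2l (_ : 0 < 4 * m ^+ 2 * N ^+ 2)); last by pos.
move=> H; rewrite -[leRHS]mulrA; apply: le_trans H; rewrite le_eqVlt; apply/orP; left; apply/eqP.
by rewrite /Ue; field; rewrite gt_eqF.
Qed.

(** Every bad point lies on one of two coordinate hyperplanes. *)
Lemma bad_null : {ae mu, forall x, forall i, ~ bad i x}.
Proof.
have H (i : I) : {ae mu, forall x, crd i x <> 0}.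
  exists [set x | crd i x = 0]; split; [|exact: coord_null|by move=> x /= /contrapT].
  rewrite (_ : [set x | crd i x = 0] = setT `&` crd i @^-1` [set 0]); last by rewrite setTI.
  by apply: measurable_coord => //; exact: measurable_set1.
apply: filterS2 (H (inl (Ordinal k_ge1))) (H (inr (Ordinal h_ge1))) => x hy hz i.
move=> [|[_ t0]]; last first.
  by apply: hz; apply/eqP; rewrite -sqrf_eq0 eq_le sqr_ge0 andbT -t0 sqz_ge.
case: i => // _ e0.
by apply: hy; apply/eqP; rewrite -sqrf_eq0 eq_le sqr_ge0 andbT -e0 sqy_ge.
Qed.

(** [gamr0] matches the powers of [Dn] on the two sides, and [N] absorbs the numerical factor. *)
Lemma pde_sum x : 0 < sqy x -> ~ (rh x = 1 /\ sqz x = 0) ->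
  2 * k%:R * Ue x + 4 * sqy x * Uee x +
  (2 * m) ^+ 2 * sqy x `^ (2 * m - 1) * (N * (2 * h%:R * VT (rh x) (sqz x) + 4 * sqz x * VTT (rh x) (sqz x))) =
  - (`|uu x| `^ r0 * uu x).
Proof.
move=> e0 nb; have rp := rh_gt0 e0; have t0 := sqz_ge0 x; have D0 := Dn_gt0 (ltW rp) t0.
have hp := pde_radial gamE ode rp t0 nb.
have hX := Xw_eq e0.
transitivity (4 * m ^+ 2 * N * (rh x / sqy x) * (rh x * Vrr (rh x) (sqz x) + a * Vr (rh x) (sqz x) +
   rh x * (2 * h%:R * VT (rh x) (sqz x) + 4 * sqz x * VTT (rh x) (sqz x)))).
  rewrite -rr_eq// /Ue /Uee aE; move: (Vr _ _) (Vrr _ _) (VT _ _) (VTT _ _) => A B C D.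
  by field; rewrite !gt_eqF.
rewrite hp.
transitivity (- (16 * m ^+ 2 * N * PP gam (rh x) (sqz x) / Dn (rh x) (sqz x) *
  (4 / Dn (rh x) (sqz x)) `^ w * n (Ss (rh x) (sqz x)))).
  by rewrite -hX; ring.
congr (- _).
have P0 : 0 < PP gam (rh x) (sqz x) by exact: powR_gt0.
have -> : `|uu x| `^ r0 * uu x = N `^ r0 * PP gam (rh x) (sqz x) `^ r0 * N * PP gam (rh x) (sqz x) * n (Ss (rh x) (sqz x)).
  rewrite /uu /V nE; move: (f _) P0 => y; move: (PP _ _ _) => q q0.
  rewrite !normrM (ger0_norm (ltW N_gt0)) (ger0_norm (ltW q0)).
  rewrite powRM ?mulr_ge0 ?(ltW N_gt0) ?(ltW q0)// powRM ?(ltW q0)//; ring.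
have -> : PP gam (rh x) (sqz x) `^ r0 = Dn (rh x) (sqz x) `^ (- m^-1).
  by rewrite /PP -powRrM mulNr gamr0.
rewrite Nr0 powRM ?invr_ge0 ?(ltW D0)// -(powR_inv1 (ltW D0)) -powRrM mulN1r.
rewrite wE powRB1// opprB.
have -> : Dn (rh x) (sqz x) `^ (1 - m^-1) = Dn (rh x) (sqz x) * Dn (rh x) (sqz x) `^ (- m^-1).
  by rewrite powRDpos// powRr1// ltW.
rewrite (powR_inv1 (ltW D0)); move: (PP _ _ _) (n _) (_ `^ - m^-1) (4 `^ _) => A B C F.
by field; rewrite gt_eqF.
Qed.

Lemma uu_bound x : `|uu x| <= N * M * Dn (rh x) (sqz x) `^ (- gam).
Proof.
rewrite /uu /V !normrM (ger0_norm (ltW N_gt0)) (ger0_norm (powR_ge0 _ _)) -mulrA ler_pM2l//.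
by rewrite mulrC ler_wpM2r// powR_ge0.
Qed.

Lemma uu_bound1 x : `|uu x| <= N * M.
Proof.
apply: le_trans (uu_bound x) _; rewrite ler_piMr//; first by pos.
exact: (PP_le1 gam_gt0 (rh_ge0 x) (sqz_ge0 x)).
Qed.

Lemma gg_bound : exists2 K : R, 0 < K & forall x,
  (forall i, `|gg (inl i) x| <= K) /\ (forall j, `|sqy x `^ ((2 * m - 1) / 2) * gg (inr j) x| <= K).
Proof.
have [K K0 HK] := density_bound; exists (1 + K); first by pos.
move=> x; have := HK x.
have Dle : Dn (rh x) (sqz x) `^ (- (2 * gam + (1 + w) / 2)) <= 1.
  rewrite -[leRHS](powRr0 (Dn (rh x) (sqz x))); apply: ler_powR; first by apply: Dn_ge1; [exact: rh_ge0|exact: sqz_ge0].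
  by move: w1 gam_gt0; lra.
have s0 : 0 <= \sum_i gg (inl i) x ^+ 2 by apply: sumr_ge0 => i _; exact: sqr_ge0.
have s1 : 0 <= \sum_j gg (inr j) x ^+ 2 by apply: sumr_ge0 => i _; exact: sqr_ge0.
have p0 : 0 <= sqy x `^ (2 * m - 1) by exact: powR_ge0.
have m4 : 1 <= (2 * m) ^+ 2 by move: m2; nra.
have KD := ler_wpM2l (ltW K0) Dle.
have m4p : 0 <= (2 * m) ^+ 2 * sqy x `^ (2 * m - 1) by rewrite mulr_ge0// (le_trans ler01).
have abs1 (y : R) : y ^+ 2 <= K -> `|y| <= 1 + K.
  by move=> yK; rewrite ler_norml; apply/andP; split; nra.
move=> H; split=> i; apply: abs1.
- have h1 : gg (inl i) x ^+ 2 <= \sum_i gg (inl i) x ^+ 2.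
    by rewrite (bigD1 i)//= lerDl sumr_ge0// => j _; exact: sqr_ge0.
  have := mulr_ge0 m4p s1.
  move: h1 H KD; move: (\sum_i _) (_ * \sum_j _) (K * _) (gg (inl i) x ^+ 2) => *; lra.
- have h1 : gg (inr i) x ^+ 2 <= \sum_j gg (inr j) x ^+ 2.
    by rewrite (bigD1 i)//= lerDl sumr_ge0// => j _; exact: sqr_ge0.
  have -> : (sqy x `^ ((2 * m - 1) / 2) * gg (inr i) x) ^+ 2 = sqy x `^ (2 * m - 1) * gg (inr i) x ^+ 2.
    by rewrite exprMn; congr (_ * _); rewrite -powR_mulrn ?powR_ge0// -powRrM; congr (_ `^ _); field.
  have h2 : sqy x `^ (2 * m - 1) * gg (inr i) x ^+ 2 <= (2 * m) ^+ 2 * sqy x `^ (2 * m - 1) * \sum_j gg (inr j) x ^+ 2.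
    apply: ler_pM => //; first exact: sqr_ge0.
    by rewrite ler_peMl.
  move: h2 H KD s0; move: (\sum_i _) (_ * \sum_j _) (K * _) (_ * gg (inr i) x ^+ 2) => *; lra.
Qed.

Lemma pp_cont (i : I) x (t : R) : {for t, continuous (fun t : R => pp i (x + t *: base i))}.
Proof.
case: i => i; first by rewrite /pp; exact: gg_cont_line.
rewrite (_ : (fun t : R => _) = fun t : R => (2 * m) ^+ 2 * sqy x `^ (2 * m - 1) * gg (inr i) (x + t *: base (inr i))); last first.
  by apply/funext => s; rewrite /pp sqy_linez.
have H := @gg_cont_line (inr i) x t.
by apply: cvgM; [exact: cvg_cst|exact: H].
Qed.

Lemma pp_der (i : I) x : ~ bad i x ->
  is_derive (0 : R) 1 (fun t => pp i (x + t *: base i)) (dpp i x).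
Proof.
move=> /der_uu_good[_ H]; case: i H => i H //.
rewrite (_ : (fun t : R => _) = fun t : R => (2 * m) ^+ 2 * sqy x `^ (2 * m - 1) * gg (inr i) (x + t *: base (inr i))); last first.
  by apply/funext => s; rewrite /pp sqy_linez.
by derby; rewrite /dpp; ring.
Qed.

Lemma dpp_sum x : \sum_(i < k) dpp (inl i) x + \sum_(j < h) dpp (inr j) x =
  2 * k%:R * Ue x + 4 * sqy x * Uee x +
  (2 * m) ^+ 2 * sqy x `^ (2 * m - 1) * (N * (2 * h%:R * VT (rh x) (sqz x) + 4 * sqz x * VTT (rh x) (sqz x))).
Proof.
congr (_ + _).
- rewrite (eq_bigr (fun i => 2 * Ue x + (x.1 ord0 i) ^+ 2 * (4 * Uee x))) => [|i _].
    by rewrite (@sum_affine _ _ _ _ (fun i => x.1 ord0 i ^+ 2)) -/(sqy x); ring.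
  by rewrite /dpp /dgg /crd; ring.
- rewrite -mulr_sumr; congr (_ * _).
  rewrite (eq_bigr (fun j => N * (2 * VT (rh x) (sqz x)) + (x.2 ord0 j) ^+ 2 * (4 * N * VTT (rh x) (sqz x)))) => [|j _].
    by rewrite (@sum_affine _ _ _ _ (fun j => x.2 ord0 j ^+ 2)) -/(sqz x); ring.
  by rewrite /dgg /crd; ring.
Qed.

Lemma dpp_sum_all x : (forall i, ~ bad i x) -> \sum_i dpp i x = - (`|uu x| `^ r0 * uu x).
Proof.
move=> nb; have e0 : 0 < sqy x.
  by have [e0|//] := sqy_ge0_cases x; case: (nb (inl (Ordinal k_ge1))); left.
have nb' : ~ (rh x = 1 /\ sqz x = 0) by move=> H; case: (nb (inl (Ordinal k_ge1))); right.
by rewrite -pde_sum// -dpp_sum big_sumType.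
Qed.

Lemma cube_bounds (r : R) x : cube r x -> sqy x <= k%:R * r ^+ 2 /\ sqz x <= h%:R * r ^+ 2.
Proof.
move=> /cubeP H.
have sq (i : I) : crd i x ^+ 2 <= r ^+ 2.
  by rewrite -real_normK ?num_real// lerXn2r ?nnegrE//; apply: le_trans (H i).
split.
- rewrite mulr_natl -[X in _ *+ X]card_ord -sumr_const; apply: ler_sum => i _; exact: (sq (inl i)).
- rewrite mulr_natl -[X in _ *+ X]card_ord -sumr_const; apply: ler_sum => i _; exact: (sq (inr i)).
Qed.

Let weight_bound (r : R) x : cube r x -> sqy x `^ (2 * m - 1) <= (k%:R * r ^+ 2) `^ (2 * m - 1).
Proof.
move=> /cube_bounds[h1 _]; apply: ge0_ler_powR; rewrite ?nnegrE ?sqy_ge0//; last by rewrite mulr_ge0 ?sqr_ge0.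
by move: m2; lra.
Qed.

Lemma pp_bound (r : R) : exists B : R, forall i x, cube r x -> `|pp i x| <= B.
Proof.
have [K K0 HK] := gg_bound.
pose B := (2 * m) ^+ 2 * (k%:R * r ^+ 2) `^ (2 * m - 1) * (2 * `|r| * (N * (2 * (M * (1 + gam)) + gam * M))).
have B0 : 0 <= B by rewrite /B mulr_ge0 ?mulr_ge0 ?powR_ge0 ?sqr_ge0//; pos.
exists (K + B) => -[i|j] x cx.
  by apply: le_trans ((HK x).1 i) _; rewrite lerDl.
apply: (@le_trans _ _ B); last by rewrite lerDr ltW.
rewrite /pp /gg; have := VT_bound gam_gt0 w1 M_gt0 fM ode g_out (rh_ge0 x) (sqz_ge0 x).
move: (VT _ _) => v hv.
have hc : `|crd (inr j) x| <= `|r| by apply: le_trans (ler_norm r); move/cubeP : cx => /(_ (inr j)).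
rewrite normrM; apply: ler_pM => //.
  by rewrite ger0_norm; [apply: ler_wpM2l; [exact: sqr_ge0|exact: weight_bound]|apply: mulr_ge0; [exact: sqr_ge0|exact: powR_ge0]].
rewrite normrM normrM [`|N * v|]normrM (ger0_norm (ltW N_gt0)) [`|2|]ger0_norm//.
by apply: ler_pM; [exact: mulr_ge0|apply: mulr_ge0; [exact: ltW|]|exact: ler_wpM2l|rewrite ler_pM2l].
Qed.

(** The second derivatives in [z] are bounded directly. Those in [y] contain [Vrr], for which no
    estimate is made: the equation itself expresses [4 * sqy x * Uee x] by bounded quantities. *)
Lemma dpp_bound (r : R) : exists B : R, forall i x, cube r x -> ~ bad i x -> `|dpp i x| <= B.
Proof.
have [K HK] := TVTT_bound gam_gt0 a_gt0 h0 w1 M_gt0 fM nM ode g_out.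
pose VB := 2 * (M * (1 + gam)) + gam * M.
pose W := (2 * m) ^+ 2 * (k%:R * r ^+ 2) `^ (2 * m - 1).
have [B1 B10 HB1] := Ue_bound (Num.max (k%:R * r ^+ 2) (h%:R * r ^+ 2)).
pose Bz := W * (N * (2 * VB + 4 * `|K|)).
have W0 : 0 <= W by rewrite /W mulr_ge0 ?powR_ge0 ?sqr_ge0.
have VB0 : 0 <= VB by rewrite /VB; pos.
have Bz0 : 0 <= Bz by rewrite /Bz; pos.
pose Bu := (N * M) `^ r0 * (N * M).
have Bu0 : 0 <= Bu by rewrite /Bu mulr_ge0 ?powR_ge0//; pos.
have zb x (j : 'I_h) : cube r x -> ~ (rh x = 1 /\ sqz x = 0) -> `|dpp (inr j) x| <= Bz.
  move=> cx nb; rewrite /dpp normrM; apply: ler_pM => //.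
    by rewrite ger0_norm; [apply: ler_wpM2l; [exact: sqr_ge0|exact: weight_bound]|apply: mulr_ge0; [exact: sqr_ge0|exact: powR_ge0]].
  rewrite /dgg normrM (ger0_norm (ltW N_gt0)) ler_pM2l//.
  have hv := VT_bound gam_gt0 w1 M_gt0 fM ode g_out (rh_ge0 x) (sqz_ge0 x).
  have hw := HK _ _ (rh_ge0 x) (sqz_ge0 x) nb.
  apply: le_trans (ler_normD _ _) _; apply: lerD.
    by rewrite normrM ger0_norm// ler_pM2l.
  rewrite -mulrA normrM ger0_norm// ler_pM2l//; apply: le_trans (ler_norm K); apply: le_trans hw.
  rewrite !normrM; apply: ler_wpM2r => //.
  by rewrite -normrM -expr2 (ger0_norm (sqr_ge0 _)) (ger0_norm (sqz_ge0 x)) sqz_ge.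
exists (2 * B1 + (Bu + h%:R * Bz + 2 * k%:R * B1) + Bz) => -[i|j] x cx nb; last first.
  apply: le_trans (zb x j cx _) _; first by move=> H; apply: nb; right.
  by rewrite lerDr; pos.
have e0 : 0 < sqy x by have [e0|//] := sqy_ge0_cases x; case: nb; left.
have nb' : ~ (rh x = 1 /\ sqz x = 0) by move=> H; case: nb; right.
have [c1 c2] := cube_bounds cx.
have hU : `|Ue x| <= B1 by apply: HB1 => //; rewrite le_max ?c1 ?c2 ?orbT.
have hE : `|4 * sqy x * Uee x| <= Bu + h%:R * Bz + 2 * k%:R * B1.
  have := pde_sum e0 nb'; rewrite -dpp_sum => hp.
  have -> : 4 * sqy x * Uee x = - (`|uu x| `^ r0 * uu x) - \sum_(j < h) dpp (inr j) x - 2 * k%:R * Ue x.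
    have hs := dpp_sum x; have : 4 * sqy x * Uee x + 2 * k%:R * Ue x = \sum_(i < k) dpp (inl i) x.
      rewrite (eq_bigr (fun i => 2 * Ue x + (x.1 ord0 i) ^+ 2 * (4 * Uee x))) => [|l _].
        by rewrite (@sum_affine _ _ _ _ (fun l => x.1 ord0 l ^+ 2)) -/(sqy x); ring.
      by rewrite /dpp /dgg /crd; ring.
    by move: hp; move: (\sum_(i < k) _) (\sum_(j < h) _) => A B h1 h2; rewrite -h1 -h2; ring.
  apply: le_trans (ler_normB _ _) _; apply: lerD; last first.
    by rewrite normrM ger0_norm ?mulr_ge0// ler_wpM2l// mulr_ge0.
  apply: le_trans (ler_normB _ _) _; apply: lerD.
    rewrite normrN normrM (ger0_norm (powR_ge0 _ _)); have ub := uu_bound1 x.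
    apply: ler_pM => //.
    by apply: ge0_ler_powR; rewrite ?nnegrE ?(ltW r0_gt0)//; pos.
  apply: le_trans (ler_norm_sum _ _ _) _.
  rewrite mulr_natl -[X in _ *+ X]card_ord -sumr_const; apply: ler_sum => j _; exact: zb.
rewrite /dpp /dgg; apply: (@le_trans _ _ (2 * B1 + (Bu + h%:R * Bz + 2 * k%:R * B1))); last by rewrite lerDl.
apply: le_trans (ler_normD _ _) _; apply: lerD.
  by rewrite normrM ger0_norm// ler_pM2l.
apply: le_trans hE; rewrite !normrM; apply: ler_wpM2r => //; rewrite [`|4|]ger0_norm// ler_pM2l//.
by rewrite -normrM -expr2 (ger0_norm (sqr_ge0 _)) (ger0_norm (sqy_ge0 x)) sqy_ge.
Qed.

End solution.

(** * Integrability *)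

Section tails.
Context {R : realType}.
Implicit Types (s t : R).

Lemma der_tail s t : 0 < 1 + t -> is_derive t 1 (fun t : R => (1 + t) `^ (1 - s) / (1 - s)) ((1 - s) * (1 + t) `^ (- s) / (1 - s)).
Proof.
move=> t0; derby => //; rewrite (_ : 1 - s - 1 = - s); last by ring.
by move: (_ `^ _) => A; rewrite !add0r; ring.
Qed.

Lemma tail_integral s : 1 < s -> (\int[lebesgue_measure]_t ((1 + `|t|) `^ (- s))%:E < +oo)%E.
Proof.
move=> s1; have s10 : 1 - s != 0 by rewrite lt_eqF// subr_lt0.
rewrite ge0_symfun_integralT; last 3 first.
- by move=> t; exact: powR_ge0.
- move=> t.
  have c1 : {for 1 + `|t|, continuous (fun x : R => x `^ (- s))}.
    by apply: der_cont; apply: is_derive1_powR; rewrite ltr_pwDl.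
  apply: (@continuous_comp _ _ _ (fun t : R => 1 + `|t|) (fun x : R => x `^ (- s))); last exact: c1.
  by apply: cvgD; [exact: cvg_cst|exact: norm_continuous].
- by move=> t /=; rewrite normrN.
rewrite -set_itvcy.
under eq_integral => t.
  rewrite inE/= in_itv/= andbT => t0; rewrite (ger0_norm t0); over.
rewrite (@ge0_continuous_FTC2y _ (fun t => (1 + t) `^ (- s)) (fun t => (1 + t) `^ (1 - s) / (1 - s)) 0 0).
- by rewrite -EFinB -EFinM ltry.
- by move=> t _; exact: powR_ge0.
- apply: continuous_in_subspaceT => t; rewrite inE/= in_itv/= andbT => t0.
  have c1 : {for 1 + t, continuous (fun x : R => x `^ (- s))}.
    by apply: der_cont; apply: is_derive1_powR; rewrite ltr_pwDl.
  apply: (@continuous_comp _ _ _ (fun t : R => 1 + t) (fun x : R => x `^ (- s))); last exact: c1.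
  by apply: cvgD; [exact: cvg_cst|exact: cvg_id].
- rewrite -[X in _ --> X](mul0r (1 - s)^-1); apply: cvgMl.
  apply/cvgrPdist_le => e e0.
  have sp : 0 < s - 1 by rewrite subr_gt0.
  have [d d0 Hd] := pow_small sp e0.
  near=> t.
  have t0 : 0 <= t by near: t; apply: nbhs_pinfty_ge; exact: num_real.
  have td : d^-1 <= t by near: t; apply: nbhs_pinfty_ge; exact: num_real.
  have t1 : 0 < 1 + t by rewrite ltr_pwDl.
  rewrite sub0r normrN ger0_norm ?powR_ge0//.
  have -> : (1 + t) `^ (1 - s) = ((1 + t)^-1) `^ (s - 1).
    by rewrite -(powR_inv1 (ltW t1)) -powRrM; congr (_ `^ _); ring.
  apply: Hd; first by rewrite invr_ge0 ltW.
  rewrite -[leRHS]invrK lef_pV2 ?posrE ?invr_gt0//; apply: le_trans td _.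
  by rewrite lerDr.
- move=> t t0; have := @der_tail s t; rewrite ltr_pwDl ?ltW// => /(_ isT) H.
  exact: ex_derive.
- apply: cvg_at_right_filter.
  have := @der_tail s 0; rewrite addr0 ltr01 => /(_ isT) H.
  have := der_cont H; rewrite /prop_for /continuous_at addr0; exact.
- move=> t; rewrite in_itv/= andbT => t0; rewrite derive1E.
  have := @der_tail s t; rewrite ltr_pwDl ?ltW// => /(_ isT) H.
  by rewrite derive_val; field.
Unshelve. all: by end_near. Qed.

Local Open Scope ereal_scope.

Lemma integral_prod_fin d1 d2 (T1 : measurableType d1) (T2 : measurableType d2)
  (m1 : {sigma_finite_measure set T1 -> \bar R}) (m2 : {sigma_finite_measure set T2 -> \bar R})
  (f : T1 -> R) (g : T2 -> R) :
  measurable_fun setT f -> measurable_fun setT g -> (forall x, 0 <= f x)%R -> (forall y, 0 <= g y)%R ->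
  \int[m1]_x (f x)%:E < +oo -> \int[m2]_y (g y)%:E < +oo ->
  \int[m1 \x m2]_z (f z.1 * g z.2)%:E < +oo.
Proof.
move=> mf mg f0 g0 fi gi.
have g0' : 0 <= \int[m2]_y (g y)%:E by apply: integral_ge0 => y _; rewrite lee_fin.
rewrite fubini_tonelli1; last 2 first.
- apply/measurable_EFinP; apply: measurable_funM.
    by apply: measurableT_comp mf _; exact: measurable_fst.
  by apply: measurableT_comp mg _; exact: measurable_snd.
- by move=> z; rewrite lee_fin mulr_ge0.
rewrite /fubini_F.
under eq_integral => x _.
  under eq_integral do rewrite /= EFinM.
  rewrite ge0_integralZl_EFin//; last 2 first.
  - by move=> y _; rewrite lee_fin.
  - exact/measurable_EFinP.
  over.
rewrite ge0_integralZr//; last 2 first.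
- exact/measurable_EFinP.
- by move=> x _; rewrite lee_fin.
apply: lte_mul_pinfty => //; first by apply: integral_ge0 => x _; rewrite lee_fin.
by rewrite ge0_fin_numE//; apply: integral_ge0 => x _; rewrite lee_fin.
Qed.

Lemma integral_rV_fin n (f : 'I_n -> R -> R) :
  (forall i, measurable_fun setT (f i)) -> (forall i t, 0 <= f i t)%R ->
  (forall i, \int[lebesgue_measure]_t (f i t)%:E < +oo) ->
  \int[lebesgue_rV R n]_x (\prod_i f i (x ord0 i))%:E < +oo.
Proof.
elim: n f => [|n IH] f mf f0 fi.
  rewrite (eq_integral (fun=> 1)) => [|x _]; last by rewrite big_ord0.
  rewrite (integral_cst _ measurableT) mul1e.
  by rewrite /= diracE; case: (_ \in _); rewrite ltry.
rewrite /= /lebesgue_rV_step.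
have mF : measurable_fun setT (fun x : 'rV[R]_n.+1 => (\prod_i f i (x ord0 i))%R).
  apply: measurable_prod => i _; apply: measurableT_comp (mf i) _; exact: (measurable_rV_coord i).
rewrite ge0_integral_pushforward//; last 3 first.
- exact: measurable_cons_rV.
- exact/measurable_EFinP.
- by move=> x _; rewrite lee_fin; apply: prodr_ge0.
rewrite preimage_setT.
under eq_integral => p _.
  rewrite /= big_ord_recl /cons_rV mxE unlift_none/=.
  under eq_bigr do rewrite mxE liftK/=.
  over.
apply: (@integral_prod_fin _ _ _ _ (@lebesgue_measure R) (lebesgue_rV R n) (f ord0) (fun x => (\prod_i f (lift ord0 i) (x ord0 i))%R)) => //.
- exact: mf.
- apply: measurable_prod => i _; apply: measurableT_comp (mf _) _; exact: (measurable_rV_coord i).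
- by move=> x; apply: prodr_ge0.
- by apply: (IH (fun i => f (lift ord0 i))).
Qed.

End tails.

Section decay.
Context {R : realType} {k h : nat}.
Local Notation E := ('rV[R]_k * 'rV[R]_h)%type.
Local Notation I := ('I_k + 'I_h)%type.
Local Notation mu := (@lebesgue_kh R k h).
Implicit Types (x : E).

Lemma integral_coord_fin (s : R) : 1 < s ->
  (\int[mu]_x (\prod_i (1 + `|crd i x|) `^ (- s))%:E < +oo)%E.
Proof.
move=> s1.
have m1 : measurable_fun setT (fun t : R => (1 + `|t|) `^ (- s)).
  apply: (measurableT_comp (f := fun t : R => t `^ (- s))); first exact: measurable_powR.
  by apply: measurable_funD => //; exact: normr_measurable.
under eq_integral do rewrite big_sumType/=.
apply: (@integral_prod_fin _ _ _ _ _ (lebesgue_rV R k) (lebesgue_rV R h)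
  (fun y => \prod_i (1 + `|y ord0 i|) `^ (- s)) (fun y => \prod_i (1 + `|y ord0 i|) `^ (- s))).
- by apply: measurable_prod => i _; apply: measurableT_comp m1 _; exact: (measurable_rV_coord i).
- by apply: measurable_prod => i _; apply: measurableT_comp m1 _; exact: (measurable_rV_coord i).
- by move=> y; apply: prodr_ge0 => i _; exact: powR_ge0.
- by move=> y; apply: prodr_ge0 => i _; exact: powR_ge0.
- by apply: (@integral_rV_fin _ _ (fun _ t => (1 + `|t|) `^ (- s))) => // i; exact: tail_integral.
- by apply: (@integral_rV_fin _ _ (fun _ t => (1 + `|t|) `^ (- s))) => // i; exact: tail_integral.
Qed.

Lemma prod_le_powR (s : R) (n : nat) (c : 'I_n -> R) (D ex : R) : 0 < s -> 1 <= D -> 0 <= ex ->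
  (forall i, 0 <= c i) -> (forall i, c i <= D `^ ex) ->
  \prod_i (1 + c i) `^ s <= (2 `^ s) ^+ n * D `^ (n%:R * (s * ex)).
Proof.
move=> s0 D1 ex0 c0 cD; have D0 : 0 < D by apply: lt_le_trans D1.
have -> : D `^ (n%:R * (s * ex)) = (D `^ (s * ex)) ^+ n by rewrite -powR_mulrn ?powR_ge0// -powRrM mulrC.
rewrite -exprMn -[X in _ <= _ ^+ X]card_ord -prodr_const; apply: ler_prod => i _.
rewrite powR_ge0/=.
have -> : 2 `^ s * D `^ (s * ex) = (2 * D `^ ex) `^ s.
  by rewrite powRM ?powR_ge0// -powRrM [ex * s]mulrC.
have Dx : 1 <= D `^ ex by rewrite -[leLHS](powRr0 D); apply: ler_powR.
apply: ge0_ler_powR; rewrite ?nnegrE ?addr_ge0 ?mulr_ge0 ?powR_ge0 ?(ltW s0)//.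
by rewrite mulr_natl mulr2n; apply: lerD.
Qed.

(** Comparison with a product of one-dimensional tails: [|y_i|] is at most [Dn ^ (1 / (4 * m))] and
    [|z_j|] at most [Dn ^ (1 / 2)]. *)
Lemma Dn_integral_fin (m ex : R) : 1 / 2 < m -> (0 < k + h)%N -> k%:R / (4 * m) + h%:R / 2 < ex ->
  (\int[mu]_x (Dn (sqy x `^ m) (sqz x) `^ (- ex))%:E < +oo)%E.
Proof.
move=> m2 kh exq; have m0 : 0 < m by apply: lt_trans m2; rewrite divr_gt0.
pose q : R := k%:R / (4 * m) + h%:R / 2.
have q0 : 0 < q.
  rewrite /q; case: (posnP k) => [k0|k0].
    by rewrite ltr_wpDl// ?divr_ge0// ?mulr_ge0// ?(ltW m0)// divr_gt0// ltr0n; move: kh; rewrite k0 add0n.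
  by rewrite ltr_wpDr ?divr_ge0// divr_gt0 ?ltr0n// mulr_gt0.
(* The threshold [q] sums the exponents of all coordinates; the excess of [ex] is shared so that
   each tail has the same exponent [s > 1]. *)
pose s := ex / q; have s1 : 1 < s by rewrite /s ltr_pdivlMr// mul1r.
have s0 : 0 < s by apply: lt_trans s1.
pose C : R := (2 `^ s) ^+ k * (2 `^ s) ^+ h.
have C0 : 0 < C by rewrite /C mulr_gt0// exprn_gt0// powR_gt0.
have key x : Dn (sqy x `^ m) (sqz x) `^ (- ex) <= C * \prod_i (1 + `|crd i x|) `^ (- s).
  set D := Dn _ _; have r0 : 0 <= sqy x `^ m by exact: powR_ge0.
  have D1 : 1 <= D by apply: Dn_ge1 => //; exact: sqz_ge0.
  have D0 : 0 < D by apply: lt_le_trans D1.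
  have [_ _ _ rD] := Dn_ineq r0 (sqz_ge0 x).
  have TD : sqz x <= D by rewrite /D /Dn lerDr sqr_ge0.
  have hy (i : 'I_k) : `|crd (inl i) x| <= D `^ (4 * m)^-1.
    have -> : `|crd (inl i) x| = (`|crd (inl i) x| `^ (4 * m)) `^ (4 * m)^-1.
      by rewrite -powRrM mulfV ?powRr1// mulf_neq0 ?gt_eqF.
    apply: ge0_ler_powR; rewrite ?nnegrE ?powR_ge0 ?(ltW D0) ?invr_ge0 ?mulr_ge0 ?(ltW m0)//.
    apply: le_trans rD; have -> : (sqy x `^ m) ^+ 2 = sqy x `^ (2 * m).
      by rewrite -powR_mulrn ?powR_ge0// -powRrM mulrC.
    have -> : `|crd (inl i) x| `^ (4 * m) = (`|crd (inl i) x| ^+ 2) `^ (2 * m).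
      by rewrite -powR_mulrn// -powRrM; congr (_ `^ _); ring.
    apply: ge0_ler_powR; rewrite ?nnegrE ?sqr_ge0 ?sqy_ge0 ?mulr_ge0 ?(ltW m0)//.
    by rewrite real_normK ?num_real// sqy_ge.
  have hz (j : 'I_h) : `|crd (inr j) x| <= D `^ (2^-1).
    have -> : `|crd (inr j) x| = (`|crd (inr j) x| ^+ 2) `^ (2^-1).
      by rewrite powR12_sqrt ?sqr_ge0// sqrtr_sqr normr_id.
    apply: ge0_ler_powR; rewrite ?nnegrE ?sqr_ge0 ?(ltW D0)// real_normK ?num_real//.
    by apply: le_trans TD; exact: sqz_ge.
  rewrite (eq_bigr (fun i => ((1 + `|crd i x|) `^ s)^-1)) => [|i _]; last by rewrite powRN.
  rewrite prodfV powRN.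
  have P0 : 0 < \prod_(i : I) (1 + `|crd i x|) `^ s.
    by apply: prodr_gt0 => i _; rewrite powR_gt0// ltr_pwDl.
  rewrite ler_pdivlMr// ler_pdivrMl ?powR_gt0//.
  have -> : D `^ ex * C = ((2 `^ s) ^+ k * D `^ (k%:R * (s * (4 * m)^-1))) * ((2 `^ s) ^+ h * D `^ (h%:R * (s * 2^-1))).
    have -> : ex = k%:R * (s * (4 * m)^-1) + h%:R * (s * 2^-1).
      by rewrite /s -[LHS](@divfK _ q) ?gt_eqF// {2}/q; ring.
    by rewrite powRDpos// /C; ring.
  rewrite big_sumType/=; apply: ler_pM.
  - by apply: prodr_ge0 => i _; exact: powR_ge0.
  - by apply: prodr_ge0 => i _; exact: powR_ge0.
  - by apply: (@prod_le_powR s k (fun i => `|crd (inl i) x|)) => //; rewrite invr_ge0 mulr_ge0// ltW.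
  - by apply: (@prod_le_powR s h (fun i => `|crd (inr i) x|)) => //; rewrite invr_ge0.
have mP : measurable_fun setT (fun x : E => \prod_i (1 + `|crd i x|) `^ (- s)).
  apply: measurable_prod => i _; apply: (measurableT_comp (f := fun t : R => t `^ (- s))); first exact: measurable_powR.
  by apply: measurable_funD => //; apply: measurableT_comp (measurable_coord i); exact: normr_measurable.
apply: (@le_lt_trans _ _ (\int[mu]_x (C * \prod_i (1 + `|crd i x|) `^ (- s))%:E)%E).
  apply: ge0_le_integral => //.
  - by move=> x _; rewrite lee_fin powR_ge0.
  - apply/measurable_EFinP; apply: (measurableT_comp (f := fun t : R => t `^ (- ex))); first exact: measurable_powR.
    rewrite /Dn; apply: measurable_funD; last by apply: continuous_measurable_kh; exact: continuous_sqz.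
    apply: measurable_funX; apply: measurable_funD => //.
    apply: (measurableT_comp (f := fun t : R => t `^ m)); first exact: measurable_powR.
    by apply: continuous_measurable_kh; exact: continuous_sqy.
  - by apply/measurable_EFinP; apply: measurable_funM.
  - by move=> x _; rewrite lee_fin.
under eq_integral do rewrite EFinM.
rewrite ge0_integralZl_EFin ?(ltW C0)//; last 2 first.
- by move=> x _; rewrite lee_fin prodr_ge0// => i _; exact: powR_ge0.
- exact/measurable_EFinP.
apply: lte_mul_pinfty => //; first by rewrite lee_fin ltW.
exact: integral_coord_fin.
Qed.

End decay.

Section generalities.
Context {R : realType} {k h : nat}.
Local Notation E := ('rV[R]_k * 'rV[R]_h)%type.
Local Notation I := ('I_k + 'I_h)%type.
Local Notation mu := (@lebesgue_kh R k h).
Implicit Types (x : E).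

Lemma nbhs_not_null x (A : set E) : nbhs x A -> ~ mu.-negligible A.
Proof.
move=> /nbhs_coordP[r r0 rA] [B [mB B0 AB]].
pose X (i : I) : set (measurableTypeR R) := `]crd i x - r, crd i x + r[%classic.
have mX i : measurable (X i) by exact: measurable_itv.
have : (0 < mu (box X))%E.
  apply: box_gt0 => // i; rewrite lebesgue_measure_itv/= lte_fin.
  have -> : crd i x - r < crd i x + r by lra.
  by rewrite -EFinB lte_fin; lra.
apply/negP; rewrite -leNgt -B0; apply: le_measure; rewrite ?inE//; first exact: measurable_box.
move=> y Hy; apply: AB; apply: rA => i.
by have := Hy i; rewrite /X/= in_itv/= ltr_distl.
Qed.

Lemma continuous_sign_changing (u : E -> R) (x y : E) : continuous u -> 0 < u x -> u y < 0 -> sign_changing u.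
Proof.
move=> cu ux uy; split => H.
- apply: (@nbhs_not_null x [set z | 0 < u z]).
    by apply: (cvgr_gt _ (cu x)).
  case: H => B [mB B0 HB]; exists B; split => // z /= uz; apply: HB => /=.
  rewrite /funrpos => h0; have : u z <= 0 by rewrite -h0 le_max lexx.
  by rewrite leNgt uz.
- apply: (@nbhs_not_null y [set z | u z < 0]).
    by apply: (cvgr_lt _ (cu y)).
  case: H => B [mB B0 HB]; exists B; split => // z /= uz; apply: HB => /=.
  rewrite /funrneg => h0; have : - u z <= 0 by rewrite -h0 le_max lexx.
  by rewrite oppr_le0 leNgt uz.
Qed.

Lemma sqr_enorm n (y : 'rV[R]_n) : enorm y ^+ 2 = \sum_i y ord0 i ^+ 2.
Proof. by rewrite /enorm sqr_sqrtr// sumr_ge0// => i _; exact: sqr_ge0. Qed.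

(** Rewrites the density through [|y| ^ alpha * gz], the quantity of which a weak gradient
    guarantees measurability. *)
Lemma energy_density alpha (gy : E -> 'rV[R]_k) (gz : E -> 'rV[R]_h) x :
  enorm (gy x) ^+ 2 + (alpha + 1) ^+ 2 * enorm x.1 `^ (2 * alpha) * enorm (gz x) ^+ 2 =
  \sum_i gy x ord0 i ^+ 2 + (alpha + 1) ^+ 2 * \sum_j (enorm x.1 `^ alpha * gz x ord0 j) ^+ 2.
Proof.
rewrite !sqr_enorm -mulrA; congr (_ + _ * _); rewrite mulr_sumr; apply: eq_bigr => j _.
by rewrite exprMn -(powR_mulrn 2 (powR_ge0 _ _)) -powRrM [alpha * _]mulrC.
Qed.

End generalities.

Section solution.
Context {R : realType} {k h : nat}.
Local Notation E := ('rV[R]_k * 'rV[R]_h)%type.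
Local Notation I := ('I_k + 'I_h)%type.
Local Notation mu := (@lebesgue_kh R k h).
Implicit Types (x : E).
Variables (alpha m gam a w N M r0 : R) (f g g2 n : R -> R).

Local Notation V := (V gam f).
Local Notation Vr := (Vr gam f g).
Local Notation VT := (VT gam f g).
Local Notation Vrr := (Vrr gam f g g2).
Local Notation VTT := (VTT gam f g g2).

Local Notation Ue := (Ue m gam N f g).
Local Notation Uee := (Uee m gam N f g g2).
Local Notation gg := (gg m gam N f g).
Local Notation pp := (pp m gam N f g).
Local Notation dgg := (dgg m gam N f g g2).
Local Notation dpp := (dpp m gam N f g g2).
Local Notation bad := (bad m).
Hypothesis m2 : 1 / 2 < m.
Hypothesis gam_gt0 : 0 < gam.
Hypothesis a_gt0 : 0 < a.
Hypothesis aE : a = 1 + (k%:R - 2) / (2 * m).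
Hypothesis gamE : 2 * gam = a + h%:R - 1.
Hypothesis wE : w = m^-1 - 1.
Hypothesis M_gt0 : 0 < M.
Hypothesis fM : forall s, `|f s| <= M.
Hypothesis nM : forall s, `|n s| <= M.
Hypothesis cf : continuous f.
Hypothesis ode : forall s : R, 0 < s < 1 -> [/\ is_derive s 1 f (g s), is_derive s 1 g (g2 s),
  s * (1 - s) * g2 s = a * gam / 2 * f s - (1 - s) `^ w * n s - ((h%:R + 1) / 2 * (1 - s) - a * s) * g s &
  `|g s + gam / 2 * f s| <= M * ((1 - s) + (1 - s) `^ w)].
Hypothesis g_out : forall s : R, ~ 0 < s < 1 -> g s = 0.
Hypothesis r0_gt0 : 0 < r0.
Hypothesis gamr0 : gam * r0 = m^-1.
Hypothesis N_gt0 : 0 < N.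
Hypothesis Nr0 : N `^ r0 = 4 * m ^+ 2 * 4 `^ m^-1.
Hypothesis nE : forall s, n s = `|f s| `^ r0 * f s.

Hypothesis k_ge1 : (1 <= k)%N.
Hypothesis h_ge1 : (1 <= h)%N.
Hypothesis mE : m = (1 + alpha) / 2.
Hypothesis r0E : r0 = 4 / (hdim (R := R) (k := k) (h := h) alpha - 2).

Let al_gt0 : 0 < alpha. Proof. by have := m2; rewrite mE; lra. Qed.
Local Notation uu := (bubble m gam N f : E -> R).

Let m0 : 0 < m. Proof. by apply: lt_trans m2; rewrite divr_gt0. Qed.
Let Q := hdim (R := R) (k := k) (h := h) alpha.
Let QE : Q = k%:R + 2 * m * h%:R.
Proof. by rewrite /Q /hdim mE; field. Qed.
Let gamQ : gam = (Q - 2) / (4 * m).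
Proof.
have -> : gam = (a + h%:R - 1) / 2 by rewrite -gamE; field.
by rewrite aE QE; field; rewrite gt_eqF.
Qed.
Let Q2 : 2 < Q.
Proof. by move: gam_gt0; rewrite gamQ pmulr_lgt0 ?invr_gt0 ?mulr_gt0// subr_gt0. Qed.
Let Qm : k%:R / (4 * m) + h%:R / 2 = Q / (4 * m).
Proof. by rewrite QE; field; rewrite gt_eqF. Qed.
Let kh : (0 < k + h)%N. Proof. by rewrite addn_gt0 k_ge1. Qed.

Let wgt x : enorm x.1 `^ alpha = sqy x `^ ((2 * m - 1) / 2).
Proof. by rewrite -enorm_sqy mE; congr (_ `^ _); field. Qed.

Let mu_uu : measurable_fun setT uu.
Proof. by apply: continuous_measurable_kh => x; exact: (continuous_uu m2 cf). Qed.


Lemma solution_weak_grad : exists2 C : R, (forall (i : 'I_k) x, `|gg (inl i) x| <= C) &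
  weak_grad alpha uu (grad_of_y (gg : I -> E -> R)) (grad_of_z (gg : I -> E -> R)).
Proof.
have [K K0 HK] := gg_bound (k := k) (h := h) m2 gam_gt0 wE M_gt0 fM ode g_out N_gt0.
have NM0 : 0 <= N * M by rewrite mulr_ge0// ltW.
exists (N * M + K) => [i x|]; first by apply: le_trans ((HK x).1 i) _; rewrite lerDr.
apply: (@classical_weak_grad _ _ _ _ _ _ (N * M + K)) => //.
- move=> x; apply: le_trans (uu_bound1 m gam_gt0 M_gt0 fM N_gt0 x) _.
  by rewrite lerDl ltW.
- by move=> i x; exact: (der_uu m2 gam_gt0 wE M_gt0 fM cf ode g_out N_gt0).
- by move=> i x; apply: le_trans ((HK x).1 i) _; rewrite lerDr.
- by move=> j x; rewrite wgt; apply: le_trans ((HK x).2 j) _; rewrite lerDr.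
Qed.

Lemma solution_energy_fin : (energy alpha (grad_of_y (gg : I -> E -> R)) (grad_of_z (gg : I -> E -> R)) < +oo)%E.
Proof.
have [K K0 HK] := density_bound (k := k) (h := h) m2 gam_gt0 wE M_gt0 fM ode g_out N_gt0.
have [_ _ [_ my mz _]] := solution_weak_grad.
have Dfin : (\int[mu]_x (Dn (sqy x `^ m) (sqz x) `^ (- (2 * gam + (1 + w) / 2)))%:E < +oo)%E.
  (* The exponent is [(2 * Q - 2) / (4 * m)] against the threshold [Q / (4 * m)]; the condition is
     [2 < Q]. *)
  apply: Dn_integral_fin => //; rewrite Qm gamQ wE.
  have -> : 2 * ((Q - 2) / (4 * m)) + (1 + (m^-1 - 1)) / 2 = (2 * Q - 2) / (4 * m) by field; rewrite gt_eqF.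
  by rewrite ltr_pM2r ?invr_gt0 ?mulr_gt0//; move: Q2; lra.
have mD : measurable_fun setT (fun x : E => Dn (sqy x `^ m) (sqz x) `^ (- (2 * gam + (1 + w) / 2))).
  apply: (measurableT_comp (f := fun t : R => t `^ _)); first exact: measurable_powR.
  rewrite /Dn; apply: measurable_funD; last by apply: continuous_measurable_kh; exact: continuous_sqz.
  apply: measurable_funX; apply: measurable_funD => //.
  apply: (measurableT_comp (f := fun t : R => t `^ m)); first exact: measurable_powR.
  by apply: continuous_measurable_kh; exact: continuous_sqy.
apply: (@le_lt_trans _ _ (\int[mu]_x (K * Dn (sqy x `^ m) (sqz x) `^ (- (2 * gam + (1 + w) / 2)))%:E)%E).
  apply: ge0_le_integral => //.
  - move=> x _; rewrite lee_fin; apply: addr_ge0; first exact: sqr_ge0.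
    by apply: mulr_ge0; [apply: mulr_ge0; [exact: sqr_ge0|exact: powR_ge0]|exact: sqr_ge0].
  - apply/measurable_EFinP; under eq_fun do rewrite energy_density.
    apply: measurable_funD.
      by apply: measurable_sum => i; apply: measurable_funX; exact: (my i).1.
    apply: measurable_funM => //.
    by apply: measurable_sum => j; apply: measurable_funX; exact: (mz j).1.
  - by apply/measurable_EFinP; apply: measurable_funM.
  - move=> x _; rewrite lee_fin energy_density; apply: le_trans (HK x).
    rewrite le_eqVlt; apply/orP; left; apply/eqP; congr (_ + _).
      by apply: eq_bigr => i _; rewrite mxE.
    rewrite -mulrA (_ : alpha + 1 = 2 * m); last by rewrite mE; field.
    congr (_ * _); rewrite mulr_sumr; apply: eq_bigr => j _.
    rewrite mxE exprMn wgt; congr (_ * _).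
    by rewrite -(powR_mulrn 2 (powR_ge0 _ _)) -powRrM; congr (_ `^ _); field.
under eq_integral do rewrite EFinM.
rewrite ge0_integralZl_EFin ?(ltW K0)//; last 2 first.
- by move=> x _; rewrite lee_fin powR_ge0.
- exact/measurable_EFinP.
by apply: lte_mul_pinfty => //; rewrite lee_fin ltW.
Qed.

Lemma solution_norm_fin : (grushin_norm alpha uu < +oo)%E.
Proof.
apply: poweR_lty; apply: le_lt_trans solution_energy_fin; apply: ereal_inf_lbound.
by exists (grad_of_y (gg : I -> E -> R)), (grad_of_z (gg : I -> E -> R)); split => //; have [] := solution_weak_grad.
Qed.

Lemma solution_Lfun : uu \in Lfun mu (2 * Q / (Q - 2))%:E.
Proof.
have q0 : 0 < 2 * Q / (Q - 2) by rewrite divr_gt0 ?subr_gt0// mulr_gt0// (lt_trans _ Q2).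
apply/andP; split; first by rewrite inE.
rewrite inE /finite_norm unlock /Lnorm; apply: poweR_lty.
have Dfin : (\int[mu]_x (Dn (sqy x `^ m) (sqz x) `^ (- (gam * (2 * Q / (Q - 2)))))%:E < +oo)%E.
  (* At the critical exponent the decay of [uu] gives [2 * Q / (4 * m)], twice the threshold. *)
  apply: Dn_integral_fin => //; rewrite Qm gamQ.
  have -> : (Q - 2) / (4 * m) * (2 * Q / (Q - 2)) = (2 * Q) / (4 * m).
    by field; rewrite !gt_eqF// subr_gt0.
  by rewrite ltr_pM2r ?invr_gt0 ?mulr_gt0//; move: Q2; lra.
have mD : measurable_fun setT (fun x : E => Dn (sqy x `^ m) (sqz x) `^ (- (gam * (2 * Q / (Q - 2))))).
  apply: (measurableT_comp (f := fun t : R => t `^ _)); first exact: measurable_powR.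
  rewrite /Dn; apply: measurable_funD; last by apply: continuous_measurable_kh; exact: continuous_sqz.
  apply: measurable_funX; apply: measurable_funD => //.
  apply: (measurableT_comp (f := fun t : R => t `^ m)); first exact: measurable_powR.
  by apply: continuous_measurable_kh; exact: continuous_sqy.
have NM0 : 0 <= N * M by rewrite mulr_ge0// ltW.
apply: (@le_lt_trans _ _ (\int[mu]_x ((N * M) `^ (2 * Q / (Q - 2)) * Dn (sqy x `^ m) (sqz x) `^ (- (gam * (2 * Q / (Q - 2)))))%:E)%E).
  apply: ge0_le_integral => //.
  - by move=> x _; exact: poweR_ge0.
  - rewrite (_ : (fun x => _) = EFin \o (fun x : E => `|uu x| `^ (2 * Q / (Q - 2)))); last by apply/funext => x.
    apply/measurable_EFinP; apply: (measurableT_comp (f := fun t : R => t `^ _)); first exact: measurable_powR.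
    by apply: measurableT_comp mu_uu; exact: normr_measurable.
  - by apply/measurable_EFinP; apply: measurable_funM.
  - move=> x _; rewrite /= lee_fin.
    have -> : (N * M) `^ (2 * Q / (Q - 2)) * Dn (sqy x `^ m) (sqz x) `^ (- (gam * (2 * Q / (Q - 2)))) =
        (N * M * Dn (rh m x) (sqz x) `^ (- gam)) `^ (2 * Q / (Q - 2)).
      by rewrite [in RHS]powRM ?powR_ge0// -[in RHS]powRrM mulNr.
    apply: ge0_ler_powR; rewrite ?nnegrE ?(ltW q0) ?mulr_ge0 ?powR_ge0//; last exact: uu_bound.
    exact: ltW.
    exact: ltW.
under eq_integral do rewrite EFinM.
rewrite ge0_integralZl_EFin ?powR_ge0//; last 2 first.
- by move=> x _; rewrite lee_fin powR_ge0.
- exact/measurable_EFinP.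
by apply: lte_mul_pinfty => //; rewrite lee_fin powR_ge0.
Qed.

Lemma solution_weak : weak_solution alpha uu.
Proof.
split; first by split; [exact: solution_Lfun|exact: solution_norm_fin].
exists (grad_of_y (gg : I -> E -> R)), (grad_of_z (gg : I -> E -> R)); split; first by have [] := solution_weak_grad.
move=> phi tphi; rewrite -/Q -r0E.
apply: (@classical_weak_eq _ _ _ _ _ gg (N * M) _ _ _ r0 pp dpp bad) => //.
- exact: uu_bound1.
- by move=> i x; exact: (der_uu m2 gam_gt0 wE M_gt0 fM cf ode g_out N_gt0).
- move=> x; split => // j.
  have e1 : 2 * m - 1 = alpha by rewrite mE; field.
  have e2 : 2 * m = 1 + alpha by rewrite mE; field.
  by rewrite /pp -/(gg (inr j) x) enorm_sqy e1 e2.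
- by move=> i x t; exact: (pp_cont m2 gam_gt0 wE M_gt0 fM cf ode g_out N_gt0).
- by move=> i x nb; exact: (pp_der N ode nb).
- exact: (pp_bound m2 gam_gt0 wE M_gt0 fM ode g_out N_gt0).
- exact: (dpp_bound m2 gam_gt0 a_gt0 aE gamE wE M_gt0 fM nM ode g_out r0_gt0 gamr0 N_gt0 Nr0 nE).
- by move=> i x; exact: bad_line.
- exact: bad_null.
- exact: ltW.
- by move=> x; exact: (dpp_sum_all m2 aE gamE wE ode gamr0 N_gt0 Nr0 nE k_ge1).
Qed.

(** A point with [|y| = 1] and [|z| ^ 2 = T]. There [S = T / (4 + T)], so these points realize every
    value of [S] in the open unit interval. *)
Definition sphere_point (T : R) : E :=
  (0 : E) + 1 *: base (inl (Ordinal k_ge1)) + Num.sqrt T *: base (inr (Ordinal h_ge1)).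

Lemma sphere_pointE (T : R) : 0 <= T -> sqy (sphere_point T) = 1 /\ sqz (sphere_point T) = T.
Proof.
move=> T0; rewrite /sphere_point sqy_linez sqy_liney sqz_linez sqz_liney.
have c0 (i : I) : crd i 0 = 0 :> R by case: i => i; rewrite /crd mxE.
have -> : sqy (0 : E) = 0 by apply: big1 => i _; rewrite mxE expr0n.
have -> : sqz (0 : E) = 0 by apply: big1 => i _; rewrite mxE expr0n.
rewrite crd_shift !c0 (_ : (inr _ == inl _) = false)//.
split; first by ring.
by rewrite sqr_sqrtr// mulr0n !mulr0 !addr0 mulr0 !add0r.
Qed.

Lemma uu_sign (s : R) : 0 < s < 1 -> exists x, exists2 c : R, 0 < c & uu x = c * f s.
Proof.
move=> /andP[s0 s1]; have T0 : 0 <= 4 * s / (1 - s) by rewrite divr_ge0 ?mulr_ge0 ?subr_ge0 ?ltW.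
have [h1 h2] := sphere_pointE T0.
exists (sphere_point (4 * s / (1 - s))), (N * Dn 1 (4 * s / (1 - s)) `^ (- gam)).
  by rewrite mulr_gt0// powR_gt0// Dn_gt0.
rewrite /bubble /V /rh h1 h2 powR1 mulrA; congr (_ * f _).
rewrite /Ss /Xx /Dn; field; rewrite gt_eqF ?subr_gt0//=.
by rewrite -mulrDr subrK mulr1 gt_eqF.
Qed.

Lemma solution_sign_changing (s s' : R) : 0 < s < 1 -> 0 < s' < 1 -> 0 < f s -> f s' < 0 -> sign_changing uu.
Proof.
move=> s01 s01' fs fs'; have [x [c c0 hx]] := uu_sign s01; have [y [c' c0' hy]] := uu_sign s01'.
apply: (@continuous_sign_changing _ _ _ _ x y); first by move=> z; exact: (continuous_uu m2 cf).
- by rewrite hx mulr_gt0.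
- by rewrite hy pmulr_rlt0.
Qed.

End solution.

(** * Uniqueness of weak gradients *)

Section flat.
Context {R : realType}.
Implicit Types (t : R) (m n : nat).

(** [flat m] extends the derivatives of [exp (- 1 / t)] by [0]. *)
Definition flat m t : R := if 0 < t then expR (- t^-1) * t ^- m else 0.

(** One term of the exponential series at [1 / t] suffices. *)
Lemma flat_small n : exists2 K : R, 0 < K & forall t, 0 < t -> expR (- t^-1) <= K * t ^+ n.+1.
Proof.
exists n.+1`!%:R; first by rewrite ltr0n fact_gt0.
move=> t t0; have f0 : 0 < n.+1`!%:R :> R by rewrite ltr0n fact_gt0.
have it : 0 <= t^-1 by rewrite invr_ge0 ltW.
have h := expR_ge1Dxn n it.
rewrite expRN -[leRHS]invrK lef_pV2 ?posrE ?expR_gt0 ?invr_gt0 ?mulr_gt0 ?exprn_gt0//.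
apply: le_trans h; rewrite invfM mulrC -exprVn; apply: (@le_trans _ _ (t^-1 ^+ n.+1 / n.+1`!%:R)).
  by rewrite mulrC.
by rewrite lerDr.
Qed.

Lemma der_flat m t : is_derive t 1 (flat m) (flat m.+2 t - m%:R * flat m.+1 t).
Proof.
have [t0|t0|t0] := ltgtP t 0.
- rewrite /flat ltNge (ltW t0)/= mulr0 subr0.
  apply: (@near_eq_is_derive _ _ _ (fun=> 0)).
    have ci : s @[s --> t] --> t by exact: cvg_id.
    have : \forall s \near t, s < 0 by apply: (cvgr_lt _ ci).
    by apply: filterS => s s0; rewrite ltNge (ltW s0).
- apply: (@near_eq_is_derive R R R (fun s : R => expR (- s^-1) * s ^- m) (flat m) t 1 _).
    have ci : s @[s --> t] --> t by exact: cvg_id.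
    have : \forall s \near t, 0 < s by apply: (cvgr_gt _ ci).
    by apply: filterS => s s0; rewrite /flat s0.
  have tn : t != 0 by rewrite gt_eqF.
  have hV : is_derive t 1 GRing.inv (- (t ^+ 2)^-1 * 1).
    exact: (@derV _ (fun s => s) t 1 tn (derI _)).
  derby; first by rewrite expf_neq0.
  rewrite /flat t0; case: m => [|m]; first by rewrite !expr0; field.
  by rewrite /= !exprS; move: (expR _) => A; field; rewrite expf_neq0.
- rewrite t0 /flat ltxx mulr0 subrr; apply/der_eps => e e0.
  have [K K0 HK] := flat_small m.+1.
  exists (e / K); first by rewrite divr_gt0.
  move=> y; rewrite !subr0 mul0r subr0 ltxx subr0 => ye.
  case: ifPn => [y0|_]; last by rewrite normr0 mulr_ge0// ltW.
  rewrite ger0_norm ?mulr_ge0 ?expR_ge0 ?invr_ge0 ?exprn_ge0 ?(ltW y0)//.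
  rewrite (gtr0_norm y0) ler_pdivrMr ?exprn_gt0//; apply: le_trans (HK y y0) _.
  rewrite !exprS mulrA mulrA -mulrA -[leRHS]mulrA -exprS; apply: ler_wpM2r.
    by rewrite exprn_ge0// ltW.
  move: ye; rewrite (gtr0_norm y0) ltr_pdivlMr// mulrC; exact: ltW.
Qed.

Lemma flat0_bound t : 0 <= flat 0 t <= 1.
Proof.
rewrite /flat; case: ifPn => [t0|_]; last by rewrite lexx ler01.
by rewrite expr0 invr1 mulr1 expR_ge0/= expR_le1 oppr_le0 invr_ge0 ltW.
Qed.

Lemma flat0_cvg t : 0 < t -> flat 0 (n.+1%:R * t) @[n --> \oo] --> (1 : R).
Proof.
move=> t0; apply: (@squeeze_cvgr _ _ _ _ (fun n => 1 - t^-1 * harmonic n) (fun=> 1)).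
- apply: nearW => n; have nt : 0 < n.+1%:R * t by rewrite mulr_gt0// ltr0n.
  have /andP[_ ->] := flat0_bound (n.+1%:R * t); rewrite andbT /flat nt expr0 invr1 mulr1.
  apply: le_trans (expR_ge1Dx _); rewrite lerD2l lerN2 invfM mulrC.
  by rewrite /harmonic.
- rewrite -[X in _ --> X](subr0 1); apply: cvgB; first exact: cvg_cst.
  by rewrite -(mulr0 t^-1); apply: cvgMr; exact: cvg_harmonic.
- exact: cvg_cst.
Qed.

End flat.

Section smooth.
Context {R : realType} {k h : nat}.
Local Notation E := ('rV[R]_k * 'rV[R]_h)%type.
Local Notation I := ('I_k + 'I_h)%type.
Implicit Types (x v : E) (f g : E -> R).

(** A class containing the bumps and stable under directional derivatives, which is all that
    [smooth] asks; smoothness then follows by induction on the list of directions. *)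
Inductive elementary : (E -> R) -> Prop :=
| elementary_cst c : elementary (fun=> c)
| elementary_crd i : elementary (crd i)
| elementary_add f g : elementary f -> elementary g -> elementary (fun x => f x + g x)
| elementary_mul f g : elementary f -> elementary g -> elementary (fun x => f x * g x)
| elementary_flat m f : elementary f -> elementary (fun x => flat m (f x)).

Lemma is_derive_line f x v (d : R) : is_derive x v f d <-> is_derive (0 : R) 1 (fun t => f (x + t *: v)) d.
Proof.
have Q : (fun r : R => r^-1 *: ((f \o shift x) (r *: v) - f x)) =
         (fun r : R => r^-1 *: (((fun s : R => f (x + s *: v)) \o shift 0) (r *: 1) - f (x + 0 *: v))).
  by apply/funext => r; rewrite /= scale0r addr0 [r *: 1]mulr1 addr0 [_ + x]addrC.
split=> -[H1 H2]; split.
- by move: H1; rewrite /derivable Q.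
- by rewrite -H2 /derive Q.
- by move: H1; rewrite /derivable Q.
- by rewrite -H2 /derive Q.
Qed.

Lemma elementary_facts f : elementary f -> continuous f /\
  forall v, exists2 g, elementary g & forall x, is_derive x v f (g x).
Proof.
elim=> {f} [c|i|f g ef [cf df] eg [cg dg]|f g ef [cf df] eg [cg dg]|m f ef [cf df]].
- split => [|v]; first by move=> x; exact: cvg_cst.
  exists (fun=> 0); first exact: elementary_cst.
  by move=> x; exact: is_derive_cst.
- split => [|v]; first exact: continuous_crd.
  exists (fun=> crd i v); first exact: elementary_cst.
  move=> x; apply/is_derive_line.
  rewrite (_ : (fun t : R => _) = fun t => crd i x + t * crd i v); last first.
    by apply/funext => t; rewrite crdD crdZ.
  by derby; ring.
- split => [|v]; first by move=> x; apply: cvgD; [exact: cf|exact: cg].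
  have [f' ef' hf] := df v; have [g' eg' hg] := dg v.
  exists (fun x => f' x + g' x); first exact: elementary_add.
  by move=> x; apply: is_deriveD.
- split => [|v]; first by move=> x; apply: cvgM; [exact: cf|exact: cg].
  have [f' ef' hf] := df v; have [g' eg' hg] := dg v.
  exists (fun x => f' x * g x + f x * g' x).
    by apply: elementary_add; exact: elementary_mul.
  move=> x; apply/is_derive_line.
  have hf' := (is_derive_line _ _ _ _).1 (hf x); have hg' := (is_derive_line _ _ _ _).1 (hg x).
  by derby; rewrite !scale0r !addr0; ring.
- split => [x|v].
    apply: (@continuous_comp _ _ _ f (flat m)); first exact: cf.
    by apply: der_cont; exact: der_flat.
  have [f' ef' hf] := df v.
  exists (fun x => (flat m.+2 (f x) + (- m%:R) * flat m.+1 (f x)) * f' x).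
    apply: elementary_mul => //; apply: elementary_add; first exact: elementary_flat.
    by apply: elementary_mul; [exact: elementary_cst|exact: elementary_flat].
  move=> x; apply/is_derive_line.
  have hf' := (is_derive_line _ _ _ _).1 (hf x).
  have h0 : is_derive (f (x + (0 : R) *: v)) 1 (flat m) (flat m.+2 (f x) - m%:R * flat m.+1 (f x)).
    by rewrite scale0r addr0; exact: der_flat.
  by notypeclasses refine (derE (@derComp _ _ (fun t => f (x + t *: v)) _ _ _ h0 hf') _); ring.
Qed.

Lemma elementary_smooth f : elementary f -> smooth f.
Proof.
move=> ef s; have : elementary (iter_derive s f).
  elim: s => [//|v s IH]; rewrite /iter_derive/= -/(iter_derive s f).
  have [_ /(_ v)[g eg hg]] := elementary_facts IH.
  rewrite (_ : 'D_v _ = g)//; apply/funext => x.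
  by have [_ ->] := hg x.
move=> /elementary_facts[c d]; split => // x v; have [g _ hg] := d v.
by have [] := hg x.
Qed.

(** The product in each factor is positive exactly between the two faces, so the bumps increase to
    the indicator of the open box as [n] grows. *)
Definition obump (a b : I -> R) (n : nat) x : R :=
  \prod_i flat 0 (n.+1%:R * ((crd i x - a i) * (b i - crd i x))).

Lemma obump_elementary a b n : elementary (obump a b n).
Proof.
rewrite /obump; elim: (index_enum I) => [|i s IH].
  by rewrite (_ : (fun _ => _) = fun=> 1)//; [exact: elementary_cst|apply/funext => x; rewrite big_nil].
rewrite (_ : (fun _ => _) = fun x => flat 0 (n.+1%:R * ((crd i x + (- a i)) * (b i + (-1) * crd i x))) *
  \prod_(j <- s) flat 0 (n.+1%:R * ((crd j x - a j) * (b j - crd j x)))); last first.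
  by apply/funext => x; rewrite big_cons mulN1r.
apply: elementary_mul => //; apply: elementary_flat; apply: elementary_mul; first exact: elementary_cst.
apply: elementary_mul; apply: elementary_add.
- exact: elementary_crd.
- exact: elementary_cst.
- exact: elementary_cst.
- by apply: elementary_mul; [exact: elementary_cst|exact: elementary_crd].
Qed.

Definition obox (a b : I -> R) : set E := box (fun i => `]a i, b i[%classic).

Lemma oboxP a b x : obox a b x <-> forall i, a i < crd i x < b i.
Proof. by split=> H i; have := H i; rewrite /= in_itv. Qed.

Lemma obump_bound a b n x : 0 <= obump a b n x <= 1.
Proof.
apply/andP; split; first by apply: prodr_ge0 => i _; have /andP[] := flat0_bound (n.+1%:R * ((crd i x - a i) * (b i - crd i x))).
by apply: prodr_ile1 => i _; exact: flat0_bound.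
Qed.

Lemma obump_out a b n x : (forall i, a i <= b i) -> ~ obox a b x -> obump a b n x = 0.
Proof.
move=> ab nx; have [i hi] : exists i, ~ (a i < crd i x < b i).
  by apply/existsNP => H; apply: nx; apply/oboxP.
rewrite /obump (bigD1 i)//= /flat ifN ?mul0r// -leNgt.
apply: mulr_ge0_le0 => //.
have [xa|xa] := leP (crd i x) (a i).
  by apply: mulr_le0_ge0; rewrite ?subr_le0// subr_ge0 (le_trans xa).
have xb : b i <= crd i x by rewrite leNgt; apply/negP => xb; apply: hi; rewrite xa xb.
by apply: mulr_ge0_le0; rewrite ?subr_le0// subr_ge0 ltW.
Qed.

Lemma obump_cvg a b x : obox a b x -> obump a b n x @[n --> \oo] --> (1 : R).
Proof.
move=> /oboxP H; rewrite /obump; elim: (index_enum I) => [|i s IH].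
  by under eq_fun do rewrite big_nil; exact: cvg_cst.
under eq_fun do rewrite big_cons.
have hi : 0 < (crd i x - a i) * (b i - crd i x).
  by have /andP[h1 h2] := H i; rewrite mulr_gt0// subr_gt0.
by have c := cvgM (flat0_cvg hi) IH; rewrite mulr1 in c; exact: c.
Qed.

Lemma obump_test a b n : (forall i, a i <= b i) -> test_fun (obump a b n).
Proof.
move=> ab; split; first by apply: elementary_smooth; exact: obump_elementary.
pose K : set E := [set y : 'rV[R]_k | forall i, [set` `[a (inl i), b (inl i)]] (y ord0 i)] `*`
  [set z : 'rV[R]_h | forall i, [set` `[a (inr i), b (inr i)]] (z ord0 i)].
have cK : compact K.
  by apply: compact_setX; apply: (@rV_compact R _ (fun i => [set` `[_, _]])) => i; exact: segment_compact.
apply: (@subclosed_compact _ _ K) => //; first exact: closed_closure.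
have clK : closed K by apply: compact_closed => //; exact: norm_hausdorff.
rewrite (closure_id K).1//; apply: closure_subset => x /= bx.
have : obox a b x by apply: contrapT => nx; move: bx; rewrite obump_out ?eqxx.
move=> /oboxP H; split => i /=; rewrite in_itv/=.
- by have /andP[h1 h2] := H (inl i); rewrite !ltW.
- by have /andP[h1 h2] := H (inr i); rewrite !ltW.
Qed.

End smooth.

Section uniqueness.
Context {R : realType} {k h : nat}.
Local Notation E := ('rV[R]_k * 'rV[R]_h)%type.
Local Notation I := ('I_k + 'I_h)%type.
Local Notation mu := (@lebesgue_kh R k h).
Implicit Types (x : E) (a b : I -> R).

Lemma compact_cube (r : R) : compact (cube r : set E).
Proof.
pose K : set E := [set y : 'rV[R]_k | forall i, [set` `[- r, r]] (y ord0 i)] `*`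
  [set z : 'rV[R]_h | forall i, [set` `[- r, r]] (z ord0 i)].
rewrite (_ : cube r = K).
  by apply: compact_setX; apply: (@rV_compact R _ (fun i => [set` `[_, _]])) => i; exact: segment_compact.
apply/seteqP; split => x.
  by move=> /cubeP H; split => i /=; rewrite in_itv/= -ler_norml; [exact: (H (inl i))|exact: (H (inr i))].
move=> [H1 H2]; apply/cubeP => -[i|i]; [have := H1 i|have := H2 i];
  by rewrite /= in_itv/= -ler_norml.
Qed.

Lemma loc_integrable_cube (w : E -> R) (r : R) : loc_integrable w -> mu.-integrable (cube r) (EFin \o w).
Proof.
move=> [mw iw]; apply/integrableP; split; first by apply/measurable_EFinP; exact: measurable_funTS.
by apply: iw; exact: compact_cube.
Qed.

Definition oboxes : set (set E) := [set B | exists a b, (forall i, a i <= b i) /\ B = obox a b].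

Lemma measurable_obox a b : measurable (obox a b : set E).
Proof. by apply: measurable_box => i; exact: measurable_itv. Qed.

Lemma oboxes_setI : setI_closed oboxes.
Proof.
move=> _ _ [a [b [ab ->]]] [a' [b' [ab' ->]]].
(* The outer maximum keeps [c i <= d i] when the boxes are disjoint in direction [i]; the side is
   then empty. *)
pose c i := Num.max (a i) (a' i); pose d i := Num.max (c i) (Num.min (b i) (b' i)).
exists c, d; split; first by move=> i; rewrite /d le_max lexx.
apply/seteqP; split => x.
- move=> [/oboxP H1 /oboxP H2]; apply/oboxP => i.
  have /andP[p1 p2] := H1 i; have /andP[q1 q2] := H2 i.
  by rewrite /d /c gt_max p1 q1/= lt_max lt_min p2 q2 orbT.
- move=> /oboxP H; split; apply/oboxP => i; have := H i; rewrite /d /c gt_max !lt_max lt_min => /andP[/andP[p1 p2]];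
    by rewrite ?p1 ?p2 ltNge (ltW p1)/= ltNge (ltW p2)/= => /andP[].
Qed.

Lemma cube_obox (r : R) x : 0 <= r -> (forall i, `|crd i x| < r) -> obox (fun=> - r) (fun=> r) x.
Proof. by move=> r0 H; apply/oboxP => i; rewrite -ltr_norml. Qed.

Lemma coord_lt_nat x : exists n : nat, forall i, `|crd i x| < n%:R.
Proof.
exists (Num.truncn (\sum_i `|crd i x|)).+1 => i.
apply: le_lt_trans (truncnS_gt _).
by rewrite (bigD1 i)//= lerDl sumr_ge0.
Qed.

(** A half-space in one coordinate is a countable union of boxes, which makes all coordinates
    measurable for the sigma-algebra that the boxes generate. *)
Lemma measurable_oboxes : @measurable _ E = <<s oboxes >>.
Proof.
apply/seteqP; split; last first.
  apply: smallest_sub; first exact: sigma_algebra_measurable.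
  by move=> _ [a [b [_ ->]]]; exact: measurable_obox.
pose T' := g_sigma_algebraType oboxes.
have mc (i : I) : measurable_fun [set: T'] (crd i : T' -> R).
  apply: (measurability _ (RGenOInfty.measurableE R)) => _ [_ [c ->] <-].
  rewrite setTI.
  pose a (n : nat) (j : I) : R := if j == i then c else - n%:R.
  pose b (n : nat) (j : I) : R := Num.max (a n j) n%:R.
  rewrite (_ : _ @^-1` _ = \bigcup_n obox (a n) (b n)); last first.
    apply/seteqP; split => x /=; rewrite in_itv/= andbT.
      move=> cx; have [n Hn] := coord_lt_nat x; exists n => //.
      apply/oboxP => j; have := Hn j; rewrite ltr_norml => /andP[h1 h2].
      by rewrite /b lt_max h2 orbT andbT /a; case: eqP => [->|].
    by move=> [n _ /oboxP/(_ i)]; rewrite /a eqxx => /andP[].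
  apply: bigcup_measurable => n _; apply: sub_sigma_algebra.
  by exists (a n), (b n); split => // j; rewrite /b le_max lexx.
have mid : measurable_fun [set: T'] (fun x : T' => (x : E)).
  apply/measurable_fun_pairP; split; apply: measurable_fun_rV => j.
  - exact: (mc (inl j)).
  - exact: (mc (inr j)).
move=> A mA; have := mid measurableT A mA; rewrite setTI; exact.
Qed.

Variable w : E -> R.
Hypothesis loc_w : loc_integrable w.
Hypothesis w_test : forall phi, test_fun phi -> \int[mu]_x (w x * phi x) = 0.

Let mw : measurable_fun setT w. Proof. by case: loc_w. Qed.

Lemma obox_cube a b : exists2 r : R, 0 <= r & obox a b `<=` cube r.
Proof.
exists (\sum_i (`|a i| + `|b i|)); first by apply: sumr_ge0 => i _; rewrite addr_ge0.
move=> x /oboxP H; apply/cubeP => i; have /andP[h1 h2] := H i.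
apply: (@le_trans _ _ (`|a i| + `|b i|)); last by rewrite [leRHS](bigD1 i)//= lerDl sumr_ge0// => j _; rewrite addr_ge0.
have a1 := ler_norm (- a i); rewrite normrN in a1; have b1 := ler_norm (b i).
have a0 := normr_ge0 (a i); have b0 := normr_ge0 (b i).
rewrite ler_norml; apply/andP; split; move: h1 h2 a1 b1 a0 b0; lra.
Qed.

(** Dominated convergence along bumps that tend to the indicator of the box. *)
Lemma integral_obox a b : (forall i, a i <= b i) -> (\int[mu]_(x in obox a b) (w x)%:E = 0)%E.
Proof.
move=> ab; have [r r0 Hr] := obox_cube a b.
have mo := measurable_obox a b.
have iw := loc_integrable_cube r loc_w.
have iwT : mu.-integrable setT ((EFin \o w) \_ (cube r)).
  by apply/(integrable_mkcond _ (measurable_cube r)).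
have mb n : measurable_fun setT (obump a b n).
  by apply: continuous_measurable_kh; have [] := elementary_facts (obump_elementary a b n).
have dom n x : (`|(w x * obump a b n x)%:E| <= `|((EFin \o w) \_ (cube r)) x|)%E.
  rewrite patchE; case: ifPn => [_|nc].
    rewrite /= lee_fin normrM ler_piMr//.
    by have /andP[h1 h2] := obump_bound a b n x; rewrite ger0_norm.
  have -> : obump a b n x = 0.
    by apply: obump_out => // /Hr cx; move: nc; rewrite notin_setE.
  by rewrite mulr0 abse0.
have iwb n : mu.-integrable setT (fun x => (w x * obump a b n x)%:E).
  apply: le_integrable iwT => //; first by apply/measurable_EFinP; apply: measurable_funM.
have int0 n : (\int[mu]_x (w x * obump a b n x)%:E = 0)%E.
  rewrite -[LHS]fineK; last exact: (integrable_fin_num measurableT (iwb n)).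
  by have := w_test (obump_test n ab); rewrite /Rintegral => ->.
rewrite integral_mkcond.
have [|||||Fi _ lim] := @dominated_convergence _ _ _ mu setT measurableT (fun n x => (w x * obump a b n x)%:E)
  ((EFin \o w) \_ (obox a b)) (fun x => `|((EFin \o w) \_ (cube r)) x|%E).
- by move=> n; apply/measurable_EFinP; apply: measurable_funM.
- have mE : measurable_fun (obox a b) (EFin \o w) by apply/measurable_EFinP; exact: measurable_funTS.
  exact: (measurable_restrictT _ mo).1 mE.
- apply: aeW => x _; rewrite patchE; case: ifPn => [/set_mem xo|nx].
    apply: cvg_EFin; first exact: nearW.
    have c := cvgM (cvg_cst (w x)) (obump_cvg xo); rewrite mulr1 in c; exact: c.
  apply: cvg_near_cst; apply: nearW => n.
  by rewrite obump_out ?mulr0//; move: nx; rewrite notin_setE.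
- exact: integrable_abse.
- by apply: aeW => x n _; exact: dom.
move/cvg_lim : lim => <-//; rewrite (_ : (fun n => _) = fun=> 0%E).
  by rewrite lim_cst.
by apply/funext => n; exact: int0.
Qed.

(** A Dynkin argument relative to a fixed box, inside which [w] is integrable and integrals over
    complements and unions make sense. *)
Lemma integral_inter_obox (A : set E) a b : measurable A -> (forall i, a i <= b i) ->
  (\int[mu]_(x in A `&` obox a b) (w x)%:E = 0)%E.
Proof.
move=> mA ab; have mo := measurable_obox a b.
have [r r0 Hr] := obox_cube a b.
have iw : mu.-integrable (obox a b) (EFin \o w).
  by apply: integrableS (loc_integrable_cube r loc_w) => //; exact: measurable_cube.
pose P (A : set E) := (\int[mu]_(x in A `&` obox a b) (w x)%:E = 0)%E.
apply: (@dynkin_induction _ _ oboxes P); rewrite /P.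
- exact: measurable_oboxes.
- exact: oboxes_setI.
- by rewrite setTI; exact: integral_obox.
- move=> B GB; have GO : oboxes (obox a b) by exists a, b.
  by have [c [d [cd ->]]] := oboxes_setI GB GO; exact: integral_obox.
- move=> S mS SP.
  have mSo : measurable (S `&` obox a b) by exact: measurableI.
  have mSo' : measurable (~` S `&` obox a b) by apply: measurableI => //; exact: measurableC.
  have OE : obox a b = (S `&` obox a b) `|` (~` S `&` obox a b) by rewrite -setIUl setUv setTI.
  have := integral_obox ab; rewrite {1}OE integral_setU//=.
  + by rewrite SP add0e.
  + by apply/measurable_EFinP; exact: measurable_funTS.
  + by apply/disj_setPS => x [[Sx _] [nSx _]].
- move=> F mF tF FP; rewrite setI_bigcupl integral_bigcup//=.
  + by rewrite eseries0.
  + exact: trivIset_setIr.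
  + by move=> n; exact: measurableI.
  + apply: integrableS iw => //; first by apply: bigcup_measurable => n _; exact: measurableI.
    by move=> x [n _ []].
- by rewrite -measurable_oboxes.
Qed.

Lemma weakly_null_ae : {ae mu, forall x, w x = 0}.
Proof.
have key (n : nat) : {ae mu, forall x, obox (fun=> - n%:R) (fun=> n%:R) x -> w x = 0}.
  have nn (i : I) : - n%:R <= n%:R :> R by rewrite -subr_ge0 opprK addr_ge0.
  have mo := measurable_obox (fun=> - n%:R) (fun=> n%:R).
  have [r r0 Hr] := obox_cube (fun=> - n%:R) (fun=> n%:R).
  have iw : mu.-integrable (obox (fun=> - n%:R) (fun=> n%:R)) (EFin \o w).
    by apply: integrableS (loc_integrable_cube r loc_w) => //; exact: measurable_cube.
  have := @integral_ae_eq _ _ _ mu _ mo (fun=> 0%E) (EFin \o w) iw (measurable_cst _).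
  move=> /(_ _)/filterS; apply.
    by move=> x H /H/= [].
  move=> B Bo mB; rewrite integral0 -(integral_inter_obox mB nn).
  by congr (integral _ _ _); rewrite setIidl.
have := @ae_foralln _ _ _ mu _ key; apply: filterS => x H.
have [n Hn] := coord_lt_nat x; apply: (H n).
by apply: cube_obox.
Qed.

End uniqueness.

(** * Growth of the energy *)

Section one_dim_energy.
Context {R : realType}.

(** Cauchy-Schwarz in the form [2 * K * H - K ^+ 2 <= H ^+ 2], whose left side has the explicit
    primitive [W]; [K] is the mean slope over the length [L]. *)
Lemma oscillation_integral (U H : R -> R) (L p q : R) : 0 < L -> 0 <= p -> p < q -> q <= L ->
  (forall t : R, is_derive t 1 U (H t)) -> continuous H ->
  (((U q - U p) ^+ 2 / L)%:E <= \int[lebesgue_measure]_(t in `[0%R, L]) (H t ^+ 2)%:E)%E.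
Proof.
move=> L0 p0 pq qL dU cH.
pose K := (U q - U p) / L.
pose W t := 2 * K * U t - K ^+ 2 * t.
have dW (t : R) : is_derive t 1 W (2 * K * H t - K ^+ 2) by have hU := dU t; rewrite /W; derby; ring.
have cf : continuous (fun t : R => 2 * K * H t - K ^+ 2).
  by move=> t; apply: cvgB; [apply: cvgM; [exact: cvg_cst|exact: cH]|exact: cvg_cst].
have cH2 : continuous (fun t : R => H t ^+ 2).
  by move=> t; apply: cvg_sqr; exact: cH.
have ftc := @continuous_FTC2 R (fun t => 2 * K * H t - K ^+ 2) W p q pq.
have intE : (\int[lebesgue_measure]_(t in `[p, q]) (2 * K * H t - K ^+ 2)%:E = (W q - W p)%:E)%E.
  rewrite EFinB; apply: ftc.
  - by apply: continuous_subspaceT.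
  - split.
    + by move=> t _; exact: ex_derive.
    + by apply: cvg_at_right_filter; exact: (der_cont (dW p)).
    + by apply: cvg_at_left_filter; exact: (der_cont (dW q)).
  - by move=> t _; rewrite derive1E; apply: derive_val.
apply: (@le_trans _ _ (\int[lebesgue_measure]_(t in `[p, q]) (H t ^+ 2)%:E)%E); last first.
  apply: ge0_subset_integral => //=.
  - by apply/measurable_EFinP; apply: measurable_funTS; exact: continuous_measurable_fun.
  - by move=> t _; rewrite lee_fin sqr_ge0.
  - by apply: subset_itv; rewrite bnd_simp.
apply: (@le_trans _ _ (\int[lebesgue_measure]_(t in `[p, q]) (2 * K * H t - K ^+ 2)%:E)%E).
  rewrite intE lee_fin.
  have -> : W q - W p = (U q - U p) ^+ 2 / L + K ^+ 2 * (L - (q - p)).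
    by rewrite /W /K; field; rewrite gt_eqF.
  rewrite lerDl mulr_ge0 ?sqr_ge0//; lra.
apply: le_integral => //=.
- apply: continuous_compact_integrable; first exact: segment_compact.
  exact: continuous_subspaceT.
- apply: continuous_compact_integrable; first exact: segment_compact.
  exact: continuous_subspaceT.
- move=> t _; rewrite lee_fin -subr_ge0.
  have -> : H t ^+ 2 - (2 * K * H t - K ^+ 2) = (H t - K) ^+ 2 by ring.
  exact: sqr_ge0.
Qed.

Lemma oscillation_integral_sym (U H : R -> R) (L p q : R) : 0 < L -> 0 <= p <= L -> 0 <= q <= L ->
  (forall t : R, is_derive t 1 U (H t)) -> continuous H ->
  (((U q - U p) ^+ 2 / L)%:E <= \int[lebesgue_measure]_(t in `[0%R, L]) (H t ^+ 2)%:E)%E.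
Proof.
move=> L0 /andP[p0 pL] /andP[q0 qL] dU cH; have [pq|qp|->] := ltgtP p q.
- exact: oscillation_integral.
- by rewrite -sqrrN opprB; exact: oscillation_integral.
- rewrite subrr expr0n/= mul0r; apply: integral_ge0 => t _; by rewrite lee_fin sqr_ge0.
Qed.

End one_dim_energy.

Section averaging.
Context {R : realType} {k h : nat}.
Local Notation E := ('rV[R]_k * 'rV[R]_h)%type.
Local Notation I := ('I_k + 'I_h)%type.
Local Notation mu := (@lebesgue_kh R k h).
Implicit Types (x : E).

Lemma measurable_line (i : I) : measurable_fun setT (fun p : E * measurableTypeR R => p.1 + (p.2 : R) *: base i : E).
Proof.
have mc (j : I) : measurable_fun setT (fun p : E * measurableTypeR R => crd j p.1 + p.2 * (j == i)%:R : R).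
  apply: measurable_funD; first by apply: measurableT_comp (measurable_coord j) _; exact: measurable_fst.
  by apply: measurable_funM => //; exact: measurable_snd.
apply/measurable_fun_pairP; split; apply: measurable_fun_rV => j.
- rewrite (_ : _ \o _ = fun p : E * measurableTypeR R => crd (inl j) p.1 + p.2 * (inl j == i)%:R : R).
    exact: mc.
  by apply/funext => p; have := crd_shift (inl j) i p.2 p.1.
- rewrite (_ : _ \o _ = fun p : E * measurableTypeR R => crd (inr j) p.1 + p.2 * (inr j == i)%:R : R).
    exact: mc.
  by apply/funext => p; have := crd_shift (inr j) i p.2 p.1.
Qed.

Local Open Scope ereal_scope.

(** Averaging over translates in the direction [i] replaces a decomposition of
    the measure along the lines [x + t *: base i]. *)
Lemma line_average (G : E -> R) (i : I) (L c : R) (A : set E) :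
  measurable_fun setT G -> measurable A -> (0 < L)%R -> (0 <= c)%R -> (forall x, 0 <= G x)%R ->
  (forall x, A x -> c%:E <= \int[lebesgue_measure]_(t in `[0%R, L]) (G (x + t *: base i)%R)%:E) ->
  c%:E * mu A <= L%:E * \int[mu]_x (G x)%:E.
Proof.
move=> mG mA L0 c0 G0 HA.
have [J|] := ltP (\int[mu]_x (G x)%:E) +oo; last first.
  by rewrite leye_eq => /eqP ->; rewrite gt0_muley ?lte_fin// leey.
have Gi : mu.-integrable setT (EFin \o G).
  apply/integrableP; split; first exact/measurable_EFinP.
  by under eq_integral do rewrite /= ger0_norm//.
pose IL : set (measurableTypeR R) := [set` `[0%R, L]].
have mIL : measurable IL by exact: measurable_itv.
pose F (p : E * measurableTypeR R) := ((G (p.1 + (p.2 : R) *: base i)%R) * (\1_A p.1 * \1_IL p.2))%R.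
have mF : measurable_fun setT F.
  apply: measurable_funM.
    by apply: measurableT_comp mG _; exact: measurable_line.
  apply: measurable_funM.
    by apply: measurableT_comp (measurable_indic _) _ => //; exact: measurable_fst.
  by apply: measurableT_comp (measurable_indic _) _ => //; exact: measurable_snd.
have F0 p : (0 <= F p)%R by rewrite /F mulr_ge0// mulr_ge0// indicE; case: (_ \in _).
have tonelli := @fubini_tonelli _ _ _ _ R mu (@lebesgue_measure R) (fun p => (F p)%:E)
  (proj2 (measurable_EFinP _ _) mF) (fun p => F0 p).
have mGl x : measurable_fun setT (fun t : measurableTypeR R => G (x + (t : R) *: base i)%R).
  rewrite (_ : (fun t : measurableTypeR R => _) =
    G \o ((fun p : E * measurableTypeR R => p.1 + (p.2 : R) *: base i)%R \o (fun t : measurableTypeR R => (x, t))))//.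
  apply: measurableT_comp mG _; apply: measurableT_comp (measurable_line i) _; exact: pair1_measurable.
have left_ : c%:E * mu A <= \int[mu]_x \int[lebesgue_measure]_t (F (x, t))%:E.
  rewrite -integral_cst// integral_mkcond.
  apply: ge0_le_integral => //.
  - by move=> x _; rewrite patchE; case: ifP => // _; rewrite lee_fin.
  - apply: (measurable_restrictT _ mA).1; exact: measurable_cst.
  - exact: (@measurable_fun_fubini_tonelli_F _ _ _ _ R _ (fun p => (F p)%:E) (proj2 (measurable_EFinP _ _) mF)).
  - move=> x _; rewrite patchE; case: ifPn => [/set_mem Ax|_]; last first.
      by apply: integral_ge0 => t _; rewrite lee_fin.
    apply: le_trans (HA x Ax) _; rewrite integral_mkcond; apply: ge0_le_integral => //.
    + by move=> t _; rewrite patchE; case: ifP => // _; rewrite lee_fin.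
    + apply: (measurable_restrictT _ mIL).1; apply/measurable_EFinP; exact: measurable_funTS.
    + apply/measurable_EFinP; apply: measurableT_comp mF _; exact: pair1_measurable.
    + move=> t _; rewrite patchE /F/= !indicE (mem_set Ax) mul1r.
      by case: (t \in IL); rewrite ?mulr1 ?mulr0.
apply: le_trans left_ _; rewrite tonelli.
have -> : L%:E * \int[mu]_x (G x)%:E = \int[lebesgue_measure]_(t in IL) \int[mu]_x (G x)%:E.
  have mI : lebesgue_measure IL = L%:E by rewrite /IL lebesgue_measure_itv/= lte_fin L0 -EFinB subr0.
  by rewrite integral_cst// muleC; congr (_ * _); exact/esym/mI.
rewrite [leRHS]integral_mkcond; apply: ge0_le_integral => //.
- by move=> t _; apply: integral_ge0 => x _; rewrite lee_fin.
- exact: (@measurable_fun_fubini_tonelli_G _ _ _ _ R _ (fun p => (F p)%:E) (proj2 (measurable_EFinP _ _) mF)).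
- apply: (measurable_restrictT _ mIL).1; exact: measurable_cst.
- move=> t _; have [g1 g2] := integral_shift i t mG Gi.
  rewrite patchE; case: ifPn => tI; last first.
    rewrite integral0_eq// => x _; rewrite /F/= !indicE (negbTE tI) !mulr0.
    by [].
  rewrite -g2; apply: ge0_le_integral => //.
  + by move=> x _; rewrite lee_fin.
  + apply/measurable_EFinP; apply: measurableT_comp mF _; exact: pair2_measurable.
  + by have /integrableP[] := g1.
  + move=> x _; rewrite lee_fin /F/= ler_piMr// !indicE.
Qed.

End averaging.

Section weak_gradient_unique.
Context {R : realType} {k h : nat}.
Local Notation E := ('rV[R]_k * 'rV[R]_h)%type.
Local Notation I := ('I_k + 'I_h)%type.
Local Notation mu := (@lebesgue_kh R k h).
Implicit Types (x : E).

Lemma loc_integrable_test (f phi : E -> R) : loc_integrable f -> test_fun phi ->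
  mu.-integrable setT (EFin \o (fun x => f x * phi x)).
Proof.
move=> lf tphi; have [cphi _ _ [r [M [r0 M0 phiM _ phi0]]]] := test_fun_facts tphi.
have iw := loc_integrable_cube r lf.
have iwT : mu.-integrable setT ((fun x => (M%:E * (EFin \o f) x)%E) \_ (cube r)).
  by apply/(integrable_mkcond _ (measurable_cube r)); apply: integrableZl => //; exact: measurable_cube.
apply: le_integrable iwT => //.
  by apply/measurable_EFinP; apply: measurable_funM; [exact: lf.1|exact: continuous_measurable_kh].
move=> x _; rewrite patchE; case: ifPn => [_|nx].
  by rewrite /= lee_fin !normrM mulrC ler_wpM2r// (ger0_norm (ltW M0)).
have [p0 _] : phi x = 0 /\ forall i, partial phi i x = 0.
  by apply: phi0; move: nx; rewrite notin_setE.
have -> : (EFin \o (fun x0 => f x0 * phi x0)) x = 0%E by rewrite /= p0 mulr0.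
by rewrite abse0.
Qed.

Lemma loc_integrableB (f g : E -> R) : loc_integrable f -> loc_integrable g ->
  loc_integrable (fun x => f x - g x).
Proof.
move=> [mf fi] [mg gi]; split; first exact: measurable_funB.
move=> K cK; have mK : measurable K.
  rewrite -[K]setCK; apply: measurableC; apply: open_measurable_kh; apply: closed_openC.
  by apply: compact_closed => //; exact: norm_hausdorff.
have fi' : mu.-integrable K (EFin \o f).
  by apply/integrableP; split; [apply/measurable_EFinP; exact: measurable_funTS|exact: fi].
have gi' : mu.-integrable K (EFin \o g).
  by apply/integrableP; split; [apply/measurable_EFinP; exact: measurable_funTS|exact: gi].
by have /integrableP[] := integrableB mK fi' gi'.
Qed.

(** Only the weighted [z]-gradient is determined, since that is what the weak identity tests; it is
    also what the energy contains. *)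
Lemma weak_gz_unique (alpha : R) (u : E -> R) gy gz gy' gz' (j : 'I_h) :
  weak_grad alpha u gy gz -> weak_grad alpha u gy' gz' ->
  {ae mu, forall x, enorm x.1 `^ alpha * gz x ord0 j = enorm x.1 `^ alpha * gz' x ord0 j}.
Proof.
move=> [_ _ lz wz] [_ _ lz' wz'].
have := weakly_null_ae (loc_integrableB (lz j) (lz' j)).
move=> /(_ _)/filterS; apply; first by move=> x /eqP; rewrite subr_eq0 => /eqP.
move=> phi tphi; have [_ /(_ j) h1] := wz phi tphi; have [_ /(_ j) h2] := wz' phi tphi.
transitivity (\int[mu]_x (enorm x.1 `^ alpha * gz x ord0 j * phi x - enorm x.1 `^ alpha * gz' x ord0 j * phi x)).
  by apply: eq_Rintegral => x _; rewrite mulrBl.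
rewrite RintegralB//; last 2 first.
- exact: (loc_integrable_test (lz j) tphi).
- exact: (loc_integrable_test (lz' j) tphi).
by apply/eqP; rewrite subr_eq0; apply/eqP; apply: oppr_inj; rewrite -h1 -h2.
Qed.

(** One component of the [z]-gradient already carries a lower bound; it may be replaced by an almost
    everywhere equal representative that is continuous on lines. *)
Lemma energy_ge_gz (alpha : R) (gy : E -> 'rV[R]_k) (gz : E -> 'rV[R]_h) (j : 'I_h) (H : E -> R) : 
  (forall i, measurable_fun setT (fun x : E => gy x ord0 i)) ->
  (forall j, measurable_fun setT (fun x : E => enorm x.1 `^ alpha * gz x ord0 j)) ->
  measurable_fun setT H ->
  {ae mu, forall x, enorm x.1 `^ alpha * gz x ord0 j = H x} ->
  (\int[mu]_x (((alpha + 1) * H x) ^+ 2)%:E <= energy alpha gy gz)%E.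
Proof.
move=> my mz mH HE; have mz' := mz j.
rewrite (@ge0_ae_eq_integral _ _ _ mu setT _ (fun x => (((alpha + 1) * (enorm x.1 `^ alpha * gz x ord0 j)) ^+ 2)%:E))//; last 5 first.
- by apply/measurable_EFinP; apply: measurable_funX; apply: measurable_funM.
- by apply/measurable_EFinP; apply: measurable_funX; apply: measurable_funM.
- by move=> x _; rewrite lee_fin sqr_ge0.
- by move=> x _; rewrite lee_fin sqr_ge0.
- by apply: filterS HE => x -> _.
apply: ge0_le_integral => //.
- by move=> x _; rewrite lee_fin sqr_ge0.
- by apply/measurable_EFinP; apply: measurable_funX; apply: measurable_funM.
- apply/measurable_EFinP; under eq_fun do rewrite energy_density.
  apply: measurable_funD.
    by apply: measurable_sum => i; apply: measurable_funX.
  apply: measurable_funM => //.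
  by apply: measurable_sum => l; apply: measurable_funX.
- move=> x _; rewrite lee_fin energy_density exprMn.
  have s0 : 0 <= \sum_i gy x ord0 i ^+ 2 by apply: sumr_ge0 => i _; exact: sqr_ge0.
  apply: (@le_trans _ _ ((alpha + 1) ^+ 2 * \sum_l (enorm x.1 `^ alpha * gz x ord0 l) ^+ 2)); last by rewrite lerDr.
  rewrite ler_wpM2l ?sqr_ge0// (bigD1 j)//= lerDl sumr_ge0// => l _; exact: sqr_ge0.
Qed.

End weak_gradient_unique.

Section slab.
Context {R : realType} {k h : nat}.
Local Notation E := ('rV[R]_k * 'rV[R]_h)%type.
Local Notation mu := (@lebesgue_kh R k h).
Variable m : R.
Hypothesis m2 : 1 / 2 < m.
Hypothesis k_ge1 : (1 <= k)%N.
Hypothesis h_ge1 : (1 <= h)%N.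

(** A neighbourhood of the sphere, independent of the solution. From each of its points a segment of
    length [7] in a fixed [z] direction meets every level of [S] in [[1 / 4, 3 / 4]]. *)
Definition slab : set E := [set x | 1 / 2 < rh m x < 3 / 2 /\ sqz x < 5 / 12].

Lemma measurable_slab : measurable slab.
Proof.
have -> : slab = (rh m @^-1` `]1 / 2, 3 / 2[%classic) `&` (sqz @^-1` `]-oo, 5 / 12[%classic).
  by apply/seteqP; split => x /=; rewrite !in_itv/=.
apply: measurableI; rewrite -[X in measurable X]setTI.
- by apply: continuous_measurable_kh => //; exact: (continuous_rh m2).
- by apply: continuous_measurable_kh => //; exact: continuous_sqz.
Qed.

Lemma slab_gt0 : (0 < mu slab)%E.
Proof.
rewrite lt_neqAle measure_ge0 andbT eq_sym; apply/negP => /eqP mu0.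
have [h1 h2] := sphere_pointE k_ge1 h_ge1 (lexx (0 : R)).
apply: (@nbhs_not_null _ _ _ (sphere_point k_ge1 h_ge1 0) slab); last first.
  by exists slab; split => //; exact: measurable_slab.
have r1 : rh m (sphere_point k_ge1 h_ge1 0) = 1 :> R by rewrite /rh h1 powR1.
have n1 : \forall y \near sphere_point k_ge1 h_ge1 (0 : R), 1 / 2 < rh m y.
  by apply: (cvgr_gt _ (@continuous_rh R k h m m2 (sphere_point k_ge1 h_ge1 0))); rewrite r1; lra.
have n2 : \forall y \near sphere_point k_ge1 h_ge1 (0 : R), rh m y < 3 / 2.
  by apply: (cvgr_lt _ (@continuous_rh R k h m m2 (sphere_point k_ge1 h_ge1 0))); rewrite r1; lra.
have n3 : \forall y \near sphere_point k_ge1 h_ge1 (0 : R), sqz y < 5 / 12.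
  by apply: (cvgr_lt _ (@continuous_sqz R k h (sphere_point k_ge1 h_ge1 0))); rewrite h2; lra.
by apply: filterS3 n1 n2 n3 => y y1 y2 y3; split => //; rewrite y1.
Qed.

Lemma line_hit (x : E) (j : 'I_h) (s : R) : slab x -> 1 / 4 <= s <= 3 / 4 ->
  exists t : R, [/\ 0 <= t <= 7, Ss (rh m x) (sqz (x + t *: base (inr j))) = s &
    sqz (x + t *: base (inr j)) <= 24].
Proof.
move=> [/andP[r1 r2] T1] /andP[s1 s2]; set r := rh m x in r1 r2 *.
(* The value of [|z| ^ 2] at which [S = s]. The bound [5 / 12] puts it above the starting value, so
   that the segment runs forward; [24] bounds its length. *)
pose T := 4 * r / (1 - s) - (1 + r) ^+ 2.
have s0 : 0 < 1 - s by lra.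
have T5 : 5 / 12 <= T.
  rewrite /T lerBrDr ler_pdivlMr//.
  have : (5 / 12 + (1 + r) ^+ 2) * (1 - s) <= (5 / 12 + (1 + r) ^+ 2) * (3 / 4).
    by apply: ler_wpM2l; [rewrite addr_ge0// sqr_ge0|lra].
  move=> hh; apply: le_trans hh _; nra.
have T24 : T <= 24.
  rewrite /T lerBlDr ler_pdivrMr//.
  have : (24 + (1 + r) ^+ 2) * (1 / 4) <= (24 + (1 + r) ^+ 2) * (1 - s).
    by apply: ler_wpM2l; [rewrite addr_ge0// sqr_ge0|lra].
  by apply: le_trans; nra.
pose c := crd (inr j) x.
have cT : c ^+ 2 <= sqz x by exact: sqz_ge.
have d0 : 0 <= c ^+ 2 + T - sqz x by move: (sqr_ge0 c); lra.
(* The larger root of the quadratic equation for the parameter: nonnegative since [sqz x <= T], and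
   at most [6 + 1]. *)
pose t := Num.sqrt (c ^+ 2 + T - sqz x) - c.
have tE : sqz (x + t *: base (inr j)) = T.
  rewrite sqz_linez -/c /t; have := sqr_sqrtr d0; move: (Num.sqrt _) => q qq.
  transitivity (sqz x + q ^+ 2 - c ^+ 2); first by ring.
  by rewrite qq; ring.
exists t; split; last by rewrite tE.
- have c1 : `|c| <= 1 by rewrite -(@ler_pXn2r _ 2)// ?nnegrE// expr1n real_normK ?num_real//; lra.
  have cs : `|c| <= Num.sqrt (c ^+ 2 + T - sqz x) by rewrite -sqrtr_sqr ler_sqrt//; lra.
  have q5 : Num.sqrt (c ^+ 2 + T - sqz x) <= 6.
    have -> : 6 = Num.sqrt (6 ^+ 2) :> R by rewrite sqrtr_sqr ger0_norm.
    by rewrite ler_sqrt//; lra.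
  have cl := ler_norm c; have cl' := ler_norm (- c); rewrite normrN in cl'.
  by apply/andP; split; rewrite /t; lra.
- rewrite tE /Ss /Xx /Dn /T; have r0 : r != 0 by rewrite gt_eqF//; lra.
  by rewrite [X in _ / X]addrC subrK; field; rewrite r0 gt_eqF.
Qed.

End slab.

Section solution.
Context {R : realType} {k h : nat}.
Local Notation E := ('rV[R]_k * 'rV[R]_h)%type.
Local Notation I := ('I_k + 'I_h)%type.
Local Notation mu := (@lebesgue_kh R k h).
Implicit Types (x : E).
Variables (alpha m gam a w N M r0 : R) (f g g2 n : R -> R).

Local Notation V := (V gam f).
Local Notation Vr := (Vr gam f g).
Local Notation VT := (VT gam f g).
Local Notation Vrr := (Vrr gam f g g2).
Local Notation VTT := (VTT gam f g g2).

Local Notation Ue := (Ue m gam N f g).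
Local Notation Uee := (Uee m gam N f g g2).
Local Notation gg := (gg m gam N f g).
Local Notation pp := (pp m gam N f g).
Local Notation dgg := (dgg m gam N f g g2).
Local Notation dpp := (dpp m gam N f g g2).
Local Notation bad := (bad m).
Hypothesis m2 : 1 / 2 < m.
Hypothesis gam_gt0 : 0 < gam.
Hypothesis a_gt0 : 0 < a.
Hypothesis aE : a = 1 + (k%:R - 2) / (2 * m).
Hypothesis gamE : 2 * gam = a + h%:R - 1.
Hypothesis wE : w = m^-1 - 1.
Hypothesis M_gt0 : 0 < M.
Hypothesis fM : forall s, `|f s| <= M.
Hypothesis nM : forall s, `|n s| <= M.
Hypothesis cf : continuous f.
Hypothesis ode : forall s : R, 0 < s < 1 -> [/\ is_derive s 1 f (g s), is_derive s 1 g (g2 s),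
  s * (1 - s) * g2 s = a * gam / 2 * f s - (1 - s) `^ w * n s - ((h%:R + 1) / 2 * (1 - s) - a * s) * g s &
  `|g s + gam / 2 * f s| <= M * ((1 - s) + (1 - s) `^ w)].
Hypothesis g_out : forall s : R, ~ 0 < s < 1 -> g s = 0.
Hypothesis r0_gt0 : 0 < r0.
Hypothesis gamr0 : gam * r0 = m^-1.
Hypothesis N_gt0 : 0 < N.
Hypothesis Nr0 : N `^ r0 = 4 * m ^+ 2 * 4 `^ m^-1.
Hypothesis nE : forall s, n s = `|f s| `^ r0 * f s.

Hypothesis k_ge1 : (1 <= k)%N.
Hypothesis h_ge1 : (1 <= h)%N.
Hypothesis mE : m = (1 + alpha) / 2.
Hypothesis r0E : r0 = 4 / (hdim (R := R) (k := k) (h := h) alpha - 2).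


Local Notation uu := (bubble m gam N f : E -> R).
Let m0 : 0 < m. Proof. by apply: lt_trans m2; rewrite divr_gt0. Qed.
Let al_gt0 : 0 < alpha. Proof. by have := m2; rewrite mE; lra. Qed.

(** The first factors bound [(alpha + 1) ^+ 2 * |y| ^ (2 * alpha)] from below on [slab]; [31]
    exceeds [Dn], which is at most [(5 / 2) ^+ 2 + 24]; [7] is the length of the segments. *)
Definition growth : R := (2 * m) ^+ 2 * (1 / 2) `^ ((2 * m - 1) / m) * (N * 31 `^ (- gam)) ^+ 2 / 7.

Lemma growth_gt0 : 0 < growth.
Proof.
by rewrite /growth divr_gt0// mulr_gt0 ?exprn_gt0 ?mulr_gt0 ?powR_gt0// ?exprn_gt0// mulr_gt0.
Qed.

Variables (Lam s0 s1 : R).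
Hypothesis Lam0 : 0 <= Lam.
Hypothesis s0P : 1 / 4 <= s0 <= 3 / 4.
Hypothesis s1P : 1 / 4 <= s1 <= 3 / 4.
Hypothesis f0 : f s0 = 0.
Hypothesis f1 : Lam <= `|f s1|.

(** On each segment [uu] vanishes where [S = s0] and has at least size [N * 31 ^ (- gam) * Lam]
    where [S = s1]; the one-dimensional oscillation bound is then averaged over [slab]. The bound
    holds for every weak gradient, as the infimum in the norm requires. *)
Lemma energy_lower gy gz : weak_grad alpha uu gy gz ->
  ((growth * Lam ^+ 2)%:E * mu (slab m) <= 7%:E * energy alpha gy gz)%E.
Proof.
move=> wg; pose j := Ordinal h_ge1.
have [_ _ wg'] := solution_weak_grad (k := k) (h := h) m2 gam_gt0 wE M_gt0 fM cf ode g_out N_gt0 mE.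
have [_ my mz _] := wg; have [_ _ mz' _] := wg'.
pose H (x : E) : R := enorm x.1 `^ alpha * gg (inr j) x.
have mH : measurable_fun setT H.
  have := (mz' j).1; rewrite (_ : (fun x => _) = H)//; by apply/funext => x; rewrite mxE.
have HE : {ae mu, forall x, enorm x.1 `^ alpha * gz x ord0 j = H x}.
  by have := weak_gz_unique j wg wg'; apply: filterS => x ->; rewrite mxE.
have := energy_ge_gz (fun i => (my i).1) (fun l => (mz l).1) mH HE.
move=> hE; apply: (@le_trans _ _ (7%:E * \int[mu]_x (((alpha + 1) * H x) ^+ 2)%:E)%E); last first.
  by apply: lee_wpmul2l.
apply: (@line_average _ _ _ (fun x => ((alpha + 1) * H x) ^+ 2) (inr j)) => //.
- by apply: measurable_funX; apply: measurable_funM.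
- exact: measurable_slab.
- by rewrite mulr_ge0 ?sqr_ge0// ltW// growth_gt0.
- by move=> x; exact: sqr_ge0.
move=> x Sx; have [t0 [t0P St0 _]] := line_hit j Sx s0P; have [t1 [t1P St1 T1]] := line_hit j Sx s1P.
pose q := (alpha + 1) * enorm x.1 `^ alpha.
have qline t : (alpha + 1) * H (x + t *: base (inr j)) = q * gg (inr j) (x + t *: base (inr j)).
  by rewrite /H /q enorm_shift mulrA.
have dU (t : R) : is_derive t 1 (fun t => q * uu (x + t *: base (inr j))) (q * gg (inr j) (x + t *: base (inr j))).
  have hu := der_line0 (der_uu m2 gam_gt0 wE M_gt0 fM cf ode g_out N_gt0 (inr j) (x + t *: base (inr j))) erefl.
  by derby; ring.
have cU : continuous (fun t : R => q * gg (inr j) (x + t *: base (inr j))).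
  move=> t; have c := @gg_cont_line R k h m gam a w N M f g g2 n m2 gam_gt0 wE M_gt0 fM cf ode g_out N_gt0 (inr j) x t.
  by apply: cvgM; [exact: cvg_cst|exact: c].
have := @oscillation_integral_sym R _ _ 7 t0 t1 (ltr0n _ 7) t0P t1P dU cU.
under [in X in (_ <= X)%E -> _]eq_integral do rewrite -qline.
apply: le_trans; rewrite lee_fin.
have [/andP[r1 r2] _] := Sx.
have rl t : rh m (x + t *: base (inr j)) = rh m x by rewrite /rh sqy_linez.
have -> : uu (x + t0 *: base (inr j)) = 0 by rewrite /bubble /V rl St0 f0 !mulr0.
rewrite mulr0 subr0 /growth [leLHS]mulrAC ler_pM2r ?invr_gt0// [in leRHS]exprMn.
have q2 : q ^+ 2 = (2 * m) ^+ 2 * rh m x `^ ((2 * m - 1) / m).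
  rewrite /q exprMn; congr (_ * _); first by congr (_ ^+ 2); rewrite mE; field.
  rewrite -(powR_mulrn 2 (powR_ge0 _ _)) -powRrM mulrC enorm_sqy /rh -powRrM.
  congr (_ `^ _); transitivity (2 * m - 1); first by rewrite mE; field.
  by field; rewrite gt_eqF.
have -> : (2 * m) ^+ 2 * (1 / 2) `^ ((2 * m - 1) / m) * (N * 31 `^ (- gam)) ^+ 2 * Lam ^+ 2 =
  ((2 * m) ^+ 2 * (1 / 2) `^ ((2 * m - 1) / m)) * (N * 31 `^ (- gam) * Lam) ^+ 2 by ring.
apply: ler_pM; [by apply: mulr_ge0; [exact: sqr_ge0|exact: powR_ge0]|exact: sqr_ge0| |].
  rewrite q2; apply: ler_wpM2l; first exact: sqr_ge0.
  apply: ge0_ler_powR; rewrite ?nnegrE ?rh_ge0 ?(ltW r1)//.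
  by apply: divr_ge0; [move: m2; lra|exact: ltW].
rewrite -[leRHS]real_normK ?num_real//; apply: lerXn2r; rewrite ?nnegrE ?mulr_ge0 ?powR_ge0 ?(ltW N_gt0)//.
rewrite /bubble /V !normrM (ger0_norm (ltW N_gt0)) (ger0_norm (powR_ge0 _ _)) -mulrA ler_pM2l//.
rewrite rl St1; apply: ler_pM; rewrite ?powR_ge0//.
have D0 : 0 < Dn (rh m x) (sqz (x + t1 *: base (inr j))) by apply: Dn_gt0; [exact: rh_ge0|exact: sqz_ge0].
rewrite /PP !powRN lef_pV2 ?posrE ?powR_gt0//; apply: ge0_ler_powR; rewrite ?nnegrE ?(ltW gam_gt0) ?(ltW D0)//.
by rewrite /Dn; nra.
Qed.

Lemma norm_lower (del : R) : 0 < del -> (del%:E <= mu (slab m))%E ->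
  ((Num.sqrt (growth * del / 7) * Lam)%:E <= grushin_norm alpha uu)%E.
Proof.
move=> del0 hdel; have g0 := growth_gt0.
have c0 : 0 <= growth * del / 7 by apply: divr_ge0 => //; apply: mulr_ge0; exact: ltW.
have -> : (Num.sqrt (growth * del / 7) * Lam)%:E = ((growth * del / 7 * Lam ^+ 2)%:E `^ 2^-1)%E.
  have l0 : 0 <= growth * del / 7 * Lam ^+ 2 by apply: mulr_ge0 => //; exact: sqr_ge0.
  by rewrite poweR_EFin powR12_sqrt// (sqrtrM _ c0) sqrtr_sqr ger0_norm.
rewrite /grushin_norm; apply: gt0_ler_poweR => //.
- by rewrite in_itv/= leey andbT lee_fin; apply: mulr_ge0 => //; exact: sqr_ge0.
- rewrite in_itv/= leey andbT; apply/ereal_infP => _ [gy [gz [_ ->]]].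
  apply: integral_ge0 => x _; rewrite lee_fin; apply: addr_ge0; first exact: sqr_ge0.
  by apply: mulr_ge0; [apply: mulr_ge0; [exact: sqr_ge0|exact: powR_ge0]|exact: sqr_ge0].
apply/ereal_infP => _ [gy [gz [wg ->]]].
have h1 := energy_lower wg.
have h2 : ((growth * Lam ^+ 2)%:E * del%:E <= 7%:E * energy alpha gy gz)%E.
  apply: le_trans h1; apply: lee_wpmul2l => //.
  by rewrite lee_fin mulr_ge0 ?sqr_ge0// ltW.
rewrite -(@lee_pmul2l _ 7%:E)//; apply: le_trans h2; rewrite -!EFinM lee_fin.
by rewrite le_eqVlt; apply/orP; left; apply/eqP; field.
Qed.

End solution.

(** * Choice of the parameters and conclusion *)

Section existence.
Context {R : realType} {k h : nat}.
Local Notation E := ('rV[R]_k * 'rV[R]_h)%type.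
Local Notation mu := (@lebesgue_kh R k h).
Variable alpha : R.
Hypothesis alpha_gt0 : 0 < alpha.
Hypothesis k_ge1 : (1 <= k)%N.
Hypothesis h_ge1 : (1 <= h)%N.

Let m : R := (1 + alpha) / 2.
Let Q : R := k%:R + 2 * m * h%:R.
Let gam : R := (Q - 2) / (4 * m).
Let a : R := 1 + (k%:R - 2) / (2 * m).
Let w : R := m^-1 - 1.
Let r0 : R := 4 / (Q - 2).
Let p : R := 1 + r0.
(** Scaling that removes the constant [16 * m ^+ 2 * 4 ^ w] produced by the change of variables. *)
Let N : R := (4 * m ^+ 2 * 4 `^ m^-1) `^ r0^-1.

Let m2 : 1 / 2 < m. Proof. by rewrite /m; move: alpha_gt0; lra. Qed.
Let m0 : 0 < m. Proof. by move: m2; lra. Qed.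
Let k1 : 1 <= k%:R :> R. Proof. by rewrite ler1n. Qed.
Let h1 : 1 <= h%:R :> R. Proof. by rewrite ler1n. Qed.
Let hQ : h%:R + 1 < Q.
Proof.
rewrite /Q; have : h%:R < 2 * m * h%:R by rewrite ltr_pMl; [move: m2; lra|exact: lt_le_trans h1].
by move: k1; lra.
Qed.
Let kQ : k%:R < Q.
Proof. by rewrite /Q ltrDl; apply: mulr_gt0; [apply: mulr_gt0|apply: lt_le_trans ltr01 h1]. Qed.
Let Q2 : 0 < Q - 2. Proof. by move: hQ h1; lra. Qed.
Let Q0 : 0 < Q. Proof. by move: Q2; lra. Qed.
Let gam0 : 0 < gam. Proof. by rewrite /gam divr_gt0// mulr_gt0. Qed.
Let a0 : 0 < a.
Proof.
have -> : a = (2 * m + k%:R - 2) / (2 * m) by rewrite /a; field; rewrite gt_eqF.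
have n0 : 0 < 2 * m + k%:R - 2 by move: m2 k1; move: m (k%:R : R) => *; lra.
by rewrite divr_gt0// mulr_gt0.
Qed.
Let r00 : 0 < r0. Proof. by rewrite divr_gt0. Qed.
Let p1 : 1 < p. Proof. by rewrite /p ltrDl. Qed.
Let pE : p + 1 = 2 * Q / (Q - 2). Proof. by rewrite /p /r0; field; rewrite gt_eqF. Qed.

Let gamE : 2 * gam = a + h%:R - 1.
Proof. by rewrite /gam /a /Q; field; rewrite gt_eqF. Qed.

Let gamr0 : gam * r0 = m^-1.
Proof. by rewrite /gam /r0; field; rewrite !gt_eqF. Qed.

Let N0 : 0 < N.
Proof. by rewrite /N powR_gt0// mulr_gt0 ?powR_gt0// mulr_gt0// exprn_gt0. Qed.

Let Nr0 : N `^ r0 = 4 * m ^+ 2 * 4 `^ m^-1.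
Proof.
by rewrite /N -powRrM mulVf ?gt_eqF// powRr1// ltW// mulr_gt0 ?powR_gt0// mulr_gt0// exprn_gt0.
Qed.

(** Subcriticality at [S = 0] reduces to [h + 1 < Q]. *)
Let exponents0 : end_exponents ((h%:R + 1) / 2) ((h%:R - 1) / 2) p.
Proof.
split; first by split; move: h1; lra.
split; first by move: h1; lra.
rewrite pE ltr_pdivlMr ?divr_gt0 ?mulr_gt0// mulrA ltr_pdivrMr//.
by move: hQ; nra.
Qed.

(** Subcriticality at [S = 1] reduces to [k < Q]; the condition [d < e] becomes [m^-1 < 2], that is
    [0 < alpha]. *)
Let exponents1 : end_exponents a (k%:R / (2 * m) - 1) p.
Proof.
have im : 0 < m^-1 by rewrite invr_gt0.
have im2 : m^-1 < 2 by rewrite -[ltRHS]invrK ltf_pV2 ?posrE ?invr_gt0//; move: m2; lra.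
have e1 : a + (k%:R / (2 * m) - 1) = (k%:R - 1) / m by rewrite /a; field; rewrite gt_eqF.
have e2 : k%:R / (2 * m) - 1 + 2 - a = m^-1 by rewrite /a; field; rewrite gt_eqF.
have e3 : a - (k%:R / (2 * m) - 1) = 2 - m^-1 by rewrite /a; field; rewrite gt_eqF.
split; first split.
- exact: a0.
- by rewrite ltrBrDr addNr; apply: divr_gt0; [apply: lt_le_trans ltr01 k1|apply: mulr_gt0].
- by rewrite e2.
- by rewrite e3 subr_gt0.
split; first by rewrite e1 divr_ge0 ?(ltW m0)// subr_ge0.
have -> : (a - 1) / 2 = (k%:R - 2) * Q / (4 * m * Q) by rewrite /a; field; rewrite !gt_eqF.
have -> : (k%:R / (2 * m) - 1 + 1) / (p + 1) = k%:R * (Q - 2) / (4 * m * Q).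
  by rewrite pE; field; rewrite !gt_eqF.
have d0 : 0 < 4 * m * Q by apply: mulr_gt0 => //; exact: mulr_gt0.
by rewrite ltr_pM2r ?invr_gt0// mulrBl mulrBr ltrD2l ltrN2 [k%:R * 2]mulrC ltr_pM2l.
Qed.

(** The constant [c] is fixed before [Lam], so profiles of growing size give norms that grow without
    bound. *)
Lemma solution_of_size : exists2 c : R, 0 < c & forall Lam : R, 0 <= Lam -> exists v : E -> R, [/\ weak_solution alpha v, sign_changing v,
    (grushin_norm alpha v < +oo)%E &
    ((c * Lam)%:E <= grushin_norm alpha v)%E].
Proof.
(* A finite positive lower bound is enough, so finiteness of the measure need not be shown. *)
have [del del0 hdel] : exists2 del : R, 0 < del & (del%:E <= mu (slab m))%E.
  have := slab_gt0 m2 k_ge1 h_ge1; case: (lebesgue_kh _) => [r||//].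
    by rewrite lte_fin => rgt0; exists r.
  by move=> _; exists 1 => //; rewrite leey.
exists (Num.sqrt (growth m gam N * del / 7)).
  by rewrite sqrtr_gt0 divr_gt0// mulr_gt0//; exact: growth_gt0.
move=> Lam Lam0.
have k00 : 0 < a * gam / 2 by apply: divr_gt0 => //; exact: mulr_gt0.
have de : (h%:R - 1) / 2 + 1 = (h%:R + 1) / 2 :> R by field.
have [f [g0 [M0 [M00 [cf fM0] ode0 [s0 [s1 [s0P s1P fs0 fs1]]] [x1 [x2 [x1P x2P fx1 fx2]]]]]]] :=
  profile p1 k00 exponents0 exponents1 de Lam.
have dw : k%:R / (2 * m) - 1 + 1 - a = w by rewrite /a /w; field; rewrite gt_eqF.
rewrite dw in ode0.
(* One constant bounds both the profile and its nonlinearity. *)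
pose n (s : R) : R := nl p (f s); pose M := M0 + M0 `^ p.
pose g (s : R) : R := if 0 < s < 1 then g0 s else 0.
pose g2 := profile_der2 ((h%:R + 1) / 2) a (a * gam / 2) p w f g0.
have M0M : M0 <= M by rewrite /M lerDl powR_ge0.
have Mgt0 : 0 < M by apply: lt_le_trans M0M.
have fM s : `|f s| <= M by apply: le_trans M0M.
have nM s : `|n s| <= M.
  rewrite /n norm_nl//; apply: (@le_trans _ _ (M0 `^ p)); last by rewrite /M lerDr ltW.
  by apply: ge0_ler_powR; rewrite ?nnegrE ?(ltW M00)//; move: p1; lra.
have nE s : n s = `|f s| `^ r0 * f s by rewrite /n nl.unlock /p addrAC subrr add0r.
have ode (s : R) : 0 < s < 1 -> [/\ is_derive s 1 f (g s), is_derive s 1 g (g2 s),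
  s * (1 - s) * g2 s = a * gam / 2 * f s - (1 - s) `^ w * n s - ((h%:R + 1) / 2 * (1 - s) - a * s) * g s &
  `|g s + gam / 2 * f s| <= M * ((1 - s) + (1 - s) `^ w)].
  move=> s01; have [d1 d2 b1] := ode0 s s01; have /andP[sp sl] := s01.
  have gE : g s = g0 s by rewrite /g s01.
  split.
  - by rewrite gE.
  - apply: (@near_eq_is_derive R R R g0 g s 1 _) => //.
    have sI : s \in `]0, 1[ by rewrite in_itv.
    have := near_in_itvoo sI; apply: filterS => t; rewrite in_itv/= => t01.
    by rewrite /g t01.
  - by rewrite gE /g2 /profile_der2 mulrCA mulfV ?mulr1// mulf_neq0 ?gt_eqF ?subr_gt0.
  - rewrite gE; have -> : gam / 2 = a * gam / 2 / a by field; rewrite gt_eqF.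
    apply: le_trans b1 _; apply: ler_wpM2r => //.
    by apply: addr_ge0; [rewrite subr_ge0; exact: ltW|exact: powR_ge0].
have g_out (s : R) : ~ 0 < s < 1 -> g s = 0 by rewrite /g => /negP/negbTE ->.
have hdE : hdim (R := R) (k := k) (h := h) alpha = Q by rewrite /hdim /Q /m; field.
have r0E : r0 = 4 / (hdim (R := R) (k := k) (h := h) alpha - 2) by rewrite hdE.
have s0P' : 1 / 4 <= s0 <= 3 / 4 by rewrite [1 / 4]div1r.
have s1P' : 1 / 4 <= s1 <= 3 / 4 by rewrite [1 / 4]div1r.
exists (bubble m gam N f); split.
- exact: (solution_weak m2 gam0 a0 erefl gamE erefl Mgt0 fM nM cf ode g_out r00 gamr0 N0 Nr0 nE k_ge1 h_ge1 erefl r0E).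
- exact: (solution_sign_changing gam m2 cf N0 k_ge1 h_ge1 x1P x2P fx1 fx2).
- exact: (solution_norm_fin m2 gam0 erefl gamE erefl Mgt0 fM cf ode g_out N0 k_ge1 erefl).
- exact: (norm_lower m2 gam0 erefl Mgt0 fM cf ode g_out N0 h_ge1 erefl Lam0 s0P' s1P' fs0 fs1 del0 hdel).
Qed.

End existence.

Theorem theorem5p3 (R : realType) (alpha : R) (k h : nat)
    (alpha_gt0 : 0 < alpha) (k_ge1 : (1 <= k)%N) (h_ge1 : (1 <= h)%N) :
  exists v : nat -> ('rV[R]_k * 'rV[R]_h -> R),
    (forall j, [/\ weak_solution alpha (v j), sign_changing (v j) &
                   (grushin_norm alpha (v j) < +oo)%E]) /\
    (fun j => grushin_norm alpha (v j)) @ \oo --> +oo%E.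
Proof.
have [c c0 sol] := @solution_of_size R k h alpha alpha_gt0 k_ge1 h_ge1.
have /choice[v Hv] : forall j : nat, exists v : 'rV[R]_k * 'rV[R]_h -> R,
    [/\ weak_solution alpha v, sign_changing v, (grushin_norm alpha v < +oo)%E &
       (j%:R%:E <= grushin_norm alpha v)%E].
  move=> j; have [|v [v1 v2 v3 v4]] := sol (j%:R / c); first by rewrite divr_ge0// ltW.
  by exists v; split => //; apply: le_trans v4; rewrite mulrC divfK ?gt_eqF.
exists v; split; first by move=> j; have [v1 v2 v3 _] := Hv j.
apply/cvgeyPge => A; near=> j.
have [_ _ _ hj] := Hv j; apply: le_trans hj; rewrite lee_fin.
by near: j; exact: nbhs_infty_ger.
Unshelve. all: by end_near. Qed.
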